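(* Let $c(n)$, $n\ge 0$, be the Fourier coefficients of the modular invariant $j$. Then the sequence $\{c(n)\}_{n\ge 1}$ satisfies the higher order Turán inequality, i.e. for all $n\ge 2$, $$4\left(c(n)^2-c(n-1)c(n+1)\right)\left(c(n+1)^2-c(n)c(n+2)\right)-\left(c(n)c(n+1)-c(n-1)c(n+2)\right)^2\ge 0.$$
   Context: The modular invariant $j$ is defined for $\tau$ in the upper half-plane, with $q=e^{2\pi i\tau}$, by $$j(\tau)=\frac{\left(1+240\sum_{n\ge 1}\sigma_3(n)q^n\right)^3}{q\prod_{n\ge 1}(1-q^n)^{24}}=q^{-1}+\sum_{n\ge 0}c(n)q^n=q^{-1}+744+196884q+21493760q^2+\cdots,$$ where $\sigma_3(n)=\sum_{d\mid n}d^3$. This defines the integers $c(n)$, $n\ge 0$. A sequence $\{a_n\}_{n\ge 1}$ satisfies the higher order Turán inequality if for all $n\ge 2$, $4(a_n^2-a_{n-1}a_{n+1})(a_{n+1}^2-a_na_{n+2})-(a_na_{n+1}-a_{n-1}a_{n+2})^2\ge 0$. *)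

(* Defs.v *)
From Stdlib Require Import Reals ZArith List Arith.
From Coquelicot Require Import Coquelicot.

Definition sigma (k n : nat) : nat :=
  list_sum (map (fun d => Nat.pow d k)
                (filter (fun d => Nat.eqb (Nat.modulo n d) 0) (seq 1 n))).

Local Open Scope C_scope.

Definition Cexp (z : C) : C :=
  exp (Re z) * (cos (Im z) + Ci * sin (Im z)).

(* A total limit operator, with no meaning on divergent sequences. *)
Definition Clim_seq (u : nat -> C) : C :=
  C_complete_lim (filtermap u eventually).

Lemma Clim_seq_correct (u : nat -> C) (l : C) :
  filterlim u eventually (locally l) -> Clim_seq u = l.
Proof.
intros Hu.
apply eq_close; intros eps.
set (F := filtermap u eventually).
assert (HF : ProperFilter F) by (apply filtermap_proper_filter, eventually_filter).
assert (Hball : forall e : posreal, F (ball l e))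
  by (intros e; apply Hu; exists e; auto).
assert (Hlim : F (ball (C_complete_lim F) (pos_div_2 eps)))
  by (apply C_complete_ax1; auto; intros e; exists l; apply Hball).
destruct (filter_ex _ (filter_and _ _ Hlim (Hball (pos_div_2 eps)))) as [x [H1 H2]].
rewrite <- (Rplus_half_diag eps).
exact (ball_triangle _ _ _ _ _ H1 (ball_sym _ _ _ H2)).
Qed.

(* Sums and products over all [n >= 1]. *)
Definition Csum_ge1 (u : nat -> C) : C :=
  Clim_seq (fun N => sum_n_m u 1 N).

Definition Cprod_ge1 (u : nat -> C) : C :=
  Clim_seq (fun N => Iter.iter_nat Cmult 1 u 1 N).

Definition nome (tau : C) : C := Cexp (2 * PI * Ci * tau).

Definition j_invariant (tau : C) : C :=
  let q := nome tau in
  (1 + 240 * Csum_ge1 (fun n => INR (sigma 3 n) * q ^ n)) ^ 3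
  / (q * Cprod_ge1 (fun n => (1 - q ^ n) ^ 24)).

(* By uniqueness of power series expansions, exactly one sequence [c]
   satisfies this. *)
Definition j_fourier_coefficients (c : nat -> Z) : Prop :=
  forall tau : C, (0 < Im tau)%R ->
    is_series (fun n => IZR (c n) * nome tau ^ n)
              (j_invariant tau - / nome tau).

(* The sequence is indexed by [n >= 1]: the value [a 0] is not involved. *)
Definition higher_order_turan (a : nat -> R) : Prop :=
  forall n : nat, (2 <= n)%nat ->
    (4 * (a n ^ 2 - a (n - 1)%nat * a (n + 1)%nat)
       * (a (n + 1)%nat ^ 2 - a n * a (n + 2)%nat)
     - (a n * a (n + 1)%nat - a (n - 1)%nat * a (n + 2)%nat) ^ 2 >= 0)%R.

(* Main.v *)
(* The coefficients are compared with the Fourier coefficients of an explicit function with the same cusp at [0].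
   Since [j(-1/tau) = j(tau)], near [0] the invariant is [exp(2 PI i / tau)] up to a bounded error; summing this over the
   translates [tau + m], with convergence corrections, gives by Lipschitz' formula a Fourier series with coefficients
   [Mt n = sum_k (4 PI^2)^(k+2) n^(k+1) / ((k+2)! (k+1)!)], a modified Bessel function.  On [Im tau = 1 / sqrt n] the
   product formula bounds [j] away from the cusp, whence [c n = Mt n + O(exp((2 PI + 15/4) sqrt n))], against a main term of
   size [exp(4 PI sqrt n)].  Modularity of [j] follows from partial fractions of the cotangent: they give [E_4(-1/tau)] and,
   through an interchange of a conditionally convergent double sum, [E_2(-1/tau)], which is the logarithmic derivative of
   the discriminant.
   Writing [u_n = c(n-1) c(n+1) / c(n)^2], the inequality says that
   [4 (1 - u_n) (1 - u_(n+1)) - ((1 - u_n) + (1 - u_(n+1)) - (1 - u_n) (1 - u_(n+1)))^2 >= 0].  The Riccati equation of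
   the Bessel ratio shows that [1 - u_n] is of order [n^(-3/2)] and varies by [O(n^(-5/2))], which suffices for [n >= 145].
   The remaining cases are checked on the integers [c 1], ..., [c 146], which are determined by the product formula
   modulo [q^148]. *)

Require Import Defs.
From Stdlib Require Import Reals ZArith List Lra Lia Psatz.
From Coquelicot Require Import Coquelicot.

Open Scope R_scope.

(** * Series of complex numbers *)

(** With al = 1 - u_n and be = 1 - u_(n+1) the inequality reads al be (2 (al + be) - al be) >= (al -
    be)^2. The left side has order n^(-9/2), the right side order n^(-5), so the margin is only
    n^(1/2). An error in u_n must therefore be about as small as n^(-5/2). The gap between exp(4 PI
    sqrt n) and the error term leaves a relative error below n^(-3) once sqrt n >= 12; this, applied
    from index n - 1 on, is where 145 comes from. Contour integrals and holomorphy are avoided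
    throughout. Coefficients are isolated by averages over N equidistant points with N tending to
    infinity; derivatives are taken only along real segments and only of finite products; identities
    between families of series come from uniqueness of real power series; and every interchange of
    limits rests on one dominated convergence theorem for series, [Tannery]. *)

Definition Clim (u : nat -> C) (l : C) : Prop :=
  is_lim_seq (fun n => Re (u n)) (Re l) /\ is_lim_seq (fun n => Im (u n)) (Im l).

(** Here [n] counts the terms, whereas [sum_n] includes the index [n]; this is the source of the
    [S n] wherever the two meet. *)
Fixpoint csum (u : nat -> C) (n : nat) : C :=
  match n with O => 0%C | S n => (csum u n + u n)%C end.

Definition CSer (u : nat -> C) (l : C) : Prop := Clim (csum u) l.

(** Total, with the arbitrary value of [Series] on divergent families. Convergence is carried by
    [CSer], and [Csum_unique] links the two. *)
Definition Csum (u : nat -> C) : C :=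
  (Series (fun n => Re (u n)), Series (fun n => Im (u n))).

Lemma C_eq (z w : C) : Re z = Re w -> Im z = Im w -> z = w.
Proof. destruct z, w; simpl; intros; subst; reflexivity. Qed.

Lemma Im_le_Cmod (z : C) : Rabs (Im z) <= Cmod z.
Proof. eapply Rle_trans; [apply Rmax_r | apply Rmax_Cmod]. Qed.

Lemma Cmod_le_ReIm (z : C) : Cmod z <= Rabs (Re z) + Rabs (Im z).
Proof.
replace z with (RtoC (Re z) + Ci * RtoC (Im z))%C at 1
  by (apply C_eq; simpl; ring).
eapply Rle_trans; [apply Cmod_triangle|].
rewrite Cmod_mult, Cmod_Ci, !Cmod_R; lra.
Qed.

Lemma is_lim_seq_0_abs (u e : nat -> R) :
  (forall n, Rabs (u n) <= e n) -> is_lim_seq e 0 -> is_lim_seq u 0.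
Proof.
intros H He; apply is_lim_seq_abs_0.
apply (is_lim_seq_le_le (fun _ => 0) _ e); auto.
- intros n; split; [apply Rabs_pos | apply H].
- apply is_lim_seq_const.
Qed.

Lemma Clim_Cmod (u : nat -> C) (l : C) :
  Clim u l <-> is_lim_seq (fun n => Cmod (u n - l)) 0.
Proof.
split.
- intros [H1 H2].
  apply (is_lim_seq_0_abs _ (fun n => Rabs (Re (u n) - Re l) + Rabs (Im (u n) - Im l))).
  + intros n; rewrite Rabs_pos_eq by apply Cmod_ge_0.
    eapply Rle_trans; [apply Cmod_le_ReIm|]; apply Req_le; f_equal; f_equal; destruct (u n), l; simpl; ring.
  + replace (Finite 0) with (Rbar_plus 0 0) by (simpl; f_equal; ring).
    apply is_lim_seq_plus'; apply -> is_lim_seq_abs_0.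
    * replace 0 with (Re l - Re l) by ring; apply is_lim_seq_minus'; auto; apply is_lim_seq_const.
    * replace 0 with (Im l - Im l) by ring; apply is_lim_seq_minus'; auto; apply is_lim_seq_const.
- intros H; split.
  + apply (is_lim_seq_ext (fun n => (Re (u n) - Re l) + Re l)); [intros; ring|].
    replace (Finite (Re l)) with (Finite (0 + Re l)) by (f_equal; ring).
    apply is_lim_seq_plus'; [|apply is_lim_seq_const].
    apply (is_lim_seq_0_abs _ _ ) with (2 := H); intros n.
    eapply Rle_trans; [|apply re_le_Cmod]; apply Req_le; f_equal; destruct (u n), l; simpl; ring.
  + apply (is_lim_seq_ext (fun n => (Im (u n) - Im l) + Im l)); [intros; ring|].
    replace (Finite (Im l)) with (Finite (0 + Im l)) by (f_equal; ring).
    apply is_lim_seq_plus'; [|apply is_lim_seq_const].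
    apply (is_lim_seq_0_abs _ _ ) with (2 := H); intros n.
    eapply Rle_trans; [|apply Im_le_Cmod]; apply Req_le; f_equal; destruct (u n), l; simpl; ring.
Qed.

Lemma Clim_squeeze (u : nat -> C) (l : C) (e : nat -> R) :
  (forall n, Cmod (u n - l) <= e n) -> is_lim_seq e 0 -> Clim u l.
Proof.
intros H He; apply Clim_Cmod, is_lim_seq_0_abs with (2 := He).
intros n; rewrite Rabs_pos_eq by apply Cmod_ge_0; apply H.
Qed.

Lemma Clim_squeeze_ev (u : nat -> C) (l : C) (e : nat -> R) (N : nat) :
  (forall n, (N <= n)%nat -> Cmod (u n - l) <= e n) -> is_lim_seq e 0 -> Clim u l.
Proof.
intros H He; apply Clim_Cmod.
apply (is_lim_seq_le_le_loc (fun _ => 0) _ e); auto; [|apply is_lim_seq_const].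
exists N; intros n Hn; split; [apply Cmod_ge_0 | apply H; auto].
Qed.

Lemma Clim_unique (u : nat -> C) (l m : C) : Clim u l -> Clim u m -> l = m.
Proof.
intros [H1 H2] [H3 H4]; apply C_eq.
- apply is_lim_seq_unique in H1, H3; rewrite H1 in H3; injection H3; auto.
- apply is_lim_seq_unique in H2, H4; rewrite H2 in H4; injection H4; auto.
Qed.

Lemma Clim_ext_ev (u v : nat -> C) (l : C) (N : nat) :
  (forall n, (N <= n)%nat -> u n = v n) -> Clim u l -> Clim v l.
Proof.
intros H [H1 H2]; split.
- apply is_lim_seq_ext_loc with (2 := H1); exists N; intros n Hn; rewrite H; auto.
- apply is_lim_seq_ext_loc with (2 := H2); exists N; intros n Hn; rewrite H; auto.
Qed.

Lemma Clim_ext (u v : nat -> C) (l : C) : (forall n, u n = v n) -> Clim u l -> Clim v l.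
Proof. intros H; apply (Clim_ext_ev u v l 0); auto. Qed.

Lemma Clim_const (l : C) : Clim (fun _ => l) l.
Proof. split; apply is_lim_seq_const. Qed.

Lemma Clim_plus (u v : nat -> C) (l m : C) :
  Clim u l -> Clim v m -> Clim (fun n => u n + v n)%C (l + m)%C.
Proof. intros [? ?] [? ?]; split; simpl; apply is_lim_seq_plus'; auto. Qed.

Lemma Clim_opp (u : nat -> C) (l : C) : Clim u l -> Clim (fun n => - u n)%C (- l)%C.
Proof.
intros [H1 H2]; split; simpl; 
[apply (proj1 (is_lim_seq_opp _ _) H1) | apply (proj1 (is_lim_seq_opp _ _) H2)].
Qed.

Lemma Clim_minus (u v : nat -> C) (l m : C) :
  Clim u l -> Clim v m -> Clim (fun n => u n - v n)%C (l - m)%C.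
Proof. intros; apply Clim_plus; auto; apply Clim_opp; auto. Qed.

Lemma Clim_mult (u v : nat -> C) (l m : C) :
  Clim u l -> Clim v m -> Clim (fun n => u n * v n)%C (l * m)%C.
Proof.
intros [? ?] [? ?]; split; simpl.
- apply is_lim_seq_minus'; apply is_lim_seq_mult'; auto.
- apply is_lim_seq_plus'; apply is_lim_seq_mult'; auto.
Qed.

Lemma Clim_scal (a : C) (u : nat -> C) (l : C) : Clim u l -> Clim (fun n => a * u n)%C (a * l)%C.
Proof. intros; apply Clim_mult; auto; apply Clim_const. Qed.

Lemma Clim_pow (u : nat -> C) (l : C) k : Clim u l -> Clim (fun n => u n ^ k)%C (l ^ k)%C.
Proof.
intros H; induction k; simpl.
- apply Clim_const.
- apply Clim_mult; auto.
Qed.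

Lemma Clim_mod (u : nat -> C) (l : C) : Clim u l -> is_lim_seq (fun n => Cmod (u n)) (Cmod l).
Proof.
intros H; apply Clim_Cmod in H.
apply (is_lim_seq_ext (fun n => (Cmod (u n) - Cmod l) + Cmod l)); [intros; ring|].
replace (Finite (Cmod l)) with (Finite (0 + Cmod l)) by (f_equal; ring).
apply is_lim_seq_plus'; [|apply is_lim_seq_const].
apply is_lim_seq_0_abs with (2 := H); intros n.
apply Rabs_le; split.
- assert (Cmod l <= Cmod (u n) + Cmod (u n - l)); [|lra].
  replace l with (u n + - (u n - l))%C at 1 by ring.
  eapply Rle_trans; [apply Cmod_triangle|]; rewrite Cmod_opp; lra.
- assert (Cmod (u n) <= Cmod l + Cmod (u n - l)); [|lra].
  replace (u n) with (l + (u n - l))%C at 1 by ring.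
  apply Cmod_triangle.
Qed.

Lemma Clim_mod_le (u : nat -> C) (l : C) (B : R) (N : nat) :
  Clim u l -> (forall n, (N <= n)%nat -> Cmod (u n) <= B) -> Cmod l <= B.
Proof.
intros H HB; apply Clim_mod in H.
apply (is_lim_seq_le_loc (fun n => Cmod (u n)) (fun _ => B) (Cmod l) B); auto.
- exists N; auto.
- apply is_lim_seq_const.
Qed.

Lemma Clim_mod_ge (u : nat -> C) (l : C) (B : R) :
  Clim u l -> (forall n, B <= Cmod (u n)) -> B <= Cmod l.
Proof.
intros H HB; apply Clim_mod in H.
apply (is_lim_seq_le (fun _ => B) (fun n => Cmod (u n)) B (Cmod l)); auto.
apply is_lim_seq_const.
Qed.

Lemma Clim_inv (u : nat -> C) (l : C) : l <> 0%C -> Clim u l -> Clim (fun n => / u n)%C (/ l)%C.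
Proof.
intros Hl H; pose proof (Clim_mod _ _ H) as Hm.
apply Cmod_gt_0 in Hl.
assert (Hd : Rbar_plus (Rbar_mult 1 1) 0 <> 0) by (simpl; intros E; injection E; lra).
destruct H as [H1 H2].
assert (HD : is_lim_seq (fun n => Re (u n) ^ 2 + Im (u n) ^ 2) (Re l ^ 2 + Im l ^ 2)).
{ simpl; apply is_lim_seq_plus'; apply is_lim_seq_mult'; auto;
  apply is_lim_seq_mult'; auto; apply is_lim_seq_const. }
assert (Hnz : Re l ^ 2 + Im l ^ 2 <> 0) by (rewrite <- Cmod2_alt; nra).
split; simpl.
- apply is_lim_seq_div'; auto.
- apply is_lim_seq_div'; auto; apply (proj1 (is_lim_seq_opp _ _) H2).
Qed.

Lemma Clim_div (u v : nat -> C) (l m : C) :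
  m <> 0%C -> Clim u l -> Clim v m -> Clim (fun n => u n / v n)%C (l / m)%C.
Proof. intros; apply Clim_mult; auto; apply Clim_inv; auto. Qed.

Lemma Clim_subseq (u : nat -> C) (l : C) (p : nat -> nat) :
  filterlim p eventually eventually -> Clim u l -> Clim (fun n => u (p n)) l.
Proof. intros Hp [H1 H2]; split;
[apply (is_lim_seq_subseq (fun n => Re (u n)) (Re l) p) | apply (is_lim_seq_subseq (fun n => Im (u n)) (Im l) p)]; auto. Qed.

Lemma Clim_incr (u : nat -> C) (l : C) : Clim u l -> Clim (fun n => u (S n)) l.
Proof. intros [H1 H2]; split; apply -> is_lim_seq_incr_1 in H1; apply -> is_lim_seq_incr_1 in H2; auto. Qed.

Lemma csum_ext (u v : nat -> C) n : (forall k, (k < n)%nat -> u k = v k) -> csum u n = csum v n.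
Proof. induction n; simpl; intros H; auto; rewrite IHn, H; auto. Qed.

Lemma csum_plus (u v : nat -> C) n : csum (fun k => u k + v k)%C n = (csum u n + csum v n)%C.
Proof. induction n; simpl; [ring|rewrite IHn; ring]. Qed.

Lemma csum_minus (u v : nat -> C) n : csum (fun k => u k - v k)%C n = (csum u n - csum v n)%C.
Proof. induction n; simpl; [ring|rewrite IHn; ring]. Qed.

Lemma csum_scal (a : C) (u : nat -> C) n : csum (fun k => a * u k)%C n = (a * csum u n)%C.
Proof. induction n; simpl; [ring|rewrite IHn; ring]. Qed.

Lemma csum_split (u : nat -> C) n m : csum u (n + m) = (csum u n + csum (fun k => u (n + k)%nat) m)%C.
Proof.
induction m; simpl.
- rewrite Nat.add_0_r; ring.
- rewrite Nat.add_succ_r; simpl; rewrite IHm; ring.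
Qed.

Lemma csum_head (u : nat -> C) n : csum u (S n) = (u 0%nat + csum (fun k => u (S k)) n)%C.
Proof. change (S n) with (1 + n)%nat; rewrite csum_split; simpl; f_equal; ring. Qed.

Lemma csum_rev (u : nat -> C) n : csum u n = csum (fun k => u (n - 1 - k)%nat) n.
Proof.
induction n; auto.
rewrite (csum_head (fun k => u (S n - 1 - k)%nat)).
change (csum u (S n)) with (csum u n + u n)%C; rewrite IHn.
replace (S n - 1 - 0)%nat with n by lia; rewrite Cplus_comm; f_equal.
apply csum_ext; intros k Hk; f_equal; lia.
Qed.

Lemma csum_zero (u : nat -> C) n : (forall k, (k < n)%nat -> u k = 0%C) -> csum u n = 0%C.
Proof. induction n; simpl; intros H; auto; rewrite IHn, H; auto; ring. Qed.

Lemma Re_csum u n : Re (csum u (S n)) = sum_n (fun k => Re (u k)) n.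
Proof.
induction n.
- rewrite sum_O; simpl csum; rewrite Cplus_0_l; reflexivity.
- rewrite sum_Sn, <- IHn; reflexivity.
Qed.

Lemma Im_csum u n : Im (csum u (S n)) = sum_n (fun k => Im (u k)) n.
Proof.
induction n.
- rewrite sum_O; simpl csum; rewrite Cplus_0_l; reflexivity.
- rewrite sum_Sn, <- IHn; reflexivity.
Qed.

Lemma CSer_is_series (u : nat -> C) (l : C) :
  CSer u l <-> is_series (fun n => Re (u n)) (Re l) /\ is_series (fun n => Im (u n)) (Im l).
Proof.
unfold CSer, Clim; split; intros [H1 H2]; split.
- apply is_lim_seq_incr_1 in H1.
  apply (is_lim_seq_ext _ _ _ (Re_csum u) H1).
- apply is_lim_seq_incr_1 in H2.
  apply (is_lim_seq_ext _ _ _ (Im_csum u) H2).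
- apply is_lim_seq_incr_1; eapply is_lim_seq_ext; [intros n; symmetry; apply Re_csum|exact H1].
- apply is_lim_seq_incr_1; eapply is_lim_seq_ext; [intros n; symmetry; apply Im_csum|exact H2].
Qed.

Lemma CSer_unique u l m : CSer u l -> CSer u m -> l = m.
Proof. apply Clim_unique. Qed.

Lemma Csum_unique u l : CSer u l -> Csum u = l.
Proof.
intros H; apply CSer_is_series in H as [H1 H2]; apply C_eq; simpl; apply is_series_unique; auto.
Qed.

Lemma CSer_ext u v l : (forall n, u n = v n) -> CSer u l -> CSer v l.
Proof. intros H; apply Clim_ext; intros n; apply csum_ext; auto. Qed.

Lemma Csum_ext u v : (forall n, u n = v n) -> Csum u = Csum v.
Proof. intros H; unfold Csum; f_equal; apply Series_ext; intros; rewrite H; auto. Qed.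

Lemma CSer_plus u v l m : CSer u l -> CSer v m -> CSer (fun n => u n + v n)%C (l + m)%C.
Proof.
intros H1 H2; eapply Clim_ext; [intros n; symmetry; apply csum_plus|]; apply Clim_plus; auto.
Qed.

Lemma CSer_minus u v l m : CSer u l -> CSer v m -> CSer (fun n => u n - v n)%C (l - m)%C.
Proof.
intros H1 H2; eapply Clim_ext; [intros n; symmetry; apply csum_minus|]; apply Clim_minus; auto.
Qed.

Lemma CSer_scal a u l : CSer u l -> CSer (fun n => a * u n)%C (a * l)%C.
Proof.
intros H1; eapply Clim_ext; [intros n; symmetry; apply csum_scal|]; apply Clim_scal; auto.
Qed.

Lemma CSer_head u l : CSer (fun n => u (S n)) l -> CSer u (u 0%nat + l)%C.
Proof.
intros H; unfold CSer.
assert (Clim (fun n => csum u (S n)) (u 0%nat + l)%C).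
{ eapply Clim_ext; [intros n; symmetry; apply csum_head|].
  apply Clim_plus; auto; apply Clim_const. }
destruct H0 as [H1 H2]; split; apply is_lim_seq_incr_1; auto.
Qed.

Lemma CSer_tail u l : CSer u l -> CSer (fun n => u (S n)) (l - u 0%nat)%C.
Proof.
intros H; apply Clim_incr in H; unfold CSer.
eapply (Clim_ext (fun n => csum u (S n) - u 0%nat)%C).
- intros n; rewrite csum_head; ring.
- apply Clim_minus; auto; apply Clim_const.
Qed.

Lemma ex_series_le_pos (a b : nat -> R) :
  (forall n, Rabs (a n) <= b n) -> ex_series b -> ex_series a.
Proof. intros H; apply (ex_series_le a b); auto. Qed.

Lemma CSer_Csum u (b : nat -> R) : (forall n, Cmod (u n) <= b n) -> ex_series b -> CSer u (Csum u).
Proof.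
intros H Hb; apply CSer_is_series; split; simpl; apply Series_correct;
  apply (ex_series_le_pos _ b); auto; intros n; eapply Rle_trans; try apply (H n).
- apply re_le_Cmod.
- apply Im_le_Cmod.
Qed.

Lemma Cmod_csum_le u (b : nat -> R) n :
  (forall k, (k <= n)%nat -> Cmod (u k) <= b k) -> Cmod (csum u (S n)) <= sum_n b n.
Proof.
induction n; intros H.
- simpl; rewrite Cplus_0_l, sum_O; apply H; auto.
- rewrite sum_Sn; eapply Rle_trans; [apply Cmod_triangle|].
  apply Rplus_le_compat; [apply IHn; auto | apply H; auto].
Qed.

Lemma sum_n_le_series (b : nat -> R) B n :
  (forall k, 0 <= b k) -> is_series b B -> sum_n b n <= B.
Proof.
intros Hb HB.
apply (is_lim_seq_incr_compare (sum_n b)); auto.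
intros k; rewrite sum_Sn; unfold plus; simpl; specialize (Hb (S k)); lra.
Qed.

Lemma CSer_mod_le u l (b : nat -> R) B :
  (forall n, Cmod (u n) <= b n) -> is_series b B -> CSer u l -> Cmod l <= B.
Proof.
intros H HB Hu.
apply (Clim_mod_le (csum u) l B 1); auto.
intros [|n] Hn; [lia|].
eapply Rle_trans; [apply Cmod_csum_le; intros; apply H|].
apply sum_n_le_series; auto.
intros k; eapply Rle_trans; [apply Cmod_ge_0|apply H].
Qed.

Lemma Csum_mod_le u (b : nat -> R) B :
  (forall n, Cmod (u n) <= b n) -> is_series b B -> Cmod (Csum u) <= B.
Proof.
intros H HB; eapply CSer_mod_le; eauto; eapply CSer_Csum; eauto; exists B; auto.
Qed.

Lemma CSer_dist u l (b : nat -> R) B n :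
  (forall n, Cmod (u n) <= b n) -> is_series b B -> CSer u l ->
  Cmod (csum u (S n) - l) <= B - sum_n b n.
Proof.
intros H HB Hu.
assert (Hb : forall k, 0 <= b k) by (intros k; eapply Rle_trans; [apply Cmod_ge_0|apply H]).
apply (Clim_mod_le (fun m => csum u (S n) - csum u (S n + m))%C _ _ 1).
- apply Clim_minus; [apply Clim_const|].
  apply (Clim_subseq (csum u) l (fun m => (S n + m)%nat)); auto.
  apply eventually_subseq_loc; exists 0%nat; intros; lia.
- intros [|m] Hm; [lia|].
  rewrite csum_split.
  match goal with |- Cmod (?a - (?a + ?b)) <= _ => replace (a - (a + b))%C with (- b)%C by ring end.
  rewrite Cmod_opp.
  eapply Rle_trans; [apply (Cmod_csum_le _ (fun k => b (S n + k)%nat)); auto|].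
  pose proof (sum_n_le_series b B (n + S m) Hb HB) as Hle.
  assert (E : sum_n b (n + S m) = sum_n b n + sum_n (fun k => b (S n + k)%nat) m).
  { clear; induction m.
    - rewrite Nat.add_1_r, sum_Sn, sum_O, Nat.add_0_r; reflexivity.
    - rewrite Nat.add_succ_r, sum_Sn, IHm, sum_Sn; unfold plus; simpl.
      rewrite Rplus_assoc; do 3 f_equal; lia. }
  lra.
Qed.

(** Dominated convergence for series: the common majorant makes the tails beyond a fixed index small
    for all [N] at once, and the finitely many remaining terms converge. *)
Lemma Tannery (u : nat -> nat -> C) (v s : nat -> C) (b : nat -> R) :
  ex_series b ->
  (forall N k, Cmod (u N k) <= b k) ->
  (forall k, Clim (fun N => u N k) (v k)) ->
  (forall N, CSer (u N) (s N)) ->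
  Clim s (Csum v).
Proof.
intros [B HB] Hb Hv Hs.
assert (Hbv : forall k, Cmod (v k) <= b k).
{ intros k; apply (Clim_mod_le (fun N => u N k) _ _ 0); auto. }
assert (HV : CSer v (Csum v)) by (apply (CSer_Csum v b); auto; exists B; auto).
apply Clim_Cmod; apply is_lim_seq_spec; intros eps; simpl.
assert (Htail : exists n, B - sum_n b n < eps / 4).
{ assert (HB' : is_lim_seq (sum_n b) B) by exact HB.
  apply is_lim_seq_spec in HB'.
  destruct (HB' (mkposreal (eps / 4) ltac:(destruct eps; simpl; lra))) as [n Hn].
  exists n; specialize (Hn n (Nat.le_refl _)); simpl in Hn.
  apply Rabs_def2 in Hn; lra. }
destruct Htail as [n Hn].
assert (Hfin : Clim (fun N => csum (u N) (S n)) (csum v (S n))).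
{ clear -Hv; induction (S n); simpl; [apply Clim_const|apply Clim_plus; auto]. }
apply Clim_Cmod, is_lim_seq_spec in Hfin.
destruct (Hfin (mkposreal (eps / 4) ltac:(destruct eps; simpl; lra))) as [N HN].
exists N; intros M HM; specialize (HN M HM); simpl in HN.
rewrite Rminus_0_r, Rabs_pos_eq in HN |- * by apply Cmod_ge_0.
replace (s M - Csum v)%C with
  (- (csum (u M) (S n) - s M) + (csum (u M) (S n) - csum v (S n)) + (csum v (S n) - Csum v))%C by ring.
eapply Rle_lt_trans; [apply Cmod_triangle|].
eapply Rle_lt_trans; [apply Rplus_le_compat_r, Cmod_triangle|].
rewrite Cmod_opp.
pose proof (CSer_dist (u M) (s M) b B n (Hb M) HB (Hs M)).
pose proof (CSer_dist v _ b B n Hbv HB HV).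
destruct eps; simpl in *; lra.
Qed.

Lemma csum_CSer (u : nat -> C) n : CSer (fun k => if (k <? n)%nat then u k else 0%C) (csum u n).
Proof.
apply (Clim_ext_ev (fun _ => csum u n) _ _ n); [|apply Clim_const].
intros m Hm.
replace m with (n + (m - n))%nat by lia; rewrite csum_split.
rewrite (csum_zero _ (m - n)), Cplus_0_r.
- apply csum_ext; intros k Hk; apply Nat.ltb_lt in Hk; rewrite Hk; auto.
- intros k Hk; destruct (Nat.ltb_spec (n + k) n); auto; lia.
Qed.

Lemma Tannery_fin (u : nat -> nat -> C) (v : nat -> C) (p : nat -> nat) (b : nat -> R) :
  ex_series b -> (forall k, 0 <= b k) ->
  filterlim p eventually eventually ->
  (forall N k, (k < p N)%nat -> Cmod (u N k) <= b k) ->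
  (forall k, Clim (fun N => u N k) (v k)) ->
  Clim (fun N => csum (u N) (p N)) (Csum v).
Proof.
intros Hb Hb0 Hp Hu Hv.
apply (Tannery (fun N k => if (k <? p N)%nat then u N k else 0%C) v _ b); auto.
- intros N k; destruct (Nat.ltb_spec k (p N)); [auto|rewrite Cmod_0; auto].
- intros k.
  assert (HE : eventually (fun N => (k < p N)%nat)) by (apply Hp; exists (S k); intros; lia).
  destruct HE as [N0 HN0].
  apply (Clim_ext_ev (fun N => u N k) _ _ N0); auto.
  intros N HN; specialize (HN0 N HN); apply Nat.ltb_lt in HN0; rewrite HN0; auto.
- intros N; apply csum_CSer.
Qed.

(** Fubini for double series. A partial sum over [m] is itself a series in [n], dominated by the
    column sums [c] independently of its length, so [Tannery] applies. *)
Lemma CSer_swap (a : nat -> nat -> C) (B : nat -> nat -> R) (c : nat -> R) :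
  (forall m n, Cmod (a m n) <= B m n) ->
  (forall n, is_series (fun m => B m n) (c n)) -> ex_series c ->
  CSer (fun m => Csum (a m)) (Csum (fun n => Csum (fun m => a m n))).
Proof.
intros H Hc HC.
assert (HB0 : forall m n, 0 <= B m n) by (intros; eapply Rle_trans; [apply Cmod_ge_0|apply H]).
assert (HBc : forall m n, B m n <= c n).
{ intros m n; eapply Rle_trans; [|apply (sum_n_le_series _ _ m (fun k => HB0 k n) (Hc n))].
  destruct m; [rewrite sum_O; lra|].
  rewrite sum_Sn; unfold plus; simpl.
  assert (0 <= sum_n (fun k => B k n) m); [|lra].
  clear -HB0; induction m; [rewrite sum_O; auto|rewrite sum_Sn; unfold plus; simpl; specialize (HB0 (S m) n); lra]. }
assert (Hrow : forall m, CSer (a m) (Csum (a m))).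
{ intros m; apply (CSer_Csum _ c); auto; intros n; eapply Rle_trans; eauto. }
unfold CSer.
apply (Tannery (fun N n => csum (fun m => a m n) N) (fun n => Csum (fun m => a m n)) _ c); auto.
- intros N n; destruct N; [simpl; rewrite Cmod_0; eapply Rle_trans; [apply (HB0 0%nat n)|auto]|].
  eapply Rle_trans; [apply (Cmod_csum_le _ (fun m => B m n)); auto|].
  apply sum_n_le_series; auto.
- intros n; apply (CSer_Csum _ (fun m => B m n)); auto; exists (c n); auto.
- intros N; induction N.
  + simpl; apply (CSer_ext (fun _ => 0%C)); [intros; reflexivity|].
    apply (Clim_ext (fun _ => 0%C)); [|apply Clim_const].
    intros n; rewrite csum_zero; auto.
  + simpl; apply CSer_plus; auto.
Qed.

Lemma Clim_eq (u : nat -> C) (l m : C) : l = m -> Clim u l -> Clim u m.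
Proof. intros E; rewrite E; auto. Qed.

Lemma CSer_eq (u : nat -> C) (l m : C) : l = m -> CSer u l -> CSer u m.
Proof. intros E; rewrite E; auto. Qed.

(** * The exponential function and the nome *)

Lemma Cminus_0_r (z : C) : (z - 0)%C = z. Proof. ring. Qed.

Lemma Re_plus z w : Re (z + w) = Re z + Re w. Proof. reflexivity. Qed.

Lemma Im_plus z w : Im (z + w) = Im z + Im w. Proof. reflexivity. Qed.

Lemma Re_minus z w : Re (z - w) = Re z - Re w. Proof. reflexivity. Qed.

Lemma Im_minus z w : Im (z - w) = Im z - Im w. Proof. reflexivity. Qed.

Lemma Re_mult z w : Re (z * w) = Re z * Re w - Im z * Im w. Proof. reflexivity. Qed.

Lemma Im_mult z w : Im (z * w) = Re z * Im w + Im z * Re w. Proof. reflexivity. Qed.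

Lemma Re_Cexp z : Re (Cexp z) = exp (Re z) * cos (Im z).
Proof. unfold Cexp; simpl; ring. Qed.

Lemma Im_Cexp z : Im (Cexp z) = exp (Re z) * sin (Im z).
Proof. unfold Cexp; simpl; ring. Qed.

Lemma Cexp_add z w : Cexp (z + w) = (Cexp z * Cexp w)%C.
Proof.
apply C_eq.
- rewrite Re_Cexp, Re_mult, !Re_Cexp, !Im_Cexp, Re_plus, Im_plus, exp_plus, cos_plus; ring.
- rewrite Im_Cexp, Im_mult, !Re_Cexp, !Im_Cexp, Re_plus, Im_plus, exp_plus, sin_plus; ring.
Qed.

Lemma Cexp_0 : Cexp 0 = 1%C.
Proof. apply C_eq; [rewrite Re_Cexp | rewrite Im_Cexp]; simpl; rewrite exp_0, ?cos_0, ?sin_0; ring. Qed.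

Lemma Cmod_Cexp z : Cmod (Cexp z) = exp (Re z).
Proof.
apply Rsqr_inj; [apply Cmod_ge_0|left; apply exp_pos|].
rewrite !Rsqr_pow2, Cmod2_alt, Re_Cexp, Im_Cexp.
pose proof (sin2_cos2 (Im z)) as H; rewrite !Rsqr_pow2 in H.
replace (exp (Re z) ^ 2) with (exp (Re z) ^ 2 * (sin (Im z) ^ 2 + cos (Im z) ^ 2)) by (rewrite H; ring).
ring.
Qed.

Lemma exp_mono x y : x <= y -> exp x <= exp y.
Proof. intros [H|H]; [left; apply exp_increasing; auto|rewrite H; right; auto]. Qed.

Lemma Cexp_nz z : Cexp z <> 0%C.
Proof. apply Cmod_gt_0; rewrite Cmod_Cexp; apply exp_pos. Qed.

Lemma Cexp_opp z : Cexp (- z) = (/ Cexp z)%C.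
Proof.
assert (H : (Cexp (- z) * Cexp z = 1)%C).
{ rewrite <- Cexp_add, <- Cexp_0; f_equal; ring. }
pose proof (Cexp_nz z).
rewrite <- (Cmult_1_l (/ Cexp z)), <- H; field; auto.
Qed.

Lemma Cexp_pow z n : (Cexp z ^ n)%C = Cexp (INR n * z).
Proof.
induction n.
- simpl; rewrite Cmult_0_l, Cexp_0; auto.
- rewrite S_INR, RtoC_plus, Cmult_plus_distr_r, Cexp_add; simpl; rewrite IHn, Cmult_1_l; ring.
Qed.

Lemma Cexp_RtoC (x : R) : Cexp x = RtoC (exp x).
Proof. apply C_eq; [rewrite Re_Cexp | rewrite Im_Cexp]; simpl; rewrite ?cos_0, ?sin_0; ring. Qed.

Lemma Rder_ext (f g : R -> R) (t l : R) :
  (forall x : R, f x = g x) -> is_derive f t l -> is_derive g t l.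
Proof. intros H; apply is_derive_ext, H. Qed.

Lemma Rder_plus (f g : R -> R) (t l m : R) :
  is_derive f t l -> is_derive g t m -> is_derive (fun x => f x + g x) t (l + m).
Proof. apply (is_derive_plus f g). Qed.

Lemma Rder_minus (f g : R -> R) (t l m : R) :
  is_derive f t l -> is_derive g t m -> is_derive (fun x => f x - g x) t (l - m).
Proof. apply (is_derive_minus f g). Qed.

Lemma Rder_scal (f : R -> R) (t k l : R) :
  is_derive f t l -> is_derive (fun x => k * f x) t (k * l).
Proof. apply (is_derive_scal f). Qed.

Lemma Rder_comp (f g : R -> R) (t l m : R) :
  is_derive f (g t) l -> is_derive g t m -> is_derive (fun x => f (g x)) t (m * l).
Proof. apply (is_derive_comp f g). Qed.

Lemma Rder_eq (f : R -> R) (t l m : R) : l = m -> is_derive f t l -> is_derive f t m.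
Proof. intros ->; auto. Qed.

Lemma derive_continuity_pt (g : R -> R) t l : is_derive g t l -> continuity_pt g t.
Proof.
intros H; apply continuity_pt_filterlim.
apply (ex_derive_continuous g t); exists l; auto.
Qed.

Lemma mvt_incr (g g' : R -> R) :
  (forall t, 0 <= t <= 1 -> is_derive g t (g' t)) ->
  (forall t, 0 <= t <= 1 -> 0 <= g' t) -> g 0 <= g 1.
Proof.
intros Hg Hp.
destruct (MVT_gen g 0 1 g') as [c [Hc E]].
- intros x; rewrite Rmin_left, Rmax_right by lra; intros; apply Hg; lra.
- intros x; rewrite Rmin_left, Rmax_right by lra; intros.
  apply derive_continuity_pt with (g' x), Hg; lra.
- rewrite Rmin_left, Rmax_right in Hc by lra; specialize (Hp c Hc); nra.
Qed.

(* The scalar mean value theorem is applied to the projection of [f] on the direction of [f 1 - f 0]. *)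
Lemma C_mvt (f f' : R -> C) (g g' : R -> R) :
  (forall t, 0 <= t <= 1 -> is_derive (fun t => Re (f t)) t (Re (f' t))) ->
  (forall t, 0 <= t <= 1 -> is_derive (fun t => Im (f t)) t (Im (f' t))) ->
  (forall t, 0 <= t <= 1 -> is_derive g t (g' t)) ->
  (forall t, 0 <= t <= 1 -> Cmod (f' t) <= g' t) ->
  Cmod (f 1 - f 0) <= g 1 - g 0.
Proof.
intros Hr Hi Hg Hle.
set (d := (f 1 - f 0)%C).
assert (G : g 0 <= g 1).
{ apply (mvt_incr g g'); auto; intros t Ht; eapply Rle_trans; [apply Cmod_ge_0|auto]. }
destruct (Req_dec (Cmod d) 0) as [Z|NZ]; [lra|].
assert (P : 0 < Cmod d) by (pose proof (Cmod_ge_0 d); lra).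
set (K0 := fun t => g t * Cmod d - (Re d * Re (f t) + Im d * Im (f t))).
assert (K : K0 0 <= K0 1).
{ apply (mvt_incr K0 (fun t => g' t * Cmod d - (Re d * Re (f' t) + Im d * Im (f' t)))).
  - intros t Ht.
    apply (Rder_minus (fun t => g t * Cmod d) (fun t => Re d * Re (f t) + Im d * Im (f t))).
    + apply (Rder_ext (fun t => Cmod d * g t)); [intros; ring|].
      rewrite Rmult_comm; apply Rder_scal; auto.
    + apply (Rder_plus (fun t => Re d * Re (f t)) (fun t => Im d * Im (f t)));
       apply Rder_scal; auto.
  - intros t Ht.
    assert (Re d * Re (f' t) + Im d * Im (f' t) <= Cmod d * Cmod (f' t)).
    { rewrite <- (Cmod_conj d), <- Cmod_mult.
      eapply Rle_trans; [|apply re_le_Cmod]; eapply Rle_trans; [|apply Rle_abs].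
      apply Req_le; destruct d, (f' t); simpl; ring. }
    specialize (Hle t Ht); nra. }
unfold K0 in K.
assert (E : Cmod d ^ 2 = Re d * (Re (f 1) - Re (f 0)) + Im d * (Im (f 1) - Im (f 0))).
{ rewrite Cmod2_alt; unfold d; destruct (f 1), (f 0); simpl; ring. }
nra.
Qed.

(** Taylor polynomial of the exponential at [t z]. The separate real parameter allows
    differentiation, which lowers the degree by one and multiplies by [z]. *)
Definition ctay (n : nat) (t : R) (z : C) : C := csum (fun k => RtoC (t ^ k / INR (fact k)) * z ^ k)%C n.

Lemma is_derive_pow_fact k t : is_derive (fun t => t ^ S k / INR (fact (S k))) t (t ^ k / INR (fact k)).
Proof.
apply (Rder_eq _ _ (/ INR (fact (S k)) * (INR (S k) * 1 * t ^ k))).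
- rewrite fact_simpl, mult_INR; field; split; [apply INR_fact_neq_0|apply not_0_INR; lia].
- apply (Rder_ext (fun x => / INR (fact (S k)) * x ^ S k)); [intros; unfold Rdiv; ring|].
  apply Rder_scal, (is_derive_pow (fun x => x)), (is_derive_id (K := R_AbsRing)).
Qed.

Lemma ctay_S n t z : ctay (S n) t z = (ctay n t z + RtoC (t ^ n / INR (fact n)) * z ^ n)%C.
Proof. reflexivity. Qed.

Lemma is_derive_ctay n t z :
  is_derive (fun t => Re (ctay (S n) t z)) t (Re (z * ctay n t z)) /\
  is_derive (fun t => Im (ctay (S n) t z)) t (Im (z * ctay n t z)).
Proof.
induction n as [|n [IH1 IH2]].
- unfold ctay; simpl; split; auto_derive; auto; ring.
- split.
  + apply (Rder_ext (fun t => Re (ctay (S n) t z) + t ^ S n / INR (fact (S n)) * Re (z ^ S n)%C)).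
    * intros u; rewrite (ctay_S (S n)); rewrite <- re_scal_l; reflexivity.
    * rewrite (ctay_S n).
      replace (Re (z * _)) with (Re (z * ctay n t z) + (t ^ n / INR (fact n)) * Re (z ^ S n)%C)
        by (rewrite <- re_scal_l; simpl Cpow; destruct (z ^ n)%C, z, (ctay n t (r1, r2)); simpl; ring).
      apply Rder_plus; auto.
      apply (Rder_ext (fun u => Re (z ^ S n)%C * (u ^ S n / INR (fact (S n))))); [intros; ring|].
      rewrite (Rmult_comm (t ^ n / _)); apply Rder_scal, is_derive_pow_fact.
  + apply (Rder_ext (fun t => Im (ctay (S n) t z) + t ^ S n / INR (fact (S n)) * Im (z ^ S n)%C)).
    * intros u; rewrite (ctay_S (S n)); rewrite <- im_scal_l; reflexivity.
    * rewrite (ctay_S n).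
      replace (Im (z * _)) with (Im (z * ctay n t z) + (t ^ n / INR (fact n)) * Im (z ^ S n)%C)
        by (rewrite <- im_scal_l; simpl Cpow; destruct (z ^ n)%C, z, (ctay n t (r1, r2)); simpl; ring).
      apply Rder_plus; auto.
      apply (Rder_ext (fun u => Im (z ^ S n)%C * (u ^ S n / INR (fact (S n))))); [intros; ring|].
      rewrite (Rmult_comm (t ^ n / _)); apply Rder_scal, is_derive_pow_fact.
Qed.

Lemma is_derive_Cexp_lin (t : R) z :
  is_derive (fun t : R => Re (Cexp (t * z))) t (Re (z * Cexp (t * z))) /\
  is_derive (fun t : R => Im (Cexp (t * z))) t (Im (z * Cexp (t * z))).
Proof.
split.
- apply (Rder_ext (fun t => exp (t * Re z) * cos (t * Im z))).
  + intros u; rewrite Re_Cexp, re_scal_l, im_scal_l; auto.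
  + auto_derive; auto; destruct z as [x y]; unfold Cexp; simpl.
    replace (t * x - 0 * y) with (t * x) by ring; replace (t * y + 0 * x) with (t * y) by ring; ring.
- apply (Rder_ext (fun t => exp (t * Re z) * sin (t * Im z))).
  + intros u; rewrite Im_Cexp, re_scal_l, im_scal_l; auto.
  + auto_derive; auto; destruct z as [x y]; unfold Cexp; simpl.
    replace (t * x - 0 * y) with (t * x) by ring; replace (t * y + 0 * x) with (t * y) by ring; ring.
Qed.

(** The derivative in [t] of the remainder of order [S n] is [z] times the remainder of order [n],
    so [C_mvt] integrates the induction hypothesis. The last factor bounds the modulus of the
    exponential on the segment from 0 to [z]. *)
Lemma Cexp_taylor_aux n : forall z t, 0 <= t <= 1 ->
  Cmod (Cexp (t * z) - ctay n t z) <= (t * Cmod z) ^ n / INR (fact n) * exp (Rmax (Re z) 0).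
Proof.
induction n; intros z t Ht.
- unfold ctay; simpl; unfold Rdiv; rewrite Rinv_1, !Rmult_1_l.
  rewrite Cminus_0_r, Cmod_Cexp, re_scal_l.
  apply exp_mono.
  pose proof (Rmax_l (Re z) 0); pose proof (Rmax_r (Re z) 0).
  destruct (Rle_dec 0 (Re z)); nra.
- assert (H := C_mvt (fun s => Cexp (RtoC (s * t) * z) - ctay (S n) (s * t) z)%C
    (fun s => RtoC t * (z * (Cexp (RtoC (s * t) * z) - ctay n (s * t) z)))%C
    (fun s => (s * t * Cmod z) ^ S n / INR (fact (S n)) * exp (Rmax (Re z) 0))
    (fun s => t * Cmod z * ((s * t * Cmod z) ^ n / INR (fact n) * exp (Rmax (Re z) 0)))).
  cbv beta in H.
  rewrite !Rmult_1_l, !Rmult_0_l in H.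
  replace (Cexp (0 * z) - ctay (S n) 0 z)%C with (RtoC 0) in H.
  2:{ rewrite Cmult_0_l, Cexp_0; unfold ctay; rewrite csum_head, csum_zero.
      - simpl; unfold Rdiv; rewrite Rinv_1, Rmult_1_l; ring.
      - intros k _; simpl pow; unfold Rdiv; rewrite !Rmult_0_l; ring. }
  replace (0 ^ S n / INR (fact (S n)) * exp (Rmax (Re z) 0)) with 0 in H
   by (simpl pow; unfold Rdiv; ring).
  rewrite Cminus_0_r, Rminus_0_r in H.
  apply H; clear H.
  + intros s Hs.
    replace (Re (t * (z * (Cexp (RtoC (s * t) * z) - ctay n (s * t) z)))%C) with
      (t * (Re (z * Cexp (RtoC (s * t) * z)) - Re (z * ctay n (s * t) z)))
      by (rewrite re_scal_l; destruct z, (Cexp (RtoC (s * t) * (r, r0))), (ctay n (s * t) (r, r0)); simpl; ring).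
    apply (Rder_comp (fun u : R => Re (Cexp (RtoC u * z) - ctay (S n) u z)%C) (fun s => s * t) s).
    * apply (Rder_minus (fun u : R => Re (Cexp (RtoC u * z))) (fun u => Re (ctay (S n) u z)));
      [apply is_derive_Cexp_lin | apply is_derive_ctay].
    * auto_derive; auto; ring.
  + intros s Hs.
    replace (Im (t * (z * (Cexp (RtoC (s * t) * z) - ctay n (s * t) z)))%C) with
      (t * (Im (z * Cexp (RtoC (s * t) * z)) - Im (z * ctay n (s * t) z)))
      by (rewrite im_scal_l; destruct z, (Cexp (RtoC (s * t) * (r, r0))), (ctay n (s * t) (r, r0)); simpl; ring).
    apply (Rder_comp (fun u : R => Im (Cexp (RtoC u * z) - ctay (S n) u z)%C) (fun s => s * t) s).
    * apply (Rder_minus (fun u : R => Im (Cexp (RtoC u * z))) (fun u => Im (ctay (S n) u z)));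
      [apply is_derive_Cexp_lin | apply is_derive_ctay].
    * auto_derive; auto; ring.
  + intros s Hs.
    replace (t * Cmod z * ((s * t * Cmod z) ^ n / INR (fact n) * exp (Rmax (Re z) 0))) with
      ((t * Cmod z) * exp (Rmax (Re z) 0) * ((s * t * Cmod z) ^ n / INR (fact n))) by ring.
    apply (Rder_ext (fun s => exp (Rmax (Re z) 0) * ((s * t * Cmod z) ^ S n / INR (fact (S n)))));
     [intros; ring|].
    rewrite (Rmult_comm (t * Cmod z)), Rmult_assoc.
    apply Rder_scal.
    apply (Rder_comp (fun u => u ^ S n / INR (fact (S n))) (fun s => s * t * Cmod z) s).
    * apply is_derive_pow_fact.
    * auto_derive; auto; ring.
  + intros s Hs; rewrite !Cmod_mult, Cmod_R, Rabs_pos_eq, Rmult_assoc by lra.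
    apply Rmult_le_compat_l; [lra|]; apply Rmult_le_compat_l; [apply Cmod_ge_0|].
    apply IHn; nra.
Qed.

Definition cexpsum (n : nat) (z : C) : C := csum (fun k => z ^ k / INR (fact k))%C n.

Lemma Cexp_taylor n z :
  Cmod (Cexp z - cexpsum n z) <= Cmod z ^ n / INR (fact n) * exp (Rmax (Re z) 0).
Proof.
pose proof (Cexp_taylor_aux n z 1 ltac:(lra)) as H.
rewrite !Rmult_1_l, !Cmult_1_l in H.
replace (cexpsum n z) with (ctay n 1 z); auto.
apply csum_ext; intros k _; rewrite pow1; unfold Rdiv; rewrite Rmult_1_l, RtoC_inv by apply INR_fact_neq_0.
unfold Cdiv; ring.
Qed.

Lemma is_series_exp x : is_series (fun k => x ^ k / INR (fact k)) (exp x).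
Proof.
apply is_series_Reals; unfold infinite_sum, exp.
destruct (exist_exp x) as [l Hl]; simpl.
intros eps He; destruct (Hl eps He) as [N HN]; exists N; intros n Hn.
rewrite (sum_eq _ (fun i => / INR (fact i) * x ^ i)); [apply HN; auto|intros; unfold Rdiv; ring].
Qed.

Lemma CSer_Cexp z : CSer (fun k => z ^ k / INR (fact k))%C (Cexp z).
Proof.
apply (Clim_squeeze _ _ (fun n => Cmod z ^ n / INR (fact n) * exp (Rmax (Re z) 0))).
- intros n; fold (cexpsum n z).
  replace (cexpsum n z - Cexp z)%C with (- (Cexp z - cexpsum n z))%C by ring.
  rewrite Cmod_opp; apply Cexp_taylor.
- replace (Finite 0) with (Rbar_mult 0 (exp (Rmax (Re z) 0))) by (simpl; f_equal; ring).
  apply is_lim_seq_mult'; [|apply is_lim_seq_const].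
  apply ex_series_lim_0; eexists; apply is_series_exp.
Qed.

Lemma Cexp_sub1 z : Cmod (Cexp z - 1) <= Cmod z * exp (Rmax (Re z) 0).
Proof.
pose proof (Cexp_taylor 1 z) as H; unfold cexpsum in H; simpl in H.
unfold Rdiv in H; rewrite Rinv_1, !Rmult_1_r in H.
replace (Cexp z - 1)%C with (Cexp z - (0 + 1 / 1))%C by field; exact H.
Qed.

Lemma Cexp_sub2 z : Cmod (Cexp z - 1 - z) <= Cmod z ^ 2 / 2 * exp (Rmax (Re z) 0).
Proof.
pose proof (Cexp_taylor 2 z) as H; unfold cexpsum in H; simpl in H.
replace (Cexp z - 1 - z)%C with (Cexp z - (0 + 1 / 1 + z * 1 / 1))%C by field.
replace (Cmod z ^ 2 / 2) with (Cmod z * (Cmod z * 1) / (1 + 1)) by (simpl; field); exact H.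
Qed.

Lemma nome_add z w : nome (z + w) = (nome z * nome w)%C.
Proof. unfold nome; rewrite <- Cexp_add; f_equal; ring. Qed.

Lemma nome_0 : nome 0 = 1%C.
Proof. unfold nome; rewrite <- Cexp_0; f_equal; ring. Qed.

Lemma nome_1 : nome 1 = 1%C.
Proof.
unfold nome; apply C_eq; [rewrite Re_Cexp | rewrite Im_Cexp]; simpl.
- replace (_ - _) with 0 by ring.
  match goal with |- _ * cos ?a = _ => replace a with (2 * PI) by ring end.
  rewrite exp_0, cos_2PI; ring.
- match goal with |- _ * sin ?a = _ => replace a with (2 * PI) by ring end.
  rewrite sin_2PI; ring.
Qed.

Lemma nome_half : nome (1 / 2) = (- 1)%C.
Proof.
unfold nome; apply C_eq; [rewrite Re_Cexp | rewrite Im_Cexp]; simpl.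
- match goal with |- exp ?b * cos ?a = _ => replace a with PI by field; replace b with 0 by field end.
  rewrite exp_0, cos_PI; ring.
- match goal with |- _ * sin ?a = _ => replace a with PI by field end.
  rewrite sin_PI; ring.
Qed.

Lemma nome_nz z : nome z <> 0%C.
Proof. apply Cexp_nz. Qed.

Lemma nome_opp z : nome (- z) = (/ nome z)%C.
Proof. unfold nome; rewrite <- Cexp_opp; f_equal; ring. Qed.

Lemma nome_pow z n : (nome z ^ n)%C = nome (INR n * z).
Proof. unfold nome; rewrite Cexp_pow; f_equal; ring. Qed.

Lemma nome_INR n : nome (INR n) = 1%C.
Proof. rewrite <- (Cmult_1_r (INR n)), <- nome_pow, nome_1, Cpow_1_l; auto. Qed.

Lemma nome_shift z n : nome (z + INR n) = nome z.
Proof. rewrite nome_add, nome_INR; ring. Qed.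

Lemma nome_shift_neg z n : nome (z - INR n) = nome z.
Proof. rewrite <- (nome_shift (z - INR n) n); f_equal; ring. Qed.

Lemma Cmod_nome z : Cmod (nome z) = exp (- (2 * PI * Im z)).
Proof. unfold nome; rewrite Cmod_Cexp; f_equal; destruct z; simpl; ring. Qed.

Lemma Cmod_nome_lt1 z : 0 < Im z -> Cmod (nome z) < 1.
Proof.
intros H; rewrite Cmod_nome, <- exp_0; apply exp_increasing; pose proof PI_RGT_0; nra.
Qed.

(** * The partial fraction expansion of the cotangent *)

Lemma is_lim_seq_inv_INR_1 : is_lim_seq (fun n => / INR (S n)) 0.
Proof.
apply (is_lim_seq_incr_1 (fun n => / INR n)).
exact (is_lim_seq_inv INR p_infty is_lim_seq_INR ltac:(discriminate)).
Qed.

Lemma is_series_inv_telescope : is_series (fun k => / INR (S k) - / INR (S (S k))) 1.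
Proof.
enough (is_lim_seq (sum_n (fun k => / INR (S k) - / INR (S (S k)))) 1) by assumption.
apply (is_lim_seq_ext (fun n => 1 - / INR (S (S n)))).
- intros n; induction n.
  + rewrite sum_O; simpl; field.
  + rewrite sum_Sn, <- IHn; unfold plus; simpl; ring.
- replace (Finite 1) with (Finite (1 - 0)) by (f_equal; ring).
  apply is_lim_seq_minus'; [apply is_lim_seq_const|].
  exact (proj1 (is_lim_seq_incr_1 (fun n => / INR (S n)) 0) is_lim_seq_inv_INR_1).
Qed.

Lemma inv_sq_le_telescope k : / INR (S k) ^ 2 <= 2 * (/ INR (S k) - / INR (S (S k))).
Proof.
rewrite !S_INR; pose proof (pos_INR k).
apply Rminus_le_0.
replace (_ - _) with (INR k * / ((INR k + 1) ^ 2 * (INR k + 1 + 1))) by (field; lra).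
apply Rmult_le_pos; auto; left; apply Rinv_0_lt_compat; nra.
Qed.

Lemma ex_series_Rscal (c : R) (a : nat -> R) : ex_series a -> ex_series (fun n => c * a n).
Proof. apply (ex_series_scal (K := R_AbsRing) (V := R_NormedModule) c a). Qed.

Lemma ex_series_inv_sq : ex_series (fun k => / INR (S k) ^ 2).
Proof.
apply (ex_series_le_pos _ (fun k => 2 * (/ INR (S k) - / INR (S (S k))))).
- intros n; rewrite Rabs_pos_eq; [apply inv_sq_le_telescope|].
  left; apply Rinv_0_lt_compat, pow_lt, lt_0_INR; lia.
- apply ex_series_Rscal; exists 1; apply is_series_inv_telescope.
Qed.

Lemma ex_series_const_inv_sq (c : R) : ex_series (fun k => c * / INR (S k) ^ 2).
Proof. apply ex_series_Rscal, ex_series_inv_sq. Qed.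

Lemma sin_lower x : 0 <= x <= 2 -> x - x ^ 3 / 6 <= sin x.
Proof.
intros H; destruct (pre_sin_bound x 0) as [H1 _]; try lra.
eapply Rle_trans; [|exact H1]; unfold sin_approx, sin_term; simpl; apply Req_le; field.
Qed.

Lemma PI_le_4 : PI <= 4. Proof. apply PI_4. Qed.

Lemma PI_ge_3 : 3 < PI. Proof. pose proof PI2_3_2; lra. Qed.

Lemma sin_upper x : 0 <= x <= 2 -> sin x <= x - x ^ 3 / 6 + x ^ 5 / 120.
Proof.
intros H; destruct (pre_sin_bound x 0) as [_ H1]; try lra.
eapply Rle_trans; [exact H1|]; unfold sin_approx, sin_term; simpl; apply Req_le; field.
Qed.

(** Otherwise monotonicity gives sin(0.524) <= sin(PI/6) = 1/2, against the cubic Taylor bound.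
    [PI_lower] uses the quintic bound in the same way. *)
Lemma PI_upper : PI < 3144 / 1000.
Proof.
destruct (Rlt_le_dec PI (3144/1000)) as [|H]; auto; exfalso.
assert (sin (524/1000) <= 1 / 2).
{ rewrite <- sin_PI6; apply sin_incr_1; pose proof PI_le_4; lra. }
pose proof (sin_lower (524/1000) ltac:(lra)); simpl in *; lra.
Qed.

Lemma PI_lower : 314 / 100 < PI.
Proof.
destruct (Rlt_le_dec (314/100) PI) as [|H]; auto; exfalso.
assert (1 / 2 <= sin (314/600)).
{ rewrite <- sin_PI6; apply sin_incr_1; pose proof PI_ge_3; lra. }
pose proof (sin_upper (314/600) ltac:(lra)); simpl in *; lra.
Qed.

Lemma sin_ge_half x : 0 <= x <= PI / 2 -> x / 2 <= sin x.
Proof.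
intros H; pose proof PI_upper.
eapply Rle_trans; [|apply sin_lower; lra]; simpl; nra.
Qed.

Lemma RtoC_neq0 (r : R) : r <> 0 -> RtoC r <> 0%C.
Proof. intros H E; apply H; injection E; auto. Qed.

Lemma C_neq0_Im (z : C) : Im z <> 0 -> z <> 0%C.
Proof. intros H E; apply H; rewrite E; reflexivity. Qed.

Lemma INR_C_neq0 n : (0 < n)%nat -> RtoC (INR n) <> 0%C.
Proof. intros; apply RtoC_neq0, not_0_INR; lia. Qed.

Lemma Im_div_INR z n : (0 < n)%nat -> Im (z / INR n)%C = Im z / INR n.
Proof.
intros H; unfold Cdiv; rewrite <- RtoC_inv by (apply not_0_INR; lia).
rewrite im_scal_r; auto.
Qed.

Lemma one_minus_nome_nz z : 0 < Im z -> (1 - nome z <> 0)%C.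
Proof.
intros H E; pose proof (Cmod_nome_lt1 z H) as L.
replace (nome z) with (RtoC 1) in L; [rewrite Cmod_1 in L; lra|].
apply Ceq_minus; exact E.
Qed.

Lemma one_plus_nome_nz z : 0 < Im z -> (1 + nome z <> 0)%C.
Proof.
intros H E; pose proof (Cmod_nome_lt1 z H) as L.
replace (nome z) with (- RtoC 1)%C in L; [rewrite Cmod_opp, Cmod_1 in L; lra|].
apply Ceq_minus; replace (- (1) - nome z)%C with (- (1 + nome z))%C by ring; rewrite E; ring.
Qed.

(* [PI * cot (PI z) = - PI i * ct z] *)
Definition ct (z : C) : C := ((1 + nome z) / (1 - nome z))%C.

(** Duplication formula of the cotangent: halving the argument takes a square root of the nome, and
    the shift by 1/2 changes its sign. Iterated, it writes [ct] as an average of [2 ^ n] rescaled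
    copies, a Riemann-sum form of the partial fractions. *)
Lemma ct_dup z : 0 < Im z -> ct z = ((ct (z / 2) + ct (z / 2 + 1 / 2)) / 2)%C.
Proof.
intros H; unfold ct.
assert (H2 : 0 < Im (z / 2)%C).
{ replace (RtoC 2) with (RtoC (INR 2)) by (simpl; f_equal; ring); rewrite Im_div_INR by lia; simpl; lra. }
rewrite nome_add, nome_half.
replace (nome z) with (nome (z / 2) * nome (z / 2))%C by (rewrite <- nome_add; f_equal; field).
pose proof (one_minus_nome_nz _ H2); pose proof (one_plus_nome_nz _ H2).
assert (1 - nome (z / 2) * nome (z / 2) <> 0)%C.
{ replace (1 - nome (z / 2) * nome (z / 2))%C with ((1 - nome (z / 2)) * (1 + nome (z / 2)))%C by ring.
  apply Cmult_neq_0; auto. }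
field; repeat split; auto.
replace (1 - nome (z / 2) * -1)%C with (1 + nome (z / 2))%C by ring; auto.
Qed.

Lemma two_pow_pos n : (0 < 2 ^ n)%nat.
Proof. induction n; simpl; lia. Qed.

Lemma ct_sum n z : 0 < Im z ->
  ct z = (csum (fun k => ct ((z + INR k) / INR (2 ^ n))) (2 ^ n) / INR (2 ^ n))%C.
Proof.
intros H; induction n.
- simpl; rewrite Cplus_0_l.
  replace ((z + 0) / 1)%C with z by field; field.
- rewrite IHn.
  assert (P := two_pow_pos n).
  replace (2 ^ S n)%nat with (2 ^ n + 2 ^ n)%nat by (simpl; lia).
  rewrite csum_split, <- csum_plus.
  rewrite (csum_ext _ (fun k => (1 / 2) * (ct ((z + INR k) / INR (2 ^ n + 2 ^ n)) +
      ct ((z + INR (2 ^ n + k)) / INR (2 ^ n + 2 ^ n))))%C).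
  + rewrite csum_scal, plus_INR, RtoC_plus.
    field; split; [|apply INR_C_neq0; auto].
    rewrite <- RtoC_plus, <- plus_INR; apply INR_C_neq0; lia.
  + intros k Hk.
    assert (NZ := INR_C_neq0 _ P).
    rewrite ct_dup.
    2:{ rewrite Im_div_INR by auto; apply Rdiv_lt_0_compat; [rewrite Im_plus, im_RtoC; lra|apply lt_0_INR; auto]. }
    rewrite !plus_INR, !RtoC_plus.
    assert (RtoC (INR (2 ^ n)) + RtoC (INR (2 ^ n)) <> 0)%C.
    { rewrite <- RtoC_plus, <- plus_INR; apply INR_C_neq0; lia. }
    replace ((z + INR k) / (INR (2 ^ n) + INR (2 ^ n)))%C with ((z + INR k) / INR (2 ^ n) / 2)%C by (field; auto).
    replace ((z + (INR (2 ^ n) + INR k)) / (INR (2 ^ n) + INR (2 ^ n)))%C with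
      ((z + INR k) / INR (2 ^ n) / 2 + 1 / 2)%C by (field; auto).
    field.
Qed.

Lemma ct_shift_neg z n : ct (z - INR n) = ct z.
Proof. unfold ct; rewrite nome_shift_neg; auto. Qed.

(** The upper half of the indices is folded to negative ones by periodicity. Only the resulting
    pairs decay fast enough to be dominated uniformly in [n]. *)
Lemma ct_sum_pair n z : 0 < Im z ->
  ct z = csum (fun k => (ct ((z + INR k) / INR (2 ^ S n)) + ct ((z - INR (S k)) / INR (2 ^ S n))) / INR (2 ^ S n))%C (2 ^ n).
Proof.
intros H; rewrite (ct_sum (S n) z H) at 1.
assert (P := two_pow_pos n).
set (N := (2 ^ S n)%nat).
replace (csum _ N) with (csum (fun k => ct ((z + INR k) / INR N)) (2 ^ n + 2 ^ n))
  by (f_equal; unfold N; simpl; lia).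
rewrite csum_split, (csum_rev (fun k => ct ((z + INR (2 ^ n + k)) / INR N))), <- csum_plus.
unfold Cdiv at 1; rewrite Cmult_comm, <- csum_scal.
apply csum_ext; intros k Hk.
rewrite Cmult_comm; unfold Cdiv at 3; f_equal; f_equal.
(* A shift by 1 = N / N turns the index [N - S k] into [- S k]. *)
rewrite <- (ct_shift_neg _ 1); f_equal.
replace (2 ^ n + (2 ^ n - 1 - k))%nat with (N - S k)%nat by (unfold N; simpl; lia).
rewrite minus_INR by (unfold N; simpl; lia).
rewrite RtoC_minus; simpl (INR 1).
field; apply INR_C_neq0; unfold N; simpl; lia.
Qed.

Lemma Re_2pii z : Re (2 * PI * Ci * z)%C = - (2 * PI * Im z).
Proof. destruct z; simpl; ring. Qed.

Lemma Cmod_2pii z : Cmod (2 * PI * Ci * z)%C = 2 * PI * Cmod z.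
Proof.
rewrite !Cmod_mult, Cmod_Ci, !Cmod_R, !Rabs_pos_eq; [ring|pose proof PI_RGT_0; lra|lra].
Qed.

Lemma nome_sub1 z : 0 <= Im z -> Cmod (nome z - 1) <= 2 * PI * Cmod z.
Proof.
intros H; unfold nome; eapply Rle_trans; [apply Cexp_sub1|].
rewrite Cmod_2pii, Re_2pii, Rmax_right, exp_0 by (pose proof PI_RGT_0; nra); lra.
Qed.

Lemma nome_sub2 z : 0 <= Im z ->
  Cmod (nome z - 1 - 2 * PI * Ci * z) <= (2 * PI * Cmod z) ^ 2 / 2.
Proof.
intros H; unfold nome; eapply Rle_trans; [apply Cexp_sub2|].
rewrite Cmod_2pii, Re_2pii, Rmax_right, exp_0 by (pose proof PI_RGT_0; nra); lra.
Qed.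

Lemma Re_nome z : Re (nome z) = exp (- (2 * PI * Im z)) * cos (2 * PI * Re z).
Proof. unfold nome; rewrite Re_Cexp, Re_2pii; f_equal; f_equal; destruct z; simpl; ring. Qed.

Lemma Im_nome z : Im (nome z) = exp (- (2 * PI * Im z)) * sin (2 * PI * Re z).
Proof. unfold nome; rewrite Im_Cexp, Re_2pii; f_equal; f_equal; destruct z; simpl; ring. Qed.

Lemma Cmod2_one_minus_nome z : let rho := exp (- (2 * PI * Im z)) in
  Cmod (1 - nome z) ^ 2 = (1 - rho) ^ 2 + 4 * rho * sin (PI * Re z) ^ 2.
Proof.
intros rho; rewrite Cmod2_alt, Re_minus, Im_minus, Re_nome, Im_nome; fold rho; simpl (Re 1); simpl (Im 1).
replace (2 * PI * Re z) with (2 * (PI * Re z)) by ring.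
rewrite cos_2a, sin_2a.
pose proof (sin2_cos2 (PI * Re z)) as E; rewrite !Rsqr_pow2 in E.
set (c := cos (PI * Re z)) in *; set (s := sin (PI * Re z)) in *.
replace (c * c) with (1 - s ^ 2) by (rewrite <- E; ring).
replace ((0 - rho * (2 * s * c)) ^ 2) with (rho ^ 2 * 4 * s ^ 2 * c ^ 2) by ring.
replace (c ^ 2) with (1 - s ^ 2) by (rewrite <- E; ring).
ring.
Qed.

Lemma one_minus_nome_lower z : 0 <= Im z -> -(1/2) <= Re z <= 1 / 2 ->
  2 * exp (- (2 * PI * Im z)) * Rabs (Re z) <= Cmod (1 - nome z).
Proof.
intros Hi Hr.
pose proof (Cmod2_one_minus_nome z) as E; cbv zeta in E.
set (rho := exp (- (2 * PI * Im z))) in *.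
assert (Hrho : 0 < rho <= 1).
{ split; [apply exp_pos|]; unfold rho; rewrite <- exp_0; apply exp_mono; pose proof PI_RGT_0; nra. }
assert (Hs : Rabs (Re z) <= Rabs (sin (PI * Re z))).
{ pose proof PI_ge_3.
  destruct (Rle_dec 0 (Re z)).
  - rewrite (Rabs_pos_eq (Re z)) by auto.
    eapply Rle_trans; [|apply Rle_abs].
    eapply Rle_trans; [|apply sin_ge_half; nra]; nra.
  - rewrite <- (Rabs_Ropp (sin _)), <- sin_neg, <- Rabs_Ropp.
    rewrite (Rabs_pos_eq (- Re z)) by lra.
    eapply Rle_trans; [|apply Rle_abs].
    eapply Rle_trans; [|apply sin_ge_half; nra]; nra. }
assert (Hs2 : Rabs (Re z) ^ 2 <= sin (PI * Re z) ^ 2).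
{ rewrite <- (pow2_abs (sin _)); apply pow_incr; split; auto; apply Rabs_pos. }
apply Rsqr_incr_0_var; [|apply Cmod_ge_0].
rewrite !Rsqr_pow2, E.
assert (rho ^ 2 <= rho) by nra.
pose proof (pow2_ge_0 (1 - rho)); pose proof (pow2_ge_0 (Rabs (Re z))).
replace ((2 * rho * Rabs (Re z)) ^ 2) with (4 * rho ^ 2 * Rabs (Re z) ^ 2) by ring.
assert (4 * rho ^ 2 * Rabs (Re z) ^ 2 <= 4 * rho * sin (PI * Re z) ^ 2); [|lra].
apply Rmult_le_compat; nra.
Qed.

Lemma exp_ge_1p x : 1 + x <= exp x.
Proof. pose proof (exp_ineq1_le x); lra. Qed.

Lemma one_minus_nome_lower0 z : 0 <= Im z ->
  2 * PI * Im z * exp (- (2 * PI * Im z)) <= Cmod (1 - nome z).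
Proof.
intros Hi.
set (s := 2 * PI * Im z).
assert (Cmod 1 <= Cmod (1 - nome z) + Cmod (nome z)).
{ replace (RtoC 1) with ((1 - nome z) + nome z)%C at 1 by ring; apply Cmod_triangle. }
rewrite Cmod_1, Cmod_nome in H; fold s in H.
assert (exp (- s) * exp s = 1) by (rewrite <- exp_plus, <- exp_0; f_equal; ring).
pose proof (exp_ge_1p s); pose proof (exp_pos (- s)); nra.
Qed.

(** The point is uniformity in [N]. For [k = 0] the real part may vanish and the imaginary part
    gives the bound; for larger [k] the real part does, and [S (S k) <= 2 * S k] absorbs the shift
    of the index. *)
Lemma one_minus_nome_lower_scaled z k N : 0 < Im z -> 0 < N -> INR k <= Rabs (Re z) <= N / 2 -> 1 <= N ->
  exp (- (2 * PI * Im z)) * Rmin 1 (2 * PI * Im z) * (INR (S k) / N) <=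
  Cmod (1 - nome (RtoC (/ N) * z)).
Proof.
intros Hi HN Hk HN1.
set (w := (RtoC (/ N) * z)%C).
assert (Iw : Im w = Im z / N) by (unfold w; rewrite im_scal_l; unfold Rdiv; ring).
assert (Rw : Re w = Re z / N) by (unfold w; rewrite re_scal_l; unfold Rdiv; ring).
assert (HI : 0 < Im w <= Im z).
{ rewrite Iw; split; [apply Rdiv_lt_0_compat; auto|].
  apply Rle_div_l; auto; nra. }
assert (E : exp (- (2 * PI * Im z)) <= exp (- (2 * PI * Im w))).
{ apply exp_mono; pose proof PI_RGT_0; nra. }
set (r0 := exp (- (2 * PI * Im z))) in *.
assert (0 < r0) by apply exp_pos.
pose proof PI_RGT_0.
destruct k.
- eapply Rle_trans; [|apply one_minus_nome_lower0; lra].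
  rewrite Rmult_comm.
  rewrite Iw in *; simpl INR.
  apply Rle_trans with (2 * PI * (Im z / N) * r0); [|apply Rmult_le_compat_l; [nra|auto]].
  replace (2 * PI * (Im z / N) * r0) with (1 / N * (r0 * (2 * PI * Im z))) by (field; lra).
  apply Rmult_le_compat_l; [left; apply Rdiv_lt_0_compat; lra|].
  apply Rmult_le_compat_l; [lra|apply Rmin_r].
- assert (HR : Rabs (Re w) = Rabs (Re z) / N).
  { rewrite Rw; unfold Rdiv; rewrite Rabs_mult, (Rabs_pos_eq (/ N)); auto.
    left; apply Rinv_0_lt_compat; auto. }
  assert (HR2 : INR (S k) / N <= Rabs (Re w)).
  { rewrite HR; apply Rmult_le_compat_r; [left; apply Rinv_0_lt_compat; auto|lra]. }
  assert (Hb : Rabs (Re w) <= 1 / 2).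
  { rewrite HR; apply Rle_div_l; lra. }
  eapply Rle_trans; [|apply one_minus_nome_lower; [lra|apply Rabs_le_between in Hb; lra]].
  assert (P : 0 < INR (S k) / N) by (apply Rdiv_lt_0_compat; auto; apply lt_0_INR; lia).
  assert (Q : INR (S (S k)) / N <= 2 * (INR (S k) / N)).
  { replace (2 * (INR (S k) / N)) with ((2 * INR (S k)) / N) by (field; lra).
    apply Rmult_le_compat_r; [left; apply Rinv_0_lt_compat; auto|].
    rewrite (S_INR (S k)); rewrite S_INR; pose proof (pos_INR k); lra. }
  assert (Rmin 1 (2 * PI * Im z) <= 1) by apply Rmin_l.
  assert (0 <= Rmin 1 (2 * PI * Im z)) by (apply Rmin_glb; nra).
  apply Rle_trans with (r0 * 1 * (2 * Rabs (Re w))).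
  + apply Rmult_le_compat; [nra| |nra|lra].
    apply Rdiv_le_0_compat; auto; apply pos_INR.
  + pose proof (Rabs_pos (Re w)); nra.
Qed.

Lemma ct_pair a b : (1 - nome a <> 0)%C -> (1 - nome b <> 0)%C ->
  (ct a + ct b)%C = (2 * (1 - nome (a + b)) / ((1 - nome a) * (1 - nome b)))%C.
Proof. intros; unfold ct; rewrite nome_add; field; auto. Qed.

(** Adding the two terms leaves the numerator 1 - nome(a + b), where a + b = (2 z - 1) / N no longer
    depends on [k]. It is O(1 / N), each denominator is at least a multiple of (k + 1) / N, and the
    outer division by [N] balances the powers of [N]. *)
Lemma Cmod_pair_bound (z : C) (k : nat) (N : R) :
  0 < Im z -> 0 <= Re z < 1 -> INR (S k) <= N / 2 -> 1 <= N ->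
  let c0 := exp (- (2 * PI * Im z)) * Rmin 1 (2 * PI * Im z) in
  Cmod ((ct ((z + INR k) / RtoC N) + ct ((z - INR (S k)) / RtoC N)) / RtoC N) <=
   (4 * PI * Cmod (2 * z - 1) / c0 ^ 2) * / INR (S k) ^ 2.
Proof.
intros Hi Hr Hk HN c0.
pose proof PI_RGT_0.
assert (Hc0 : 0 < c0).
{ unfold c0; apply Rmult_lt_0_compat; [apply exp_pos|apply Rmin_glb_lt; nra]. }
assert (NZ : RtoC N <> 0%C) by (apply RtoC_neq0; lra).
assert (Ea : ((z + INR k) / RtoC N)%C = (RtoC (/ N) * (z + INR k))%C) by (rewrite RtoC_inv by lra; unfold Cdiv; ring).
assert (Eb : ((z - INR (S k)) / RtoC N)%C = (RtoC (/ N) * (z - INR (S k)))%C) by (rewrite RtoC_inv by lra; unfold Cdiv; ring).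
set (a := ((z + INR k) / RtoC N)%C) in *.
set (b := ((z - INR (S k)) / RtoC N)%C) in *.
rewrite S_INR in *.
pose proof (pos_INR k).
assert (La : c0 * (INR (S k) / N) <= Cmod (1 - nome a)).
{ rewrite Ea; replace c0 with (exp (- (2 * PI * Im (z + INR k))) * Rmin 1 (2 * PI * Im (z + INR k))).
  - apply one_minus_nome_lower_scaled; try lra.
    + rewrite Im_plus, im_RtoC; lra.
    + rewrite Re_plus, re_RtoC, Rabs_pos_eq; lra.
  - unfold c0; rewrite Im_plus, im_RtoC, Rplus_0_r; auto. }
assert (Lb : c0 * (INR (S k) / N) <= Cmod (1 - nome b)).
{ rewrite Eb; replace c0 with (exp (- (2 * PI * Im (z - RtoC (INR k + 1))%C)) * Rmin 1 (2 * PI * Im (z - RtoC (INR k + 1))%C)).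
  - apply one_minus_nome_lower_scaled; try lra.
    + rewrite Im_minus, !im_RtoC; lra.
    + rewrite Re_minus, re_RtoC, Rabs_left; lra.
  - unfold c0; rewrite Im_minus, im_RtoC, Rminus_0_r; auto. }
rewrite S_INR in La, Lb.
set (t := (INR k + 1) / N) in *.
assert (Ht : 0 < t) by (apply Rdiv_lt_0_compat; lra).
assert (Hct : 0 < c0 * t) by nra.
assert (Na : (1 - nome a)%C <> 0%C) by (apply Cmod_gt_0; lra).
assert (Nb : (1 - nome b)%C <> 0%C) by (apply Cmod_gt_0; lra).
rewrite ct_pair; auto.
rewrite Cmod_div, Cmod_div, !Cmod_mult, !Cmod_R, (Rabs_pos_eq 2), (Rabs_pos_eq N) by (auto; try lra; apply Cmult_neq_0; auto).
assert (U : Cmod (1 - nome (a + b)) <= 2 * PI * (Cmod (2 * z - 1) / N)).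
{ replace (1 - nome (a + b))%C with (- (nome (a + b) - 1))%C by ring; rewrite Cmod_opp.
  replace (a + b)%C with ((2 * z - 1) / RtoC N)%C
    by (unfold a, b; rewrite S_INR, RtoC_plus; field; auto).
  rewrite <- (Rabs_pos_eq N) at 2 by lra.
  rewrite <- Cmod_R, <- Cmod_div by auto.
  apply nome_sub1.
  unfold Cdiv; rewrite <- RtoC_inv by lra; rewrite im_scal_r.
  apply Rmult_le_pos; [|left; apply Rinv_0_lt_compat; lra].
  rewrite Im_minus, im_scal_l, im_RtoC; lra. }
assert (D : (c0 * t) ^ 2 <= Cmod (1 - nome a) * Cmod (1 - nome b)) by nra.
apply Rle_div_l; [lra|].
apply Rle_div_l; [apply Rlt_le_trans with (2 := D); nra|].
apply Rle_trans with (4 * PI * Cmod (2 * z - 1) / c0 ^ 2 * / (INR k + 1) ^ 2 * N * (c0 * t) ^ 2).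
- replace (4 * PI * Cmod (2 * z - 1) / c0 ^ 2 * / (INR k + 1) ^ 2 * N * (c0 * t) ^ 2) with
   (2 * (2 * PI * (Cmod (2 * z - 1) / N))) by (unfold t; field; repeat split; lra).
  lra.
- apply Rmult_le_compat_l; auto.
  apply Rmult_le_pos; [|lra].
  apply Rmult_le_pos; [|left; apply Rinv_0_lt_compat; nra].
  apply Rmult_le_pos; [|left; apply Rinv_0_lt_compat; nra].
  pose proof (Cmod_ge_0 (2 * z - 1)); nra.
Qed.

Lemma Clim_nome_small (z : C) (p : nat -> R) :
  0 < Im z -> (forall n, 0 < p n) -> is_lim_seq p p_infty ->
  Clim (fun n => RtoC (p n) * (1 - nome (z / RtoC (p n))))%C (- (2 * PI * Ci * z))%C /\
  Clim (fun n => nome (z / RtoC (p n)))%C 1%C.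
Proof.
intros Hi Hp Hl.
assert (Hinv : is_lim_seq (fun n => / p n) 0) by exact (is_lim_seq_inv p p_infty Hl ltac:(discriminate)).
assert (HI : forall n, 0 <= Im (z / RtoC (p n))%C).
{ intros n; unfold Cdiv; rewrite <- RtoC_inv by (specialize (Hp n); lra); rewrite im_scal_r.
  apply Rmult_le_pos; [lra|left; apply Rinv_0_lt_compat; auto]. }
assert (HM : forall n, Cmod (z / RtoC (p n)) = Cmod z * / p n).
{ intros n; rewrite Cmod_div, Cmod_R, Rabs_pos_eq; auto.
  - left; auto.
  - apply RtoC_neq0; specialize (Hp n); lra. }
split.
- apply (Clim_squeeze _ _ (fun n => (2 * PI * Cmod z) ^ 2 / 2 * / p n)).
  + intros n; specialize (Hp n).
    replace (_ - _)%C with (- (RtoC (p n) * (nome (z / RtoC (p n)) - 1 - 2 * PI * Ci * (z / RtoC (p n)))))%C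
      by (field; apply RtoC_neq0; lra).
    rewrite Cmod_opp, Cmod_mult, Cmod_R, Rabs_pos_eq by lra.
    eapply Rle_trans; [apply Rmult_le_compat_l; [lra|apply nome_sub2; auto]|].
    rewrite HM; apply Req_le; field; lra.
  + replace (Finite 0) with (Finite ((2 * PI * Cmod z) ^ 2 / 2 * 0)) by (f_equal; ring).
    apply is_lim_seq_mult'; auto; apply is_lim_seq_const.
- apply (Clim_squeeze _ _ (fun n => (2 * PI * Cmod z) * / p n)).
  + intros n; eapply Rle_trans; [apply nome_sub1; auto|].
    rewrite HM; apply Req_le; ring.
  + replace (Finite 0) with (Finite ((2 * PI * Cmod z) * 0)) by (f_equal; ring).
    apply is_lim_seq_mult'; auto; apply is_lim_seq_const.
Qed.

Lemma PI_C_neq0 : RtoC PI <> 0%C.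
Proof. apply RtoC_neq0, PI_neq0. Qed.

Lemma Clim_ct_small (z : C) (p : nat -> R) :
  0 < Im z -> (forall n, 0 < p n) -> is_lim_seq p p_infty ->
  Clim (fun n => ct (z / RtoC (p n)) / RtoC (p n))%C (Ci / PI / z)%C.
Proof.
intros Hi Hp Hl.
destruct (Clim_nome_small z p Hi Hp Hl) as [H1 H2].
assert (Zz : z <> 0%C) by (apply C_neq0_Im; lra).
assert (NZ : (- (2 * PI * Ci * z))%C <> 0%C).
{ intros E; assert (E' : (2 * PI * Ci * z)%C = 0%C)
    by (transitivity (- (- (2 * PI * Ci * z)))%C; [ring|rewrite E; ring]).
  revert E'; repeat apply Cmult_neq_0; auto; [apply RtoC_neq0; lra|apply PI_C_neq0|apply Ci_nz]. }
apply (Clim_ext (fun n => (1 + nome (z / RtoC (p n))) / (RtoC (p n) * (1 - nome (z / RtoC (p n)))))%C).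
- intros n; unfold ct; specialize (Hp n).
  assert (0 < Im (z / RtoC (p n))%C).
  { unfold Cdiv; rewrite <- RtoC_inv by lra; rewrite im_scal_r.
    apply Rmult_lt_0_compat; [lra|apply Rinv_0_lt_compat; auto]. }
  field; split; [apply one_minus_nome_nz; auto|apply RtoC_neq0; lra].
- replace (Ci / PI / z)%C with ((1 + 1) / (- (2 * PI * Ci * z)))%C.
  + apply Clim_div; auto; apply Clim_plus; auto; apply Clim_const.
  + transitivity (- (Ci * Ci) * (1 + 1) / (- (2 * PI * Ci * z)))%C.
    * replace (Ci * Ci)%C with (RtoC (-1)) by (apply C_eq; simpl; ring). unfold Cdiv; ring.
    * field; repeat split; auto; [apply PI_C_neq0|apply Ci_nz].
Qed.

Lemma INR_pow2 n : INR (2 ^ n) = 2 ^ n.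
Proof. rewrite pow_INR; reflexivity. Qed.

Lemma is_lim_seq_pow2 : is_lim_seq (fun n => INR (2 ^ S n)) p_infty.
Proof.
apply (is_lim_seq_ext (fun n => 2 ^ S n)); [intros; rewrite INR_pow2; auto|].
apply (is_lim_seq_incr_1 (fun n => 2 ^ n)), is_lim_seq_geom_p; lra.
Qed.

Lemma eventually_pow2 : filterlim (fun n => 2 ^ n)%nat eventually eventually.
Proof.
apply eventually_subseq; intros n; pose proof (two_pow_pos n) as P.
change (2 ^ n < 2 ^ S n)%nat; rewrite Nat.pow_succ_r'; lia.
Qed.

Lemma shift_nz (z : C) (a : R) : 0 < Im z -> (z + RtoC a)%C <> 0%C.
Proof. intros; apply C_neq0_Im; rewrite Im_plus, im_RtoC; lra. Qed.

Lemma shift_nz' (z : C) (a : R) : 0 < Im z -> (z - RtoC a)%C <> 0%C.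
Proof. intros; apply C_neq0_Im; rewrite Im_minus, im_RtoC; lra. Qed.

Definition cotterm (z : C) (k : nat) : C := (/ (z + INR k) + / (z - INR (S k)))%C.

(** In [ct_sum_pair] the left side does not depend on [n], while each term on the right tends to a
    partial fraction because ct(w / p) / p tends to Ci / (PI w). [Tannery_fin] passes to the limit
    with the majorant of [Cmod_pair_bound]. *)
Lemma cot_series_strip z : 0 < Im z -> 0 <= Re z < 1 ->
  CSer (cotterm z) (- (PI * Ci * ct z))%C.
Proof.
intros Hi Hr.
set (c0 := exp (- (2 * PI * Im z)) * Rmin 1 (2 * PI * Im z)).
set (K := 4 * PI * Cmod (2 * z - 1) / c0 ^ 2).
set (u := fun n k => ((ct ((z + INR k) / INR (2 ^ S n)) + ct ((z - INR (S k)) / INR (2 ^ S n))) / INR (2 ^ S n))%C).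
set (v := fun k => (Ci / PI * cotterm z k)%C).
pose proof PI_RGT_0.
assert (Hp : forall n, 1 <= INR (2 ^ S n)).
{ intros n; apply (le_INR 1); pose proof (two_pow_pos (S n)); lia. }
assert (Hc0 : 0 < c0).
{ unfold c0; apply Rmult_lt_0_compat; [apply exp_pos|apply Rmin_glb_lt; nra]. }
assert (HK : 0 <= K).
{ unfold K; apply Rmult_le_pos; [|left; apply Rinv_0_lt_compat; nra].
  pose proof (Cmod_ge_0 (2 * z - 1)); nra. }
assert (Hu : forall n k, (k < 2 ^ n)%nat -> Cmod (u n k) <= K * / INR (S k) ^ 2).
{ intros n k Hk; unfold u, K, c0; apply Cmod_pair_bound; auto.
  simpl (2 ^ S n)%nat; rewrite Nat.add_0_r, plus_INR.
  apply (le_INR (S k)) in Hk; lra. }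
assert (Hv : forall k, Clim (fun n => u n k) (v k)).
{ intros k; unfold v, cotterm.
  apply (Clim_ext (fun n => ct ((z + INR k) / RtoC (INR (2 ^ S n))) / RtoC (INR (2 ^ S n))
     + ct ((z - INR (S k)) / RtoC (INR (2 ^ S n))) / RtoC (INR (2 ^ S n)))%C).
  - intros n; unfold u, Cdiv; ring.
  - replace (Ci / PI * _)%C with (Ci / PI / (z + INR k) + Ci / PI / (z - INR (S k)))%C by (unfold Cdiv; ring).
    apply Clim_plus; apply (Clim_ct_small _ (fun n => INR (2 ^ S n))); try apply is_lim_seq_pow2.
    + rewrite Im_plus, im_RtoC; lra.
    + intros n; specialize (Hp n); lra.
    + rewrite Im_minus, im_RtoC; lra.
    + intros n; specialize (Hp n); lra. }
assert (HB : ex_series (fun k => K * / INR (S k) ^ 2)) by apply ex_series_const_inv_sq.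
assert (L : Clim (fun n => csum (u n) (2 ^ n)) (Csum v)).
{ apply (Tannery_fin u v _ (fun k => K * / INR (S k) ^ 2)); auto.
  - intros k; apply Rmult_le_pos; auto; left; apply Rinv_0_lt_compat, pow_lt, lt_0_INR; lia.
  - apply eventually_pow2. }
assert (E : Csum v = ct z).
{ apply (Clim_unique _ _ _ L).
  apply (Clim_ext (fun _ => ct z)); [|apply Clim_const].
  intros n; apply ct_sum_pair; auto. }
assert (S : CSer v (ct z)).
{ rewrite <- E; apply (CSer_Csum v (fun k => K * / INR (S k) ^ 2)); auto.
  intros k; assert (exists n, (k < 2 ^ n)%nat) as [n0 Hn0].
  { exists k; clear; induction k; simpl; [lia|pose proof (two_pow_pos k); lia]. }
  apply (Clim_mod_le (fun n => u n k) _ _ n0); auto.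
  intros n Hn; apply Hu; apply Nat.lt_le_trans with (1 := Hn0).
  apply Nat.pow_le_mono_r; lia. }
replace (- (PI * Ci * ct z))%C with (- (PI * Ci) * ct z)%C by ring.
apply (CSer_ext (fun k => - (PI * Ci) * v k)%C); [|apply CSer_scal; auto].
intros k; unfold v.
transitivity (- (Ci * Ci) * cotterm z k)%C; [field; apply PI_C_neq0|].
replace (Ci * Ci)%C with (RtoC (-1)) by (apply C_eq; simpl; ring); ring.
Qed.

Lemma Clim_inv_far (u : nat -> C) (b : R) :
  (forall n, INR n - b <= Cmod (u n)) -> Clim (fun n => / u n)%C 0%C.
Proof.
intros H.
destruct (nfloor_ex (Rabs b + 1)) as [N [_ HN]]; [pose proof (Rabs_pos b); lra|].
apply (Clim_squeeze_ev _ _ (fun n => / (INR n - b)) (S N)).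
- intros n Hn; rewrite Cminus_0_r.
  apply le_INR in Hn; rewrite S_INR in Hn; pose proof (Rle_abs b).
  assert (0 < INR n - b) by lra.
  specialize (H n).
  rewrite Cmod_inv by (apply Cmod_gt_0; lra).
  apply Rinv_le_contravar; auto.
- apply (is_lim_seq_inv (fun n => INR n - b) p_infty); [|discriminate].
  apply (is_lim_seq_minus INR (fun _ => b) p_infty b); [apply is_lim_seq_INR|apply is_lim_seq_const|reflexivity].
Qed.

Lemma Cmod_far (z : C) (n : nat) : INR n - Cmod z <= Cmod (z + INR n).
Proof.
assert (Cmod (INR n) <= Cmod (z + INR n) + Cmod z).
{ replace (RtoC (INR n)) with ((z + INR n) + - z)%C at 1 by ring.
  eapply Rle_trans; [apply Cmod_triangle|]; rewrite Cmod_opp; lra. }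
rewrite Cmod_R, Rabs_pos_eq in H by apply pos_INR; lra.
Qed.

Lemma Cmod_far' (z : C) (n : nat) : INR n - Cmod z <= Cmod (z - INR n).
Proof.
replace (z - INR n)%C with (- (- z + INR n))%C by ring.
rewrite Cmod_opp, <- (Cmod_opp z); apply Cmod_far.
Qed.

Lemma cotterm_partial_shift z n : 0 < Im z ->
  csum (cotterm (z + 1)) n = (csum (cotterm z) n + (/ (z + INR n) - / (z - INR n)))%C.
Proof.
intros H; induction n.
- simpl; rewrite !Cplus_0_l, Cminus_0_r, Cplus_0_r; ring.
- simpl csum; rewrite IHn; unfold cotterm.
  replace (z + 1 + INR n)%C with (z + INR (S n))%C by (rewrite S_INR, RtoC_plus; ring).
  replace (z + 1 - INR (S n))%C with (z - INR n)%C by (rewrite S_INR, RtoC_plus; ring).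
  ring.
Qed.

(** The partial sums differ by two boundary terms that tend to 0. This frees the expansion from the
    strip to which the uniform bounds are tied. *)
Lemma cot_series_shift z l : 0 < Im z -> (CSer (cotterm z) l <-> CSer (cotterm (z + 1)) l).
Proof.
intros H.
assert (Z : Clim (fun n => / (z + INR n) - / (z - INR n))%C 0%C).
{ replace (RtoC 0) with (0 - 0)%C by ring; apply Clim_minus.
  - apply (Clim_inv_far _ (Cmod z)), Cmod_far.
  - apply (Clim_inv_far _ (Cmod z)), Cmod_far'. }
unfold CSer; split; intros L.
- replace l with (l + 0)%C by ring.
  eapply Clim_ext; [intros n; symmetry; apply cotterm_partial_shift; auto|].
  apply Clim_plus; auto.
- replace l with (l - 0)%C by ring.
  apply (Clim_ext (fun n => csum (cotterm (z + 1)) n - (/ (z + INR n) - / (z - INR n)))%C).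
  + intros n; rewrite cotterm_partial_shift by auto; ring.
  + apply Clim_minus; auto.
Qed.

Lemma cot_series_shift_n z l n : 0 < Im z -> (CSer (cotterm z) l <-> CSer (cotterm (z + INR n)) l).
Proof.
intros H; induction n.
- simpl; rewrite Cplus_0_r; tauto.
- rewrite IHn.
  replace (z + INR (S n))%C with (z + INR n + 1)%C by (rewrite S_INR, RtoC_plus; ring).
  apply cot_series_shift; rewrite Im_plus, im_RtoC; lra.
Qed.

Lemma cot_series z : 0 < Im z -> CSer (cotterm z) (- (PI * Ci * ct z))%C.
Proof.
intros H.
assert (Hn : exists n, 0 <= Re z + INR n).
{ destruct (nfloor_ex (Rabs (Re z) + 1)) as [n [_ Hn]]; [pose proof (Rabs_pos (Re z)); lra|].
  exists (S n); rewrite S_INR; pose proof (Rle_abs (- Re z)); rewrite Rabs_Ropp in *; lra. }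
destruct Hn as [n Hn].
apply (proj2 (cot_series_shift_n z _ n H)).
replace (ct z) with (ct (z + INR n)) by (unfold ct; rewrite nome_shift; auto).
set (w := (z + INR n)%C).
assert (Hw : 0 < Im w) by (unfold w; rewrite Im_plus, im_RtoC; lra).
destruct (nfloor_ex (Re w)) as [m Hm]; [unfold w; rewrite Re_plus, re_RtoC; auto|].
assert (Hs : 0 < Im (w - INR m)) by (rewrite Im_minus, im_RtoC; lra).
replace (ct w) with (ct (w - INR m)) by apply ct_shift_neg.
replace w with (w - INR m + INR m)%C at 1 by ring.
apply (proj1 (cot_series_shift_n (w - INR m) _ m Hs)).
apply cot_series_strip; auto.
rewrite Re_minus, re_RtoC; lra.
Qed.

(** * Lipschitz' formula *)

Lemma CV_radius_ge_series (a : nat -> R) x : ex_series (fun n => a n * x ^ n) -> Rbar_le (Rabs x) (CV_radius a).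
Proof.
intros H; apply Rbar_not_lt_le; intros L.
apply CV_disk_outside in L; apply L; apply ex_series_lim_0; auto.
Qed.

(** The series begin with the first power of [x], so a zero coefficient is prepended; convergence at
    [x = d] provides a positive radius of convergence. *)
Lemma pseries_unique (a b : nat -> R) (d : R) : 0 < d ->
  (forall x, Rabs x <= d -> exists s, is_series (fun k => x ^ S k * a k) s /\ is_series (fun k => x ^ S k * b k) s) ->
  forall k, a k = b k.
Proof.
intros Hd H k.
assert (HE : forall c x s, is_series (fun k => x ^ S k * c k) s -> PSeries (PS_incr_1 c) x = s).
{ intros c x s Hs; rewrite PSeries_incr_1; unfold PSeries; rewrite <- Series_scal_l.
  rewrite <- (is_series_unique _ _ Hs); apply Series_ext; intros n; simpl; ring. }
assert (HR : forall c, (exists s, is_series (fun k => d ^ S k * c k) s) -> Rbar_lt 0 (CV_radius (PS_incr_1 c))).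
{ intros c [s Hs].
  apply Rbar_lt_le_trans with (Rabs d); [simpl; rewrite Rabs_pos_eq; lra|].
  apply CV_radius_ge_series.
  apply ex_series_incr_1; exists s.
  apply (is_series_ext (fun k => d ^ S k * c k)); auto; intros n; simpl; ring. }
change (PS_incr_1 a (S k) = PS_incr_1 b (S k)).
apply PSeries_ext_recip.
- apply HR; destruct (H d) as [s [Hs _]]; [rewrite Rabs_pos_eq; lra|exists s; auto].
- apply HR; destruct (H d) as [s [_ Hs]]; [rewrite Rabs_pos_eq; lra|exists s; auto].
- exists (mkposreal d Hd); intros x Hx.
  unfold ball in Hx; simpl in Hx; unfold AbsRing_ball, abs, minus, plus, opp in Hx; simpl in Hx.
  rewrite Ropp_0, Rplus_0_r in Hx.
  destruct (H x) as [s [H1 H2]]; [lra|].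
  rewrite (HE _ _ _ H1), (HE _ _ _ H2); auto.
Qed.

Lemma C_pseries_unique (a b : nat -> C) (d : R) : 0 < d ->
  (forall x, Rabs x <= d -> exists s, CSer (fun k => RtoC (x ^ S k) * a k)%C s /\ CSer (fun k => RtoC (x ^ S k) * b k)%C s) ->
  forall k, a k = b k.
Proof.
intros Hd H k; apply C_eq.
- apply (pseries_unique (fun k => Re (a k)) (fun k => Re (b k)) d); auto.
  intros x Hx; destruct (H x Hx) as [s [H1 H2]]; exists (Re s).
  apply CSer_is_series in H1 as [H1 _]; apply CSer_is_series in H2 as [H2 _]; split.
  + apply (is_series_ext (fun k => Re (RtoC (x ^ S k) * a k)%C)); auto; intros n; apply re_scal_l.
  + apply (is_series_ext (fun k => Re (RtoC (x ^ S k) * b k)%C)); auto; intros n; apply re_scal_l.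
- apply (pseries_unique (fun k => Im (a k)) (fun k => Im (b k)) d); auto.
  intros x Hx; destruct (H x Hx) as [s [H1 H2]]; exists (Im s).
  apply CSer_is_series in H1 as [_ H1]; apply CSer_is_series in H2 as [_ H2]; split.
  + apply (is_series_ext (fun k => Im (RtoC (x ^ S k) * a k)%C)); auto; intros n; apply im_scal_l.
  + apply (is_series_ext (fun k => Im (RtoC (x ^ S k) * b k)%C)); auto; intros n; apply im_scal_l.
Qed.

Lemma is_lim_seq_geom_0 q : 0 <= q < 1 -> is_lim_seq (fun n => q ^ n) 0.
Proof. intros; apply is_lim_seq_geom; rewrite Rabs_pos_eq; lra. Qed.

Lemma csum_geom (x : C) n : ((1 - x) * csum (fun k => x ^ k) n)%C = (1 - x ^ n)%C.
Proof. induction n; simpl; [ring|rewrite Cmult_plus_distr_l, IHn; ring]. Qed.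

Lemma Cmod_lt1_neq (x : C) : Cmod x < 1 -> (1 - x)%C <> 0%C.
Proof.
intros H E; apply Ceq_minus in E; rewrite <- E, Cmod_1 in H; lra.
Qed.

Lemma CSer_geom (x : C) : Cmod x < 1 -> CSer (fun k => x ^ k)%C (/ (1 - x))%C.
Proof.
intros H; assert (NZ := Cmod_lt1_neq x H).
assert (P : Clim (fun n => x ^ n)%C 0%C).
{ apply (Clim_squeeze _ _ (fun n => Cmod x ^ n)).
  - intros n; rewrite Cminus_0_r, Cmod_pow; lra.
  - apply is_lim_seq_geom_0; split; auto; apply Cmod_ge_0. }
unfold CSer.
apply (Clim_ext (fun n => (1 - x ^ n) * / (1 - x))%C).
- intros n; rewrite <- csum_geom; field; auto.
- apply (Clim_eq _ ((1 - 0) * / (1 - x))%C); [field; auto|].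
  apply Clim_mult; [|apply Clim_const].
  apply Clim_minus; auto; apply Clim_const.
Qed.

Lemma CSer_geom1 (x : C) : Cmod x < 1 -> CSer (fun k => x ^ S k)%C (x / (1 - x))%C.
Proof.
intros H; apply (CSer_ext (fun k => x * x ^ k)%C); [reflexivity|].
apply CSer_scal, CSer_geom; auto.
Qed.

Lemma CSer_inv_shift (a w : C) : Cmod w < Cmod a ->
  CSer (fun k => w ^ S k * / a ^ (S (S k)))%C (/ (a - w) - / a)%C.
Proof.
intros H.
assert (Ha : a <> 0%C) by (apply Cmod_gt_0; pose proof (Cmod_ge_0 w); lra).
assert (Hd : (a - w)%C <> 0%C).
{ intros E; apply Ceq_minus in E; rewrite E in H; lra. }
assert (Hq : Cmod (w / a) < 1).
{ rewrite Cmod_div by auto; apply Rlt_div_l; [apply Cmod_gt_0; auto|lra]. }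
apply (CSer_ext (fun k => / a * (w / a) ^ S k)%C).
- intros k.
  replace (w / a)%C with (w * / a)%C by reflexivity.
  rewrite Cpow_mult_l, Cpow_inv by auto.
  change (a ^ S (S k))%C with (a * a ^ S k)%C.
  field; split; auto; apply Cpow_nz; auto.
- replace (/ (a - w) - / a)%C with (/ a * ((w / a) / (1 - w / a)))%C.
  + apply CSer_scal, CSer_geom1; auto.
  + field; repeat split; auto.
Qed.

Lemma ct_geom z : 0 < Im z -> CSer (fun k => nome z ^ S k)%C ((ct z - 1) / 2)%C.
Proof.
intros H; replace ((ct z - 1) / 2)%C with (nome z / (1 - nome z))%C.
- apply CSer_geom1, Cmod_nome_lt1; auto.
- unfold ct; field; apply one_minus_nome_nz; auto.
Qed.

(** The modulus is at least Im z and at least m - |z|. These two bounds, taken with weights |z| + 1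
    and Im z, add up to Im z (m + 1), which explains the constant. *)
Lemma Cmod_shift_lower z m : 0 < Im z ->
  Im z / (Im z + Cmod z + 1) * INR (S m) <= Cmod (z + INR m) /\
  Im z / (Im z + Cmod z + 1) * INR (S m) <= Cmod (z - INR (S m)).
Proof.
intros H; pose proof (Cmod_ge_0 z); rewrite S_INR.
assert (L : forall t, Im z <= t -> INR m - Cmod z <= t -> Im z / (Im z + Cmod z + 1) * (INR m + 1) <= t).
{ intros t H1 H2.
  replace (Im z / (Im z + Cmod z + 1) * (INR m + 1)) with ((Im z * (INR m + 1)) / (Im z + Cmod z + 1)) by (field; lra).
  apply Rle_div_l; [lra|]; pose proof (pos_INR m); nra. }
split; apply L.
- eapply Rle_trans; [|apply Im_le_Cmod]; rewrite Im_plus, im_RtoC, Rplus_0_r; apply Rle_abs.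
- apply Cmod_far.
- eapply Rle_trans; [|apply Im_le_Cmod]; rewrite Im_minus, im_RtoC, Rminus_0_r; apply Rle_abs.
- pose proof (Cmod_far' z (S m)); rewrite S_INR in H1; lra.
Qed.

(* Summation over [Z], listed as [0, -1, 1, -2, 2, ...], of the [k]-th powers. *)
Definition zpow (k : nat) (z : C) (m : nat) : C := (/ (z + INR m) ^ k + / (z - INR (S m)) ^ k)%C.

Definition zc (z : C) : R := Im z / (Im z + Cmod z + 1).

Lemma zc_pos z : 0 < Im z -> 0 < zc z.
Proof. intros; apply Rdiv_lt_0_compat; auto; pose proof (Cmod_ge_0 z); lra. Qed.

Lemma Cmod_inv_pow_le (a : C) (b c : R) k : 0 < b -> 0 < c -> b <= Cmod a -> c <= Cmod a ->
  Cmod (/ a ^ (S (S k))) <= / b ^ k * / c ^ 2.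
Proof.
intros Hb Hc H1 H2.
assert (Ha : a <> 0%C) by (apply Cmod_gt_0; lra).
rewrite Cmod_inv, Cmod_pow by (apply Cpow_nz; auto).
rewrite <- Rinv_mult.
apply Rinv_le_contravar; [apply Rmult_lt_0_compat; apply pow_lt; auto|].
replace (Cmod a ^ S (S k)) with (Cmod a ^ k * Cmod a ^ 2) by (simpl; ring).
apply Rmult_le_compat; try (left; apply pow_lt; auto); apply pow_incr; lra.
Qed.

(** Of the [k + 2] factors, two are spent on summability in [m], and the others on a growth in [k]
    that is geometric with ratio 1 / Im z. *)
Lemma zpow_bound k z m : 0 < Im z ->
  Cmod (zpow (S (S k)) z m) <= / Im z ^ k * (2 / zc z ^ 2) * / INR (S m) ^ 2.
Proof.
intros H; unfold zpow; eapply Rle_trans; [apply Cmod_triangle|].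
assert (Hc := zc_pos z H).
assert (Hm : 0 < INR (S m)) by (apply lt_0_INR; lia).
destruct (Cmod_shift_lower z m H) as [H1 H2]; fold (zc z) in H1, H2.
assert (0 < zc z * INR (S m)) by nra.
assert (I1 : Im z <= Cmod (z + INR m)).
{ eapply Rle_trans; [|apply Im_le_Cmod]; rewrite Im_plus, im_RtoC, Rplus_0_r; apply Rle_abs. }
assert (I2 : Im z <= Cmod (z - INR (S m))).
{ eapply Rle_trans; [|apply Im_le_Cmod]; rewrite Im_minus, im_RtoC, Rminus_0_r; apply Rle_abs. }
pose proof (Cmod_inv_pow_le _ _ _ k H H0 I1 H1).
pose proof (Cmod_inv_pow_le _ _ _ k H H0 I2 H2).
replace (/ Im z ^ k * (2 / zc z ^ 2) * / INR (S m) ^ 2) with (2 * (/ Im z ^ k * / (zc z * INR (S m)) ^ 2)).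
- lra.
- field; repeat split; try lra; apply Rgt_not_eq, pow_lt; auto.
Qed.

Lemma ex_zpow k z : 0 < Im z -> CSer (zpow (S (S k)) z) (Csum (zpow (S (S k)) z)).
Proof.
intros H; apply (CSer_Csum _ (fun m => / Im z ^ k * (2 / zc z ^ 2) * / INR (S m) ^ 2)).
- intros m; apply zpow_bound; auto.
- apply ex_series_const_inv_sq.
Qed.

Lemma pow_le_fact_exp x k : 0 <= x -> x ^ k / INR (fact k) <= exp x.
Proof.
intros H.
assert (forall n, 0 <= x ^ n / INR (fact n)).
{ intros n; apply Rmult_le_pos; [apply pow_le; auto|left; apply Rinv_0_lt_compat, INR_fact_lt_0]. }
eapply Rle_trans; [|apply (sum_n_le_series _ _ k H0 (is_series_exp x))].
destruct k; [rewrite sum_O; lra|].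
rewrite sum_Sn; unfold plus; simpl.
assert (0 <= sum_n (fun k => x ^ k / INR (fact k)) k).
{ clear -H0; induction k; [rewrite sum_O; auto|rewrite sum_Sn; unfold plus; simpl; specialize (H0 (S k)); simpl in H0; lra]. }
lra.
Qed.

Lemma exp_pow x n : exp x ^ n = exp (INR n * x).
Proof.
induction n; [simpl; rewrite Rmult_0_l, exp_0; auto|].
rewrite S_INR, Rmult_plus_distr_r, exp_plus, <- IHn, Rmult_1_l; simpl; ring.
Qed.

Lemma ex_series_geom1 q : 0 <= q < 1 -> ex_series (fun n => q ^ S n).
Proof.
intros H; apply (ex_series_incr_1 (fun n => q ^ n)); exists (/ (1 - q)).
apply is_series_geom; rewrite Rabs_pos_eq; lra.
Qed.

Lemma ex_series_pow_geom k r : 0 < r < 1 -> ex_series (fun n => INR (S n) ^ k * r ^ S n).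
Proof.
intros Hr.
(* Half of the exponential decay pays for the power of [n]; the other half remains as a convergent
   geometric series. *)
set (s := - ln r / 2).
assert (Hs : 0 < s).
{ unfold s; assert (ln r < 0) by (rewrite <- ln_1; apply ln_increasing; lra); lra. }
assert (Er : r = exp (- (2 * s))).
{ unfold s; replace (- (2 * (- ln r / 2))) with (ln r) by field; rewrite exp_ln; lra. }
apply (ex_series_le_pos _ (fun n => INR (fact k) / s ^ k * exp (- s) ^ S n)).
- intros n; rewrite Rabs_pos_eq by (apply Rmult_le_pos; apply pow_le; [apply pos_INR|lra]).
  rewrite Er, !exp_pow.
  pose proof (pow_le_fact_exp (INR (S n) * s) k ltac:(apply Rmult_le_pos; [apply pos_INR|lra])).
  replace (INR (S n) * - (2 * s)) with (- (INR (S n) * s) + - (INR (S n) * s)) by ring.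
  rewrite exp_plus; replace (INR (S n) * - s) with (- (INR (S n) * s)) by ring.
  set (e := exp (- (INR (S n) * s))).
  assert (0 < e) by apply exp_pos.
  assert (Ee : e * exp (INR (S n) * s) = 1) by (unfold e; rewrite <- exp_plus, <- exp_0; f_equal; ring).
  assert (F := INR_fact_lt_0 k).
  assert (Sk : 0 < s ^ k) by (apply pow_lt; auto).
  rewrite Rpow_mult_distr in H.
  assert (INR (S n) ^ k * e <= INR (fact k) / s ^ k).
  { apply Rmult_le_reg_r with (s ^ k); auto.
    replace (INR (fact k) / s ^ k * s ^ k) with (e * exp (INR (S n) * s) * INR (fact k)) by (rewrite Ee; field; lra).
    replace (INR (S n) ^ k * e * s ^ k) with (e * (INR (S n) ^ k * s ^ k)) by ring.
    rewrite Rmult_assoc.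
    apply Rmult_le_compat_l; [lra|]; apply Rle_div_l in H; auto; lra. }
  nra.
- apply ex_series_Rscal, ex_series_geom1; split; [left; apply exp_pos|].
  rewrite <- exp_0; apply exp_increasing; lra.
Qed.

Definition npow (k : nat) (q : C) (n : nat) : C := (RtoC (INR (S n) ^ k) * q ^ S n)%C.

Lemma ex_npow k q : 0 < Cmod q < 1 -> CSer (npow k q) (Csum (npow k q)).
Proof.
intros H; apply (CSer_Csum _ (fun n => INR (S n) ^ k * Cmod q ^ S n)).
- intros n; unfold npow; rewrite Cmod_mult, Cmod_R, Cmod_pow, Rabs_pos_eq; [lra|].
  apply pow_le, pos_INR.
- apply ex_series_pow_geom; auto.
Qed.

Lemma Cmod_nome_01 z : 0 < Im z -> 0 < Cmod (nome z) < 1.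
Proof. intros; split; [rewrite Cmod_nome; apply exp_pos|apply Cmod_nome_lt1; auto]. Qed.

Lemma is_series_Rscal (c : R) (a : nat -> R) l : is_series a l -> is_series (fun n => c * a n) (c * l).
Proof. apply (is_series_scal (K := R_AbsRing) (V := R_NormedModule) c a l). Qed.

Lemma ex_series_Rext (a b : nat -> R) : (forall n, a n = b n) -> ex_series a -> ex_series b.
Proof. intros H; apply ex_series_ext, H. Qed.

Lemma is_series_Rext (a b : nat -> R) (l : R) : (forall n, a n = b n) -> is_series a l -> is_series b l.
Proof. intros H; apply is_series_ext, H. Qed.

Lemma is_series_tail (a : nat -> R) (l : R) : is_series a l -> is_series (fun k => a (S k)) (l - a 0%nat).
Proof.
intros H; apply is_series_incr_1; unfold plus; simpl.
replace (l - a 0%nat + a 0%nat) with l by ring; auto.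
Qed.

Lemma Cmod_ge_Im_shift z (a : R) : Im z <= Cmod (z + RtoC a) /\ Im z <= Cmod (z - RtoC a).
Proof.
split; (eapply Rle_trans; [|apply Im_le_Cmod]); [rewrite Im_plus | rewrite Im_minus];
 rewrite im_RtoC, ?Rplus_0_r, ?Rminus_0_r; apply Rle_abs.
Qed.

Lemma is_series_geom_half : is_series (fun k => (/ 2) ^ k) 2.
Proof.
pose proof (is_series_geom (/ 2) ltac:(rewrite Rabs_pos_eq; lra)) as G.
replace (/ (1 - / 2)) with 2 in G by field; exact G.
Qed.

(** Partial fractions of ct(z - x) - ct(z), each expanded geometrically in [x]. The restriction on
    [x] gives the ratio 1/2 that justifies the exchange of summations. [lipschitz_rhs] expands the
    same function through its series in the nome. *)
Lemma lipschitz_lhs z x : 0 < Im z -> Rabs x <= Im z / 2 ->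
  CSer (fun k => RtoC (x ^ S k) * Csum (zpow (S (S k)) z))%C (- (PI * Ci * (ct (z - x) - ct z)))%C.
Proof.
intros H Hx.
set (a := fun m k => (RtoC (x ^ S k) * zpow (S (S k)) z m)%C).
set (B := fun m k => Im z / 2 * (2 / zc z ^ 2) * / INR (S m) ^ 2 * (/ 2) ^ k).
assert (Hc := zc_pos z H).
assert (HB : forall m k, Cmod (a m k) <= B m k).
{ intros m k; unfold a, B; rewrite Cmod_mult, Cmod_R.
  rewrite <- RPow_abs.
  assert (Rabs x ^ S k <= (Im z / 2) ^ S k) by (apply pow_incr; split; auto; apply Rabs_pos).
  pose proof (zpow_bound k z m H).
  replace (Im z / 2 * (2 / zc z ^ 2) * / INR (S m) ^ 2 * (/ 2) ^ k) with
    ((Im z / 2) ^ S k * (/ Im z ^ k * (2 / zc z ^ 2) * / INR (S m) ^ 2)).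
  - apply Rmult_le_compat; auto; [apply pow_le, Rabs_pos|apply Cmod_ge_0].
  - unfold Rdiv; rewrite !Rpow_mult_distr; simpl ((/ 2) ^ S k); simpl (Im z ^ S k).
    field; repeat split; try lra; [apply not_0_INR; lia|apply Rgt_not_eq, pow_lt; auto]. }
assert (Hrow : forall m, CSer (a m) (cotterm (z - x) m - cotterm z m)%C).
{ intros m; unfold a, cotterm, zpow.
  apply (CSer_ext (fun k => (RtoC x) ^ S k * / (z + INR m) ^ S (S k) + (RtoC x) ^ S k * / (z - INR (S m)) ^ S (S k))%C).
  - intros k; rewrite RtoC_pow; ring.
  - replace (/ (z - x + INR m) + / (z - x - INR (S m)) - (/ (z + INR m) + / (z - INR (S m))))%C with
     ((/ (z + INR m - x) - / (z + INR m)) + (/ (z - INR (S m) - x) - / (z - INR (S m))))%C.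
    + apply CSer_plus; apply CSer_inv_shift; rewrite Cmod_R.
      * pose proof (proj1 (Cmod_ge_Im_shift z (INR m))); lra.
      * pose proof (proj2 (Cmod_ge_Im_shift z (INR (S m)))); lra.
    + replace (z + INR m - x)%C with (z - x + INR m)%C by ring.
      replace (z - INR (S m) - x)%C with (z - x - INR (S m))%C by ring.
      ring. }
assert (E1 : CSer (fun m => cotterm (z - x) m - cotterm z m)%C (- (PI * Ci * (ct (z - x) - ct z)))%C).
{ apply (CSer_eq _ (- (PI * Ci * ct (z - x)) - - (PI * Ci * ct z))%C); [ring|].
  apply CSer_minus; apply cot_series; auto; rewrite Im_minus, im_RtoC; lra. }
assert (HS : CSer (fun k => Csum (fun m => a m k)) (Csum (fun m => Csum (a m)))).
{ apply (CSer_swap (fun k m => a m k) (fun k m => B m k) (fun m => Im z / 2 * (2 / zc z ^ 2) * / INR (S m) ^ 2 * 2)).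
  - intros k m; apply HB.
  - intros m; unfold B; apply is_series_Rscal, is_series_geom_half.
  - apply (ex_series_Rext (fun m => (Im z / 2 * (2 / zc z ^ 2) * 2) * / INR (S m) ^ 2)); [intros; ring|].
    apply ex_series_const_inv_sq. }
replace (- (PI * Ci * (ct (z - x) - ct z)))%C with (Csum (fun m => Csum (a m))).
- apply (CSer_ext (fun k => Csum (fun m => a m k))); auto.
  intros k; unfold a; apply Csum_unique, CSer_scal, ex_zpow; auto.
- apply Csum_unique; apply (CSer_ext (fun m => cotterm (z - x) m - cotterm z m)%C); auto.
  intros m; symmetry; apply Csum_unique, Hrow.
Qed.

Definition lipcoef (k : nat) : C := (- (2 * PI * Ci) * (- (2 * PI * Ci)) ^ S k / INR (fact (S k)))%C.

Lemma is_series_exp_tail x : is_series (fun k => x ^ S k / INR (fact (S k))) (exp x - 1).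
Proof.
replace (exp x - 1) with (exp x - x ^ 0 / INR (fact 0)) by (simpl; field).
apply (is_series_tail (fun k => x ^ k / INR (fact k))), is_series_exp.
Qed.

Lemma CSer_Cexp_tail z : CSer (fun k => z ^ S k / INR (fact (S k)))%C (Cexp z - 1)%C.
Proof.
apply (CSer_eq _ (Cexp z - z ^ 0 / INR (fact 0))%C).
- simpl; field.
- apply (CSer_tail (fun k => z ^ k / INR (fact k))%C), CSer_Cexp.
Qed.

Lemma Cmod_m2pii : Cmod (- (2 * PI * Ci)) = 2 * PI.
Proof. rewrite Cmod_opp, <- (Cmult_1_r (2 * PI * Ci)), Cmod_2pii, Cmod_1; ring. Qed.

Lemma lipschitz_rhs z x : 0 < Im z -> Rabs x <= Im z / 2 ->
  CSer (fun k => RtoC (x ^ S k) * (lipcoef k * Csum (npow (S k) (nome z))))%C (- (PI * Ci * (ct (z - x) - ct z)))%C.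
Proof.
intros H Hx.
set (q := nome z).
assert (Hq : 0 < Cmod q < 1) by (apply Cmod_nome_01; auto).
set (w := fun n => (- (2 * PI * Ci) * RtoC (INR (S n) * x))%C).
set (a := fun n k => (- (2 * PI * Ci) * (q ^ S n * (w n ^ S k / INR (fact (S k)))))%C).
set (W := fun n => 2 * PI * (INR (S n) * Rabs x)).
pose proof PI_RGT_0 as HPI.
assert (HW : forall n, Cmod (w n) = W n).
{ intros n; unfold w, W; rewrite Cmod_mult, Cmod_m2pii, Cmod_R, Rabs_mult, (Rabs_pos_eq (INR _)) by apply pos_INR; ring. }
set (B := fun n k => 2 * PI * Cmod q ^ S n * (W n ^ S k / INR (fact (S k)))).
assert (HB : forall n k, Cmod (a n k) <= B n k).
{ intros n k; unfold a, B; rewrite !Cmod_mult, Cmod_m2pii, Cmod_pow.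
  rewrite Cmod_div by (apply RtoC_neq0, INR_fact_neq_0).
  rewrite Cmod_pow, HW, Cmod_R, Rabs_pos_eq by (left; apply INR_fact_lt_0); apply Req_le; ring. }
assert (Hrow : forall n, CSer (a n) (- (2 * PI * Ci) * (q ^ S n * (Cexp (w n) - 1)))%C).
{ intros n; unfold a; apply CSer_scal, CSer_scal, CSer_Cexp_tail. }
assert (Hqx : forall n, (q ^ S n * Cexp (w n))%C = (nome (z - x) ^ S n)%C).
{ intros n; unfold q; rewrite !nome_pow; unfold nome; rewrite <- Cexp_add; f_equal; unfold w.
  rewrite RtoC_mult; ring. }
assert (E1 : CSer (fun n => - (2 * PI * Ci) * (q ^ S n * (Cexp (w n) - 1)))%C (- (PI * Ci * (ct (z - x) - ct z)))%C).
{ apply (CSer_eq _ (- (2 * PI * Ci) * ((ct (z - x) - 1) / 2 - (ct z - 1) / 2))%C); [field|].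
  apply CSer_scal.
  apply (CSer_ext (fun n => nome (z - x) ^ S n - q ^ S n)%C).
  - intros n; rewrite <- Hqx; ring.
  - apply CSer_minus; apply ct_geom; auto; rewrite Im_minus, im_RtoC; lra. }
assert (HS : CSer (fun k => Csum (fun n => a n k)) (Csum (fun n => Csum (a n)))).
{ apply (CSer_swap (fun k n => a n k) (fun k n => B n k) (fun n => 2 * PI * Cmod q ^ S n * (exp (W n) - 1))).
  - intros k n; apply HB.
  - intros n; unfold B; apply is_series_Rscal, is_series_exp_tail.
  (* The growth of the exponential series in [x] costs at most half of the decay of the nome,
     because |x| <= Im z / 2. *)
  - set (r := exp (- (PI * Im z))).
    apply (ex_series_le_pos _ (fun n => 2 * PI * r ^ S n)).
    + intros n.
      assert (1 <= exp (W n)).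
      { rewrite <- exp_0; apply exp_mono; unfold W.
        pose proof (pos_INR (S n)); pose proof (Rabs_pos x).
        apply Rmult_le_pos; [lra|apply Rmult_le_pos; auto]. }
      assert (Hp : 0 < Cmod q ^ S n) by (apply pow_lt; lra).
      rewrite Rabs_pos_eq by (apply Rmult_le_pos; [|lra]; apply Rmult_le_pos; lra).
      rewrite Rmult_assoc; apply Rmult_le_compat_l; [lra|].
      apply Rle_trans with (Cmod q ^ S n * exp (W n)); [apply Rmult_le_compat_l; lra|].
      unfold q; rewrite Cmod_nome; unfold r; rewrite !exp_pow, <- exp_plus; apply exp_mono.
      unfold W; pose proof (pos_INR (S n)).
      assert (INR (S n) * Rabs x <= INR (S n) * (Im z / 2)) by (apply Rmult_le_compat_l; auto).
      nra.
    + apply ex_series_Rscal, ex_series_geom1; split; [left; apply exp_pos|].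
      rewrite <- exp_0; apply exp_increasing; nra. }
replace (- (PI * Ci * (ct (z - x) - ct z)))%C with (Csum (fun n => Csum (a n))).
- apply (CSer_ext (fun k => Csum (fun n => a n k))); auto.
  intros k; apply Csum_unique.
  apply (CSer_ext (fun n => RtoC (x ^ S k) * (lipcoef k * npow (S k) q n))%C).
  + intros n; unfold a, w, npow, lipcoef.
    rewrite RtoC_mult, !Cpow_mult_l, <- !RtoC_pow.
    unfold Cdiv; ring.
  + apply CSer_scal, CSer_scal, ex_npow; auto.
- apply Csum_unique; eapply CSer_ext; [|exact E1].
  intros n; symmetry; apply Csum_unique, Hrow.
Qed.

(** Two expansions of one function of a small real [x] have the same coefficients. This replaces
    repeated termwise differentiation of the cotangent series. *)
Lemma lipschitz k z : 0 < Im z ->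
  Csum (zpow (S (S k)) z) = (lipcoef k * Csum (npow (S k) (nome z)))%C.
Proof.
intros H.
apply (C_pseries_unique (fun k => Csum (zpow (S (S k)) z))
  (fun k => lipcoef k * Csum (npow (S k) (nome z)))%C (Im z / 2)); [lra|].
intros x Hx; eexists; split; [apply lipschitz_lhs; auto|apply lipschitz_rhs; auto].
Qed.

(** * Modularity of the Eisenstein series of weight 4 *)

(** The Lambert series of the Eisenstein series of weight [k + 1]; [sigma_lambert] identifies it
    with the generating series of the divisor sums. *)
Definition lambert (k : nat) (q : C) : C :=
  Csum (fun d => RtoC (INR (S d) ^ k) * (q ^ S d / (1 - q ^ S d)))%C.

Lemma pow_S_lt1 r n : 0 <= r < 1 -> 0 <= r ^ S n <= r.
Proof.
intros H; assert (0 <= r ^ n <= 1).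
{ split; [apply pow_le; lra|rewrite <- (pow1 n); apply pow_incr; lra]. }
simpl; split; nra.
Qed.

Lemma lambert_term_bound k q d : 0 < Cmod q < 1 ->
  Cmod (RtoC (INR (S d) ^ k) * (q ^ S d / (1 - q ^ S d)))%C <= / (1 - Cmod q) * (INR (S d) ^ k * Cmod q ^ S d).
Proof.
intros H.
assert (P := pow_S_lt1 (Cmod q) d ltac:(lra)).
assert (N : (1 - q ^ S d)%C <> 0%C) by (apply Cmod_lt1_neq; rewrite Cmod_pow; lra).
rewrite Cmod_mult, Cmod_R, Cmod_div, Cmod_pow, Rabs_pos_eq by (auto; apply pow_le, pos_INR).
assert (1 - Cmod q <= Cmod (1 - q ^ S d)).
{ assert (Cmod 1 <= Cmod (1 - q ^ S d) + Cmod (q ^ S d)).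
  { replace (RtoC 1) with ((1 - q ^ S d) + q ^ S d)%C at 1 by ring; apply Cmod_triangle. }
  rewrite Cmod_1, Cmod_pow in H0; lra. }
assert (0 <= INR (S d) ^ k) by (apply pow_le, pos_INR).
unfold Rdiv; rewrite (Rmult_comm (/ (1 - Cmod q))), <- Rmult_assoc.
apply Rmult_le_compat_l; [apply Rmult_le_pos; lra|].
apply Rinv_le_contravar; lra.
Qed.

Lemma ex_lambert k q : 0 < Cmod q < 1 ->
  CSer (fun d => RtoC (INR (S d) ^ k) * (q ^ S d / (1 - q ^ S d)))%C (lambert k q).
Proof.
intros H; apply (CSer_Csum _ (fun d => / (1 - Cmod q) * (INR (S d) ^ k * Cmod q ^ S d))).
- intros d; apply lambert_term_bound; auto.
- apply ex_series_Rscal, ex_series_pow_geom; auto.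
Qed.

Lemma is_series_geom1 q : 0 <= q < 1 -> is_series (fun n => q ^ S n) (q / (1 - q)).
Proof.
intros H.
apply (is_series_Rext (fun n => q * q ^ n)); [reflexivity|].
apply is_series_Rscal, is_series_geom; rewrite Rabs_pos_eq; lra.
Qed.

(** Both sides sum d^k q^(d n) over all d, n >= 1; only the order differs. *)
Lemma lambert_swap k q : 0 < Cmod q < 1 -> CSer (fun n => Csum (npow k (q ^ S n)%C)) (lambert k q).
Proof.
intros H.
set (a := fun n d => (RtoC (INR (S d) ^ k) * (q ^ S d) ^ S n)%C).
assert (HP : forall d, 0 <= Cmod q ^ S d < 1).
{ intros d; pose proof (pow_S_lt1 (Cmod q) d ltac:(lra)); lra. }
assert (S0 : CSer (fun n => Csum (a n)) (Csum (fun d => Csum (fun n => a n d)))).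
{ apply (CSer_swap a (fun n d => INR (S d) ^ k * (Cmod q ^ S d) ^ S n)
   (fun d => INR (S d) ^ k * (Cmod q ^ S d / (1 - Cmod q ^ S d)))).
  - intros n d; unfold a; rewrite Cmod_mult, Cmod_R, !Cmod_pow, Rabs_pos_eq; [lra|apply pow_le, pos_INR].
  - intros d; apply is_series_Rscal, is_series_geom1; auto.
  - apply (ex_series_le_pos _ (fun d => / (1 - Cmod q) * (INR (S d) ^ k * Cmod q ^ S d))).
    + intros d; pose proof (lambert_term_bound k (RtoC (Cmod q)) d) as L.
      rewrite Cmod_R, (Rabs_pos_eq (Cmod q)) in L by lra; specialize (L H).
      rewrite <- RtoC_pow, <- RtoC_minus, <- RtoC_div, <- RtoC_mult, Cmod_R in L
        by (specialize (HP d); lra); exact L.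
    + apply ex_series_Rscal, ex_series_pow_geom; auto. }
apply (CSer_ext (fun n => Csum (a n))).
- intros n; apply Csum_ext; intros d; unfold a, npow; f_equal.
  rewrite <- !Cpow_mult_r; f_equal; lia.
- apply (CSer_eq _ (Csum (fun d => Csum (fun n => a n d)))); auto.
  apply Csum_ext; intros d; apply Csum_unique, CSer_scal, CSer_geom1.
  rewrite Cmod_pow; apply HP.
Qed.

(** The imaginary part of the lattice point gives b Im t, and that of its product with the conjugate
    of [t] gives a Im t; the two bounds are multiplied. A bound by the product a b separates the
    variables in the double sums. *)
Lemma quad_lower (t : C) (a b : R) : 0 < Im t -> 0 <= a -> 0 <= b ->
  a * b * (Im t ^ 2 / Cmod t) <= Cmod (a + b * t) ^ 2 /\
  a * b * (Im t ^ 2 / Cmod t) <= Cmod (a - b * t) ^ 2.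
Proof.
intros H Ha Hb.
assert (Ht : 0 < Cmod t) by (apply Cmod_gt_0, C_neq0_Im; lra).
assert (L : forall c : R, Rabs c = b -> a * b * (Im t ^ 2 / Cmod t) <= Cmod (a + c * t) ^ 2).
{ intros c Hc.
  assert (H1 : b * Im t <= Cmod (a + c * t)).
  { eapply Rle_trans; [|apply Im_le_Cmod].
    rewrite Im_plus, im_RtoC, im_scal_l, Rplus_0_l, Rabs_mult, Hc, (Rabs_pos_eq (Im t)); lra. }
  assert (H2 : a * Im t <= Cmod (a + c * t) * Cmod t).
  { rewrite <- (Cmod_conj t), <- Cmod_mult.
    eapply Rle_trans; [|apply Im_le_Cmod].
    replace (Im ((a + c * t) * Cconj t)) with (- (a * Im t)) by (destruct t; simpl; ring).
    rewrite Rabs_Ropp; apply Rle_abs. }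
  replace (a * b * (Im t ^ 2 / Cmod t)) with ((a * Im t / Cmod t) * (b * Im t)) by (field; lra).
  replace (Cmod (a + c * t) ^ 2) with (Cmod (a + c * t) * Cmod (a + c * t)) by ring.
  apply Rmult_le_compat; auto; try nra.
  - apply Rmult_le_pos; [nra|left; apply Rinv_0_lt_compat; auto].
  - apply Rle_div_l; auto. }
split.
- apply L; apply Rabs_pos_eq; auto.
- replace (a - b * t)%C with (a + RtoC (- b) * t)%C by (rewrite RtoC_opp; ring).
  apply L; rewrite Rabs_Ropp; apply Rabs_pos_eq; auto.
Qed.

(** Lattice points off both axes, up to a common sign. The axes are kept apart and appear as the
    terms in [zeta]. *)
Definition quad (k : nat) (t : C) (m n : nat) : C :=
  (/ (INR (S m) + INR (S n) * t) ^ k + / (INR (S m) - INR (S n) * t) ^ k)%C.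

Definition zeta (k : nat) : C := Csum (fun n => / (RtoC (INR (S n)) ^ k))%C.

Lemma Im_INR_mult n t : Im (INR (S n) * t)%C = INR (S n) * Im t.
Proof. apply im_scal_l. Qed.

Lemma INR_S_pos n : 0 < INR (S n). Proof. apply lt_0_INR; lia. Qed.

Lemma zeta_CSer k : CSer (fun n => / (RtoC (INR (S n)) ^ (S (S k))))%C (zeta (S (S k))).
Proof.
apply (CSer_Csum _ (fun n => / INR (S n) ^ 2)); [|apply ex_series_inv_sq].
intros n; pose proof (INR_S_pos n).
assert (1 <= INR (S n)) by (rewrite S_INR; pose proof (pos_INR n); lra).
rewrite <- RtoC_pow, <- RtoC_inv, Cmod_R by (apply Rgt_not_eq, pow_lt; auto).
rewrite Rabs_pos_eq by (left; apply Rinv_0_lt_compat, pow_lt; auto).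
apply Rinv_le_contravar; [apply pow_lt; auto|].
apply Rle_pow; auto; lia.
Qed.

Lemma half_zpow_CSer k z : 0 < Im z ->
  CSer (fun m => / (z + INR m) ^ (S (S k)))%C (Csum (fun m => / (z + INR m) ^ (S (S k)))%C) /\
  CSer (fun m => / (z - INR (S m)) ^ (S (S k)))%C (Csum (fun m => / (z - INR (S m)) ^ (S (S k)))%C).
Proof.
intros H; assert (Hc := zc_pos z H).
split; apply (CSer_Csum _ (fun m => (/ Im z ^ k * / zc z ^ 2) * / INR (S m) ^ 2));
 try apply ex_series_const_inv_sq; intros m; pose proof (INR_S_pos m);
 destruct (Cmod_shift_lower z m H) as [H1 H2]; fold (zc z) in H1, H2;
 rewrite Rmult_assoc, <- Rinv_mult, <- Rpow_mult_distr;
 (apply Cmod_inv_pow_le; auto; [nra|]); apply Cmod_ge_Im_shift.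
Qed.

(** Evenness of the exponent folds the negative integers onto the positive ones; the integer 0
    contributes the subtracted term. *)
Lemma zpow_quad k t n : 0 < Im t -> (forall x : C, ((- x) ^ S (S k) = x ^ S (S k))%C) ->
  CSer (fun m => quad (S (S k)) t m n)
    (Csum (zpow (S (S k)) (INR (S n) * t)) - / (INR (S n) * t) ^ S (S k))%C.
Proof.
intros H He.
set (z := (INR (S n) * t)%C).
assert (Hz : 0 < Im z) by (unfold z; rewrite Im_INR_mult; pose proof (INR_S_pos n); nra).
destruct (half_zpow_CSer k z Hz) as [H1 H2].
pose proof (CSer_plus _ _ _ _ H1 H2) as H3.
apply Csum_unique in H3.
apply CSer_tail in H1.
pose proof (CSer_plus _ _ _ _ H1 H2) as H4.
apply (CSer_eq _ _ (Csum (zpow (S (S k)) z) - / z ^ S (S k))%C) in H4.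
- revert H4; apply CSer_ext; intros m; unfold quad; fold z.
  rewrite (Cplus_comm z); f_equal; f_equal.
  rewrite <- He; f_equal; ring.
- unfold zpow; rewrite H3; simpl INR; rewrite Cplus_0_r; ring.
Qed.

Definition K4 (t : C) : R := Im t ^ 2 / Cmod t.

Lemma K4_pos t : 0 < Im t -> 0 < K4 t.
Proof.
intros H; apply Rdiv_lt_0_compat; [apply pow_lt; auto|apply Cmod_gt_0, C_neq0_Im; lra].
Qed.

Lemma Cmod_inv4_le (w : C) (x : R) : 0 < x -> x <= Cmod w ^ 2 -> Cmod (/ w ^ 4) <= / x ^ 2.
Proof.
intros Hx H.
assert (w <> 0%C) by (intros E; rewrite E, Cmod_0 in H; lra).
rewrite Cmod_inv, Cmod_pow by (apply Cpow_nz; auto).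
apply Rinv_le_contravar; [apply pow_lt; auto|].
replace (Cmod w ^ 4) with ((Cmod w ^ 2) ^ 2) by ring; apply pow_incr; lra.
Qed.

Lemma quad4_bound t m n : 0 < Im t ->
  Cmod (quad 4 t m n) <= 2 / K4 t ^ 2 * / INR (S n) ^ 2 * / INR (S m) ^ 2.
Proof.
intros H; unfold quad; eapply Rle_trans; [apply Cmod_triangle|].
pose proof (INR_S_pos m) as Hm; pose proof (INR_S_pos n) as Hn; pose proof (K4_pos t H) as HK.
destruct (quad_lower t (INR (S m)) (INR (S n)) H ltac:(lra) ltac:(lra)) as [H1 H2]; fold (K4 t) in H1, H2.
assert (P : 0 < INR (S m) * INR (S n) * K4 t) by (apply Rmult_lt_0_compat; nra).
pose proof (Cmod_inv4_le _ _ P H1); pose proof (Cmod_inv4_le _ _ P H2).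
replace (2 / K4 t ^ 2 * / INR (S n) ^ 2 * / INR (S m) ^ 2) with (2 * / (INR (S m) * INR (S n) * K4 t) ^ 2)
  by (field; lra).
lra.
Qed.

Lemma CSer_swap_inv_sq (a : nat -> nat -> C) (K : R) : 
  (forall m n, Cmod (a m n) <= K * / INR (S n) ^ 2 * / INR (S m) ^ 2) ->
  CSer (fun m => Csum (a m)) (Csum (fun n => Csum (fun m => a m n))) /\
  CSer (fun n => Csum (fun m => a m n)) (Csum (fun n => Csum (fun m => a m n))).
Proof.
intros H.
destruct ex_series_inv_sq as [Z HZ].
assert (HK : 0 <= K).
{ specialize (H 0%nat 0%nat); pose proof (Cmod_ge_0 (a 0%nat 0%nat)); simpl in H.
  replace (K * / (1 * (1 * 1)) * / (1 * (1 * 1))) with K in H by field; lra. }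
assert (S1 : CSer (fun m => Csum (a m)) (Csum (fun n => Csum (fun m => a m n)))).
{ apply (CSer_swap _ (fun m n => K * / INR (S n) ^ 2 * / INR (S m) ^ 2) (fun n => K * / INR (S n) ^ 2 * Z)); auto.
  - intros n; apply is_series_Rscal; auto.
  - apply (ex_series_Rext (fun n => (K * Z) * / INR (S n) ^ 2)); [intros; ring|apply ex_series_const_inv_sq]. }
assert (S2 : CSer (fun n => Csum (fun m => a m n)) (Csum (fun m => Csum (a m)))).
{ apply (CSer_swap (fun n m => a m n) (fun n m => K * / INR (S m) ^ 2 * / INR (S n) ^ 2) (fun n => K * / INR (S n) ^ 2 * Z)).
  - intros m n; eapply Rle_trans; [apply H|]; apply Req_le; ring.
  - intros n; apply is_series_Rscal; auto.
  - apply (ex_series_Rext (fun n => (K * Z) * / INR (S n) ^ 2)); [intros; ring|apply ex_series_const_inv_sq]. }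
split; auto.
rewrite (Csum_unique _ _ S1) in S2; auto.
Qed.

Lemma inv_tau t : 0 < Im t -> 0 < Im (- / t)%C /\ t <> 0%C.
Proof.
intros H; split; [|apply C_neq0_Im; lra].
destruct t as [x y]; simpl in *.
replace (- (- y / (x * (x * 1) + y * (y * 1)))) with (y / (x ^ 2 + y ^ 2)) by (simpl; field; nra).
apply Rdiv_lt_0_compat; nra.
Qed.

(** Inversion exchanges the two coordinates of the lattice, so modularity becomes a statement about
    the order of summation. *)
Lemma quad_inv k t m n : 0 < Im t -> (forall x : C, ((- x) ^ k = x ^ k)%C) ->
  quad k (- / t) m n = (t ^ k * quad k t n m)%C.
Proof.
intros H He; destruct (inv_tau t H) as [_ Ht].
unfold quad.
assert (H1 : forall c : R, (/ (INR (S m) + c * - / t) ^ k = t ^ k * / (INR (S m) * t - c) ^ k)%C).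
{ intros c.
  replace (INR (S m) + c * - / t)%C with ((INR (S m) * t - c) * / t)%C by (field; auto).
  assert ((INR (S m) * t - c)%C <> 0%C).
  { apply C_neq0_Im; rewrite Im_minus, Im_INR_mult, im_RtoC; pose proof (INR_S_pos m); nra. }
  rewrite Cpow_mult_l, Cpow_inv by auto.
  field; split; apply Cpow_nz; auto. }
replace (INR (S m) - INR (S n) * - / t)%C with (INR (S m) + RtoC (- INR (S n)) * - / t)%C
  by (rewrite RtoC_opp; ring).
rewrite !H1, RtoC_opp, <- Cmult_plus_distr_l; f_equal.
rewrite Cplus_comm; f_equal; f_equal.
- f_equal; ring.
- rewrite <- He; f_equal; ring.
Qed.

Lemma lambert_zpow k t : 0 < Im t ->
  CSer (fun n => Csum (zpow (S (S k)) (INR (S n) * t))) (lipcoef k * lambert (S k) (nome t))%C.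
Proof.
intros H.
apply (CSer_ext (fun n => lipcoef k * Csum (npow (S k) (nome t ^ S n)))%C).
- intros n; rewrite lipschitz, nome_pow; auto.
  rewrite Im_INR_mult; pose proof (INR_S_pos n); nra.
- apply CSer_scal, lambert_swap, Cmod_nome_01; auto.
Qed.

Lemma CSer_zeta_scal k (t : C) : t <> 0%C ->
  CSer (fun n => / (INR (S n) * t) ^ S (S k))%C (zeta (S (S k)) / t ^ S (S k))%C.
Proof.
intros H.
apply (CSer_ext (fun n => / t ^ S (S k) * / (RtoC (INR (S n)) ^ S (S k)))%C).
- intros n; rewrite Cpow_mult_l; field; split; apply Cpow_nz; auto; apply INR_C_neq0; lia.
- apply (CSer_eq _ (/ t ^ S (S k) * zeta (S (S k)))%C); [unfold Cdiv; ring|].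
  apply CSer_scal, zeta_CSer.
Qed.

Lemma lambert_quad k t : 0 < Im t -> (forall x : C, ((- x) ^ S (S k) = x ^ S (S k))%C) ->
  CSer (fun n => Csum (fun m => quad (S (S k)) t m n)) 
   (lipcoef k * lambert (S k) (nome t) - zeta (S (S k)) / t ^ S (S k))%C.
Proof.
intros H He; destruct (inv_tau t H) as [_ Ht].
apply (CSer_ext (fun n => Csum (zpow (S (S k)) (INR (S n) * t)) - / (INR (S n) * t) ^ S (S k))%C).
- intros n; symmetry; apply Csum_unique, zpow_quad; auto.
- apply CSer_minus; [apply lambert_zpow; auto|apply CSer_zeta_scal; auto].
Qed.

(** This is [lambert_quad] at the inverted point, transposed by [quad_inv]: the inner sum now runs
    over the multiples of [t]. *)
Lemma lambert_quad_inv k t : 0 < Im t -> (forall x : C, ((- x) ^ S (S k) = x ^ S (S k))%C) ->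
  CSer (fun n => Csum (fun m => quad (S (S k)) t n m)) 
   (lipcoef k * lambert (S k) (nome (- / t)) / t ^ S (S k) - zeta (S (S k)))%C.
Proof.
intros H He; destruct (inv_tau t H) as [Hi Ht].
assert (Hp : (t ^ S (S k))%C <> 0%C) by (apply Cpow_nz; auto).
pose proof (lambert_quad k (- / t)%C Hi He) as L.
apply (CSer_scal (/ t ^ S (S k))%C) in L.
apply (CSer_eq _ _ (lipcoef k * lambert (S k) (nome (- / t)) / t ^ S (S k) - zeta (S (S k)))%C) in L.
- revert L; apply CSer_ext; intros n.
  assert (Q : CSer (fun m => quad (S (S k)) (- / t) m n) (Csum (fun m => quad (S (S k)) (- / t) m n))).
  { pose proof (zpow_quad k (- / t)%C n Hi He) as Q; rewrite (Csum_unique _ _ Q); auto. }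
  symmetry; apply Csum_unique.
  apply (CSer_ext (fun m => / t ^ S (S k) * quad (S (S k)) (- / t) m n)%C).
  + intros m; rewrite quad_inv by auto; field; auto.
  + apply CSer_scal; auto.
- rewrite He, Cpow_inv by auto; field; auto.
Qed.

Lemma lambert3_modular t : 0 < Im t ->
  (lipcoef 2 * lambert 3 (nome t) - zeta 4 / t ^ 4 = lipcoef 2 * lambert 3 (nome (- / t)) / t ^ 4 - zeta 4)%C.
Proof.
intros H.
assert (He : forall x : C, ((- x) ^ 4 = x ^ 4)%C) by (intros; simpl; ring).
pose proof (lambert_quad 2 t H He) as L1.
pose proof (lambert_quad_inv 2 t H He) as L2.
destruct (CSer_swap_inv_sq (quad 4 t) (2 / K4 t ^ 2)) as [S1 S2]; [intros; apply quad4_bound; auto|].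
rewrite <- (Csum_unique _ _ L1), <- (Csum_unique _ _ L2).
symmetry; apply (Csum_unique _ _ S1).
Qed.

Lemma csum_S u n : csum u (S n) = (csum u n + u n)%C.
Proof. reflexivity. Qed.

(** * The zeta values at 2 and 4 *)

Lemma exp_neg_taylor x : 0 <= x ->
  Rabs (exp (- x) - (1 - x + x ^ 2 / 2 - x ^ 3 / 6 + x ^ 4 / 24 - x ^ 5 / 120 + x ^ 6 / 720)) <= x ^ 7 / 5040.
Proof.
intros Hx.
pose proof (Cexp_taylor 7 (RtoC (- x))) as H.
rewrite Cexp_RtoC, Cmod_R, Rabs_Ropp, (Rabs_pos_eq x), re_RtoC, Rmax_right, exp_0 in H by lra.
replace (cexpsum 7 (RtoC (- x))) with
 (RtoC (1 - x + x ^ 2 / 2 - x ^ 3 / 6 + x ^ 4 / 24 - x ^ 5 / 120 + x ^ 6 / 720)) in H.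
- rewrite <- RtoC_minus, Cmod_R, Rmult_1_r in H.
  replace (INR (fact 7)) with 5040 in H by (rewrite INR_IZR_INZ; reflexivity); exact H.
- unfold cexpsum, csum.
  rewrite <- !RtoC_pow, <- !RtoC_div, <- !RtoC_plus by apply INR_fact_neq_0.
  f_equal; simpl; field.
Qed.

(** The expansion (x/2) coth(x/2) = 1 + x^2/12 - x^4/720 + ..., multiplied by 1 - exp(-x) to avoid a
    division. *)
Lemma coth_taylor x : 0 < x <= 1 ->
  Rabs (x / 2 * (1 + exp (- x)) - (1 - exp (- x)) * (1 + x ^ 2 / 12 - x ^ 4 / 720)) <= x ^ 7.
Proof.
intros Hx.
pose proof (exp_neg_taylor x ltac:(lra)) as H.
set (p := 1 - x + x ^ 2 / 2 - x ^ 3 / 6 + x ^ 4 / 24 - x ^ 5 / 120 + x ^ 6 / 720) in *.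
set (R0 := exp (- x) - p) in *.
replace (exp (- x)) with (p + R0) by (unfold R0; ring).
replace (x / 2 * (1 + (p + R0)) - (1 - (p + R0)) * (1 + x ^ 2 / 12 - x ^ 4 / 720)) with
 (x ^ 7 * (1 / 4320 + x / 17280 + x ^ 2 / 86400 - x ^ 3 / 518400) + R0 * (x / 2 + 1 + x ^ 2 / 12 - x ^ 4 / 720))
 by (unfold p; field).
assert (0 <= x ^ 2 <= 1) by nra.
assert (0 <= x ^ 3 <= 1) by (replace (x ^ 3) with (x * x ^ 2) by ring; nra).
assert (0 <= x ^ 4 <= 1) by (replace (x ^ 4) with (x * x ^ 3) by ring; nra).
assert (0 < x ^ 7) by (apply pow_lt; lra).
eapply Rle_trans; [apply Rabs_triang|].
rewrite !Rabs_mult, (Rabs_pos_eq (x ^ 7)) by lra.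
assert (Rabs (1 / 4320 + x / 17280 + x ^ 2 / 86400 - x ^ 3 / 518400) <= 1 / 2) by (apply Rabs_le; lra).
assert (Rabs (x / 2 + 1 + x ^ 2 / 12 - x ^ 4 / 720) <= 2) by (apply Rabs_le; lra).
pose proof (Rabs_pos R0); pose proof (Rabs_pos (x / 2 + 1 + x ^ 2 / 12 - x ^ 4 / 720)).
assert (Rabs R0 * Rabs (x / 2 + 1 + x ^ 2 / 12 - x ^ 4 / 720) <= x ^ 7 / 5040 * 2) by (apply Rmult_le_compat; auto).
nra.
Qed.

Definition rzeta (k : nat) : R := Series (fun n => / INR (S n) ^ k).

Lemma ex_rzeta k : (2 <= k)%nat -> ex_series (fun n => / INR (S n) ^ k).
Proof.
intros Hk; apply (ex_series_le_pos _ (fun n => / INR (S n) ^ 2)); [|apply ex_series_inv_sq].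
intros n; pose proof (INR_S_pos n).
assert (1 <= INR (S n)) by (rewrite S_INR; pose proof (pos_INR n); lra).
rewrite Rabs_pos_eq by (left; apply Rinv_0_lt_compat, pow_lt; auto).
apply Rinv_le_contravar; [apply pow_lt; auto|apply Rle_pow; auto].
Qed.

Lemma zeta_rzeta k : zeta k = RtoC (rzeta k).
Proof.
change (RtoC (rzeta k)) with (rzeta k, 0); unfold zeta, Csum, rzeta; f_equal.
- apply Series_ext; intros n; rewrite <- RtoC_pow, <- RtoC_inv; [reflexivity|].
  apply Rgt_not_eq, pow_lt, INR_S_pos.
- replace 0 with (Series (fun _ : nat => 0)).
  + apply Series_ext; intros n; rewrite <- RtoC_pow, <- RtoC_inv; [reflexivity|].
    apply Rgt_not_eq, pow_lt, INR_S_pos.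
  + apply is_series_unique.
    apply (is_series_Rext (fun n => 0 * (/ 2) ^ n)); [intros; ring|].
    pose proof (is_series_Rscal 0 _ _ is_series_geom_half) as Q; rewrite Rmult_0_l in Q; exact Q.
Qed.

Lemma coth_series y : 0 < y ->
  is_series (fun n => / (INR (S n) ^ 2 + y ^ 2))
   ((PI * y * (1 + exp (- (2 * PI * y))) / (1 - exp (- (2 * PI * y))) - 1) / (2 * y ^ 2)).
Proof.
intros Hy.
set (z := (Ci * y)%C).
assert (Hz : 0 < Im z) by (unfold z; rewrite im_scal_r; simpl; lra).
assert (Ez : z = (RtoC 0 + RtoC y * Ci)%C) by (unfold z; ring).
pose proof (cot_series z Hz) as L.
(* The pairs are changed from [n], [-(n+1)] to [n], [-n]: partial sums differ by one vanishing term
   and by the pole at 0. *)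
assert (L2 : CSer (fun n => / (z + INR (S n)) + / (z - INR (S n)))%C (- (PI * Ci * ct z) - / z)%C).
{ unfold CSer.
  assert (Zl : Clim (fun n => / (z + INR n))%C 0%C) by (apply (Clim_inv_far _ (Cmod z)), Cmod_far).
  apply (Clim_ext (fun n => csum (cotterm z) n + / (z + INR n) - / z)%C).
  - intros n; induction n.
    + simpl; rewrite Cplus_0_r; ring.
    + rewrite !csum_S, <- IHn; unfold cotterm at 2; ring.
  - apply (Clim_eq _ (- (PI * Ci * ct z) + 0 - / z)%C); [ring|].
    apply Clim_minus; [apply Clim_plus; auto|apply Clim_const]. }
assert (En : nome z = RtoC (exp (- (2 * PI * y)))).
{ unfold nome; rewrite <- Cexp_RtoC; f_equal.
  apply C_eq; unfold z; simpl; ring. }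
set (r := exp (- (2 * PI * y))) in *.
assert (Hr : r < 1).
{ unfold r; rewrite <- exp_0; apply exp_increasing; pose proof PI_RGT_0; nra. }
assert (Ect : ct z = RtoC ((1 + r) / (1 - r))).
{ unfold ct; rewrite En, RtoC_div, RtoC_plus, RtoC_minus by lra; reflexivity. }
apply (CSer_scal (Ci / (2 * y))%C) in L2.
apply CSer_is_series in L2 as [L2 _].
assert (NY : RtoC y <> 0%C) by (apply RtoC_neq0; lra).
apply (is_series_Rext _ (fun n => / (INR (S n) ^ 2 + y ^ 2))) in L2.
- replace ((PI * y * (1 + r) / (1 - r) - 1) / (2 * y ^ 2)) with (Re (Ci / (2 * y) * (- (PI * Ci * ct z) - / z))%C); auto.
  replace (Ci / (2 * y) * (- (PI * Ci * ct z) - / z))%C with (RtoC ((PI * y * (1 + r) / (1 - r) - 1) / (2 * y ^ 2))); auto.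
  rewrite Ect; unfold z.
  transitivity ((- (Ci * Ci) * PI * RtoC ((1 + r) / (1 - r)) - 1 / y) / (2 * y))%C.
  + replace (Ci * Ci)%C with (RtoC (-1)) by (apply C_eq; simpl; ring).
    apply C_eq.
    * rewrite <- RtoC_opp, <- !RtoC_mult, <- !RtoC_div, <- RtoC_minus, <- RtoC_div by lra.
      simpl; field; lra.
    * rewrite <- RtoC_opp, <- !RtoC_mult, <- !RtoC_div, <- RtoC_minus, <- RtoC_div by lra.
      reflexivity.
  + field; split; auto; apply Ci_nz.
- intros n.
  assert (P : 0 < INR (S n) ^ 2 + y ^ 2) by (pose proof (INR_S_pos n); nra).
  replace (Ci / (2 * y) * (/ (z + INR (S n)) + / (z - INR (S n))))%C with (RtoC (/ (INR (S n) ^ 2 + y ^ 2))); auto.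
  assert (N1 := shift_nz z (INR (S n)) Hz). assert (N2 := shift_nz' z (INR (S n)) Hz).
  transitivity (Ci / (2 * y) * (2 * z / ((z + INR (S n)) * (z - INR (S n)))))%C.
  + assert (E2 : ((z + INR (S n)) * (z - INR (S n)))%C = RtoC (- (INR (S n) ^ 2 + y ^ 2))).
    { unfold z; transitivity ((Ci * Ci) * y * y - INR (S n) * INR (S n))%C; [ring|].
      replace (Ci * Ci)%C with (RtoC (-1)) by (apply C_eq; simpl; ring).
      rewrite <- !RtoC_mult, <- RtoC_minus; f_equal; ring. }
    rewrite E2; unfold z.
    transitivity ((Ci * Ci) / RtoC (- (INR (S n) ^ 2 + y ^ 2)))%C.
    * replace (Ci * Ci)%C with (RtoC (-1)) by (apply C_eq; simpl; ring).
      rewrite <- RtoC_div by lra; f_equal; field; lra.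
    * field; split; auto; apply RtoC_neq0; lra.
  + field; auto.
Qed.

(** The sum of 1 / (n^2 + y^2) is expanded to order y^2 in two ways: termwise, which produces the
    zeta values, and through the hyperbolic cotangent with x = 2 PI y, whose condition x <= 1 is the
    upper bound on [y]. *)
Lemma zeta_poly_bound y : 0 < y <= 1 / (2 * PI) ->
  Rabs ((rzeta 2 - PI ^ 2 / 6) - y ^ 2 * (rzeta 4 - PI ^ 4 / 90)) <= y ^ 4 * (rzeta 6 + 64 * PI ^ 6).
Proof.
intros Hy.
pose proof PI_RGT_0 as HPI.
pose proof (coth_series y ltac:(lra)) as L.
set (x := 2 * PI * y) in *.
assert (Hx : 0 < x <= 1).
{ unfold x; split; [nra|]; destruct Hy as [_ Hy].
  apply (Rmult_le_compat_l (2 * PI)) in Hy; [|lra]; replace (2 * PI * (1 / (2 * PI))) with 1 in Hy by (field; lra); lra. }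
pose proof (coth_taylor x Hx) as T.
set (r := exp (- x)) in *.
assert (Hr : x / 2 <= 1 - r <= 1).
{ assert (r <= 1 - x + x ^ 2 / 2).
  { pose proof (Cexp_taylor 3 (RtoC (- x))) as H.
    rewrite Cexp_RtoC, Cmod_R, Rabs_Ropp, (Rabs_pos_eq x), re_RtoC, Rmax_right, exp_0 in H by lra.
    replace (cexpsum 3 (RtoC (- x))) with (RtoC (1 - x + x ^ 2 / 2)) in H
     by (unfold cexpsum, csum; rewrite <- !RtoC_pow, <- !RtoC_div, <- !RtoC_plus by apply INR_fact_neq_0;
         f_equal; simpl; field).
    rewrite <- RtoC_minus, Cmod_R, Rmult_1_r in H; fold r in H.
    pose proof (exp_neg_taylor x ltac:(lra)) as H2; fold r in H2.
    apply Rabs_le_between in H2.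
    assert (x ^ 7 <= x ^ 3 /\ x ^ 6 <= x ^ 3 /\ x ^ 4 <= x ^ 3 /\ 0 <= x ^ 5 /\ 0 <= x ^ 3).
    { assert (0 <= x ^ 3) by (apply pow_le; lra).
      assert (0 <= x ^ 2 <= 1) by nra.
      assert (0 <= x ^ 3 <= 1) by (replace (x ^ 3) with (x * x ^ 2) by ring; nra).
      assert (0 <= x ^ 4 <= 1) by (replace (x ^ 4) with (x * x ^ 3) by ring; nra).
      replace (x ^ 7) with (x ^ 3 * x ^ 4) by ring; replace (x ^ 6) with (x ^ 3 * x ^ 3) by ring.
      replace (x ^ 4) with (x * x ^ 3) at 2 by ring; repeat split; try nra; apply pow_le; lra. }
    lra. }
  pose proof (exp_pos (- x)); fold r in H0; split; [|lra].
  nra. }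
set (S0 := (PI * y * (1 + r) / (1 - r) - 1) / (2 * y ^ 2)) in *.
assert (A : Rabs (S0 - (PI ^ 2 / 6 - y ^ 2 * (PI ^ 4 / 90))) <= y ^ 4 * (64 * PI ^ 6)).
{ replace (S0 - (PI ^ 2 / 6 - y ^ 2 * (PI ^ 4 / 90))) with
   ((x / 2 * (1 + r) - (1 - r) * (1 + x ^ 2 / 12 - x ^ 4 / 720)) / ((1 - r) * (2 * y ^ 2))).
  2:{ unfold S0, x; field; repeat split; lra. }
  assert (D : 0 < (1 - r) * (2 * y ^ 2)) by (apply Rmult_lt_0_compat; nra).
  unfold Rdiv; rewrite Rabs_mult, (Rabs_pos_eq (/ _)) by (left; apply Rinv_0_lt_compat; auto).
  apply Rle_div_l; auto.
  eapply Rle_trans; [exact T|].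
  apply Rle_trans with (y ^ 4 * (64 * PI ^ 6) * (x / 2 * (2 * y ^ 2))).
  - unfold x; apply Req_le. 
    replace ((2 * PI * y) ^ 7) with (128 * PI ^ 7 * y ^ 7) by ring. 
    replace (y ^ 4 * (64 * PI ^ 6) * (2 * PI * y / 2 * (2 * y ^ 2))) with (128 * PI ^ 7 * y ^ 7) by field. reflexivity.
  - apply Rmult_le_compat_l; [apply Rmult_le_pos; [apply pow_le; lra|]; pose proof (pow_lt PI 6 HPI); lra|].
    apply Rmult_le_compat_r; [nra|lra]. }
assert (B : Rabs (S0 - (rzeta 2 - y ^ 2 * rzeta 4)) <= y ^ 4 * rzeta 6).
{ assert (H2 := Series_correct _ (ex_rzeta 2 ltac:(lia))).
  assert (H4 := Series_correct _ (ex_rzeta 4 ltac:(lia))).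
  assert (H6 := Series_correct _ (ex_rzeta 6 ltac:(lia))).
  fold (rzeta 2) in H2; fold (rzeta 4) in H4; fold (rzeta 6) in H6.
  apply (is_series_Rscal (y ^ 2)) in H4; apply (is_series_Rscal (y ^ 4)) in H6.
  pose proof (is_series_minus _ _ _ _ L (is_series_minus _ _ _ _ H2 H4)) as D.
  rewrite <- Cmod_R.
  apply (CSer_mod_le (fun n => RtoC (/ (INR (S n) ^ 2 + y ^ 2) - (/ INR (S n) ^ 2 - y ^ 2 * / INR (S n) ^ 4)))
    _ (fun n => y ^ 4 * / INR (S n) ^ 6)); auto.
  - intros n; pose proof (INR_S_pos n); rewrite Cmod_R.
    set (b := INR (S n)) in *.
    replace (/ (b ^ 2 + y ^ 2) - (/ b ^ 2 - y ^ 2 * / b ^ 4)) with (y ^ 4 * / (b ^ 4 * (b ^ 2 + y ^ 2))) by (field; split; nra).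
    assert (0 < b ^ 2) by nra.
    assert (0 < b ^ 4) by (apply pow_lt; auto).
    assert (0 < y ^ 4) by (apply pow_lt; lra).
    assert (0 < b ^ 4 * (b ^ 2 + y ^ 2)) by nra.
    rewrite Rabs_pos_eq by (apply Rmult_le_pos; [lra|left; apply Rinv_0_lt_compat; auto]).
    apply Rmult_le_compat_l; [lra|]; apply Rinv_le_contravar; [apply pow_lt; auto|].
    replace (b ^ 6) with (b ^ 4 * b ^ 2) by ring; nra.
  - apply CSer_is_series; split; simpl; [exact D|].
    apply (is_series_Rext (fun n => 0 * (/ 2) ^ n)); [intros; ring|].
    pose proof (is_series_Rscal 0 _ _ is_series_geom_half) as Q; rewrite Rmult_0_l in Q; exact Q. }
replace (rzeta 2 - PI ^ 2 / 6 - y ^ 2 * (rzeta 4 - PI ^ 4 / 90)) with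
  ((S0 - (PI ^ 2 / 6 - y ^ 2 * (PI ^ 4 / 90))) - (S0 - (rzeta 2 - y ^ 2 * rzeta 4))) by ring.
eapply Rle_trans; [apply Rabs_triang|]; rewrite Rabs_Ropp; lra.
Qed.

Lemma small_poly_zero (A B K d : R) : 0 < d -> (forall y, 0 < y <= d -> Rabs (A - y ^ 2 * B) <= y ^ 4 * K) -> A = 0 /\ B = 0.
Proof.
intros Hd H.
assert (lim_le : forall F : R -> R, forall a : R, continuous F 0 -> F 0 = 0 -> (forall y, 0 < y <= d -> Rabs a <= F y) -> a = 0).
{ intros F a HF F0 Ha.
  destruct (Req_dec a 0) as [|N]; auto; exfalso.
  assert (P : 0 < Rabs a) by (apply Rabs_pos_lt; auto).
  destruct (HF (ball (F 0) (mkposreal _ P)) ltac:(exists (mkposreal _ P); auto)) as [e He].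
  set (y := Rmin d (e / 2)).
  assert (0 < y) by (unfold y; apply Rmin_glb_lt; auto; destruct e; simpl; lra).
  assert (y <= d) by apply Rmin_l. assert (y <= e / 2) by apply Rmin_r.
  assert (Hb : ball 0 e y).
  { unfold ball; simpl; unfold AbsRing_ball, abs, minus, plus, opp; simpl.
    rewrite Ropp_0, Rplus_0_r, Rabs_pos_eq; destruct e; simpl in *; lra. }
  specialize (He y Hb); unfold ball in He; simpl in He; unfold AbsRing_ball, abs, minus, plus, opp in He; simpl in He.
  rewrite F0, Ropp_0, Rplus_0_r in He; specialize (Ha y ltac:(lra)).
  pose proof (Rle_abs (F y)); lra. }
assert (A0 : A = 0).
{ apply (lim_le (fun y => y ^ 4 * K + y ^ 2 * Rabs B)).
  - apply (ex_derive_continuous (V := R_NormedModule)); auto_derive; auto.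
  - ring.
  - intros y Hy; specialize (H y Hy).
    replace A with ((A - y ^ 2 * B) + y ^ 2 * B) by ring.
    eapply Rle_trans; [apply Rabs_triang|]; rewrite (Rabs_mult (y ^ 2)), (Rabs_pos_eq (y ^ 2)) by nra; lra. }
split; auto.
apply (lim_le (fun y => y ^ 2 * K)).
- apply (ex_derive_continuous (V := R_NormedModule)); auto_derive; auto.
- ring.
- intros y Hy; specialize (H y Hy).
  rewrite A0, Rminus_0_l, Rabs_Ropp, Rabs_mult, Rabs_pos_eq in H by nra.
  apply Rmult_le_reg_l with (y ^ 2); [nra|]; replace (y ^ 2 * (y ^ 2 * K)) with (y ^ 4 * K) by ring; auto.
Qed.

(* Both zeta values are read off the partial fraction expansion of [coth] as its argument tends to [0]. *)
Lemma rzeta_2_4 : rzeta 2 = PI ^ 2 / 6 /\ rzeta 4 = PI ^ 4 / 90.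
Proof.
destruct (small_poly_zero (rzeta 2 - PI ^ 2 / 6) (rzeta 4 - PI ^ 4 / 90) (rzeta 6 + 64 * PI ^ 6) (1 / (2 * PI))).
- apply Rdiv_lt_0_compat; pose proof PI_RGT_0; lra.
- apply zeta_poly_bound.
- lra.
Qed.

Lemma E4_modular t : 0 < Im t ->
  (1 + 240 * lambert 3 (nome (- / t)) = t ^ 4 * (1 + 240 * lambert 3 (nome t)))%C.
Proof.
intros H; destruct (inv_tau t H) as [_ Ht].
pose proof (lambert3_modular t H) as L.
replace (zeta 4) with (RtoC (PI ^ 4 / 90)) in L by (rewrite zeta_rzeta, (proj2 rzeta_2_4); auto).
(* This constant is 240 times zeta(4), the origin of the 240 in the Eisenstein series. *)
assert (EK : lipcoef 2 = RtoC (8 * PI ^ 4 / 3)).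
{ unfold lipcoef; simpl fact.
  transitivity (16 * PI ^ 4 * ((Ci * Ci) * (Ci * Ci)) / INR 6)%C; [simpl Cpow; unfold Cdiv; ring|].
  replace (Ci * Ci)%C with (RtoC (-1)) by (apply C_eq; simpl; ring).
  rewrite <- RtoC_pow, <- !RtoC_mult, <- RtoC_div by (apply not_0_INR; lia).
  f_equal; simpl; field. }
rewrite EK in L.
assert (HP : PI <> 0) by apply PI_neq0.
set (u := lambert 3 (nome (- / t))) in *; set (v := lambert 3 (nome t)) in *.
assert (T4 : (t ^ 4)%C <> 0%C) by (apply Cpow_nz; auto).
assert (PC := PI_C_neq0).
assert (P4 : RtoC (PI ^ 4 / 90) <> 0%C).
{ apply RtoC_neq0; apply Rgt_not_eq, Rdiv_lt_0_compat; [apply pow_lt, PI_RGT_0|lra]. }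
replace (RtoC (8 * PI ^ 4 / 3)) with (240 * RtoC (PI ^ 4 / 90))%C in L by (rewrite <- RtoC_mult; f_equal; field).
set (Z := RtoC (PI ^ 4 / 90)) in *.
assert (L2 : (Z * (t ^ 4 * (1 + 240 * v)) = Z * (1 + 240 * u))%C).
{ transitivity (t ^ 4 * (240 * Z * v - Z / t ^ 4) + Z * t ^ 4 + Z)%C; [field; auto|].
  rewrite L; field; auto. }
apply (f_equal (Cmult (/ Z))) in L2.
rewrite !Cmult_assoc, Cinv_l, !Cmult_1_l in L2 by auto; auto.
Qed.

(** * Quasimodularity of the Eisenstein series of weight 2 *)

Lemma cot_series0 z : 0 < Im z ->
  CSer (fun n => / (z + INR (S n)) + / (z - INR (S n)))%C (- (PI * Ci * ct z) - / z)%C.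
Proof.
intros Hz; pose proof (cot_series z Hz) as L; unfold CSer.
assert (Zl : Clim (fun n => / (z + INR n))%C 0%C) by (apply (Clim_inv_far _ (Cmod z)), Cmod_far).
apply (Clim_ext (fun n => csum (cotterm z) n + / (z + INR n) - / z)%C).
- intros n; induction n.
  + simpl; rewrite Cplus_0_r; ring.
  + rewrite !csum_S, <- IHn; unfold cotterm at 2; ring.
- apply (Clim_eq _ (- (PI * Ci * ct z) + 0 - / z)%C); [ring|].
  apply Clim_minus; [apply Clim_plus; auto|apply Clim_const].
Qed.

Definition pair_term (t : C) (a : R) (n : nat) : C := (/ (a + INR (S n) * t) + / (a - INR (S n) * t))%C.

Definition pair_sum (t : C) (a : R) : C := (PI * Ci * ct (a * (- / t)) / t - / a)%C.

Lemma ab_nz t (a : R) n : 0 < Im t -> (a + INR (S n) * t)%C <> 0%C /\ (a - INR (S n) * t)%C <> 0%C.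
Proof.
intros H; pose proof (INR_S_pos n); split; apply C_neq0_Im; rewrite ?Im_plus, ?Im_minus, Im_INR_mult, im_RtoC; nra.
Qed.

Lemma pair_CSer t a : 0 < Im t -> 0 < a -> CSer (pair_term t a) (pair_sum t a).
Proof.
intros H Ha; destruct (inv_tau t H) as [Hi Ht].
set (z := (a * (- / t))%C).
assert (Hz : 0 < Im z) by (unfold z; rewrite im_scal_l; nra).
assert (RtoC a <> 0%C) by (apply RtoC_neq0; lra).
pose proof (CSer_scal (- / t)%C _ _ (cot_series0 z Hz)) as L.
apply (CSer_eq _ _ (pair_sum t a)) in L.
- revert L; apply CSer_ext; intros n; unfold pair_term.
  destruct (ab_nz t a n H) as [N1 N2].
  unfold z.
  replace (a * - / t + INR (S n))%C with (- (a - INR (S n) * t) * / t)%C by (field; auto).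
  replace (a * - / t - INR (S n))%C with (- (a + INR (S n) * t) * / t)%C by (field; auto).
  field; repeat split; auto.
- unfold pair_sum; fold z; unfold z at 2; field; auto.
Qed.

Lemma ct_lim t : 0 < Im t -> Clim (fun n => ct (RtoC (INR n + 1 / 2) * t)%C) 1%C.
Proof.
intros H.
assert (L : Clim (fun n => nome (RtoC (INR n + 1 / 2) * t)) 0%C).
{ set (r := exp (- (2 * PI * Im t))).
  apply (Clim_squeeze _ _ (fun n => r ^ n)).
  - intros n; rewrite Cminus_0_r, Cmod_nome, im_scal_l; unfold r; rewrite exp_pow.
    apply exp_mono; pose proof PI_RGT_0; pose proof (pos_INR n); assert (0 < PI * Im t) by nra; nra.
  - apply is_lim_seq_geom_0; split; [left; apply exp_pos|].
    unfold r; rewrite <- exp_0; apply exp_increasing; pose proof PI_RGT_0; nra. }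
unfold ct; apply (Clim_eq _ ((1 + 0) / (1 - 0))%C); [field|].
apply Clim_div.
- intros E; apply (RtoC_neq0 1); [lra|rewrite <- E; ring].
- apply Clim_plus; auto; apply Clim_const.
- apply Clim_minus; auto; apply Clim_const.
Qed.

Lemma Clim_inv_half : Clim (fun n => / RtoC (INR n + 1 / 2))%C 0%C.
Proof.
apply (Clim_inv_far _ 0); intros n; rewrite Cmod_R, Rabs_pos_eq; pose proof (pos_INR n); lra.
Qed.

(** Each single [pair_term] tends to 0 by [pair_term_lim], but their sum over [n] does not. This
    failure of the interchange is exactly the anomaly in weight 2. *)
Lemma pair_sum_lim t : 0 < Im t -> Clim (fun n => pair_sum t (INR n + 1 / 2)) (PI * Ci / t)%C.
Proof.
intros H; destruct (inv_tau t H) as [Hi Ht]; unfold pair_sum.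
apply (Clim_eq _ (PI * Ci * 1 / t - 0)%C); [unfold Cdiv; ring|].
apply Clim_minus; [|apply Clim_inv_half].
apply Clim_mult; [|apply Clim_const].
apply Clim_scal, ct_lim; auto.
Qed.

Lemma pair_term_lim t n : Clim (fun m => pair_term t (INR m + 1 / 2) n) 0%C.
Proof.
unfold pair_term.
apply (Clim_eq _ (0 + 0)%C); [ring|].
apply Clim_plus.
- apply (Clim_inv_far _ (Cmod (1 / 2 + INR (S n) * t))); intros m.
  replace (RtoC (INR m + 1 / 2) + INR (S n) * t)%C with ((1 / 2 + INR (S n) * t) + INR m)%C.
  + apply Cmod_far.
  + rewrite RtoC_plus, RtoC_div by lra; ring.
- apply (Clim_inv_far _ (Cmod (1 / 2 - INR (S n) * t))); intros m.
  replace (RtoC (INR m + 1 / 2) - INR (S n) * t)%C with ((1 / 2 - INR (S n) * t) + INR m)%C.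
  + apply Cmod_far.
  + rewrite RtoC_plus, RtoC_div by lra; ring.
Qed.

Lemma CSer_telescope (u : nat -> C) l : Clim u l -> CSer (fun m => u m - u (S m))%C (u 0%nat - l)%C.
Proof.
intros H; unfold CSer.
apply (Clim_ext (fun n => u 0%nat - u n)%C).
- intros n; induction n; [simpl; ring|rewrite csum_S, <- IHn; ring].
- apply Clim_minus; auto; apply Clim_const.
Qed.

(* A telescoping comparison term for [quad 2]: the difference is [O(m^-2 n^-2)], so it may be summed in either order,
   and the two orders of summation of [hcmp] itself differ by the anomaly of [E_2]. *)
Definition hcmp (t : C) (m n : nat) : C := (pair_term t (INR m + 1 / 2) n - pair_term t (INR (S m) + 1 / 2) n)%C.

Lemma Cmod_sq_prod_lower (u v : C) (x : R) : 0 <= x -> x / 2 <= Cmod u ^ 2 -> x <= Cmod v ^ 2 -> x / 2 <= Cmod u * Cmod v.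
Proof.
intros Hx H1 H2; pose proof (Cmod_ge_0 u); pose proof (Cmod_ge_0 v).
apply Rsqr_incr_0_var; [|nra].
rewrite !Rsqr_pow2, Rpow_mult_distr; nra.
Qed.

(** The difference equals -1 / (4 w^2 (w^2 - 1/4)). Centring the telescoping term at [w], by half
    steps on both sides, is what removes the cubic order. *)
Lemma inv_sq_cmp (w : C) (x : R) : 0 < x -> x <= Cmod w ^ 2 -> x / 2 <= Cmod (w - 1 / 2) ^ 2 -> x <= Cmod (w + 1 / 2) ^ 2 ->
  Cmod (/ w ^ 2 - (/ (w - 1 / 2) - / (w + 1 / 2))) <= / x ^ 2.
Proof.
intros Hx H1 H2 H3.
assert (Nw : w <> 0%C) by (intros E; rewrite E, Cmod_0 in H1; lra).
assert (N1 : (w - 1 / 2)%C <> 0%C) by (intros E; rewrite E, Cmod_0 in H2; lra).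
assert (N2 : (w + 1 / 2)%C <> 0%C) by (intros E; rewrite E, Cmod_0 in H3; lra).
assert (P := Cmod_sq_prod_lower _ _ x ltac:(lra) H2 H3).
assert (N1' : (w * 2 - 1)%C <> 0%C).
{ replace (w * 2 - 1)%C with (2 * (w - 1 / 2))%C by field; apply Cmult_neq_0; auto; apply RtoC_neq0; lra. }
assert (N2' : (w * 2 + 1)%C <> 0%C).
{ replace (w * 2 + 1)%C with (2 * (w + 1 / 2))%C by field; apply Cmult_neq_0; auto; apply RtoC_neq0; lra. }
replace (/ w ^ 2 - (/ (w - 1 / 2) - / (w + 1 / 2)))%C with (- / (RtoC 4 * (w ^ 2 * ((w - 1 / 2) * (w + 1 / 2)))))%C
  by (field; auto).
assert (Q : x * (x / 2) <= Cmod (w ^ 2) * Cmod ((w - 1 / 2) * (w + 1 / 2))).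
{ rewrite Cmod_pow, Cmod_mult; apply Rmult_le_compat; lra. }
assert (NZ : (RtoC 4 * (w ^ 2 * ((w - 1 / 2) * (w + 1 / 2))))%C <> 0%C).
{ apply Cmult_neq_0; [apply RtoC_neq0; lra|].
  apply Cmult_neq_0; [apply Cpow_nz; auto|apply Cmult_neq_0; auto]. }
rewrite Cmod_opp, Cmod_inv by auto.
rewrite (Cmod_mult 4), Cmod_R, (Rabs_pos_eq 4), (Cmod_mult (w ^ 2)) by lra.
apply Rinv_le_contravar; nra.
Qed.

Lemma quad2_bound t m n : 0 < Im t ->
  Cmod (quad 2 t m n - hcmp t m n) <= 2 / K4 t ^ 2 * / INR (S n) ^ 2 * / INR (S m) ^ 2.
Proof.
intros H.
pose proof (INR_S_pos m) as Hm; pose proof (INR_S_pos n) as Hn; pose proof (K4_pos t H) as HK.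
set (a := INR (S m)) in *; set (b := INR (S n)) in *.
assert (Ha : 1 <= a) by (unfold a; rewrite S_INR; pose proof (pos_INR m); lra).
destruct (quad_lower t a b H ltac:(lra) ltac:(lra)) as [H1 H2]; fold (K4 t) in H1, H2.
(* Since a >= 1, the left neighbour a - 1/2 is still at least a/2; hence the halved hypothesis of
   [inv_sq_cmp]. *)
destruct (quad_lower t (a - 1 / 2) b H ltac:(lra) ltac:(lra)) as [H3 H4]; fold (K4 t) in H3, H4.
destruct (quad_lower t (a + 1 / 2) b H ltac:(lra) ltac:(lra)) as [H5 H6]; fold (K4 t) in H5, H6.
assert (P0 : 0 < b * K4 t) by nra.
assert (P : 0 < a * b * K4 t) by nra.
assert (D : RtoC (a - 1 / 2) = (a - 1 / 2)%C) by (rewrite RtoC_minus, RtoC_div by lra; auto).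
assert (E : RtoC (a + 1 / 2) = (a + 1 / 2)%C) by (rewrite RtoC_plus, RtoC_div by lra; auto).
assert (B1 := inv_sq_cmp (a + b * t) (a * b * K4 t) P H1).
assert (B2 := inv_sq_cmp (a - b * t) (a * b * K4 t) P H2).
replace (a + b * t - 1 / 2)%C with (RtoC (a - 1 / 2) + b * t)%C in B1 by (rewrite D; ring).
replace (a + b * t + 1 / 2)%C with (RtoC (a + 1 / 2) + b * t)%C in B1 by (rewrite E; ring).
replace (a - b * t - 1 / 2)%C with (RtoC (a - 1 / 2) - b * t)%C in B2 by (rewrite D; ring).
replace (a - b * t + 1 / 2)%C with (RtoC (a + 1 / 2) - b * t)%C in B2 by (rewrite E; ring).
specialize (B1 ltac:(nra) ltac:(nra)); specialize (B2 ltac:(nra) ltac:(nra)).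
replace (quad 2 t m n - hcmp t m n)%C with
 ((/ (a + b * t) ^ 2 - (/ (RtoC (a - 1 / 2) + b * t) - / (RtoC (a + 1 / 2) + b * t))) +
  (/ (a - b * t) ^ 2 - (/ (RtoC (a - 1 / 2) - b * t) - / (RtoC (a + 1 / 2) - b * t))))%C.
- eapply Rle_trans; [apply Cmod_triangle|].
  replace (2 / K4 t ^ 2 * / b ^ 2 * / a ^ 2) with (2 * / (a * b * K4 t) ^ 2) by (field; lra).
  lra.
- unfold quad, hcmp, pair_term; fold a; fold b.
  replace (INR m + 1 / 2) with (a - 1 / 2) by (unfold a; rewrite S_INR; field).
  ring.
Qed.

Lemma quad_row_CSer k t m : 0 < Im t -> (forall x : C, ((- x) ^ S (S k) = x ^ S (S k))%C) ->
  CSer (fun n => quad (S (S k)) t m n) (Csum (fun n => quad (S (S k)) t m n)).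
Proof.
intros H He; destruct (inv_tau t H) as [Hi Ht].
assert (Hp : (t ^ S (S k))%C <> 0%C) by (apply Cpow_nz; auto).
pose proof (zpow_quad k (- / t)%C m Hi He) as Q.
apply (CSer_scal (/ t ^ S (S k))%C) in Q.
apply (CSer_ext _ (fun n => quad (S (S k)) t m n)) in Q.
- rewrite (Csum_unique _ _ Q); auto.
- intros n; rewrite quad_inv by auto; field; auto.
Qed.

(** The absolutely convergent difference [X] is computed in both orders. The correction [hcmp] sums
    to [pair_sum t (1 / 2)] in one order; in the other the telescoping leaves the limit of
    [pair_sum_lim] behind as well. *)
Lemma lambert1_quasimodular t : 0 < Im t ->
  (lipcoef 0 * lambert 1 (nome t) - zeta 2 / t ^ 2 - (lipcoef 0 * lambert 1 (nome (- / t)) / t ^ 2 - zeta 2) = PI * Ci / t)%C.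
Proof.
intros H.
assert (He : forall x : C, ((- x) ^ 2 = x ^ 2)%C) by (intros; simpl; ring).
pose proof (lambert_quad 0 t H He) as L1.
pose proof (lambert_quad_inv 0 t H He) as L2.
destruct (CSer_swap_inv_sq (fun m n => quad 2 t m n - hcmp t m n)%C (2 / K4 t ^ 2)) as [S1 S2];
  [intros; apply quad2_bound; auto|].
set (X := Csum (fun n => Csum (fun m => quad 2 t m n - hcmp t m n)%C)) in *.
assert (H1 : forall n, CSer (fun m => hcmp t m n) (pair_term t (1 / 2) n)).
{ intros n; unfold hcmp.
  apply (CSer_eq _ (pair_term t (INR 0 + 1 / 2) n - 0)%C).
  - simpl; rewrite Rplus_0_l; ring.
  - apply (CSer_telescope (fun m => pair_term t (INR m + 1 / 2) n)), pair_term_lim. }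
assert (H2 : forall m, CSer (fun n => hcmp t m n) (pair_sum t (INR m + 1 / 2) - pair_sum t (INR (S m) + 1 / 2))%C).
{ intros m; unfold hcmp; apply CSer_minus; apply pair_CSer; auto; [pose proof (pos_INR m)|pose proof (pos_INR (S m))]; lra. }
assert (E1 : X = (lipcoef 0 * lambert 1 (nome t) - zeta 2 / t ^ 2 - pair_sum t (1 / 2))%C).
{ apply (CSer_unique _ _ _ S2).
  apply (CSer_ext (fun n => Csum (fun m => quad 2 t m n) - pair_term t (1 / 2) n)%C).
  - intros n; symmetry; apply Csum_unique, CSer_minus; auto.
    pose proof (zpow_quad 0 t n H He) as Q; rewrite (Csum_unique _ _ Q); auto.
  - apply CSer_minus; auto; apply pair_CSer; auto; lra. }
assert (E2 : X = (lipcoef 0 * lambert 1 (nome (- / t)) / t ^ 2 - zeta 2 - (pair_sum t (1 / 2) - PI * Ci / t))%C).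
{ apply (CSer_unique _ _ _ S1).
  apply (CSer_ext (fun m => Csum (fun n => quad 2 t m n) - (pair_sum t (INR m + 1 / 2) - pair_sum t (INR (S m) + 1 / 2)))%C).
  - intros m; symmetry; apply Csum_unique, CSer_minus; auto.
    apply quad_row_CSer; auto.
  - apply CSer_minus; auto.
    apply (CSer_eq _ (pair_sum t (INR 0 + 1 / 2) - PI * Ci / t)%C); [simpl; rewrite Rplus_0_l; auto|].
    apply (CSer_telescope (fun m => pair_sum t (INR m + 1 / 2))), pair_sum_lim; auto. }
transitivity (X + pair_sum t (1 / 2) - (X + pair_sum t (1 / 2) - PI * Ci / t))%C; [|ring].
rewrite E1 at 1; rewrite E2; ring.
Qed.

Lemma E2_quasimodular t : 0 < Im t ->
  (1 - 24 * lambert 1 (nome t) - (1 - 24 * lambert 1 (nome (- / t))) / t ^ 2 = 6 * Ci / (PI * t))%C.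
Proof.
intros H; destruct (inv_tau t H) as [_ Ht].
pose proof (lambert1_quasimodular t H) as L.
replace (zeta 2) with (RtoC (PI ^ 2 / 6)) in L by (rewrite zeta_rzeta, (proj1 rzeta_2_4); auto).
(* This constant is -24 times zeta(2), the origin of the -24 in the Eisenstein series. *)
assert (EK : lipcoef 0 = RtoC (-24 * (PI ^ 2 / 6))).
{ unfold lipcoef; simpl fact.
  transitivity (4 * PI ^ 2 * (Ci * Ci) / INR 1)%C; [simpl Cpow; unfold Cdiv; ring|].
  replace (Ci * Ci)%C with (RtoC (-1)) by (apply C_eq; simpl; ring).
  rewrite <- RtoC_pow, <- !RtoC_mult, <- RtoC_div by (apply not_0_INR; lia).
  f_equal; simpl; field. }
rewrite EK, RtoC_mult in L.
assert (T2 : (t ^ 2)%C <> 0%C) by (apply Cpow_nz; auto).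
assert (PC := PI_C_neq0).
assert (EZ : RtoC (PI ^ 2 / 6) = (PI * PI / 6)%C).
{ rewrite RtoC_div, RtoC_pow by lra; simpl Cpow; f_equal; ring. }
rewrite EZ in L.
set (u := lambert 1 (nome (- / t))) in *; set (v := lambert 1 (nome t)) in *.
transitivity ((6 / (PI * PI)) * (-24 * (PI * PI / 6) * v - PI * PI / 6 / t ^ 2 - (-24 * (PI * PI / 6) * u / t ^ 2 - PI * PI / 6)))%C.
- field; auto.
- rewrite L; field; auto.
Qed.

(** * Modularity of the discriminant *)

Fixpoint eprod (q : C) (n : nat) : C :=
  match n with O => 1%C | S n => (eprod q n * (1 - q ^ S n))%C end.

Lemma eprod_S q n : eprod q (S n) = (eprod q n * (1 - q ^ S n))%C.
Proof. reflexivity. Qed.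

Lemma Cmod_1_minus_le (x : C) : Cmod (1 - x) <= 1 + Cmod x.
Proof.
unfold Cminus; eapply Rle_trans; [apply Cmod_triangle|]; rewrite Cmod_1, Cmod_opp; lra.
Qed.

Lemma Cmod_1_minus_ge (x : C) : 1 - Cmod x <= Cmod (1 - x).
Proof.
assert (Cmod 1 <= Cmod (1 - x) + Cmod x); [|rewrite Cmod_1 in *; lra].
replace (RtoC 1) with ((1 - x) + x)%C at 1 by ring; apply Cmod_triangle.
Qed.

Lemma Cpow_S_le q r n : Cmod q <= r -> r < 1 -> Cmod (q ^ S n)%C <= r ^ S n /\ 0 <= r ^ S n <= r.
Proof.
intros H Hr; pose proof (Cmod_ge_0 q); split.
- rewrite Cmod_pow; apply pow_incr; auto.
- apply pow_S_lt1; lra.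
Qed.

Lemma geom_partial_le r n : 0 <= r < 1 -> r * (1 - r ^ n) / (1 - r) <= r / (1 - r).
Proof.
intros H; apply Rmult_le_compat_r; [left; apply Rinv_0_lt_compat; lra|].
pose proof (pow_le r n ltac:(lra)); nra.
Qed.

Lemma eprod_upper q r n : Cmod q <= r -> r < 1 -> Cmod (eprod q n) <= exp (r / (1 - r)).
Proof.
intros H Hr; pose proof (Cmod_ge_0 q) as H0.
apply Rle_trans with (exp (r * (1 - r ^ n) / (1 - r))); [|apply exp_mono, geom_partial_le; lra].
induction n.
- simpl; rewrite Cmod_1; unfold Rdiv; rewrite Rminus_diag, Rmult_0_r, Rmult_0_l, exp_0; lra.
- rewrite eprod_S, Cmod_mult.
  destruct (Cpow_S_le q r n H Hr) as [H1 H2].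
  replace (r * (1 - r ^ S n) / (1 - r)) with (r * (1 - r ^ n) / (1 - r) + r ^ S n) by (simpl; field; lra).
  rewrite exp_plus; apply Rmult_le_compat; auto; try apply Cmod_ge_0.
  eapply Rle_trans; [apply Cmod_1_minus_le|]; pose proof (exp_ge_1p (r ^ S n)); lra.
Qed.

Lemma one_minus_exp_lower x r : 0 <= x <= r -> r < 1 -> exp (- (x / (1 - r))) <= 1 - x.
Proof.
intros H Hr.
assert (E : exp (- (x / (1 - r))) * exp (x / (1 - r)) = 1) by (rewrite <- exp_plus, <- exp_0; f_equal; ring).
pose proof (exp_ge_1p (x / (1 - r))) as L; pose proof (exp_pos (- (x / (1 - r)))) as P.
assert (1 <= (1 - x) * (1 + x / (1 - r))).
{ replace ((1 - x) * (1 + x / (1 - r))) with (1 + (x * (r - x)) / (1 - r)) by (field; lra).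
  assert (0 <= x * (r - x) / (1 - r)); [|lra].
  apply Rmult_le_pos; [nra|left; apply Rinv_0_lt_compat; lra]. }
assert (1 <= (1 - x) * exp (x / (1 - r))) by (eapply Rle_trans; [exact H0|]; apply Rmult_le_compat_l; lra).
nra.
Qed.

(** On [0, r] one has 1 - x >= exp(-x / (1 - r)), and the exponents add up to a geometric sum.
    Uniformity in [n] gives the non-vanishing of the infinite product and allows division by partial
    products. *)
Lemma eprod_lower q r n : Cmod q <= r -> r < 1 -> exp (- (r / (1 - r) ^ 2)) <= Cmod (eprod q n).
Proof.
intros H Hr; pose proof (Cmod_ge_0 q) as H0.
apply Rle_trans with (exp (- (/ (1 - r) * (r * (1 - r ^ n) / (1 - r))))).
{ apply exp_mono, Ropp_le_contravar.
  replace (r / (1 - r) ^ 2) with (/ (1 - r) * (r / (1 - r))) by (field; lra).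
  apply Rmult_le_compat_l; [left; apply Rinv_0_lt_compat; lra|apply geom_partial_le; lra]. }
induction n.
- simpl; rewrite Cmod_1; unfold Rdiv; rewrite Rminus_diag, Rmult_0_r, Rmult_0_l, Rmult_0_r, Ropp_0, exp_0; lra.
- rewrite eprod_S, Cmod_mult.
  destruct (Cpow_S_le q r n H Hr) as [H1 H2].
  replace (- (/ (1 - r) * (r * (1 - r ^ S n) / (1 - r)))) with
   (- (/ (1 - r) * (r * (1 - r ^ n) / (1 - r))) + - (r ^ S n / (1 - r))) by (simpl; field; lra).
  rewrite exp_plus; apply Rmult_le_compat; auto; try (left; apply exp_pos).
  eapply Rle_trans; [apply one_minus_exp_lower; [exact H2|auto]|].
  eapply Rle_trans; [|apply Cmod_1_minus_ge]; lra.
Qed.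

(* The telescoped form of the product of all [1 - q^n]. *)
Definition euler (q : C) : C := (1 - Csum (fun n => q ^ S n * eprod q n))%C.

Lemma euler_term_bound q n : Cmod q < 1 ->
  Cmod (q ^ S n * eprod q n)%C <= exp (Cmod q / (1 - Cmod q)) * Cmod q ^ S n.
Proof.
intros H; rewrite Cmod_mult, Cmod_pow, Rmult_comm.
apply Rmult_le_compat_r; [apply pow_le, Cmod_ge_0|apply eprod_upper; auto; lra].
Qed.

Lemma euler_lim q : Cmod q < 1 -> Clim (eprod q) (euler q).
Proof.
intros H; pose proof (Cmod_ge_0 q); unfold euler.
apply (Clim_ext (fun n => 1 - csum (fun n => q ^ S n * eprod q n) n)%C).
- intros n; induction n; [simpl; ring|rewrite csum_S, eprod_S].
  transitivity ((1 - csum (fun n : nat => (q ^ S n * eprod q n)%C) n) - q ^ S n * eprod q n)%C; [ring|].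
  rewrite IHn; ring.
- apply Clim_minus; [apply Clim_const|].
  apply (CSer_Csum _ (fun n => exp (Cmod q / (1 - Cmod q)) * Cmod q ^ S n)).
  + intros n; apply euler_term_bound; auto.
  + apply ex_series_Rscal, ex_series_geom1; lra.
Qed.

Lemma euler_lower q r : Cmod q <= r -> r < 1 -> exp (- (r / (1 - r) ^ 2)) <= Cmod (euler q).
Proof.
intros H Hr; apply (Clim_mod_ge (eprod q)); [apply euler_lim; lra|].
intros; apply eprod_lower; auto.
Qed.

Lemma euler_nz q : Cmod q < 1 -> euler q <> 0%C.
Proof.
intros H; apply Cmod_gt_0; eapply Rlt_le_trans; [apply exp_pos|apply (euler_lower q (Cmod q)); lra].
Qed.

(** Complex values, real variable: the comparison of both sides of a modular identity needs
    derivatives only along a segment. *)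
Definition Cder (f : R -> C) (u : R) (l : C) : Prop :=
  is_derive (fun v => Re (f v)) u (Re l) /\ is_derive (fun v => Im (f v)) u (Im l).

Lemma Cder_eq f u l m : l = m -> Cder f u l -> Cder f u m.
Proof. intros E; rewrite E; auto. Qed.

Lemma Cder_const (c : C) u : Cder (fun _ => c) u 0%C.
Proof. split; simpl; apply (is_derive_const (K := R_AbsRing) (V := R_NormedModule)). Qed.

Lemma Cder_plus f g u l m : Cder f u l -> Cder g u m -> Cder (fun v => f v + g v)%C u (l + m)%C.
Proof.
intros [F1 F2] [G1 G2]; split.
- apply (Rder_plus (fun v => Re (f v)) (fun v => Re (g v))); auto.
- apply (Rder_plus (fun v => Im (f v)) (fun v => Im (g v))); auto.
Qed.

Lemma Rder_mult (f g : R -> R) (t l m : R) :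
  is_derive f t l -> is_derive g t m -> is_derive (fun x => f x * g x) t (l * g t + f t * m).
Proof. intros; apply (is_derive_mult f g); auto; intros; apply Rmult_comm. Qed.

Lemma Cder_mult f g u l m : Cder f u l -> Cder g u m -> Cder (fun v => f v * g v)%C u (l * g u + f u * m)%C.
Proof.
intros [F1 F2] [G1 G2]; split.
- apply (Rder_ext (fun v => Re (f v) * Re (g v) - Im (f v) * Im (g v))); [intros; rewrite Re_mult; auto|].
  apply (Rder_eq _ _ ((Re l * Re (g u) + Re (f u) * Re m) - (Im l * Im (g u) + Im (f u) * Im m)));
   [rewrite Re_plus, !Re_mult; ring|].
  apply Rder_minus; [apply (Rder_mult (fun v => Re (f v)) (fun v => Re (g v)))|apply (Rder_mult (fun v => Im (f v)) (fun v => Im (g v)))]; auto.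
- apply (Rder_ext (fun v => Re (f v) * Im (g v) + Im (f v) * Re (g v))); [intros; rewrite Im_mult; auto|].
  apply (Rder_eq _ _ ((Re l * Im (g u) + Re (f u) * Im m) + (Im l * Re (g u) + Im (f u) * Re m)));
   [rewrite Im_plus, !Im_mult; ring|].
  apply Rder_plus; [apply (Rder_mult (fun v => Re (f v)) (fun v => Im (g v)))|apply (Rder_mult (fun v => Im (f v)) (fun v => Re (g v)))]; auto.
Qed.

Lemma Cder_scal c f u l : Cder f u l -> Cder (fun v => c * f v)%C u (c * l)%C.
Proof.
intros H; apply (Cder_eq _ _ (0 * f u + c * l)%C); [ring|].
apply (Cder_mult (fun _ => c)); auto; apply Cder_const.
Qed.

Lemma Cder_Cexp f u l : Cder f u l -> Cder (fun v => Cexp (f v)) u (l * Cexp (f u))%C.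
Proof.
intros [F1 F2]; split.
- apply (Rder_ext (fun v => exp (Re (f v)) * cos (Im (f v)))); [intros; rewrite Re_Cexp; auto|].
  apply (Rder_eq _ _ ((Re l * exp (Re (f u))) * cos (Im (f u)) + exp (Re (f u)) * (Im l * - sin (Im (f u)))));
   [rewrite Re_mult, Re_Cexp, Im_Cexp; ring|].
  apply (Rder_mult (fun v => exp (Re (f v))) (fun v => cos (Im (f v)))).
  + apply (Rder_comp exp (fun v => Re (f v))); auto; apply is_derive_exp.
  + apply (Rder_comp cos (fun v => Im (f v))); auto; apply is_derive_cos.
- apply (Rder_ext (fun v => exp (Re (f v)) * sin (Im (f v)))); [intros; rewrite Im_Cexp; auto|].
  apply (Rder_eq _ _ ((Re l * exp (Re (f u))) * sin (Im (f u)) + exp (Re (f u)) * (Im l * cos (Im (f u)))));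
   [rewrite Im_mult, Re_Cexp, Im_Cexp; ring|].
  apply (Rder_mult (fun v => exp (Re (f v))) (fun v => sin (Im (f v)))).
  + apply (Rder_comp exp (fun v => Re (f v))); auto; apply is_derive_exp.
  + apply (Rder_comp sin (fun v => Im (f v))); auto; apply is_derive_sin.
Qed.

Lemma Rder_div_sq (w x y : R -> R) u c a b : x u ^ 2 + y u ^ 2 <> 0 ->
  is_derive w u c -> is_derive x u a -> is_derive y u b ->
  is_derive (fun v => w v / (x v ^ 2 + y v ^ 2)) u
   ((c * (x u ^ 2 + y u ^ 2) - w u * (2 * x u * a + 2 * y u * b)) / (x u ^ 2 + y u ^ 2) ^ 2).
Proof.
intros D W X Y.
pose proof (is_derive_unique _ _ _ X) as UX; pose proof (is_derive_unique _ _ _ Y) as UY;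
pose proof (is_derive_unique _ _ _ W) as UW.
auto_derive.
- repeat split; auto; eexists; eauto.
- replace (Derive (fun x0 => w x0) u) with c by (symmetry; exact UW).
  replace (Derive (fun x0 => x x0) u) with a by (symmetry; exact UX).
  replace (Derive (fun x0 => y x0) u) with b by (symmetry; exact UY).
  field; intros Q; apply D; rewrite <- Q; ring.
Qed.

Lemma Cder_inv (f : R -> C) u l : f u <> 0%C -> Cder f u l -> Cder (fun v => / f v)%C u (- l / (f u * f u))%C.
Proof.
intros Hn [F1 F2].
assert (D : Re (f u) ^ 2 + Im (f u) ^ 2 <> 0).
{ rewrite <- Cmod2_alt; apply Cmod_gt_0 in Hn; nra. }
assert (E : (- l / (f u * f u))%C = 
  ((- (Re l * (Re (f u) ^ 2 - Im (f u) ^ 2) + 2 * Re (f u) * Im (f u) * Im l)) / (Re (f u) ^ 2 + Im (f u) ^ 2) ^ 2,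
   (- (Im l * (Re (f u) ^ 2 - Im (f u) ^ 2) - 2 * Re (f u) * Im (f u) * Re l)) / (Re (f u) ^ 2 + Im (f u) ^ 2) ^ 2)).
{ assert (D' : Re (f u) * Re (f u) + Im (f u) * Im (f u) <> 0) by (intros Q; apply D; rewrite <- Q; ring).
  destruct (f u) as [x y], l as [a b]; simpl in *.
  apply C_eq; simpl; field; repeat split; try (intros Q; apply D'; rewrite <- Q; ring); nra. }
rewrite E; split; simpl Re; simpl Im.
- apply (Rder_ext (fun v => Re (f v) / (Re (f v) ^ 2 + Im (f v) ^ 2))); [intros; reflexivity|].
  eapply Rder_eq; [|apply (Rder_div_sq (fun v => Re (f v)) (fun v => Re (f v)) (fun v => Im (f v))); eauto].
  simpl; field; intros Q; apply D; rewrite <- Q; ring.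
- apply (Rder_ext (fun v => - Im (f v) / (Re (f v) ^ 2 + Im (f v) ^ 2))); [intros; reflexivity|].
  eapply Rder_eq; [|apply (Rder_div_sq (fun v => - Im (f v)) (fun v => Re (f v)) (fun v => Im (f v))); eauto].
  2:{ apply (is_derive_opp (fun v => Im (f v))); eauto. }
  unfold opp; simpl; field; intros Q; apply D; rewrite <- Q; ring.
Qed.

(** Stated as f' = l f, which avoids choosing a branch of the logarithm. *)
Definition Clogder (f : R -> C) (u : R) (l : C) : Prop := f u <> 0%C /\ Cder f u (l * f u)%C.

Lemma Clogder_eq f u l m : l = m -> Clogder f u l -> Clogder f u m.
Proof. intros E; rewrite E; auto. Qed.

Lemma Clogder_mult f g u l m : Clogder f u l -> Clogder g u m -> Clogder (fun v => f v * g v)%C u (l + m)%C.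
Proof.
intros [F1 F2] [G1 G2]; split; [apply Cmult_neq_0; auto|].
apply (Cder_eq _ _ (l * f u * g u + f u * (m * g u))%C); [ring|].
apply Cder_mult; auto.
Qed.

Lemma Clogder_inv f u l : Clogder f u l -> Clogder (fun v => / f v)%C u (- l)%C.
Proof.
intros [F1 F2]; split.
- apply Cmod_gt_0; rewrite Cmod_inv by auto; apply Rinv_0_lt_compat, Cmod_gt_0; auto.
- apply (Cder_eq _ _ (- (l * f u) / (f u * f u))%C); [field; auto|].
  apply Cder_inv; auto.
Qed.

Lemma Clogder_const (c : C) u : c <> 0%C -> Clogder (fun _ => c) u 0%C.
Proof. intros H; split; auto; apply (Cder_eq _ _ 0%C); [ring|apply Cder_const]. Qed.

Lemma Clogder_pow f u l n : Clogder f u l -> Clogder (fun v => f v ^ n)%C u (INR n * l)%C.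
Proof.
intros H; induction n.
- apply (Clogder_eq _ _ 0%C); [simpl; ring|]; apply (Clogder_const 1%C), C1_nz.
- apply (Clogder_eq _ _ (l + INR n * l)%C); [rewrite S_INR, RtoC_plus; ring|].
  apply (Clogder_mult f (fun v => f v ^ n)%C); auto.
Qed.

Lemma Clogder_nome f u l : Cder f u l -> Clogder (fun v => nome (f v)) u (2 * PI * Ci * l)%C.
Proof.
intros H; split; [apply nome_nz|].
unfold nome; apply (Cder_Cexp (fun v => (2 * PI * Ci * f v)%C)), Cder_scal; auto.
Qed.

Lemma Cder_minus1 f u l : Cder f u l -> Cder (fun v => 1 - f v)%C u (- l)%C.
Proof.
intros H; apply (Cder_eq _ _ (0 + (-1) * l)%C); [ring|].
assert (K : Cder (fun v => 1 + (-1) * f v)%C u (0 + (-1) * l)%C).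
{ apply (Cder_plus (fun _ => 1%C)); [apply Cder_const|apply Cder_scal; auto]. }
destruct K as [K1 K2]; split; eapply Rder_ext; [|exact K1| |exact K2]; intros v; simpl; ring.
Qed.

Definition lambertN (k : nat) (q : C) (n : nat) : C :=
  csum (fun d => RtoC (INR (S d) ^ k) * (q ^ S d / (1 - q ^ S d)))%C n.

Lemma Clogder_eprod f u l n : 0 < Im (f u) -> Cder f u l ->
  Clogder (fun v => eprod (nome (f v)) n) u (- (2 * PI * Ci * l * lambertN 1 (nome (f u)) n))%C.
Proof.
intros Hf H; induction n.
- apply (Clogder_eq _ _ 0%C); [unfold lambertN; simpl; ring|]; apply (Clogder_const 1%C), C1_nz.
- assert (Nz : (1 - nome (f u) ^ S n)%C <> 0%C).
  { apply Cmod_lt1_neq; rewrite Cmod_pow; pose proof (Cmod_nome_01 _ Hf).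
    pose proof (pow_S_lt1 (Cmod (nome (f u))) n ltac:(lra)); lra. }
  apply (Clogder_eq _ _ (- (2 * PI * Ci * l * lambertN 1 (nome (f u)) n) +
     - (INR (S n) * (2 * PI * Ci * l) * nome (f u) ^ S n) / (1 - nome (f u) ^ S n))%C).
  + unfold lambertN; rewrite csum_S, pow_1; field; auto.
  + apply (Clogder_mult (fun v => eprod (nome (f v)) n) (fun v => 1 - nome (f v) ^ S n)%C); auto.
    split; auto.
    destruct (Clogder_pow (fun v => nome (f v)) u _ (S n) (Clogder_nome f u l H)) as [_ P].
    apply (Cder_eq _ _ (- (INR (S n) * (2 * PI * Ci * l) * nome (f u) ^ S n))%C); [field; auto|].
    apply (Cder_minus1 (fun v => nome (f v) ^ S n)%C); exact P.
Qed.

(** Differentiation is applied to these partial products alone. The limit is taken in the resulting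
    estimates, so no limit has to be differentiated. *)
Definition discrN (n : nat) (t : C) : C := (nome t * eprod (nome t) n ^ 24)%C.

Lemma Clogder_discrN f u l n : 0 < Im (f u) -> Cder f u l ->
  Clogder (fun v => discrN n (f v)) u (2 * PI * Ci * l * (1 - 24 * lambertN 1 (nome (f u)) n))%C.
Proof.
intros Hf H; unfold discrN.
apply (Clogder_eq _ _ (2 * PI * Ci * l + INR 24 * (- (2 * PI * Ci * l * lambertN 1 (nome (f u)) n)))%C).
- replace (INR 24) with 24 by (simpl; ring); ring.
- apply (Clogder_mult (fun v => nome (f v)) (fun v => eprod (nome (f v)) n ^ 24)%C); [apply Clogder_nome; auto|].
  apply (Clogder_pow (fun v => eprod (nome (f v)) n)), Clogder_eprod; auto.
Qed.

Lemma Im_inv_tau (t : C) : t <> 0%C -> Im (- / t)%C = Im t / Cmod t ^ 2.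
Proof.
intros H; rewrite Cmod2_alt; destruct t as [x y]; simpl.
field; intros E; apply H; apply C_eq; simpl; nra.
Qed.

Definition lambert_bd (r : R) (n : nat) : R := / (1 - r) * (INR (S n) ^ 1 * r ^ S n).

Lemma lambertN_dist q r B n : 0 < Cmod q <= r -> r < 1 -> is_series (lambert_bd r) B ->
  Cmod (lambertN 1 q (S n) - lambert 1 q) <= B - sum_n (lambert_bd r) n.
Proof.
intros Hq Hr HB; unfold lambertN.
apply (CSer_dist _ _ (lambert_bd r)); auto; [|apply ex_lambert; lra].
intros d; eapply Rle_trans; [apply lambert_term_bound; lra|].
unfold lambert_bd.
assert (0 <= INR (S d) ^ 1) by (apply pow_le, pos_INR).
assert (Cmod q ^ S d <= r ^ S d) by (apply pow_incr; lra).
assert (0 <= Cmod q ^ S d) by (apply pow_le; lra).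
apply Rmult_le_compat.
- left; apply Rinv_0_lt_compat; lra.
- apply Rmult_le_pos; auto.
- apply Rinv_le_contravar; lra.
- apply Rmult_le_compat_l; auto.
Qed.

Definition discr (t : C) : C := (nome t * euler (nome t) ^ 24)%C.

Lemma discrN_lim t : 0 < Im t -> Clim (fun n => discrN n t) (discr t).
Proof.
intros H; unfold discrN, discr; apply Clim_scal, Clim_pow, euler_lim, Cmod_nome_lt1; auto.
Qed.

Lemma discr_nz t : 0 < Im t -> discr t <> 0%C.
Proof. intros H; apply Cmult_neq_0; [apply nome_nz|apply Cpow_nz, euler_nz, Cmod_nome_lt1; auto]. Qed.

Lemma discrN_upper t r n : 0 < Im t -> Cmod (nome t) <= r -> r < 1 ->
  Cmod (discrN n t) <= exp (r / (1 - r)) ^ 24.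
Proof.
intros H H1 Hr; unfold discrN; rewrite Cmod_mult, Cmod_pow.
pose proof (Cmod_nome_01 t H).
rewrite <- (Rmult_1_l (exp _ ^ 24)); apply Rmult_le_compat; try lra.
- apply pow_le, Cmod_ge_0.
- apply pow_incr; split; [apply Cmod_ge_0|apply eprod_upper; auto].
Qed.

Lemma discrN_lower t r n M : 0 < Im t <= M -> Cmod (nome t) <= r -> r < 1 ->
  exp (- (2 * PI * M)) * exp (- (r / (1 - r) ^ 2)) ^ 24 <= Cmod (discrN n t).
Proof.
intros H H1 Hr; unfold discrN; rewrite Cmod_mult, Cmod_pow.
apply Rmult_le_compat; try (left; apply exp_pos); try apply pow_le; try (left; apply exp_pos).
- rewrite Cmod_nome; apply exp_mono; pose proof PI_RGT_0; nra.
- apply pow_incr; split; [left; apply exp_pos|apply eprod_lower; auto].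
Qed.

Lemma Rder_affine (a b u : R) : is_derive (fun v : R => a + v * b) u b.
Proof. auto_derive; auto; ring. Qed.

(* Along the segment from [Ci] to [tau], the quotient of the two sides, formed with partial products,
   has logarithmic derivative tending to [0] by [E2_quasimodular]. *)
Lemma discr_modular tau : 0 < Im tau -> discr (- / tau) = (tau ^ 12 * discr tau)%C.
Proof.
intros Htau.
set (d := (tau - Ci)%C).
set (t := fun u : R => (Ci + u * d)%C).
set (s := fun u : R => (- / t u)%C).
set (y0 := Rmin 1 (Im tau)).
set (M := 1 + Cmod tau).
assert (Hy0 : 0 < y0) by (apply Rmin_glb_lt; lra).
assert (HM : 1 <= M) by (unfold M; pose proof (Cmod_ge_0 tau); lra).
assert (Iy : forall u, 0 <= u <= 1 -> y0 <= Im (t u)).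
{ intros u Hu; unfold t, d; rewrite Im_plus, im_scal_l, Im_minus; simpl (Im Ci).
  pose proof (Rmin_l 1 (Im tau) : y0 <= 1); pose proof (Rmin_r 1 (Im tau) : y0 <= Im tau); nra. }
assert (Mt : forall u, 0 <= u <= 1 -> Cmod (t u) <= M).
{ intros u Hu; replace (t u) with (RtoC (1 - u) * Ci + u * tau)%C by (unfold t, d; rewrite RtoC_minus; ring).
  eapply Rle_trans; [apply Cmod_triangle|]; rewrite !Cmod_mult, !Cmod_R, Cmod_Ci, !Rabs_pos_eq by lra.
  unfold M; pose proof (Cmod_ge_0 tau); nra. }
assert (Mt2 : forall u, 0 <= u <= 1 -> y0 <= Cmod (t u)).
{ intros u Hu; eapply Rle_trans; [apply (Iy u Hu)|]; eapply Rle_trans; [apply Rle_abs|apply Im_le_Cmod]. }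
assert (Nt : forall u, 0 <= u <= 1 -> t u <> 0%C).
{ intros u Hu; apply Cmod_gt_0; specialize (Mt2 u Hu); lra. }
(* Lower bound for the imaginary part along the segment and along its image under inversion; both
   nomes then stay within the single radius [r] below. *)
set (m := y0 / M ^ 2).
assert (Hm : 0 < m <= y0).
{ assert (1 <= M ^ 2) by nra.
  unfold m; split; [apply Rdiv_lt_0_compat; lra|].
  apply Rle_div_l; nra. }
assert (Is : forall u, 0 <= u <= 1 -> m <= Im (s u)).
{ intros u Hu; unfold s; rewrite Im_inv_tau by auto; unfold m.
  pose proof (Iy u Hu); pose proof (Mt u Hu); pose proof (Mt2 u Hu).
  unfold Rdiv; apply Rmult_le_compat; try lra.
  - left; apply Rinv_0_lt_compat; nra.
  - apply Rinv_le_contravar; [nra|]; apply pow_incr; lra. }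
pose proof PI_RGT_0 as HPI.
set (r := exp (- (2 * PI * m))).
assert (Hr : 0 < r < 1).
{ split; [apply exp_pos|]; unfold r; rewrite <- exp_0; apply exp_increasing; nra. }
assert (Hrle : forall z, m <= Im z -> 0 < Cmod (nome z) <= r).
{ intros z Hz; rewrite Cmod_nome; split; [apply exp_pos|]; unfold r; apply exp_mono; nra. }
assert (Dt : forall u, Cder t u d).
{ intros u; unfold t; split.
  - apply (Rder_ext (fun v => Re Ci + v * Re d)); [intros; rewrite Re_plus, re_scal_l; auto|].
    apply Rder_affine.
  - apply (Rder_ext (fun v => Im Ci + v * Im d)); [intros; rewrite Im_plus, im_scal_l; auto|].
    apply Rder_affine. }
assert (Ds : forall u, 0 <= u <= 1 -> Cder s u (d / (t u * t u))%C).
{ intros u Hu; unfold s.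
  assert (K : Cder (fun v => (-1) * / t v)%C u ((-1) * (- d / (t u * t u)))%C).
  { apply Cder_scal, Cder_inv; auto. }
  apply (Cder_eq _ _ ((-1) * (- d / (t u * t u)))%C); [field; auto|].
  destruct K as [K1 K2]; split; eapply Rder_ext; [|exact K1| |exact K2]; intros v; simpl; ring. }
set (Psi := fun n u => (discrN n (s u) * (/ t u ^ 12 * / discrN n (t u)))%C).
set (L := fun n u => (2 * PI * Ci * (d / (t u * t u)) * (1 - 24 * lambertN 1 (nome (s u)) n) +
   (- (INR 12 * (d / t u)) + - (2 * PI * Ci * d * (1 - 24 * lambertN 1 (nome (t u)) n))))%C).
assert (HL : forall n u, 0 <= u <= 1 -> Clogder (Psi n) u (L n u)).
{ intros n u Hu; pose proof (Iy u Hu); pose proof (Is u Hu); unfold Psi, L.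
  apply (Clogder_mult (fun u => discrN n (s u)) (fun u => / t u ^ 12 * / discrN n (t u))%C).
  - apply Clogder_discrN; auto; lra.
  - apply (Clogder_mult (fun u => / t u ^ 12)%C (fun u => / discrN n (t u))%C).
    + apply (Clogder_inv (fun u => t u ^ 12)%C), (Clogder_pow t); split; auto.
      apply (Cder_eq _ _ d); auto; field; auto.
    + apply (Clogder_inv (fun u => discrN n (t u))), Clogder_discrN; auto; lra. }
(* [E2_quasimodular] cancels the contribution of the factor t^(-12); only the truncation errors of
   the two Lambert series survive, and they tend to 0 uniformly on the segment. *)
assert (EL : forall n u, 0 <= u <= 1 -> L n u = (48 * PI * Ci * d *
   ((lambertN 1 (nome (t u)) n - lambert 1 (nome (t u))) - (lambertN 1 (nome (s u)) n - lambert 1 (nome (s u))) / (t u * t u)))%C).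
{ intros n u Hu; pose proof (Iy u Hu) as Hi; pose proof (Nt u Hu) as Hn.
  pose proof (E2_quasimodular (t u) ltac:(lra)) as E; fold (s u) in E.
  unfold L.
  set (a := lambertN 1 (nome (s u)) n); set (b := lambertN 1 (nome (t u)) n).
  set (u1 := lambert 1 (nome (s u))) in *; set (v1 := lambert 1 (nome (t u))) in *.
  assert (PC := PI_C_neq0).
  replace (INR 12) with 12 by (simpl; ring).
  assert (E' : (- (12 * (d / t u)) = 2 * PI * Ci * d * (1 - 24 * v1 - (1 - 24 * u1) / t u ^ 2))%C).
  { rewrite E; transitivity ((Ci * Ci) * (12 * (d / t u)))%C; [|field; auto].
    replace (Ci * Ci)%C with (RtoC (-1)) by (apply C_eq; simpl; ring); ring. }
  rewrite E'; field; auto. }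
assert (HB : ex_series (lambert_bd r)).
{ unfold lambert_bd; apply ex_series_Rscal, ex_series_pow_geom; auto. }
destruct HB as [B HB].
set (tail := fun n => B - sum_n (lambert_bd r) n).
set (KK := 48 * PI * Cmod d * (1 + / y0 ^ 2)).
assert (HKK : 0 <= KK).
{ unfold KK; apply Rmult_le_pos; [pose proof (Cmod_ge_0 d); nra|].
  assert (0 < / y0 ^ 2) by (apply Rinv_0_lt_compat; nra); lra. }
assert (BL : forall n u, 0 <= u <= 1 -> Cmod (L (S n) u) <= KK * tail n).
{ intros n u Hu; rewrite EL by auto; rewrite !Cmod_mult, !Cmod_R, Cmod_Ci, !Rabs_pos_eq by lra.
  pose proof (Iy u Hu) as Hi; pose proof (Is u Hu) as His; pose proof (Mt2 u Hu) as H2.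
  pose proof (lambertN_dist (nome (t u)) r B n (Hrle (t u) ltac:(lra)) ltac:(lra) HB) as T1.
  pose proof (lambertN_dist (nome (s u)) r B n (Hrle (s u) His) ltac:(lra) HB) as T2.
  fold (tail n) in T1, T2.
  unfold KK; rewrite Rmult_1_r, (Rmult_assoc (48 * PI * Cmod d)).
  apply Rmult_le_compat_l; [pose proof (Cmod_ge_0 d); nra|].
  unfold Cminus at 1; eapply Rle_trans; [apply Cmod_triangle|]; rewrite Cmod_opp.
  rewrite Rmult_plus_distr_r, Rmult_1_l; apply Rplus_le_compat; auto.
  rewrite Cmod_div by (apply Cmult_neq_0; auto).
  unfold Rdiv; rewrite Rmult_comm, Cmod_mult; apply Rmult_le_compat; auto.
  - left; apply Rinv_0_lt_compat; nra.
  - apply Cmod_ge_0.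
  - apply Rinv_le_contravar; nra. }
set (lo := exp (- (2 * PI * M)) * exp (- (r / (1 - r) ^ 2)) ^ 24).
assert (Hlo : 0 < lo) by (unfold lo; apply Rmult_lt_0_compat; [apply exp_pos|apply pow_lt, exp_pos]).
set (C0 := exp (r / (1 - r)) ^ 24 * (/ y0 ^ 12 * / lo)).
assert (BP : forall n u, 0 <= u <= 1 -> Cmod (Psi n u) <= C0).
{ intros n u Hu; pose proof (Iy u Hu) as Hi; pose proof (Is u Hu) as His; pose proof (Mt2 u Hu) as H2.
  pose proof (Hrle (t u) ltac:(lra)) as R1; pose proof (Hrle (s u) His) as R2.
  assert (ND : discrN n (t u) <> 0%C).
  { apply Cmod_gt_0; eapply Rlt_le_trans; [exact Hlo|apply discrN_lower; try lra; split; [lra|]].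
    eapply Rle_trans; [apply Rle_abs|]; eapply Rle_trans; [apply Im_le_Cmod|]; auto. }
  unfold Psi, C0; rewrite !Cmod_mult, !Cmod_inv, Cmod_pow by (auto; apply Cpow_nz; auto).
  apply Rmult_le_compat; try apply Cmod_ge_0.
  - apply Rmult_le_pos; left; apply Rinv_0_lt_compat; [apply pow_lt; lra|apply Cmod_gt_0; auto].
  - apply discrN_upper; lra.
  - apply Rmult_le_compat.
    + left; apply Rinv_0_lt_compat, pow_lt; lra.
    + left; apply Rinv_0_lt_compat, Cmod_gt_0; auto.
    + apply Rinv_le_contravar; [apply pow_lt; auto|apply pow_incr; lra].
    + apply Rinv_le_contravar; auto; apply discrN_lower; try lra; split; [lra|].
      eapply Rle_trans; [apply Rle_abs|]; eapply Rle_trans; [apply Im_le_Cmod|]; auto. }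
assert (DP : forall n, Cmod (Psi (S n) 1 - Psi (S n) 0) <= KK * tail n * C0).
{ intros n.
  replace (KK * tail n * C0) with (KK * tail n * C0 * 1 - KK * tail n * C0 * 0) by ring.
  apply (C_mvt (Psi (S n)) (fun u => L (S n) u * Psi (S n) u)%C (fun u => KK * tail n * C0 * u) (fun _ => KK * tail n * C0)).
  - intros u Hu; apply (HL (S n) u Hu).
  - intros u Hu; apply (HL (S n) u Hu).
  - intros u Hu; auto_derive; auto; ring.
  - intros u Hu; rewrite Cmod_mult; apply Rmult_le_compat; try apply Cmod_ge_0; auto. }
assert (t1 : t 1 = tau) by (unfold t, d; ring).
assert (t0 : t 0 = Ci) by (unfold t, d; ring).
assert (s0 : s 0 = Ci).
{ unfold s; rewrite t0; apply C_eq; simpl; field. }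
(* The starting point is fixed by inversion and its twelfth power is 1, so even the truncated
   quotient equals 1 there. *)
assert (P0 : forall n, Psi n 0 = 1%C).
{ intros n; unfold Psi; rewrite s0, t0.
  replace (Ci ^ 12)%C with (RtoC 1) by (apply C_eq; simpl; ring).
  assert (discrN n Ci <> 0%C).
  { apply Cmod_gt_0; eapply Rlt_le_trans; [|apply (discrN_lower Ci (Cmod (nome Ci)) n 1)].
    - apply Rmult_lt_0_compat; [apply exp_pos|apply pow_lt, exp_pos].
    - simpl; lra.
    - lra.
    - apply Cmod_nome_lt1; simpl; lra. }
  field; auto. }
assert (LP : Clim (fun n => Psi (S n) 1) 1%C).
{ apply (Clim_squeeze _ _ (fun n => KK * tail n * C0)).
  - intros n; rewrite <- (P0 (S n)); apply DP.
  - replace (Finite 0) with (Finite (KK * (B - B) * C0)) by (f_equal; ring).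
    apply is_lim_seq_mult'; [|apply is_lim_seq_const].
    apply is_lim_seq_mult'; [apply is_lim_seq_const|].
    apply is_lim_seq_minus'; [apply is_lim_seq_const|exact HB]. }
assert (Hi := proj1 (inv_tau tau Htau)); assert (Htn := proj2 (inv_tau tau Htau)).
assert (LP2 : Clim (fun n => Psi (S n) 1) (discr (- / tau) * (/ tau ^ 12 * / discr tau))%C).
{ apply (Clim_incr (fun n => Psi n 1)).
  unfold Psi, s; rewrite t1.
  apply Clim_mult; [apply discrN_lim; auto|].
  apply Clim_scal, Clim_inv; [apply discr_nz; auto|apply discrN_lim; auto]. }
pose proof (Clim_unique _ _ _ LP LP2) as E.
assert (N1 := discr_nz tau Htau).
assert (N2 : (tau ^ 12)%C <> 0%C) by (apply Cpow_nz; auto).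
transitivity (tau ^ 12 * discr tau * (discr (- / tau) * (/ tau ^ 12 * / discr tau)))%C.
- field; auto.
- rewrite <- E; ring.
Qed.

(** * The modular invariant *)

Lemma Clim_filterlim (u : nat -> C) (l : C) : Clim u l -> filterlim u eventually (locally l).
Proof.
intros [H1 H2]; apply filterlim_locally; intros eps.
apply is_lim_seq_spec in H1; apply is_lim_seq_spec in H2.
destruct (H1 eps) as [N1 HN1]; destruct (H2 eps) as [N2 HN2].
exists (max N1 N2); intros n Hn; split.
- apply HN1; lia.
- apply HN2; lia.
Qed.

Lemma CSer_of_is_series (u : nat -> C) (l : C) :
  is_series (K := C_AbsRing) (V := C_NormedModule) u l -> CSer u l.
Proof.
intros H.
assert (E : forall n, sum_n (G := C_AbelianMonoid) u n = csum u (S n)).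
{ intros n; induction n.
  - rewrite sum_O; simpl; rewrite Cplus_0_l; reflexivity.
  - rewrite sum_Sn, IHn; reflexivity. }
assert (H1 : forall eps : posreal, eventually (fun n => ball (M := C_UniformSpace) l eps (csum u (S n)))).
{ intros eps; destruct (proj1 (filterlim_locally_ball_norm _ _) H eps) as [N HN].
  exists N; intros n Hn; specialize (HN n Hn).
  apply (norm_compat1 (V := C_NormedModule)) in HN; rewrite <- E; exact HN. }
split; apply is_lim_seq_incr_1; apply is_lim_seq_spec; intros eps; destruct (H1 eps) as [N HN];
 exists N; intros n Hn; apply (HN n Hn).
Qed.

Lemma sum_n_m_csum (u : nat -> C) N : sum_n_m (G := C_AbelianMonoid) u 1 N = csum (fun n => u (S n)) N.
Proof.
induction N.
- rewrite sum_n_m_zero by lia; reflexivity.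
- rewrite sum_n_Sm by lia; rewrite IHN; reflexivity.
Qed.

Lemma iter_nat_eprod q N : Iter.iter_nat Cmult 1 (fun n => (1 - q ^ n) ^ 24)%C 1 N = (eprod q N ^ 24)%C.
Proof.
induction N.
- unfold Iter.iter_nat; simpl; ring.
- rewrite (Iter.iter_nat_Chasles Cmult 1%C) with (m := N); try lia; try (intros; ring).
  rewrite IHN, Iter.iter_nat_point by (intros; ring).
  rewrite eprod_S, Cpow_mult_l; reflexivity.
Qed.

Lemma sigma_csum k n : RtoC (INR (Defs.sigma k n)) =
  csum (fun d => if Nat.eqb (Nat.modulo n (S d)) 0 then RtoC (INR (S d) ^ k) else 0%C) n.
Proof.
unfold Defs.sigma.
enough (forall m, RtoC (INR (list_sum (map (fun d => Nat.pow d k) (filter (fun d => Nat.eqb (Nat.modulo n d) 0) (seq 1 m))))) =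
  csum (fun d => if Nat.eqb (Nat.modulo n (S d)) 0 then RtoC (INR (S d) ^ k) else 0%C) m) by auto.
induction m; [reflexivity|].
rewrite seq_S, filter_app, map_app, list_sum_app, plus_INR, RtoC_plus, IHm, csum_S; f_equal.
change (1 + m)%nat with (S m); cbn [filter].
destruct (Nat.eqb (n mod S m) 0); cbn [map list_sum fold_right]; [|reflexivity].
rewrite Nat.add_0_r, pow_INR; reflexivity.
Qed.

Lemma csum_multiples (x : C) D n : (0 < D)%nat ->
  csum (fun N => if Nat.eqb (Nat.modulo (S N) D) 0 then x ^ S N else 0%C)%C n = csum (fun k => (x ^ D) ^ S k)%C (n / D).
Proof.
intros HD; induction n.
- rewrite Nat.Div0.div_0_l; reflexivity.
- rewrite csum_S, IHn.
  destruct (Nat.eqb_spec (S n mod D) 0) as [E|E].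
  + apply Nat.Div0.div_exact in E.
    destruct (S n / D)%nat as [|m] eqn:Q; [lia|].
    assert (n / D = m)%nat as ->.
    { symmetry; apply (Nat.div_unique n D m (D - 1)); [lia|]. nia. }
    rewrite csum_S, <- Cpow_mult_r; do 2 f_equal; lia.
  + replace (S n / D)%nat with (n / D)%nat; [ring|].
    pose proof (Nat.div_mod_eq (S n) D) as E1.
    pose proof (Nat.mod_upper_bound (S n) D ltac:(lia)) as E2.
    symmetry; symmetry; apply eq_sym, (Nat.div_unique n D (S n / D) (S n mod D - 1)); lia.
Qed.

Lemma CSer_multiples (x : C) D : Cmod x < 1 -> (0 < D)%nat ->
  CSer (fun N => if Nat.eqb (Nat.modulo (S N) D) 0 then x ^ S N else 0%C)%C (x ^ D / (1 - x ^ D))%C.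
Proof.
intros H HD; unfold CSer.
eapply Clim_ext; [intros n; symmetry; apply csum_multiples; auto|].
apply (Clim_subseq (csum (fun k => (x ^ D) ^ S k)%C) _ (fun n => n / D)%nat).
- intros P [N HN]; exists (N * D)%nat; intros n Hn; apply HN.
  apply Nat.div_le_lower_bound; lia.
- apply CSer_geom1.
  destruct D as [|D]; [lia|].
  rewrite Cmod_pow; pose proof (Cmod_ge_0 x); pose proof (pow_S_lt1 (Cmod x) D ltac:(lra)); lra.
Qed.

Lemma sigma_lambert k q : 0 < Cmod q < 1 -> CSer (fun N => INR (Defs.sigma k (S N)) * q ^ S N)%C (lambert k q).
Proof.
intros Hq.
set (a := fun N d => (RtoC (INR (S d) ^ k) * (if Nat.eqb (Nat.modulo (S N) (S d)) 0 then q ^ S N else 0))%C).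
set (Bd := fun N d => INR (S d) ^ k * (if Nat.eqb (Nat.modulo (S N) (S d)) 0 then Cmod q ^ S N else 0)).
assert (P : forall d, 0 <= INR (S d) ^ k) by (intros; apply pow_le, pos_INR).
assert (HS : CSer (fun N => Csum (a N)) (Csum (fun d => Csum (fun N => a N d)))).
{ apply (CSer_swap a Bd (fun d => INR (S d) ^ k * (Cmod q ^ S d / (1 - Cmod q ^ S d)))).
  - intros N d; unfold a, Bd; rewrite Cmod_mult, Cmod_R, Rabs_pos_eq by auto.
    apply Rmult_le_compat_l; auto.
    destruct (Nat.eqb _ 0); [rewrite Cmod_pow|rewrite Cmod_0]; lra.
  - intros d; unfold Bd; apply is_series_Rscal.
    assert (Hm : Cmod (RtoC (Cmod q)) < 1) by (rewrite Cmod_R, Rabs_pos_eq; lra).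
    pose proof (CSer_multiples (RtoC (Cmod q)) (S d) Hm ltac:(lia)) as L.
    apply CSer_is_series in L as [L _].
    rewrite <- RtoC_pow, <- RtoC_minus, <- RtoC_div in L.
    2:{ pose proof (pow_S_lt1 (Cmod q) d ltac:(lra)); lra. }
    revert L; apply is_series_Rext; intros n.
    destruct (Nat.eqb _ 0); [rewrite <- RtoC_pow|]; reflexivity.
  - apply (ex_series_le_pos _ (fun d => / (1 - Cmod q) * (INR (S d) ^ k * Cmod q ^ S d))).
    + intros d; pose proof (lambert_term_bound k (RtoC (Cmod q)) d) as L.
      rewrite Cmod_R, (Rabs_pos_eq (Cmod q)) in L by lra; specialize (L Hq).
      rewrite <- RtoC_pow, <- RtoC_minus, <- RtoC_div, <- RtoC_mult, Cmod_R in L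
        by (pose proof (pow_S_lt1 (Cmod q) d ltac:(lra)); lra); exact L.
    + apply ex_series_Rscal, ex_series_pow_geom; auto. }
apply (CSer_eq _ (Csum (fun d => Csum (fun N => a N d)))).
- apply Csum_ext; intros d; apply Csum_unique, CSer_scal, CSer_multiples; lia || lra.
- revert HS; apply CSer_ext; intros N; apply Csum_unique.
  rewrite sigma_csum, Cmult_comm, <- csum_scal.
  eapply CSer_ext; [|apply csum_CSer].
  intros d; unfold a; destruct (Nat.ltb_spec d (S N)) as [L|L].
  + destruct (Nat.eqb _ 0); ring.
  (* A candidate divisor larger than the number leaves a non-zero remainder, so the finite divisor
     sum agrees with the infinite sum over [d]. *)
  + rewrite (Nat.mod_small (S N)) by lia; simpl; ring.
Qed.

Definition klein (t : C) : C := ((1 + 240 * lambert 3 (nome t)) ^ 3 / discr t)%C.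

Lemma j_invariant_klein t : 0 < Im t -> j_invariant t = klein t.
Proof.
intros H; pose proof (Cmod_nome_01 t H) as Hq.
unfold j_invariant, klein, discr; set (q := nome t) in *.
replace (Csum_ge1 (fun n => (INR (Defs.sigma 3 n) * q ^ n)%C)) with (lambert 3 q).
- replace (Cprod_ge1 (fun n => ((1 - q ^ n) ^ 24)%C)) with (euler q ^ 24)%C; [reflexivity|].
  symmetry; apply Clim_seq_correct, Clim_filterlim.
  apply (Clim_ext (fun n => eprod q n ^ 24)%C); [intros; symmetry; apply iter_nat_eprod|].
  apply Clim_pow, euler_lim; lra.
- symmetry; apply Clim_seq_correct, Clim_filterlim.
  eapply Clim_ext; [intros n; symmetry; apply sum_n_m_csum|].
  apply sigma_lambert; auto.
Qed.

Lemma klein_modular t : 0 < Im t -> klein (- / t) = klein t.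
Proof.
intros H; destruct (inv_tau t H) as [_ Ht]; unfold klein.
rewrite E4_modular, discr_modular by auto.
rewrite Cpow_mult_l, <- Cpow_mult_r; simpl (4 * 3)%nat.
field; split; auto; apply discr_nz; auto.
Qed.

(** * Periodization of the principal part *)

(* The polar part of [j(-1/tau)], corrected so that its sum over the translates [tau + m] converges absolutely. *)
Definition phi (z : C) : C := (Cexp (2 * PI * Ci / z) - 1 - 2 * PI * Ci / z)%C.

Definition phicoef (k : nat) : C := ((2 * PI * Ci) ^ S (S k) / INR (fact (S (S k))))%C.

Lemma phi_CSer (z : C) : z <> 0%C -> CSer (fun k => phicoef k * / z ^ S (S k))%C (phi z).
Proof.
intros H; unfold phi.
apply (CSer_eq _ (Cexp (2 * PI * Ci / z) - (2 * PI * Ci / z) ^ 0 / INR (fact 0) - (2 * PI * Ci / z) ^ 1 / INR (fact 1))%C);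
 [simpl; field; auto|].
apply (CSer_ext (fun k => (2 * PI * Ci / z) ^ S (S k) / INR (fact (S (S k))))%C).
- intros k; unfold phicoef, Cdiv; rewrite (Cpow_mult_l (2 * PI * Ci)), Cpow_inv by auto; ring.
- apply (CSer_tail (fun k => (2 * PI * Ci / z) ^ S k / INR (fact (S k)))%C).
  apply (CSer_tail (fun k => (2 * PI * Ci / z) ^ k / INR (fact k))%C), CSer_Cexp.
Qed.

Definition mterm (x : R) (k : nat) : R :=
  (4 * PI ^ 2) ^ S (S k) * x ^ S k / (INR (fact (S (S k))) * INR (fact (S k))).

(* [Mt n] is the [n]-th Fourier coefficient of the sum of [phi] over all translates. *)
Definition Mt (x : R) : R := Series (mterm x).

Lemma ex_series_exp_tail2 a : ex_series (fun k => a ^ S (S k) / INR (fact (S (S k)))).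
Proof.
apply (ex_series_incr_1 (fun k => a ^ S k / INR (fact (S k)))).
eexists; apply is_series_exp_tail.
Qed.

Lemma mterm_pos x k : 0 <= x -> 0 <= mterm x k.
Proof.
intros Hx; unfold mterm; apply Rmult_le_pos.
- apply Rmult_le_pos; apply pow_le; auto; pose proof (pow2_ge_0 PI); lra.
- left; apply Rinv_0_lt_compat, Rmult_lt_0_compat; apply INR_fact_lt_0.
Qed.

(** A free parameter [s] is moved between the two factorials: one factor becomes a term of exp(s x),
    the other a term of a convergent exponential series independent of [x]. *)
Lemma mterm_bound x s k : 0 <= x -> 0 < s ->
  mterm x k <= s * exp (s * x) * ((4 * PI ^ 2 / s) ^ S (S k) / INR (fact (S (S k)))).
Proof.
intros Hx Hs.
pose proof (pow_le_fact_exp (s * x) (S k) ltac:(nra)) as H.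
assert (F1 := INR_fact_lt_0 (S k)). assert (F2 := INR_fact_lt_0 (S (S k))).
assert (0 <= 4 * PI ^ 2) by (pose proof (pow2_ge_0 PI); lra).
assert (E : mterm x k = s * ((s * x) ^ S k / INR (fact (S k))) * ((4 * PI ^ 2 / s) ^ S (S k) / INR (fact (S (S k))))).
{ unfold mterm, Rdiv; rewrite !Rpow_mult_distr, pow_inv.
  assert (0 < s ^ S (S k)) by (apply pow_lt; auto).
  replace (s * (s ^ S k * x ^ S k * / INR (fact (S k)))) with (s ^ S (S k) * x ^ S k * / INR (fact (S k))) by (simpl; ring).
  field; lra. }
rewrite E; apply Rmult_le_compat_r; [|apply Rmult_le_compat_l; lra].
apply Rmult_le_pos; [apply pow_le; apply Rmult_le_pos; auto; left; apply Rinv_0_lt_compat; auto|left; apply Rinv_0_lt_compat; auto].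
Qed.

Lemma Mt_is_series x : 0 <= x -> is_series (mterm x) (Mt x).
Proof.
intros Hx; apply Series_correct.
apply (ex_series_le_pos _ (fun k => 1 * exp (1 * x) * ((4 * PI ^ 2 / 1) ^ S (S k) / INR (fact (S (S k)))))).
- intros k; rewrite Rabs_pos_eq by (apply mterm_pos; auto); apply mterm_bound; lra.
- apply ex_series_Rscal, ex_series_exp_tail2.
Qed.

(** Subexponential growth, so that the Fourier series with these coefficients converges absolutely
    on the whole upper half-plane. *)
Lemma Mt_growth s : 0 < s -> exists K, 0 <= K /\ forall x, 0 <= x -> 0 <= Mt x <= K * exp (s * x).
Proof.
intros Hs.
destruct (ex_series_exp_tail2 (4 * PI ^ 2 / s)) as [T HT].
assert (P : forall k, 0 <= (4 * PI ^ 2 / s) ^ S (S k) / INR (fact (S (S k)))).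
{ intros k; apply Rmult_le_pos; [|left; apply Rinv_0_lt_compat, INR_fact_lt_0].
  apply pow_le, Rmult_le_pos; [pose proof (pow2_ge_0 PI); lra|left; apply Rinv_0_lt_compat; auto]. }
assert (T0 : 0 <= T).
{ eapply Rle_trans; [|apply (sum_n_le_series _ _ 0 P HT)]; rewrite sum_O; apply P. }
exists (s * T); split; [nra|]; intros x Hx; split.
- eapply Rle_trans; [|apply (sum_n_le_series _ _ 0 (fun k => mterm_pos x k Hx) (Mt_is_series x Hx))].
  rewrite sum_O; apply mterm_pos; auto.
- replace (s * T * exp (s * x)) with (s * exp (s * x) * T) by ring.
  apply (is_lim_seq_le (sum_n (mterm x)) (sum_n (fun k => s * exp (s * x) * ((4 * PI ^ 2 / s) ^ S (S k) / INR (fact (S (S k))))))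
    (Mt x) (s * exp (s * x) * T)).
  + intros n; apply sum_n_m_le; intros k; apply mterm_bound; auto.
  + apply Mt_is_series; auto.
  + apply is_series_Rscal; auto.
Qed.

Definition Fsum (t : C) : C := Csum (fun m => phi (t + INR m) + phi (t - INR (S m)))%C.

Lemma phicoef_lipcoef k : (phicoef k * lipcoef k)%C = RtoC ((4 * PI ^ 2) ^ S (S k) / (INR (fact (S (S k))) * INR (fact (S k)))).
Proof.
unfold phicoef, lipcoef.
assert (N1 := INR_fact_neq_0 (S (S k))). assert (N2 := INR_fact_neq_0 (S k)).
rewrite RtoC_div, RtoC_mult by (apply Rmult_integral_contrapositive; auto).
transitivity (((2 * PI * Ci) * (- (2 * PI * Ci))) ^ S (S k) / (INR (fact (S (S k))) * INR (fact (S k))))%C.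
- rewrite (Cpow_mult_l (2 * PI * Ci) (- (2 * PI * Ci))%C).
  change ((- (2 * PI * Ci)) ^ S (S k))%C with (- (2 * PI * Ci) * (- (2 * PI * Ci)) ^ S k)%C.
  generalize ((2 * PI * Ci) ^ S (S k))%C, ((- (2 * PI * Ci)) ^ S k)%C; intros X Y.
  field; split; apply RtoC_neq0; auto.
- f_equal; rewrite RtoC_pow; f_equal.
  apply C_eq; simpl; ring.
Qed.

Lemma Cmod_phicoef k : Cmod (phicoef k) = (2 * PI) ^ S (S k) / INR (fact (S (S k))).
Proof.
unfold phicoef; rewrite Cmod_div, Cmod_pow, Cmod_R by (apply RtoC_neq0, INR_fact_neq_0).
rewrite <- (Cmult_1_r (2 * PI * Ci)), Cmod_2pii, Cmod_1, Rmult_1_r, Rabs_pos_eq; auto.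
left; apply INR_fact_lt_0.
Qed.

(** [phi] is expanded in powers of 1/z, starting at the second, and the translates are summed for
    each power separately, where [lipschitz] applies. [Fsum_fourier] then collects the powers by
    frequency. *)
Lemma Fsum_lambert t : 0 < Im t ->
  CSer (fun m => phi (t + INR m) + phi (t - INR (S m)))%C (Fsum t) /\
  Fsum t = Csum (fun k => phicoef k * (lipcoef k * Csum (npow (S k) (nome t))))%C.
Proof.
intros H.
set (a := fun m k => (phicoef k * zpow (S (S k)) t m)%C).
assert (HS : CSer (fun m => Csum (a m)) (Csum (fun k => Csum (fun m => a m k))) /\
   CSer (fun m => Csum (a m)) (Csum (fun m => Csum (a m)))).
{ set (B := fun m k => (2 / zc t ^ 2 * / INR (S m) ^ 2 * Im t ^ 2) * ((2 * PI / Im t) ^ S (S k) / INR (fact (S (S k))))).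
  destruct ex_series_inv_sq as [Z HZ].
  assert (HB : forall m k, Cmod (a m k) <= B m k).
  { intros m k; unfold a, B; rewrite Cmod_mult, Cmod_phicoef.
    pose proof (zpow_bound k t m H) as Hz.
    assert (0 < Im t ^ k) by (apply pow_lt; auto).
    assert (F2 := INR_fact_lt_0 (S (S k))).
    assert (0 < zc t) by (apply zc_pos; auto). pose proof (INR_S_pos m).
    eapply Rle_trans; [apply Rmult_le_compat_l; [|exact Hz]|].
    - apply Rmult_le_pos; [apply pow_le; pose proof PI_RGT_0; lra|left; apply Rinv_0_lt_compat; auto].
    - apply Req_le; unfold Rdiv; rewrite (Rpow_mult_distr (2 * PI)), pow_inv.
      change (Im t ^ S (S k)) with (Im t * (Im t * Im t ^ k)).
      field; repeat split; lra. }
  assert (S1 : CSer (fun m => Csum (a m)) (Csum (fun k => Csum (fun m => a m k)))).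
  { apply (CSer_swap a B (fun k => (2 / zc t ^ 2 * Im t ^ 2 * Z) * ((2 * PI / Im t) ^ S (S k) / INR (fact (S (S k)))))); auto.
    - intros k; unfold B.
      apply (is_series_Rext (fun m => (2 / zc t ^ 2 * Im t ^ 2 * ((2 * PI / Im t) ^ S (S k) / INR (fact (S (S k))))) * / INR (S m) ^ 2));
       [intros; ring|].
      replace (2 / zc t ^ 2 * Im t ^ 2 * Z * ((2 * PI / Im t) ^ S (S k) / INR (fact (S (S k))))) with
        ((2 / zc t ^ 2 * Im t ^ 2 * ((2 * PI / Im t) ^ S (S k) / INR (fact (S (S k))))) * Z) by ring.
      apply is_series_Rscal; auto.
    - apply ex_series_Rscal, ex_series_exp_tail2. }
  split; auto; rewrite (Csum_unique _ _ S1); auto. }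
destruct HS as [S1 S2].
assert (HR : forall m, Csum (a m) = (phi (t + INR m) + phi (t - INR (S m)))%C).
{ intros m; apply Csum_unique.
  apply (CSer_ext (fun k => phicoef k * / (t + INR m) ^ S (S k) + phicoef k * / (t - INR (S m)) ^ S (S k))%C).
  - intros k; unfold a, zpow; ring.
  - apply CSer_plus; apply phi_CSer; [apply shift_nz|apply shift_nz']; auto. }
assert (E : Fsum t = Csum (fun m => Csum (a m))) by (apply Csum_ext; intros; symmetry; apply HR).
split.
- rewrite E; revert S2; apply CSer_ext, HR.
- rewrite E, (Csum_unique _ _ S1); apply Csum_ext; intros k; unfold a.
  apply Csum_unique, CSer_scal; rewrite <- lipschitz by auto; apply ex_zpow; auto.
Qed.

Lemma Fsum_fourier t : 0 < Im t ->
  CSer (fun n => RtoC (Mt (INR (S n))) * nome t ^ S n)%C (Fsum t).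
Proof.
intros H; pose proof (Cmod_nome_01 t H) as Hq.
rewrite (proj2 (Fsum_lambert t H)).
set (q := nome t) in *.
set (a := fun k n => (RtoC (mterm (INR (S n)) k) * q ^ S n)%C).
set (s := PI * Im t).
assert (Hs : 0 < s) by (unfold s; pose proof PI_RGT_0; nra).
destruct (Mt_growth s Hs) as [K [HK0 HK]].
assert (S1 : CSer (fun k => Csum (a k)) (Csum (fun n => Csum (fun k => a k n))) /\
  CSer (fun n => Csum (fun k => a k n)) (Csum (fun n => Csum (fun k => a k n)))).
{ split.
  - apply (CSer_swap a (fun k n => Cmod q ^ S n * mterm (INR (S n)) k) (fun n => Cmod q ^ S n * Mt (INR (S n)))).
    + intros k n; unfold a; rewrite Cmod_mult, Cmod_R, Cmod_pow, Rabs_pos_eq by apply mterm_pos, pos_INR; lra.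
    + intros n; apply is_series_Rscal, Mt_is_series, pos_INR.
    + apply (ex_series_le_pos _ (fun n => K * exp (- s) ^ S n)).
      * intros n; destruct (HK (INR (S n)) (pos_INR _)) as [M1 M2].
        assert (P : 0 < Cmod q ^ S n) by (apply pow_lt; lra).
        rewrite Rabs_pos_eq by nra.
        assert (E : Cmod q ^ S n * exp (s * INR (S n)) = exp (- s) ^ S n).
        { unfold q; rewrite Cmod_nome, !exp_pow, <- exp_plus; f_equal; unfold s; ring. }
        rewrite <- E.
        replace (K * (Cmod q ^ S n * exp (s * INR (S n)))) with (Cmod q ^ S n * (K * exp (s * INR (S n)))) by ring.
        apply Rmult_le_compat_l; lra.
      * apply ex_series_Rscal, ex_series_geom1; split; [left; apply exp_pos|].
        rewrite <- exp_0; apply exp_increasing; lra.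
  - apply (CSer_Csum _ (fun n => K * exp (- s) ^ S n)).
    + intros n; destruct (HK (INR (S n)) (pos_INR _)) as [M1 M2].
      assert (P : 0 < Cmod q ^ S n) by (apply pow_lt; lra).
      replace (Csum (fun k => a k n)) with (RtoC (Mt (INR (S n))) * q ^ S n)%C.
      2:{ symmetry; apply Csum_unique.
          apply (CSer_ext (fun k => q ^ S n * RtoC (mterm (INR (S n)) k))%C); [intros k; unfold a; ring|].
          rewrite Cmult_comm; apply CSer_scal, CSer_is_series; split; simpl.
          - apply Mt_is_series, (pos_INR (S n)).
          - apply (is_series_Rext (fun n => 0 * (/ 2) ^ n)); [intros; ring|].
            pose proof (is_series_Rscal 0 _ _ is_series_geom_half) as Q; rewrite Rmult_0_l in Q; exact Q. }
      rewrite Cmod_mult, Cmod_R, Cmod_pow, Rabs_pos_eq by auto.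
      assert (E : Cmod q ^ S n * exp (s * INR (S n)) = exp (- s) ^ S n).
      { unfold q; rewrite Cmod_nome, !exp_pow, <- exp_plus; f_equal; unfold s; ring. }
      rewrite <- E.
      replace (K * (Cmod q ^ S n * exp (s * INR (S n)))) with ((K * exp (s * INR (S n))) * Cmod q ^ S n) by ring.
      apply Rmult_le_compat_r; lra.
    + apply ex_series_Rscal, ex_series_geom1; split; [left; apply exp_pos|].
      rewrite <- exp_0; apply exp_increasing; lra. }
destruct S1 as [S1 S2].
apply (CSer_eq _ (Csum (fun n => Csum (fun k => a k n)))).
- symmetry; apply Csum_unique; revert S1; apply CSer_ext; intros k.
  apply Csum_unique.
  apply (CSer_ext (fun n => phicoef k * (lipcoef k * npow (S k) q n))%C).
  + intros n; unfold a, npow, mterm; rewrite !Cmult_assoc, phicoef_lipcoef, <- RtoC_mult; f_equal; f_equal.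
    unfold Rdiv; ring.
  + apply CSer_scal, CSer_scal, ex_npow; auto.
- revert S2; apply CSer_ext; intros n; apply Csum_unique.
  apply (CSer_ext (fun k => q ^ S n * RtoC (mterm (INR (S n)) k))%C); [intros k; unfold a; ring|].
  rewrite Cmult_comm; apply CSer_scal, CSer_is_series; split; simpl.
  + apply Mt_is_series, (pos_INR (S n)).
  + apply (is_series_Rext (fun n => 0 * (/ 2) ^ n)); [intros; ring|].
    pose proof (is_series_Rscal 0 _ _ is_series_geom_half) as Q; rewrite Rmult_0_l in Q; exact Q.
Qed.

Lemma Re_2pii_div (z : C) : z <> 0%C -> Re (2 * PI * Ci / z)%C = 2 * PI * Im z / Cmod z ^ 2.
Proof.
intros H; rewrite Cmod2_alt; destruct z as [x y]; simpl.
field; intros E; apply H; apply C_eq; simpl; nra.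
Qed.

Lemma phi_bound (z : C) (b E : R) : 0 < b -> b <= Rabs (Re z) -> 0 <= Im z -> 2 * PI * Im z / b ^ 2 <= E -> 0 <= E ->
  Cmod (phi z) <= 2 * PI ^ 2 * exp E * / b ^ 2.
Proof.
intros Hb Hr Hi HE HE0.
assert (Hz : b <= Cmod z) by (eapply Rle_trans; [exact Hr|apply re_le_Cmod]).
assert (Nz : z <> 0%C) by (apply Cmod_gt_0; lra).
pose proof PI_RGT_0.
unfold phi; eapply Rle_trans; [apply Cexp_sub2|].
assert (Q : b ^ 2 <= Cmod z ^ 2) by (apply pow_incr; lra).
assert (0 < b ^ 2) by (apply pow_lt; auto).
rewrite Cmod_div by auto; rewrite <- (Cmult_1_r (2 * PI * Ci)) at 1; rewrite Cmod_2pii, Cmod_1, Rmult_1_r.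
assert (exp (Rmax (Re (2 * PI * Ci / z)) 0) <= exp E).
{ apply exp_mono, Rmax_lub; auto; rewrite Re_2pii_div by auto.
  eapply Rle_trans; [|exact HE]; apply Rmult_le_compat_l; [nra|apply Rinv_le_contravar; auto]. }
replace ((2 * PI / Cmod z) ^ 2 / 2) with (2 * PI ^ 2 * / Cmod z ^ 2) by (field; lra).
rewrite (Rmult_assoc (2 * PI ^ 2) (exp E)), (Rmult_comm (exp E)), <- Rmult_assoc.
apply Rmult_le_compat; auto.
- apply Rmult_le_pos; [nra|left; apply Rinv_0_lt_compat; nra].
- left; apply exp_pos.
- apply Rmult_le_compat_l; [nra|apply Rinv_le_contravar; auto].
Qed.

Lemma is_series_inv_sq_le : exists Z, is_series (fun k => / INR (S k) ^ 2) Z /\ Z <= 2.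
Proof.
destruct ex_series_inv_sq as [Z HZ]; exists Z; split; auto.
pose proof (is_series_Rscal 2 _ _ is_series_inv_telescope) as HT; rewrite Rmult_1_r in HT.
apply (is_lim_seq_le (sum_n (fun k => / INR (S k) ^ 2)) (sum_n (fun k => 2 * (/ INR (S k) - / INR (S (S k))))) Z 2); auto.
intros n; apply sum_n_m_le; intros k; apply inv_sq_le_telescope.
Qed.

(** All translates except [t] itself have real part at least 1/2 in modulus, where [phi] decays
    quadratically. The two families of translates contribute the factors 4 and 16; their sum 20
    times the bound 2 for zeta(2) gives 40. *)
Lemma Fsum_near t : 0 < Im t <= 1 / 12 -> Rabs (Re t) <= 1 / 2 ->
  Cmod (Fsum t - phi t) <= 40 * (2 * PI ^ 2 * exp 3).
Proof.
intros Hi Hr; destruct (Fsum_lambert t ltac:(lra)) as [HF _].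
set (A := 2 * PI ^ 2 * exp 3).
assert (HA : 0 < A) by (unfold A; apply Rmult_lt_0_compat; [pose proof PI_RGT_0; nra|apply exp_pos]).
apply Rabs_le_between in Hr.
pose proof PI_upper as PU; pose proof PI_RGT_0 as PP.
destruct is_series_inv_sq_le as [Z [HZ HZ2]].
set (u := fun m => (phi (t + INR m) + phi (t - INR (S m)) - (if Nat.ltb m 1 then phi t else 0))%C).
assert (HU : CSer u (Fsum t - phi t)%C).
{ unfold u; apply CSer_minus; auto.
  pose proof (csum_CSer (fun _ => phi t) 1) as Q; simpl in Q; rewrite Cplus_0_l in Q; exact Q. }
(* The exponent is at most 8 PI Im t <= 2 PI / 3, hence the exp(3) in [A]. *)
assert (B1 : forall z b, 1 / 2 <= b -> b <= Rabs (Re z) -> Im z = Im t -> Cmod (phi z) <= A * / b ^ 2).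
{ intros z b Hb Hz Ez; unfold A; apply phi_bound; rewrite ?Ez; try lra.
  apply Rle_trans with (2 * PI * Im t * 4); [|nra].
  apply Rmult_le_compat_l; [nra|].
  replace 4 with (/ (1 / 2) ^ 2) by field; apply Rinv_le_contravar; nra. }
apply Rle_trans with (20 * A * Z); [|nra].
apply (CSer_mod_le u _ (fun m => 20 * A * / INR (S m) ^ 2)); auto; [|apply is_series_Rscal; auto].
intros m; pose proof (pos_INR m) as Pm.
assert (C2 : Cmod (phi (t - INR (S m))) <= 4 * A * / INR (S m) ^ 2).
{ eapply Rle_trans; [apply (B1 _ (INR (S m) / 2))|].
  - rewrite S_INR; lra.
  - rewrite Re_minus, re_RtoC, S_INR, Rabs_left1; lra.
  - rewrite Im_minus, im_RtoC; ring.
  - apply Req_le; field; rewrite S_INR; lra. }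
assert (P : 0 < / INR (S m) ^ 2) by (apply Rinv_0_lt_compat, pow_lt, INR_S_pos).
unfold u; destruct m.
- change (Nat.ltb 0 1) with true; cbv iota.
  replace (phi (t + INR 0) + phi (t - INR 1) - phi t)%C with (phi (t - INR 1)).
  + eapply Rle_trans; [exact C2|nra].
  + simpl INR; rewrite Cplus_0_r; ring.
- change (Nat.ltb (S m) 1) with false; cbv iota; rewrite Cminus_0_r.
  eapply Rle_trans; [apply Cmod_triangle|].
  assert (C1 : Cmod (phi (t + INR (S m))) <= 16 * A * / INR (S (S m)) ^ 2).
  { pose proof (pos_INR m); eapply Rle_trans; [apply (B1 _ (INR (S (S m)) / 4))|].
    - rewrite !S_INR; lra.
    - rewrite Re_plus, re_RtoC, !S_INR, Rabs_pos_eq; lra.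
    - rewrite Im_plus, im_RtoC; ring.
    - apply Req_le; field; rewrite !S_INR; lra. }
  lra.
Qed.

(** * Estimates for the Fourier coefficients *)

Lemma nome_real_neq1 (x : R) : 0 < Rabs x < 1 -> nome (RtoC x) <> 1%C.
Proof.
intros Hx E.
pose proof (Cmod2_one_minus_nome (RtoC x)) as H; cbv zeta in H.
rewrite E, im_RtoC, Rmult_0_r, Ropp_0, exp_0, re_RtoC in H.
replace (1 - 1)%C with (RtoC 0) in H by ring; rewrite Cmod_0 in H.
assert (S : sin (PI * x) <> 0).
{ pose proof PI_RGT_0.
  destruct (Rlt_dec 0 x).
  - rewrite Rabs_pos_eq in Hx by lra; apply Rgt_not_eq, sin_gt_0; nra.
  - rewrite Rabs_left1 in Hx by lra.
    replace (PI * x) with (- (PI * - x)) by ring; rewrite sin_neg.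
    assert (0 < sin (PI * - x)) by (apply sin_gt_0; nra); lra. }
assert (0 < sin (PI * x) ^ 2) by (apply pow2_gt_0; auto).
lra.
Qed.

(* Averaging [nome (m x)] over [x = k / N] isolates the frequency [n] up to aliasing, and aliasing disappears as [N] grows. *)
Definition dft_weight (n N m : nat) : C :=
  (csum (fun k => nome (RtoC (INR k * ((INR m - INR n) / INR N)))) N / INR N)%C.

Lemma dft_weight_le n N m : Cmod (dft_weight n N m) <= 1.
Proof.
destruct N as [|N].
- unfold dft_weight; simpl; unfold Cdiv; rewrite Cmult_0_l, Cmod_0; lra.
- unfold dft_weight; rewrite Cmod_div, Cmod_R, Rabs_pos_eq by (try apply pos_INR; apply INR_C_neq0; lia).
  apply Rle_div_l; [apply INR_S_pos|]; rewrite Rmult_1_l.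
  assert (forall L, Cmod (csum (fun k => nome (RtoC (INR k * ((INR m - INR n) / INR (S N))))) L) <= INR L) as H; [|apply H].
  induction L.
  + simpl; rewrite Cmod_0; lra.
  + rewrite csum_S, (S_INR L); eapply Rle_trans; [apply Cmod_triangle|]; apply Rplus_le_compat; auto.
    rewrite Cmod_nome, im_RtoC, Rmult_0_r, Ropp_0, exp_0; lra.
Qed.

Lemma dft_weight_diag n N : (0 < N)%nat -> dft_weight n N n = 1%C.
Proof.
intros H; unfold dft_weight.
replace (csum _ N) with (RtoC (INR N)); [field; apply INR_C_neq0; auto|].
replace (INR n - INR n) with 0 by ring.
assert (forall L, RtoC (INR L) = csum (fun k => nome (RtoC (INR k * (0 / INR N)))) L) as E; [|apply E].
induction L; [reflexivity|].
rewrite csum_S, <- IHL, S_INR, RtoC_plus; f_equal.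
unfold Rdiv; rewrite Rmult_0_l, Rmult_0_r, nome_0; reflexivity.
Qed.

Lemma dft_weight_off n N m : (n < N)%nat -> (m < N)%nat -> m <> n -> dft_weight n N m = 0%C.
Proof.
intros Hn Hm Hmn; unfold dft_weight.
assert (HN : 0 < INR N) by (apply lt_0_INR; lia).
set (th := (INR m - INR n) / INR N).
assert (Hth : 0 < Rabs th < 1).
{ apply lt_INR in Hn; apply lt_INR in Hm; pose proof (pos_INR m); pose proof (pos_INR n).
  unfold th, Rdiv; rewrite Rabs_mult, (Rabs_pos_eq (/ INR N)) by (left; apply Rinv_0_lt_compat; auto); split.
  - apply Rmult_lt_0_compat; [|apply Rinv_0_lt_compat; auto].
    apply Rabs_pos_lt; intros E; apply Hmn, INR_eq; lra.
  - apply Rlt_div_l; auto; rewrite Rmult_1_l; apply Rabs_def1; lra. }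
set (w := nome (RtoC th)).
assert (Nw : (1 - w)%C <> 0%C).
{ intros E; apply (nome_real_neq1 th Hth); symmetry; apply Ceq_minus; exact E. }
assert (Ew : (w ^ N)%C = 1%C).
{ unfold w; rewrite nome_pow.
  replace (INR N * th)%C with (INR m - INR n)%C.
  - rewrite nome_shift_neg, nome_INR; auto.
  - unfold th; rewrite <- RtoC_mult, <- RtoC_minus; f_equal; field; lra. }
replace (csum _ N) with (csum (fun k => w ^ k)%C N).
- pose proof (csum_geom w N) as G; rewrite Ew in G.
  replace (csum (fun k => w ^ k)%C N) with (RtoC 0).
  + unfold Cdiv; ring.
  + transitivity (/ (1 - w) * (1 - 1))%C; [ring|rewrite <- G; field; auto].
- apply csum_ext; intros k _; unfold w; rewrite nome_pow, <- RtoC_mult; reflexivity.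
Qed.

(** Cauchy's estimate on a horizontal line, without integration: each average over [N] equidistant
    points is at most [B], and by [Tannery] these averages tend to the coefficient times its power
    of [r]. *)
Lemma coef_bound (b : nat -> R) (y B : R) (n : nat) : 0 < y ->
  ex_series (fun m => Rabs (b m) * exp (- (2 * PI * y)) ^ m) ->
  (forall (x : R) l, 0 <= x < 1 -> CSer (fun m => RtoC (b m) * nome (x + y * Ci) ^ m)%C l -> Cmod l <= B) ->
  Rabs (b n) * exp (- (2 * PI * y)) ^ n <= B.
Proof.
intros Hy Hb HB.
set (r := exp (- (2 * PI * y))) in *.
assert (Hr0 : 0 < r) by apply exp_pos.
set (u := fun N m => (RtoC (b m * r ^ m) * dft_weight n N m)%C).
set (v := fun m => if Nat.eqb m n then RtoC (b n * r ^ n) else 0%C).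
assert (Er : nome (y * Ci) = RtoC r).
{ unfold nome, r; rewrite <- Cexp_RtoC; f_equal; apply C_eq; simpl; ring. }
assert (HT : forall x : R, CSer (fun m => RtoC (b m) * nome (x + y * Ci) ^ m)%C (Csum (fun m => RtoC (b m) * nome (x + y * Ci) ^ m)%C)).
{ intros x; apply (CSer_Csum _ (fun m => Rabs (b m) * r ^ m)); auto.
  intros m; rewrite Cmod_mult, Cmod_R, Cmod_pow, Cmod_nome.
  rewrite Im_plus, im_RtoC, im_scal_l; simpl (Im Ci).
  unfold r; rewrite Rplus_0_l, Rmult_1_r; lra. }
set (G := fun x : R => Csum (fun m => RtoC (b m) * nome (x + y * Ci) ^ m)%C).
set (s := fun N => (/ INR N * csum (fun k => nome (RtoC (- (INR n * INR k / INR N))) * G (INR k / INR N)%R) N)%C).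
assert (Hs : forall N, CSer (u N) (s N)).
{ intros N; destruct (Nat.eq_dec N 0) as [->|HN].
  - unfold u, s, dft_weight; simpl.
    apply (CSer_ext (fun _ => 0%C)); [intros; unfold Cdiv; ring|].
    apply (CSer_eq _ 0%C); [ring|].
    apply (Clim_ext (fun _ => 0%C)); [intros; symmetry; apply csum_zero; auto|apply Clim_const].
  - assert (NZ : INR N <> 0) by (apply not_0_INR; auto).
    unfold s, u.
    apply (CSer_ext (fun m => / INR N * csum (fun k => nome (RtoC (- (INR n * INR k / INR N))) *
       (RtoC (b m) * nome (RtoC (INR k / INR N) + y * Ci) ^ m)) N)%C).
    + intros m; unfold dft_weight, Cdiv.
      transitivity (/ INR N * csum (fun k => RtoC (b m * r ^ m) * nome (RtoC (INR k * ((INR m - INR n) / INR N)))) N)%C;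
       [|rewrite csum_scal; ring].
      f_equal; apply csum_ext; intros k _.
      rewrite nome_add, Er, Cpow_mult_l, nome_pow, <- !RtoC_pow, RtoC_mult, <- RtoC_mult.
      replace (RtoC (INR k * ((INR m - INR n) / INR N))) with
        (RtoC (- (INR n * INR k / INR N)) + RtoC (INR m * (INR k / INR N)))%C.
      * rewrite nome_add; ring.
      * rewrite <- RtoC_plus; f_equal; field; auto.
    + apply CSer_scal.
      assert (forall L, CSer (fun m => csum (fun k => nome (RtoC (- (INR n * INR k / INR N))) *
       (RtoC (b m) * nome (RtoC (INR k / INR N) + y * Ci) ^ m))%C L)
       (csum (fun k => nome (RtoC (- (INR n * INR k / INR N))) * G (INR k / INR N)%R)%C L)) as H; [|apply H].
      induction L.
      * simpl; apply (Clim_ext (fun _ => 0%C)); [intros; symmetry; apply csum_zero; auto|apply Clim_const].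
      * rewrite csum_S.
        apply (CSer_plus _ (fun m => nome (RtoC (- (INR n * INR L / INR N))) *
          (RtoC (b m) * nome (RtoC (INR L / INR N) + y * Ci) ^ m))%C); auto.
        apply CSer_scal, HT. }
assert (LS : Clim s (Csum v)).
{ apply (Tannery u v s (fun m => Rabs (b m) * r ^ m)); auto.
  - intros N m; unfold u; rewrite Cmod_mult, Cmod_R, Rabs_mult, (Rabs_pos_eq (r ^ m)) by (apply pow_le; lra).
    pose proof (dft_weight_le n N m).
    rewrite <- (Rmult_1_r (Rabs (b m) * r ^ m)) at 2.
    apply Rmult_le_compat_l; auto; apply Rmult_le_pos; [apply Rabs_pos|apply pow_le; lra].
  - intros m; apply (Clim_ext_ev (fun _ => v m) _ _ (S (max n m))); [|apply Clim_const].
    intros N HN; unfold u, v; destruct (Nat.eqb_spec m n) as [->|E].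
    + rewrite dft_weight_diag by lia; ring.
    + rewrite dft_weight_off by (auto; lia); ring. }
assert (EV : Csum v = RtoC (b n * r ^ n)).
{ apply Csum_unique.
  apply (Clim_ext_ev (fun _ => RtoC (b n * r ^ n)) _ _ (S n)); [|apply Clim_const].
  intros N HN; replace N with (S n + (N - S n))%nat by lia.
  rewrite csum_split, csum_S, (csum_zero v n), (csum_zero _ (N - S n)).
  - unfold v; rewrite Nat.eqb_refl; ring.
  - intros k _; unfold v; destruct (Nat.eqb_spec (S n + k) n); auto; lia.
  - intros k Hk; unfold v; destruct (Nat.eqb_spec k n); auto; lia. }
rewrite EV in LS.
replace (Rabs (b n) * r ^ n) with (Cmod (RtoC (b n * r ^ n))).
2:{ rewrite Cmod_R, Rabs_mult, (Rabs_pos_eq (r ^ n)); auto; apply pow_le; lra. }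
apply (Clim_mod_le s _ _ 1 LS); intros N HN.
assert (HN0 : 0 < INR N) by (apply lt_0_INR; lia).
unfold s; rewrite Cmod_mult, <- RtoC_inv, Cmod_R, Rabs_pos_eq by (try lra; left; apply Rinv_0_lt_compat; auto).
rewrite Rmult_comm; apply Rle_div_l; auto; rewrite (Rmult_comm B).
assert (forall L, (L <= N)%nat -> Cmod (csum (fun k => nome (RtoC (- (INR n * INR k / INR N))) * G (INR k / INR N)%R)%C L) <= INR L * B) as H; [|apply H; auto].
induction L; intros HL.
- simpl; rewrite Cmod_0; lra.
- rewrite csum_S, S_INR; eapply Rle_trans; [apply Cmod_triangle|].
  rewrite Rmult_plus_distr_r, Rmult_1_l; apply Rplus_le_compat; [apply IHL; lia|].
  rewrite Cmod_mult, Cmod_nome, im_RtoC, Rmult_0_r, Ropp_0, exp_0, Rmult_1_l.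
  apply (HB (INR L / INR N)); [|apply HT].
  split; [apply Rdiv_le_0_compat; auto; apply pos_INR|].
  apply Rlt_div_l; auto; rewrite Rmult_1_l; apply lt_INR; lia.
Qed.

(** * The invariant near the cusp at infinity *)

Lemma Cpow_sub1 (z : C) (M : R) n : 1 <= M -> Cmod z <= M -> Cmod (z ^ n - 1) <= INR n * M ^ n * Cmod (z - 1).
Proof.
intros HM Hz; induction n.
- simpl; replace (1 - 1)%C with (RtoC 0) by ring; rewrite Cmod_0; lra.
- replace (z ^ S n - 1)%C with (z * (z ^ n - 1) + (z - 1))%C by (simpl; ring).
  eapply Rle_trans; [apply Cmod_triangle|]; rewrite Cmod_mult, S_INR.
  pose proof (Cmod_ge_0 z); pose proof (Cmod_ge_0 (z - 1)); pose proof (Cmod_ge_0 (z ^ n - 1)).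
  assert (1 <= M ^ n) by (apply pow_R1_Rle; auto).
  assert (Cmod z * Cmod (z ^ n - 1) <= M * (INR n * M ^ n * Cmod (z - 1))) by (apply Rmult_le_compat; auto).
  assert (1 <= M * M ^ n) by nra.
  assert (1 * Cmod (z - 1) <= M * M ^ n * Cmod (z - 1)) by (apply Rmult_le_compat_r; auto).
  simpl; lra.
Qed.

Lemma lambert3_small q r : 0 < Cmod q <= r -> r <= 1 / 100 -> Cmod (lambert 3 q) <= 2 * r.
Proof.
intros Hq Hr.
assert (H8 : forall d, INR (S d) ^ 3 <= 8 ^ d).
{ induction d; [simpl; lra|].
  rewrite S_INR; pose proof (INR_S_pos d).
  assert (1 <= INR (S d)) by (rewrite S_INR; pose proof (pos_INR d); lra).
  set (a := INR (S d)) in *; simpl (8 ^ S d).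
  assert ((a + 1) ^ 3 <= 8 * a ^ 3) by nra. lra. }
set (R0 := Cmod q) in *.
eapply Rle_trans.
- apply (CSer_mod_le (fun d => RtoC (INR (S d) ^ 3) * (q ^ S d / (1 - q ^ S d)))%C _ (fun d => / (1 - R0) * R0 * (8 * R0) ^ d) (/ (1 - R0) * R0 * / (1 - 8 * R0))).
  3:{ apply ex_lambert; unfold R0 in *; lra. }
  + intros d; eapply Rle_trans; [apply lambert_term_bound; unfold R0 in *; lra|]; fold R0.
    rewrite Rmult_assoc; apply Rmult_le_compat_l; [left; apply Rinv_0_lt_compat; lra|].
    rewrite Rpow_mult_distr; simpl (R0 ^ S d).
    specialize (H8 d). assert (0 <= R0 ^ d) by (apply pow_le; lra). assert (0 <= R0 * R0 ^ d) by nra. nra.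
  + apply is_series_Rscal, is_series_geom; rewrite Rabs_pos_eq; lra.
- assert (1 <= (1 - R0) * (1 - 8 * R0) * 2) by nra.
  apply Rle_trans with (2 * R0); [|lra].
  replace (/ (1 - R0) * R0 * / (1 - 8 * R0)) with (R0 / ((1 - R0) * (1 - 8 * R0))) by (field; lra).
  apply Rle_div_l; nra.
Qed.

Lemma exp_small x : 0 <= x <= 1 / 2 -> exp x <= 1 + 2 * x.
Proof.
intros H.
assert (E : exp x * exp (- x) = 1) by (rewrite <- exp_plus, <- exp_0; f_equal; ring).
pose proof (exp_ge_1p (- x)); pose proof (exp_pos x); nra.
Qed.

Lemma euler_small q r : 0 < Cmod q <= r -> r <= 1 / 100 -> Cmod (euler q - 1) <= 2 * r.
Proof.
intros Hq Hr.
set (R0 := Cmod q) in *.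
assert (HE : exp (R0 / (1 - R0)) <= 1 + 4 * R0).
{ assert (0 <= R0 / (1 - R0) <= 2 * R0).
  { split; [apply Rdiv_le_0_compat; lra|apply Rle_div_l; nra]. }
  eapply Rle_trans; [apply exp_small; lra|lra]. }
unfold euler; replace (1 - Csum _ - 1)%C with (- Csum (fun n => q ^ S n * eprod q n))%C by ring.
rewrite Cmod_opp.
eapply Rle_trans.
- apply (Csum_mod_le _ (fun n => exp (R0 / (1 - R0)) * R0 ^ S n) (exp (R0 / (1 - R0)) * (R0 / (1 - R0)))).
  + intros n; apply euler_term_bound; unfold R0 in *; lra.
  + apply is_series_Rscal, is_series_geom1; lra.
- replace (exp (R0 / (1 - R0)) * (R0 / (1 - R0))) with (exp (R0 / (1 - R0)) * R0 / (1 - R0)) by (field; lra).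
  apply Rle_div_l; nra.
Qed.

(** The numerator and the product differ from 1 by at most 1800 r and 50 r, and the product is at
    least 0.95, so the error is at most 1850 / 0.95. Only its boundedness matters later. *)
Lemma klein_cusp s : 0 < Im s -> Cmod (nome s) <= 1 / 10000 -> Cmod (klein s - / nome s) <= 2000.
Proof.
intros Hs Hr.
pose proof (Cmod_nome_01 s Hs) as Hq.
set (q := nome s) in *; set (r := Cmod q) in *.
pose proof (lambert3_small q r ltac:(unfold r in *; lra) ltac:(lra)) as HL.
pose proof (euler_small q r ltac:(unfold r in *; lra) ltac:(lra)) as HE.
set (L := lambert 3 q) in *; set (P := euler q) in *.
assert (HP : Cmod P <= 1 + 2 * r).
{ replace P with ((P - 1) + 1)%C by ring; eapply Rle_trans; [apply Cmod_triangle|]; rewrite Cmod_1; lra. }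
assert (M24 : (1 + 2 * r) ^ 24 <= 1 + 1 / 100).
{ apply Rle_trans with (exp (2 * r) ^ 24).
  - apply pow_incr; pose proof (exp_ge_1p (2 * r)); lra.
  - rewrite exp_pow; replace (INR 24) with 24 by (simpl; ring).
    eapply Rle_trans; [apply exp_small; lra|lra]. }
assert (HP24 : Cmod (P ^ 24 - 1) <= 50 * r).
{ eapply Rle_trans; [apply (Cpow_sub1 P (1 + 2 * r) 24); lra|].
  replace (INR 24) with 24 by (simpl; ring).
  pose proof (Cmod_ge_0 (P - 1)); assert (0 <= (1 + 2 * r) ^ 24) by (apply pow_le; lra).
  apply Rle_trans with (24 * (1 + 1 / 100) * (2 * r)); [|lra].
  apply Rmult_le_compat; lra. }
assert (HA : Cmod ((1 + 240 * L) ^ 3 - 1) <= 1800 * r).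
{ eapply Rle_trans; [apply (Cpow_sub1 _ (1 + 480 * r) 3)|].
  - lra.
  - eapply Rle_trans; [apply Cmod_triangle|]; rewrite Cmod_1, Cmod_mult, Cmod_R, Rabs_pos_eq; lra.
  - replace (1 + 240 * L - 1)%C with (240 * L)%C by ring.
    rewrite Cmod_mult, Cmod_R, Rabs_pos_eq by lra.
    replace (INR 3) with 3 by (simpl; ring).
    assert ((1 + 480 * r) ^ 3 <= 12 / 10).
    { apply Rle_trans with ((1 + 480 / 10000) ^ 3); [apply pow_incr; lra|simpl; lra]. }
    apply Rle_trans with (3 * (12 / 10) * (240 * (2 * r))); [|lra].
    pose proof (Cmod_ge_0 L); assert (0 <= (1 + 480 * r) ^ 3) by (apply pow_le; lra).
    apply Rmult_le_compat; lra. }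
assert (HPl : 95 / 100 <= Cmod (P ^ 24)).
{ assert (Cmod 1 <= Cmod (P ^ 24) + Cmod (P ^ 24 - 1)).
  { replace (RtoC 1) with (P ^ 24 + - (P ^ 24 - 1))%C at 1 by ring.
    eapply Rle_trans; [apply Cmod_triangle|]; rewrite Cmod_opp; lra. }
  rewrite Cmod_1 in H; lra. }
assert (Nq : q <> 0%C) by (apply Cmod_gt_0; fold r; lra).
assert (NP : (P ^ 24)%C <> 0%C) by (apply Cmod_gt_0; lra).
assert (Er : klein s = ((1 + 240 * L) ^ 3 / (q * P ^ 24))%C) by reflexivity.
rewrite Er.
replace ((1 + 240 * L) ^ 3 / (q * P ^ 24) - / q)%C with ((((1 + 240 * L) ^ 3 - 1) - (P ^ 24 - 1)) / (q * P ^ 24))%C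
  by (generalize dependent (P ^ 24)%C; intros; field; auto).
rewrite Cmod_div, Cmod_mult by (apply Cmult_neq_0; auto); fold r.
assert (0 < r * Cmod (P ^ 24)) by (apply Rmult_lt_0_compat; lra).
apply Rle_div_l; auto.
unfold Cminus at 1; eapply Rle_trans; [apply Cmod_triangle|]; rewrite Cmod_opp.
apply Rle_trans with (1850 * r); [lra|].
assert (r * (95 / 100) <= r * Cmod (P ^ 24)) by (apply Rmult_le_compat_l; lra).
lra.
Qed.

(** * Size of the invariant away from the cusp at 0 *)

Lemma tanh_le a : 0 <= a -> (1 - a) * exp (2 * a) <= 1 + a.
Proof.
intros Ha.
pose proof (mvt_incr (fun t => 1 + t * a - (1 - t * a) * exp (2 * (t * a)))
   (fun t => a * (1 - (1 - 2 * (t * a)) * exp (2 * (t * a))))) as M.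
cbv beta in M.
rewrite !Rmult_0_l, !Rmult_1_l, Rmult_0_r, exp_0 in M.
assert (0 <= 1 + a - (1 - a) * exp (2 * a)); [|lra].
replace 0 with (1 + 0 - (1 - 0) * 1) at 1 by ring.
apply M.
- intros t Ht; auto_derive; auto; ring.
- intros t Ht; apply Rmult_le_pos; auto.
  set (x := 2 * (t * a)).
  assert (E : exp x * exp (- x) = 1) by (rewrite <- exp_plus, <- exp_0; f_equal; ring).
  pose proof (exp_ge_1p (- x)); pose proof (exp_pos x); nra.
Qed.

(** Convexity: the tangent at [l * b] lies below the exponential at both 0 and [b], and these two
    inequalities are combined with weights 1 - l and l. *)
Lemma exp_chord l b : 0 <= l <= 1 -> exp (l * b) <= 1 + l * (exp b - 1).
Proof.
intros Hl.
assert (E1 : exp b = exp (l * b) * exp ((1 - l) * b)) by (rewrite <- exp_plus; f_equal; ring).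
assert (E2 : 1 = exp (l * b) * exp (- (l * b))) by (rewrite <- exp_plus, <- exp_0; f_equal; ring).
pose proof (exp_pos (l * b)) as P; set (e := exp (l * b)) in *.
pose proof (exp_ge_1p ((1 - l) * b)) as T1; pose proof (exp_ge_1p (- (l * b))) as T2.
assert (e * (1 + (1 - l) * b) <= exp b) by (rewrite E1; apply Rmult_le_compat_l; lra).
assert (e * (1 + - (l * b)) <= 1) by (rewrite E2; apply Rmult_le_compat_l; lra).
nra.
Qed.

(* [|1 - z|^2 = (1 - |z|)^2 + 2 s] with [s = |z| - Re z]; the claim is concave in [s] on [0, 2|z|], so it is enough to check
   the endpoints. *)
Lemma one_minus_phase_lower (z : C) : Cmod z < 1 -> (1 - Cmod z) * exp (Cmod z - Re z) <= Cmod (1 - z).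
Proof.
intros Hz.
set (p := Cmod z) in *.
assert (Hp : 0 <= p) by apply Cmod_ge_0.
destruct (Req_dec p 0) as [Z|NZ].
{ assert (E : z = 0%C) by (apply Cmod_eq_0; auto).
  rewrite Z, E; simpl Re; rewrite Rminus_0_r, !Rminus_0_r, exp_0, Cminus_0_r, Cmod_1; lra. }
set (s := p - Re z).
assert (Hre : - p <= Re z <= p) by (apply Rabs_le_between, re_le_Cmod).
assert (Hs : 0 <= s <= 2 * p) by (unfold s; lra).
assert (E2 : Cmod (1 - z) ^ 2 = (1 - p) ^ 2 + 2 * s).
{ rewrite Cmod2_alt, Re_minus, Im_minus; simpl (Re 1); simpl (Im 1).
  replace ((1 - Re z) ^ 2 + (0 - Im z) ^ 2) with (1 - 2 * Re z + (Re z ^ 2 + Im z ^ 2)) by ring.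
  rewrite <- Cmod2_alt; fold p; unfold s; ring. }
apply Rsqr_incr_0_var; [|apply Cmod_ge_0].
rewrite !Rsqr_pow2, E2, Rpow_mult_distr.
assert (Ee : exp s ^ 2 = exp ((s / (2 * p)) * (4 * p))).
{ rewrite exp_pow; f_equal; simpl; field; lra. }
rewrite Ee.
assert (Hl : 0 <= s / (2 * p) <= 1).
{ split; [apply Rdiv_le_0_compat; lra|apply Rle_div_l; lra]. }
pose proof (exp_chord _ (4 * p) Hl) as Ch.
pose proof (tanh_le p Hp) as T.
assert (T2 : (1 - p) ^ 2 * exp (4 * p) <= (1 + p) ^ 2).
{ replace (4 * p) with (2 * p + 2 * p) by ring; rewrite exp_plus.
  replace ((1 - p) ^ 2 * (exp (2 * p) * exp (2 * p))) with (((1 - p) * exp (2 * p)) ^ 2) by ring.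
  apply pow_incr; split; auto; apply Rmult_le_pos; [lra|left; apply exp_pos]. }
apply Rle_trans with ((1 - p) ^ 2 * (1 + s / (2 * p) * (exp (4 * p) - 1))).
- apply Rmult_le_compat_l; auto; nra.
- assert ((1 - p) ^ 2 * (exp (4 * p) - 1) <= 4 * p) by lra.
  replace ((1 - p) ^ 2 * (1 + s / (2 * p) * (exp (4 * p) - 1))) with
   ((1 - p) ^ 2 + s / (2 * p) * ((1 - p) ^ 2 * (exp (4 * p) - 1))) by ring.
  apply Rplus_le_compat_l.
  apply Rle_trans with (s / (2 * p) * (4 * p)); [apply Rmult_le_compat_l; lra|].
  apply Req_le; field; lra.
Qed.

Lemma eprod_phase_lower q n : Cmod q < 1 ->
  Cmod (eprod (RtoC (Cmod q)) n) * exp (Re (csum (fun k => RtoC (Cmod q) ^ S k - q ^ S k)%C n)) <= Cmod (eprod q n).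
Proof.
intros Hq; pose proof (Cmod_ge_0 q); induction n.
- simpl; rewrite Cmod_1, exp_0; lra.
- rewrite !eprod_S, !Cmod_mult, csum_S, Re_plus, exp_plus.
  assert (Hz : Cmod (q ^ S n) < 1) by (rewrite Cmod_pow; pose proof (pow_S_lt1 (Cmod q) n ltac:(lra)); lra).
  pose proof (one_minus_phase_lower (q ^ S n) Hz) as L.
  assert (E : Cmod (1 - RtoC (Cmod q) ^ S n) = 1 - Cmod (q ^ S n)).
  { rewrite <- RtoC_pow, <- RtoC_minus, Cmod_R, Cmod_pow, Rabs_pos_eq; auto.
    rewrite Cmod_pow in Hz; lra. }
  assert (E2 : Re (RtoC (Cmod q) ^ S n - q ^ S n)%C = Cmod (q ^ S n) - Re (q ^ S n)%C).
  { rewrite Re_minus, <- RtoC_pow, re_RtoC, Cmod_pow; auto. }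
  rewrite E, E2.
  set (X := Cmod (eprod (RtoC (Cmod q)) n)) in *; set (A := exp (Re (csum _ n))) in *.
  replace (X * (1 - Cmod (q ^ S n)) * (A * exp (Cmod (q ^ S n) - Re (q ^ S n)%C))) with
   ((X * A) * ((1 - Cmod (q ^ S n)) * exp (Cmod (q ^ S n) - Re (q ^ S n)%C))) by ring.
  apply Rmult_le_compat; auto.
  + apply Rmult_le_pos; [apply Cmod_ge_0|left; apply exp_pos].
  + apply Rmult_le_pos; [lra|left; apply exp_pos].
Qed.

(** Each factor 1 - q^n gains exp(|q|^n - Re q^n) over its value at |q|; the gains multiply to the
    exponential of a difference of geometric series. *)
Lemma euler_phase_lower q : 0 < Cmod q < 1 ->
  Cmod (euler (RtoC (Cmod q))) * exp (Re (RtoC (Cmod q) / (1 - RtoC (Cmod q)) - q / (1 - q))%C) <= Cmod (euler q).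
Proof.
intros Hq.
assert (Hr : Cmod (RtoC (Cmod q)) < 1) by (rewrite Cmod_R, Rabs_pos_eq; lra).
assert (L1 : Clim (csum (fun k => RtoC (Cmod q) ^ S k - q ^ S k)%C) (RtoC (Cmod q) / (1 - RtoC (Cmod q)) - q / (1 - q))%C).
{ apply CSer_minus; apply CSer_geom1; auto; lra. }
pose proof (Clim_mod _ _ (euler_lim q ltac:(lra))) as L2.
pose proof (Clim_mod _ _ (euler_lim _ Hr)) as L3.
destruct L1 as [L1 _].
assert (L4 : is_lim_seq (fun n => exp (Re (csum (fun k => RtoC (Cmod q) ^ S k - q ^ S k)%C n)))
   (exp (Re (RtoC (Cmod q) / (1 - RtoC (Cmod q)) - q / (1 - q))%C))).
{ apply (is_lim_seq_continuous exp); auto.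
  apply derivable_continuous_pt, derivable_pt_exp. }
apply (is_lim_seq_le (fun n => Cmod (eprod (RtoC (Cmod q)) n) * exp (Re (csum (fun k => RtoC (Cmod q) ^ S k - q ^ S k)%C n)))
  (fun n => Cmod (eprod q n)) (Cmod (euler (RtoC (Cmod q))) * exp (Re (RtoC (Cmod q) / (1 - RtoC (Cmod q)) - q / (1 - q))%C)) (Cmod (euler q))); auto.
- intros n; apply eprod_phase_lower; lra.
- apply is_lim_seq_mult'; auto.
Qed.

Lemma lambert3_positive_bound q : 0 < Cmod q < 1 -> Cmod (1 + 240 * lambert 3 q) <= Cmod (1 + 240 * lambert 3 (RtoC (Cmod q))).
Proof.
intros Hq; set (r := Cmod q) in *.
assert (Hr : 0 < Cmod (RtoC r) < 1) by (rewrite Cmod_R, Rabs_pos_eq; lra).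
pose proof (ex_lambert 3 q Hq) as L1; pose proof (ex_lambert 3 (RtoC r) Hr) as L2.
apply CSer_is_series in L2 as [L2 _].
assert (B : Cmod (lambert 3 q) <= Re (lambert 3 (RtoC r))).
{ apply (CSer_mod_le (fun d => RtoC (INR (S d) ^ 3) * (q ^ S d / (1 - q ^ S d)))%C _ (fun d => Re (RtoC (INR (S d) ^ 3) * (RtoC r ^ S d / (1 - RtoC r ^ S d)))%C) _) with (2 := L2) (3 := L1).
  intros d; pose proof (pow_S_lt1 r d ltac:(lra)) as P.
  assert (0 <= INR (S d) ^ 3) by (apply pow_le, pos_INR).
  rewrite re_scal_l, <- RtoC_pow, <- RtoC_minus, <- RtoC_div, re_RtoC by lra.
  rewrite Cmod_mult, Cmod_R, Rabs_pos_eq by auto; apply Rmult_le_compat_l; auto.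
  assert (1 - r ^ S d <= Cmod (1 - q ^ S d)).
  { eapply Rle_trans; [|apply Cmod_1_minus_ge]; rewrite Cmod_pow; fold r; lra. }
  rewrite Cmod_div, Cmod_pow by (apply Cmod_gt_0; lra); fold r.
  apply Rmult_le_compat_l; [lra|]; apply Rinv_le_contravar; lra. }
eapply Rle_trans; [apply Cmod_triangle|].
rewrite Cmod_1, Cmod_mult, Cmod_R, Rabs_pos_eq by lra.
eapply Rle_trans; [|apply re_le_Cmod]; eapply Rle_trans; [|apply Rle_abs].
rewrite Re_plus, re_RtoC, re_scal_l; lra.
Qed.

(** Comparison with the point of equal height on the imaginary axis: the numerator is largest there
    because its coefficients are positive, and the 24th power of the product gains the phase
    factor. *)
Lemma klein_minor t : 0 < Im t ->
  Cmod (klein t) <= Cmod (klein (Im t * Ci)) *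
   exp (- (24 * Re (RtoC (Cmod (nome t)) / (1 - RtoC (Cmod (nome t))) - nome t / (1 - nome t))%C)).
Proof.
intros H; pose proof (Cmod_nome_01 t H) as Hq.
set (q := nome t) in *.
assert (Er : nome (Im t * Ci) = RtoC (Cmod q)).
{ unfold q; rewrite Cmod_nome; unfold nome; rewrite <- Cexp_RtoC; f_equal; apply C_eq; destruct t; simpl; ring. }
unfold klein, discr; rewrite Er; fold q.
set (r := Cmod q) in *.
assert (Hr : 0 < Cmod (RtoC r) < 1) by (rewrite Cmod_R, Rabs_pos_eq; lra).
assert (N1 := euler_nz q ltac:(unfold r in Hq; lra)). assert (N2 := euler_nz (RtoC r) ltac:(lra)).
assert (Nq : q <> 0%C) by apply nome_nz.
assert (Nr : RtoC r <> 0%C) by (apply RtoC_neq0; lra).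
pose proof (euler_phase_lower q Hq) as L; fold r in L.
pose proof (lambert3_positive_bound q Hq) as L2; fold r in L2.
set (E := Re (RtoC r / (1 - RtoC r) - q / (1 - q))%C) in *.
rewrite !Cmod_div, !Cmod_mult, !Cmod_pow by (apply Cmult_neq_0; auto; apply Cpow_nz; auto).
rewrite (Cmod_R r), Rabs_pos_eq by lra; fold r.
set (A := Cmod (1 + 240 * lambert 3 q)) in *; set (B := Cmod (1 + 240 * lambert 3 (RtoC r))) in *.
assert (0 <= A) by apply Cmod_ge_0.
assert (PE : 0 < Cmod (euler (RtoC r))) by (apply Cmod_gt_0; auto).
assert (PE2 : 0 < Cmod (euler q)) by (apply Cmod_gt_0; auto).
assert (Pe := exp_pos E).
replace (B ^ 3 / (r * Cmod (euler (RtoC r)) ^ 24) * exp (- (24 * E))) with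
  (B ^ 3 / (r * (Cmod (euler (RtoC r)) * exp E) ^ 24)).
- apply Rmult_le_compat.
  + apply pow_le; auto.
  + left; apply Rinv_0_lt_compat, Rmult_lt_0_compat; [lra|apply pow_lt; auto].
  + apply pow_incr; auto.
  + apply Rinv_le_contravar.
    * apply Rmult_lt_0_compat; [lra|apply pow_lt, Rmult_lt_0_compat; auto].
    * apply Rmult_le_compat_l; [lra|]; apply pow_incr; split; auto; apply Rmult_le_pos; lra.
- rewrite exp_Ropp, Rpow_mult_distr, exp_pow; replace (INR 24) with 24 by (simpl; ring).
  pose proof (exp_pos (24 * E)); field; repeat split; try lra; apply Rgt_not_eq, pow_lt; auto.
Qed.

(** Used for a = PI Im t, which is at most PI / 12 < 0.263. [tanh_le] at a/2 gives the Pade bounds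
    (1 + a/2) / (1 - a/2) for the exponential. *)
Lemma sinh_le_sin a : 0 < a <= 263 / 1000 -> 2 * (exp a - exp (- a)) ^ 2 <= 4 * sin (2 * a) ^ 2.
Proof.
intros Ha.
pose proof (tanh_le (a / 2) ltac:(lra)) as T; replace (2 * (a / 2)) with a in T by field.
assert (E : exp a * exp (- a) = 1) by (rewrite <- exp_plus, <- exp_0; f_equal; ring).
pose proof (exp_pos a) as P1; pose proof (exp_pos (- a)) as P2.
assert (U : exp a <= (1 + a / 2) / (1 - a / 2)) by (apply Rle_div_r; lra).
assert (V : (1 - a / 2) / (1 + a / 2) <= exp (- a)).
{ apply Rle_div_l; [lra|].
  assert ((1 - a / 2) * exp a * exp (- a) <= (1 + a / 2) * exp (- a)) by (apply Rmult_le_compat_r; lra).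
  rewrite Rmult_assoc, E in H; lra. }
assert (W : (1 + a / 2) / (1 - a / 2) - (1 - a / 2) / (1 + a / 2) = 2 * a / (1 - a ^ 2 / 4)).
{ field; repeat split; try lra; nra. }
assert (D : exp a - exp (- a) <= 2 * a * (11 / 10)).
{ apply Rle_trans with (2 * a / (1 - a ^ 2 / 4)); [rewrite <- W; lra|].
  apply Rle_div_l; nra. }
assert (D0 : 0 <= exp a - exp (- a)).
{ assert (exp (- a) <= exp a) by (apply exp_mono; lra); lra. }
assert (S : 2 * a * (9 / 10) <= sin (2 * a)).
{ eapply Rle_trans; [|apply sin_lower; lra]. nra. }
assert ((exp a - exp (- a)) ^ 2 <= (2 * a * (11 / 10)) ^ 2) by (apply pow_incr; lra).
assert ((2 * a * (9 / 10)) ^ 2 <= sin (2 * a) ^ 2) by (apply pow_incr; nra).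
nra.
Qed.

(** With r = |q|, the real part equals (1/2) (1 + r) / (1 - r) times 1 - (1 - r)^2 / |1 - q|^2. The
    first quotient is coth(PI Im t), at least 1 / (PI Im t); away from the imaginary axis |1 - q|^2
    >= 3 (1 - r)^2, so the last factor is at least 2/3. The product 24 (1/2) (2/3) is the 8. *)
Lemma phase_gain t : 0 < Im t <= 1 / 12 -> 2 * Im t <= Rabs (Re t) <= 1 / 2 ->
  8 / (PI * Im t) <= 24 * Re (RtoC (Cmod (nome t)) / (1 - RtoC (Cmod (nome t))) - nome t / (1 - nome t))%C.
Proof.
intros Hi Hr.
pose proof PI_RGT_0 as PP; pose proof PI_upper as PU; pose proof PI_lower as PL.
set (a := PI * Im t).
assert (Ha : 0 < a <= 263 / 1000) by (unfold a; split; nra).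
set (q := nome t).
set (r := Cmod q).
assert (Er : r = exp (- a) * exp (- a)).
{ unfold r, q; rewrite Cmod_nome, <- exp_plus; f_equal; unfold a; ring. }
assert (E : exp a * exp (- a) = 1) by (rewrite <- exp_plus, <- exp_0; f_equal; ring).
assert (Hr1 : 0 < r < 1) by (unfold r, q; apply Cmod_nome_01; lra).
pose proof (Cmod2_one_minus_nome t) as D; cbv zeta in D; rewrite <- Cmod_nome in D; fold q in D; fold r in D.
set (Dq := Cmod (1 - q) ^ 2) in *.
assert (Hs : sin (2 * a) ^ 2 <= sin (PI * Re t) ^ 2).
{ assert (sin (2 * a) <= sin (PI * Rabs (Re t))).
  { apply sin_incr_1; unfold a; nra. }
  assert (0 <= sin (2 * a)) by (apply sin_ge_0; lra).
  assert (sin (PI * Re t) ^ 2 = sin (PI * Rabs (Re t)) ^ 2).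
  { unfold Rabs; destruct (Rcase_abs (Re t)); auto.
    replace (PI * - Re t) with (- (PI * Re t)) by ring; rewrite sin_neg; ring. }
  rewrite H1; apply pow_incr; lra. }
assert (HD : 3 * (1 - r) ^ 2 <= Dq).
{ rewrite D.
  assert (1 - r = exp (- a) * (exp a - exp (- a))) by (rewrite Rmult_minus_distr_l, (Rmult_comm _ (exp a)), E, <- Er; auto).
  assert (2 * (1 - r) ^ 2 <= 4 * r * sin (PI * Re t) ^ 2); [|lra].
  rewrite H, Er.
  pose proof (sinh_le_sin a Ha).
  replace (2 * (exp (- a) * (exp a - exp (- a))) ^ 2) with ((exp (- a) * exp (- a)) * (2 * (exp a - exp (- a)) ^ 2)) by ring.
  replace (4 * (exp (- a) * exp (- a)) * sin (PI * Re t) ^ 2) with ((exp (- a) * exp (- a)) * (4 * sin (PI * Re t) ^ 2)) by ring.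
  pose proof (exp_pos (- a)); apply Rmult_le_compat_l; nra. }
assert (Nq : (1 - q)%C <> 0%C) by (apply one_minus_nome_nz; lra).
assert (PD : 0 < Dq) by (unfold Dq; apply pow_lt, Cmod_gt_0; auto).
assert (ERe : Re (RtoC r / (1 - RtoC r) - q / (1 - q))%C = 1 / 2 * ((1 + r) / (1 - r)) * (1 - (1 - r) ^ 2 / Dq)).
{ rewrite Re_minus, <- RtoC_minus, <- RtoC_div, re_RtoC by lra.
  assert (E2 : Re (q / (1 - q))%C = (Re q - r ^ 2) / Dq).
  { unfold Dq, r; rewrite !Cmod2_alt.
    assert (N2 : Re (1 - q)%C ^ 2 + Im (1 - q)%C ^ 2 <> 0).
    { rewrite <- Cmod2_alt; fold Dq; lra. }
    revert N2; generalize q; intros [u v] N2; simpl in *; field; intros Q; apply N2; lra. }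
  assert (E3 : Dq = 1 - 2 * Re q + r ^ 2).
  { unfold Dq, r; rewrite !Cmod2_alt, Re_minus, Im_minus; simpl (Re 1); simpl (Im 1); ring. }
  rewrite E2; replace (Re q) with ((1 + r ^ 2 - Dq) / 2) by lra.
  field; split; lra. }
rewrite ERe.
assert (F1 : / a <= (1 + r) / (1 - r)).
{ pose proof (tanh_le a ltac:(lra)) as T.
  apply Rle_div_r; [lra|].
  rewrite Rmult_comm; fold (Rdiv (1 - r) a); apply Rle_div_l; [lra|].
  replace (exp (2 * a)) with (exp a * exp a) in T by (rewrite <- exp_plus; f_equal; ring).
  assert (T2 : r * ((1 - a) * (exp a * exp a)) <= r * (1 + a)) by (apply Rmult_le_compat_l; lra).
  replace (r * ((1 - a) * (exp a * exp a))) with ((1 - a) * ((exp a * exp (- a)) * (exp a * exp (- a)))) in T2 by (rewrite Er; ring).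
  rewrite E in T2; lra. }
assert (F2 : 2 / 3 <= 1 - (1 - r) ^ 2 / Dq).
{ assert ((1 - r) ^ 2 / Dq <= 1 / 3); [|lra].
  apply Rle_div_l; lra. }
assert (0 < / a) by (apply Rinv_0_lt_compat; lra).
replace (8 / a) with (24 * (1 / 2 * / a * (2 / 3))) by (field; lra).
apply Rmult_le_compat_l; [lra|]; apply Rmult_le_compat; try lra.
Qed.

Definition Cnear : R := 40 * (2 * PI ^ 2 * exp 3).

(** One bound for both cases of [G_bound]. The first two exponentials bound the invariant and [phi]
    where |Re t| > 2 Im t; the constant is 2000 from [klein_cusp] plus the 1 subtracted in [phi];
    the last term is the pole at infinity. *)
Definition Gbound (y : R) : R :=
  exp (2 * PI / y - 8 / (PI * y)) + exp (2 * PI / (5 * y)) + 2001 + 2 * PI / y + Cnear + exp (2 * PI * y).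

Lemma exp_ge_2pow x n : INR n <= x -> 2 ^ n <= exp x.
Proof.
intros H; apply Rle_trans with (exp (INR n)); [|apply exp_mono; auto].
replace (INR n) with (INR n * 1) by ring; rewrite <- exp_pow.
apply pow_incr; pose proof (exp_ge_1p 1); lra.
Qed.

(** For |Re t| <= 2 Im t the inverted point is high enough for [klein_cusp], and the exponential it
    produces cancels against [phi t]. Otherwise there is no cancellation to exploit, and the
    invariant and [phi] are each small enough. *)
Lemma G_bound t : 0 < Im t <= 1 / 12 -> Rabs (Re t) <= 1 / 2 ->
  Cmod (klein t - / nome t - Fsum t) <= Gbound (Im t).
Proof.
intros Hi Hr.
pose proof PI_RGT_0 as PP; pose proof PI_lower as PL.
destruct (inv_tau t ltac:(lra)) as [Hs Nt].
set (y := Im t) in *.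
pose proof (Fsum_near t Hi Hr) as HF; fold Cnear in HF.
assert (Hy1 : y <= Cmod t) by (eapply Rle_trans; [apply Rle_abs|apply Im_le_Cmod]).
assert (Hq : Cmod (/ nome t) = exp (2 * PI * y)).
{ rewrite <- nome_opp, Cmod_nome; f_equal; simpl; fold y; unfold y; destruct t; simpl; ring. }
assert (Hphi1 : Cmod (1 + 2 * PI * Ci / t) <= 1 + 2 * PI / y).
{ eapply Rle_trans; [apply Cmod_triangle|]; rewrite Cmod_1; apply Rplus_le_compat_l.
  rewrite Cmod_div by auto; rewrite <- (Cmult_1_r (2 * PI * Ci)), Cmod_2pii, Cmod_1, Rmult_1_r.
  apply Rmult_le_compat_l; [lra|apply Rinv_le_contravar; lra]. }
assert (Hexp : 0 < exp (2 * PI / y - 8 / (PI * y)) /\ 0 < exp (2 * PI / (5 * y))) by (split; apply exp_pos).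
assert (Hmod2 : Cmod t ^ 2 = Re t ^ 2 + y ^ 2) by (rewrite Cmod2_alt; auto).
destruct (Rle_dec (Rabs (Re t)) (2 * y)) as [Hx|Hx].
(* Here |t|^2 <= 5 y^2, so the height is at least 1 / (5 y). Then 2 PI * 12/5 exceeds 15, and 2^15
   exceeds the 10000 required by [klein_cusp]. *)
- assert (HIm : 12 / 5 <= Im (- / t)%C).
  { rewrite Im_inv_tau by auto; fold y.
    assert (Re t ^ 2 <= (2 * y) ^ 2) by (rewrite <- (pow2_abs (Re t)); apply pow_incr; split; auto; apply Rabs_pos).
    assert (12 * (y * y) <= y) by nra.
    apply (Rmult_le_reg_r (Cmod t ^ 2)); [rewrite Hmod2; nra|]; unfold Rdiv at 2; rewrite Rmult_assoc, Rinv_l by (rewrite Hmod2; nra); rewrite Hmod2; nra. }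
  assert (Hn : Cmod (nome (- / t)) <= 1 / 10000).
  { rewrite Cmod_nome, exp_Ropp.
    assert (B0 : INR 15 <= 2 * PI * Im (- / t)%C) by (replace (INR 15) with 15 by (simpl; ring); nra).
    pose proof (exp_ge_2pow _ 15 B0) as B.
    apply Rle_trans with (/ 2 ^ 15); [apply Rinv_le_contravar; [simpl; lra|auto]|simpl; lra]. }
  pose proof (klein_cusp (- / t)%C Hs Hn) as J; rewrite klein_modular in J by (fold y; lra).
  assert (En : (/ nome (- / t))%C = Cexp (2 * PI * Ci / t)).
  { rewrite <- nome_opp; unfold nome; f_equal; field; auto. }
  rewrite En in J.
  replace (klein t - / nome t - Fsum t)%C with
   ((klein t - Cexp (2 * PI * Ci / t)) + (- (Fsum t - phi t)) + (1 + 2 * PI * Ci / t) + (- / nome t))%C by (unfold phi; ring).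
  eapply Rle_trans; [apply Cmod_triangle|].
  { unfold Gbound; rewrite !Cmod_opp, Hq.
    assert (Cmod (klein t - Cexp (2 * PI * Ci / t) + - (Fsum t - phi t)) <= 2000 + Cnear); [|].
    { eapply Rle_trans; [apply Cmod_triangle|]; rewrite Cmod_opp; lra. }
    pose proof (Cmod_triangle (klein t - Cexp (2 * PI * Ci / t) + - (Fsum t - phi t)) (1 + 2 * PI * Ci / t)).
    lra. }
- assert (Hg := phase_gain t Hi ltac:(unfold y in *; lra)); fold y in Hg.
  pose proof (klein_minor t ltac:(fold y; lra)) as J; fold y in J.
  set (E := 24 * Re _) in *.
  assert (Jy : Cmod (klein (y * Ci)) <= exp (2 * PI / y) + 2000).
  { assert (Iy : 0 < Im (y * Ci)%C) by (rewrite im_scal_l; simpl; lra).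
    rewrite <- klein_modular by auto.
    assert (Es : (- / (y * Ci))%C = (/ y * Ci)%C).
    { rewrite <- RtoC_inv by lra; apply C_eq; simpl; field; lra. }
    rewrite Es.
    assert (Is : Im (/ y * Ci)%C = / y) by (rewrite <- RtoC_inv by lra; rewrite im_scal_l; simpl; ring).
    assert (12 <= / y) by (replace 12 with (/ (1 / 12)) by field; apply Rinv_le_contravar; lra).
    assert (Hn : Cmod (nome (/ y * Ci)) <= 1 / 10000).
    { rewrite Cmod_nome, exp_Ropp, Is.
      assert (B0 : INR 15 <= 2 * PI * / y) by (replace (INR 15) with 15 by (simpl; ring); nra).
      pose proof (exp_ge_2pow _ 15 B0) as B.
      apply Rle_trans with (/ 2 ^ 15); [apply Rinv_le_contravar; [simpl; lra|auto]|simpl; lra]. }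
    pose proof (klein_cusp (/ y * Ci)%C ltac:(rewrite Is; lra) Hn) as Jc.
    replace (klein (/ y * Ci)) with (/ nome (/ y * Ci) + (klein (/ y * Ci) - / nome (/ y * Ci)))%C by ring.
    eapply Rle_trans; [apply Cmod_triangle|]; apply Rplus_le_compat; auto.
    rewrite <- nome_opp, Cmod_nome.
    replace (Im (- (/ y * Ci))) with (- Im (/ y * Ci)%C) by reflexivity; rewrite Is.
    apply Req_le; f_equal; unfold Rdiv; ring. }
  assert (Jt : Cmod (klein t) <= exp (2 * PI / y - 8 / (PI * y)) + 2000).
  { eapply Rle_trans; [exact J|].
    assert (P0 : 0 < 8 / (PI * y)) by (apply Rdiv_lt_0_compat; nra).
    assert (E1 : exp (- E) <= exp (- (8 / (PI * y)))) by (apply exp_mono; lra).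
    assert (E2 : exp (- E) <= 1) by (rewrite <- exp_0; apply exp_mono; lra).
    pose proof (exp_pos (- E)); pose proof (exp_pos (2 * PI / y)).
    unfold Rminus; rewrite exp_plus.
    apply Rle_trans with ((exp (2 * PI / y) + 2000) * exp (- E)); [apply Rmult_le_compat_r; lra|].
    rewrite Rmult_plus_distr_r; apply Rplus_le_compat; [apply Rmult_le_compat_l; lra|lra]. }
  assert (Hphi : Cmod (phi t) <= exp (2 * PI / (5 * y)) + (1 + 2 * PI / y)).
  { unfold phi; replace (Cexp (2 * PI * Ci / t) - 1 - 2 * PI * Ci / t)%C with
      (Cexp (2 * PI * Ci / t) + - (1 + 2 * PI * Ci / t))%C by ring.
    eapply Rle_trans; [apply Cmod_triangle|]; rewrite Cmod_opp; apply Rplus_le_compat; auto.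
    rewrite Cmod_Cexp; apply exp_mono; rewrite Re_2pii_div by auto; fold y.
    assert ((2 * y) ^ 2 <= Re t ^ 2) by (rewrite <- (pow2_abs (Re t)); apply pow_incr; lra).
    apply Rle_div_l; [nra|].
    replace (2 * PI / (5 * y) * Cmod t ^ 2) with (2 * PI * (Cmod t ^ 2 / (5 * y))) by (field; lra).
    apply Rmult_le_compat_l; [lra|]; apply Rle_div_r; nra. }
  replace (klein t - / nome t - Fsum t)%C with
   (klein t + (- (Fsum t - phi t)) + (- phi t) + (- / nome t))%C by ring.
  eapply Rle_trans; [apply Cmod_triangle|]. 
  pose proof (Cmod_triangle (klein t + - (Fsum t - phi t)) (- phi t)) as T1.
  pose proof (Cmod_triangle (klein t) (- (Fsum t - phi t))) as T2.
  rewrite !Cmod_opp in *; unfold Gbound; lra.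
Qed.

(** The dominant exponent is 2 PI - 8 / PI = 3.73..., rounded up to 15/4. All other terms together
    stay below the cube of E = exp(1 / y), which is at least 2^12. *)
Lemma Gbound_simpl y : 0 < y <= 1 / 12 -> Gbound y <= 2 * exp (15 / 4 / y).
Proof.
intros Hy.
pose proof PI_RGT_0 as PP; pose proof PI_lower as PL; pose proof PI_upper as PU.
assert (Hi : 12 <= / y) by (replace 12 with (/ (1 / 12)) by field; apply Rinv_le_contravar; lra).
set (x := / y) in *.
assert (Hx : y = / x) by (unfold x; rewrite Rinv_inv; auto).
unfold Gbound.
replace (2 * PI / y - 8 / (PI * y)) with ((2 * PI - 8 / PI) * x) by (unfold x; field; lra).
replace (2 * PI / (5 * y)) with (2 * PI / 5 * x) by (unfold x; field; lra).
replace (2 * PI / y) with (2 * PI * x) by (unfold x; field; lra).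
replace (15 / 4 / y) with (15 / 4 * x) by (unfold x; field; lra).
set (E := exp x).
assert (HE : 2 ^ 12 <= E) by (apply exp_ge_2pow; simpl; lra).
assert (HE' : 4096 <= E) by (simpl in HE; lra).
assert (E2 : exp (2 * x) = E ^ 2) by (unfold E; rewrite exp_pow; f_equal; simpl; ring).
assert (E3 : exp (3 * x) = E ^ 3) by (unfold E; rewrite exp_pow; f_equal; simpl; ring).
assert (A1 : exp ((2 * PI - 8 / PI) * x) <= exp (15 / 4 * x)).
{ apply exp_mono, Rmult_le_compat_r; [lra|].
  assert (8 / 3.144 <= 8 / PI) by (apply Rmult_le_compat_l; [lra|apply Rinv_le_contravar; lra]); lra. }
assert (A2 : exp (2 * PI / 5 * x) <= E ^ 2) by (rewrite <- E2; apply exp_mono, Rmult_le_compat_r; lra).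
assert (A3 : 2 * PI * x <= 7 * E).
{ pose proof (exp_ge_1p x); fold E in H; nra. }
assert (A4 : Cnear <= 25000).
{ unfold Cnear.
  assert (exp 3 <= 27).
  { replace 3 with (INR 3 * 1) at 1 by (simpl; ring); rewrite <- exp_pow.
    replace 27 with (3 ^ 3) by ring; apply pow_incr; pose proof exp_le_3; pose proof (exp_pos 1); lra. }
  assert (PI ^ 2 <= 10) by nra.
  apply Rle_trans with (40 * (2 * 10 * 27)); [|lra].
  apply Rmult_le_compat_l; [lra|]; apply Rmult_le_compat; try nra; left; apply exp_pos. }
assert (A5 : exp (2 * PI * y) <= E).
{ unfold E; apply exp_mono; nra. }
assert (A6 : E ^ 3 <= exp (15 / 4 * x)) by (rewrite <- E3; apply exp_mono; lra).
assert (E ^ 2 + 2001 + 7 * E + 25000 + E <= E ^ 3).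
{ replace (E ^ 3) with (E * E ^ 2) by ring; assert (4096 * E <= E ^ 2) by nra; nra. }
lra.
Qed.

(* The line [Im tau = 1 / sqrt n] balances [nome tau ^ n] against the cusp at [0]. *)
Lemma coef_error (c : nat -> Z) n : j_fourier_coefficients c -> (144 <= n)%nat ->
  Rabs (IZR (c n) - Mt (INR n)) <= 2 * exp ((2 * PI + 15 / 4) * sqrt (INR n)).
Proof.
intros Hc Hn.
pose proof PI_RGT_0 as PP.
assert (Hn' : 144 <= INR n) by (apply le_INR in Hn; simpl in Hn; lra).
assert (Hsq : 12 <= sqrt (INR n)).
{ replace 12 with (sqrt (12 * 12)) by (apply sqrt_square; lra); apply sqrt_le_1; lra. }
set (y := / sqrt (INR n)).
assert (Hy : 0 < y <= 1 / 12).
{ unfold y; split; [apply Rinv_0_lt_compat; lra|].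
  replace (1 / 12) with (/ 12) by field; apply Rinv_le_contravar; lra. }
set (b := fun n => IZR (c n) - Mt (INR n)).
(* [Fsum_fourier] starts at frequency 1; this value extends it to the index set of the coefficients
   [c]. *)
assert (M0 : Mt (INR 0) = 0).
{ apply is_series_unique, (is_series_Rext (fun n => 0 * (/ 2) ^ n)).
  - intros k; unfold mterm; simpl (INR 0); rewrite pow_ne_zero by lia; unfold Rdiv; ring.
  - pose proof (is_series_Rscal 0 _ _ is_series_geom_half) as Q; rewrite Rmult_0_l in Q; exact Q. }
assert (HG : forall t, 0 < Im t -> CSer (fun m => RtoC (b m) * nome t ^ m)%C (klein t - / nome t - Fsum t)%C).
{ intros t Ht.
  pose proof (Hc t Ht) as L; apply CSer_of_is_series in L; rewrite j_invariant_klein in L by auto.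
  assert (LF : CSer (fun m => RtoC (Mt (INR m)) * nome t ^ m)%C (Fsum t)).
  { apply (CSer_eq _ (RtoC (Mt (INR 0)) * nome t ^ 0 + Fsum t)%C); [rewrite M0; ring|].
    apply (CSer_head (fun m => RtoC (Mt (INR m)) * nome t ^ m)%C), Fsum_fourier; auto. }
  pose proof (CSer_minus _ _ _ _ L LF) as D; revert D; apply CSer_ext; intros m; unfold b; rewrite RtoC_minus; ring. }
(* Absolute convergence at height [y] follows from mere convergence at height [y / 2], which puts
   [r] strictly inside the disk of convergence. *)
assert (Hb : ex_series (fun m => Rabs (b m) * exp (- (2 * PI * y)) ^ m)).
{ set (r := exp (- (2 * PI * y))); set (r2 := exp (- (2 * PI * (y / 2)))).
  assert (Hr : 0 < r < r2) by (split; [apply exp_pos|apply exp_increasing; nra]).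
  assert (En : nome (RtoC (y / 2) * Ci) = RtoC r2).
  { unfold nome, r2; rewrite <- Cexp_RtoC; f_equal; apply C_eq; simpl; ring. }
  pose proof (HG (RtoC (y / 2) * Ci)%C ltac:(rewrite im_scal_l; simpl; lra)) as L.
  rewrite En in L; apply CSer_is_series in L as [L _].
  assert (CV : Rbar_lt (Rabs r) (CV_radius b)).
  { apply Rbar_lt_le_trans with (Rabs r2); [simpl; rewrite !Rabs_pos_eq; lra|].
    apply CV_radius_ge_series.
    apply (is_series_Rext _ (fun m => b m * r2 ^ m)) in L; [eexists; exact L|].
    intros m; rewrite <- RtoC_pow, <- RtoC_mult; reflexivity. }
  apply CV_disk_inside in CV.
  revert CV; apply ex_series_Rext; intros m.
  rewrite Rabs_mult, (Rabs_pos_eq (r ^ m)); auto; apply pow_le; lra. }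
assert (K := coef_bound b y (2 * exp (15 / 4 / y)) n ltac:(lra) Hb).
rewrite exp_pow in K.
replace (INR n * - (2 * PI * y)) with (- (2 * PI * sqrt (INR n))) in K.
2:{ unfold y; rewrite <- (sqrt_sqrt (INR n)) at 2 by lra; field; lra. }
replace (15 / 4 / y) with (15 / 4 * sqrt (INR n)) in K by (unfold y; field; lra).
apply Rmult_le_reg_r with (exp (- (2 * PI * sqrt (INR n)))); [apply exp_pos|].
replace (2 * exp ((2 * PI + 15 / 4) * sqrt (INR n)) * exp (- (2 * PI * sqrt (INR n)))) with (2 * exp (15 / 4 * sqrt (INR n))).
2:{ rewrite Rmult_assoc, <- exp_plus; do 2 f_equal; ring. }
apply K; clear K; intros x l Hx Hl.
replace (15 / 4 * sqrt (INR n)) with (15 / 4 / y) by (unfold y; field; lra).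
(* The averages run over [0, 1), whereas [G_bound] requires the period centred at 0. *)
assert (exists t, Im t = y /\ Rabs (Re t) <= 1 / 2 /\ nome t = nome (x + y * Ci)) as [t [Ht1 [Ht2 Ht3]]].
{ destruct (Rle_dec x (1 / 2)).
  - exists (x + y * Ci)%C; repeat split.
    + simpl; ring.
    + replace (Re (x + y * Ci)) with x by (simpl; ring); apply Rabs_le; lra.
  - exists (x + y * Ci - INR 1)%C; repeat split.
    + simpl; ring.
    + replace (Re (x + y * Ci - INR 1)) with (x - 1) by (simpl; ring); apply Rabs_le; lra.
    + apply nome_shift_neg. }
rewrite <- Ht3 in Hl.
rewrite (CSer_unique _ _ _ Hl (HG t ltac:(lra))).
eapply Rle_trans; [apply G_bound; [rewrite Ht1; auto|auto]|].
rewrite Ht1; apply Gbound_simpl; auto.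
Qed.

(** * The main term *)

(* [bessel v = I_1(2 sqrt v) / sqrt v], where [I_1] is the modified Bessel function. *)
Definition hcoef (k : nat) : R := / (INR (fact k) * INR (fact (S k))).

Lemma hcoef_pos k : 0 < hcoef k.
Proof. apply Rinv_0_lt_compat, Rmult_lt_0_compat; apply INR_fact_lt_0. Qed.

Lemma hcoef_S k : hcoef (S k) = hcoef k / (INR (S k) * INR (S (S k))).
Proof.
unfold hcoef; rewrite (fact_simpl (S k)), (fact_simpl k), !mult_INR.
pose proof (INR_fact_lt_0 k); pose proof (INR_S_pos k); pose proof (INR_S_pos (S k)); field; lra.
Qed.

Lemma CV_hcoef : CV_radius hcoef = p_infty.
Proof.
apply CV_radius_infinite_DAlembert.
- intros n; apply Rgt_not_eq, hcoef_pos.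
- apply (is_lim_seq_0_abs _ (fun n => / INR (S n))); [|apply is_lim_seq_inv_INR_1].
  intros n; rewrite Rabs_Rabsolu; pose proof (hcoef_pos n); pose proof (INR_S_pos n); pose proof (INR_S_pos (S n)).
  rewrite hcoef_S.
  replace (hcoef n / (INR (S n) * INR (S (S n))) / hcoef n) with (/ (INR (S n) * INR (S (S n)))) by (field; lra).
  rewrite Rabs_pos_eq by (left; apply Rinv_0_lt_compat; nra).
  apply Rinv_le_contravar; auto.
  assert (1 <= INR (S (S n))) by (rewrite S_INR; lra); nra.
Qed.

Definition bessel (v : R) : R := PSeries hcoef v.

Definition bessel1 (v : R) : R := PSeries (PS_derive hcoef) v.

Lemma CV_bessel1 : CV_radius (PS_derive hcoef) = p_infty.
Proof. rewrite CV_radius_derive; apply CV_hcoef. Qed.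

Lemma bessel_derive v : is_derive bessel v (bessel1 v).
Proof. apply is_derive_PSeries; rewrite CV_hcoef; exact I. Qed.

Lemma ex_h (a : nat -> R) v : CV_radius a = p_infty -> is_series (fun k => a k * v ^ k) (PSeries a v).
Proof.
intros H; apply is_pseries_R, PSeries_correct, CV_radius_inside; rewrite H; exact I.
Qed.

Lemma bessel_ode v : v * PSeries (PS_derive (PS_derive hcoef)) v + 2 * bessel1 v = bessel v.
Proof.
unfold bessel1, bessel.
rewrite <- PSeries_incr_1, <- PSeries_scal, <- PSeries_plus.
- apply PSeries_ext; intros k; unfold PS_plus, PS_scal, PS_incr_1, PS_derive, scal, plus; simpl; unfold mult; simpl.
  destruct k as [|k].
  + rewrite (hcoef_S 0); change (@zero (NormedModule.AbelianMonoid R_AbsRing R_NormedModule)) with 0; simpl; field.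
  + change (match k with 0%nat => 1 | S _ => INR k + 1 end) with (INR (S k)).
    rewrite (hcoef_S (S k)); pose proof (pos_INR k); rewrite !S_INR; field; lra.
- apply CV_radius_inside; rewrite CV_radius_incr_1, CV_radius_derive, CV_bessel1; exact I.
- apply CV_radius_inside; rewrite CV_radius_scal, CV_bessel1; [exact I|lra].
Qed.

Lemma bessel1_derive v : 0 < v -> is_derive bessel1 v ((bessel v - 2 * bessel1 v) / v).
Proof.
intros Hv; replace ((bessel v - 2 * bessel1 v) / v) with (PSeries (PS_derive (PS_derive hcoef)) v).
- apply is_derive_PSeries; rewrite CV_bessel1; exact I.
- pose proof (bessel_ode v); apply (Rmult_eq_reg_l v); [|lra].
  replace (v * ((bessel v - 2 * bessel1 v) / v)) with (bessel v - 2 * bessel1 v) by (field; lra); lra.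
Qed.

Lemma bessel_ge1 v : 0 <= v -> 1 <= bessel v.
Proof.
intros Hv; unfold bessel.
eapply Rle_trans; [|apply (sum_n_le_series (fun k => hcoef k * v ^ k) (PSeries hcoef v) 0)].
- rewrite sum_O; unfold hcoef; simpl; right; field.
- intros k; apply Rmult_le_pos; [left; apply hcoef_pos|apply pow_le; auto].
- apply ex_h, CV_hcoef.
Qed.

Lemma bessel1_bounds v : 0 <= v -> 0 < bessel1 v <= bessel v.
Proof.
intros Hv.
assert (E : forall k, PS_derive hcoef k = hcoef k / INR (S (S k))).
{ intros k; unfold PS_derive; rewrite hcoef_S; pose proof (INR_S_pos k); pose proof (INR_S_pos (S k)); field; lra. }
assert (P : forall k, 0 <= PS_derive hcoef k * v ^ k).
{ intros k; rewrite E; apply Rmult_le_pos; [|apply pow_le; auto].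
  left; apply Rdiv_lt_0_compat; [apply hcoef_pos|apply INR_S_pos]. }
split.
- apply Rlt_le_trans with (1 / 2).
  + lra.
  + eapply Rle_trans; [|apply (sum_n_le_series _ _ 0 P (ex_h _ v CV_bessel1))].
    rewrite sum_O, E; unfold hcoef; simpl; right; field.
- apply (is_lim_seq_le (sum_n (fun k => PS_derive hcoef k * v ^ k)) (sum_n (fun k => hcoef k * v ^ k)) (bessel1 v) (bessel v)).
  + intros n; apply sum_n_m_le; intros k; apply Rmult_le_compat_r; [apply pow_le; auto|].
    rewrite E; apply Rle_div_l; [apply INR_S_pos|].
    pose proof (hcoef_pos k); rewrite !S_INR; pose proof (pos_INR k); nra.
  + apply ex_h, CV_bessel1.
  + apply ex_h, CV_hcoef.
Qed.

(* The ratio [I_2(z) / I_1(z)] of modified Bessel functions. *)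
Definition bratio (z : R) : R := z / 2 * (bessel1 (z ^ 2 / 4) / bessel (z ^ 2 / 4)).

Definition bden (z : R) : R := bessel (z ^ 2 / 4).

Lemma bden_pos z : 0 < bden z.
Proof. unfold bden; pose proof (bessel_ge1 (z ^ 2 / 4) ltac:(pose proof (pow2_ge_0 z); lra)); lra. Qed.

(** The ratio is thus a logarithmic derivative, so [bden] can enter the integrating factors for the
    Riccati equation and lower bounds on the ratio integrate to lower bounds on [bden]. *)
Lemma bden_derive z : is_derive bden z (bratio z * bden z).
Proof.
pose proof (bden_pos z) as P; unfold bden in P.
apply (Rder_eq _ _ (z / 2 * bessel1 (z ^ 2 / 4))); [unfold bratio, bden; field; lra|].
apply (Rder_comp bessel (fun z => z ^ 2 / 4)); [apply bessel_derive|].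
auto_derive; auto; field.
Qed.

Lemma bratio_derive z : 0 < z -> is_derive bratio z (1 - bratio z ^ 2 - 3 * bratio z / z).
Proof.
intros Hz.
assert (Hv : 0 < z ^ 2 / 4) by nra.
pose proof (bden_pos z) as P; unfold bden in P.
pose proof (bessel1_derive _ Hv) as D1; pose proof (bessel_derive (z ^ 2 / 4)) as D0.
assert (Dv : is_derive (fun z => z ^ 2 / 4) z (z / 2)) by (auto_derive; auto; field).
pose proof (Rder_comp bessel1 (fun z => z ^ 2 / 4) z _ _ D1 Dv) as E1.
pose proof (Rder_comp bessel (fun z => z ^ 2 / 4) z _ _ D0 Dv) as E0.
pose proof (is_derive_div _ _ z _ _ E1 E0 (Rgt_not_eq _ _ P)) as Q.
assert (Dz : is_derive (fun z => z / 2) z (/ 2)) by (auto_derive; auto; field).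
pose proof (Rder_mult _ _ z _ _ Dz Q) as F.
eapply Rder_eq; [|exact F].
unfold bratio, minus, plus, opp, mult, scal; simpl.
replace (z * (z * 1) / 4) with (z ^ 2 / 4) by (simpl; field).
generalize dependent (bessel (z ^ 2 / 4)); generalize (bessel1 (z ^ 2 / 4)); intros A B; intros; field; repeat split; nra.
Qed.

Lemma bratio_small z : 0 < z -> 0 < bratio z <= z / 2.
Proof.
intros Hz; pose proof (bden_pos z) as P; unfold bden in P.
pose proof (bessel1_bounds (z ^ 2 / 4) ltac:(nra)) as B.
assert (0 < bessel1 (z ^ 2 / 4) / bessel (z ^ 2 / 4) <= 1).
{ split; [apply Rdiv_lt_0_compat; lra|apply Rle_div_l; lra]. }
unfold bratio; split; nra.
Qed.

Lemma mvt_incr_on (g g' : R -> R) a b : 0 < a <= b ->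
  (forall t, 0 < t -> is_derive g t (g' t)) -> (forall t, a <= t -> 0 <= g' t) -> g a <= g b.
Proof.
intros Hab Hg Hp.
destruct (MVT_gen g a b g') as [c [Hc E]].
- intros x; rewrite Rmin_left, Rmax_right by lra; intros; apply Hg; lra.
- intros x; rewrite Rmin_left, Rmax_right by lra; intros; apply derive_continuity_pt with (g' x), Hg; lra.
- rewrite Rmin_left, Rmax_right in Hc by lra; specialize (Hp c ltac:(lra)); nra.
Qed.

(* Both bounds on the ratio are barriers for its Riccati equation [r' = 1 - r^2 - 3 r / z], after multiplication by an integrating factor. *)
Lemma bratio_lower z : 0 < z -> 1 - 3 / (2 * z) <= bratio z.
Proof.
intros Hz.
destruct (Rle_dec z 1) as [H1|H1].
{ pose proof (bratio_small z Hz); assert (3 / 2 <= 3 / (2 * z)); [|lra].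
  apply Rmult_le_compat_l; [lra|apply Rinv_le_contravar; lra]. }
(* For a barrier rho, the difference W = r - rho satisfies W' = -(r + rho + 3/z) W plus the defect
   of rho in the Riccati equation. The logarithmic derivative of [mu] is r + rho + 3/z, so (W mu)'
   is [mu] times the defect, here 3 / (4 z^2). *)
set (mu := fun z => bden z * exp (z + 3 / 2 * ln z)).
set (W := fun z => bratio z - (1 - 3 / (2 * z))).
assert (Pmu : forall z, 0 < mu z) by (intros; apply Rmult_lt_0_compat; [apply bden_pos|apply exp_pos]).
assert (Dmu : forall z, 0 < z -> is_derive mu z (mu z * (bratio z + 1 + 3 / (2 * z)))).
{ intros t Ht; unfold mu.
  assert (De : is_derive (fun z => exp (z + 3 / 2 * ln z)) t (exp (t + 3 / 2 * ln t) * (1 + 3 / (2 * t)))).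
  { auto_derive; auto; field; lra. }
  eapply Rder_eq; [|apply (Rder_mult _ _ t _ _ (bden_derive t) De)]; ring. }
assert (DW : forall z, 0 < z -> is_derive W z (1 - bratio z ^ 2 - 3 * bratio z / z - 3 / (2 * z ^ 2))).
{ intros t Ht; unfold W; apply Rder_minus; [apply bratio_derive; auto|]; auto_derive; [lra|field; lra]. }
assert (V : W 1 * mu 1 <= W z * mu z).
{ apply (mvt_incr_on (fun z => W z * mu z) (fun z => mu z * (3 / (4 * z ^ 2)))); [lra| |].
  - intros t Ht; eapply Rder_eq; [|apply (Rder_mult _ _ t _ _ (DW t Ht) (Dmu t Ht))].
    unfold W; field; lra.
  - intros t Ht; apply Rmult_le_pos; [left; apply Pmu|].
    left; apply Rdiv_lt_0_compat; nra. }
assert (W1 : 0 < W 1) by (unfold W; pose proof (bratio_small 1 ltac:(lra)); lra).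
assert (0 < W z); [|unfold W in *; lra].
pose proof (Pmu 1); pose proof (Pmu z).
assert (0 < W z * mu z) by nra; nra.
Qed.

(** For this barrier the defect, with sign reversed, is (1/4 + (1/z - 1)^2) / z^2, positive for all
    z. The comparison can start at 1/2, where the trivial bound 1/4 lies below the minimum 7/16 of
    the barrier. *)
Lemma bratio_upper z : 0 < z -> bratio z <= 1 - 3 / (2 * z) + 1 / z ^ 2.
Proof.
intros Hz.
set (u := fun z => 1 - 3 / (2 * z) + 1 / z ^ 2).
assert (Umin : forall t, 0 < t -> 7 / 16 <= u t).
{ intros t Ht; unfold u.
  replace (1 - 3 / (2 * t) + 1 / t ^ 2) with (7 / 16 + (/ t - 3 / 4) ^ 2) by (field; lra).
  pose proof (pow2_ge_0 (/ t - 3 / 4)); lra. }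
change (bratio z <= u z).
destruct (Rle_dec z (1 / 2)) as [H1|H1].
{ pose proof (bratio_small z Hz); pose proof (Umin z Hz); lra. }
set (mu := fun z => bden z * exp (z + 3 / 2 * ln z - / z)).
set (W := fun z => u z - bratio z).
assert (Pmu : forall z, 0 < mu z) by (intros; apply Rmult_lt_0_compat; [apply bden_pos|apply exp_pos]).
assert (Dmu : forall z, 0 < z -> is_derive mu z (mu z * (bratio z + 1 + 3 / (2 * z) + 1 / z ^ 2))).
{ intros t Ht; unfold mu.
  assert (De : is_derive (fun z => exp (z + 3 / 2 * ln z - / z)) t (exp (t + 3 / 2 * ln t - / t) * (1 + 3 / (2 * t) + 1 / t ^ 2))).
  { apply (Rder_eq _ _ ((1 + 3 / (2 * t) + 1 / t ^ 2) * exp (t + 3 / 2 * ln t - / t))); [ring|].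
    apply (Rder_comp exp (fun z => z + 3 / 2 * ln z - / z)); [apply is_derive_exp|].
    auto_derive; [repeat split; lra|field; lra]. }
  eapply Rder_eq; [|apply (Rder_mult _ _ t _ _ (bden_derive t) De)]; ring. }
assert (DW : forall z, 0 < z -> is_derive W z (3 / (2 * z ^ 2) - 2 / z ^ 3 - (1 - bratio z ^ 2 - 3 * bratio z / z))).
{ intros t Ht; unfold W, u; apply Rder_minus; [|apply bratio_derive; auto].
  auto_derive; [repeat split; nra|field; lra]. }
assert (V : W (1 / 2) * mu (1 / 2) <= W z * mu z).
{ apply (mvt_incr_on (fun z => W z * mu z) (fun z => mu z * ((5 / 4 - 2 / z + / z ^ 2) / z ^ 2))); [lra| |].
  - intros t Ht; eapply Rder_eq; [|apply (Rder_mult _ _ t _ _ (DW t Ht) (Dmu t Ht))].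
    unfold W, u; field; lra.
  - intros t Ht; apply Rmult_le_pos; [left; apply Pmu|].
    apply Rmult_le_pos; [|left; apply Rinv_0_lt_compat; nra].
    replace (5 / 4 - 2 / t + / t ^ 2) with (1 / 4 + (/ t - 1) ^ 2) by (field; lra).
    pose proof (pow2_ge_0 (/ t - 1)); lra. }
assert (W1 : 0 < W (1 / 2)).
{ unfold W; pose proof (bratio_small (1 / 2) ltac:(lra)); pose proof (Umin (1 / 2) ltac:(lra)); lra. }
assert (0 < W z); [|unfold W in *; lra].
pose proof (Pmu (1 / 2)); pose proof (Pmu z).
assert (0 < W z * mu z) by nra; nra.
Qed.

(** The quotient of the two sides is increasing, since by [bratio_lower] its logarithmic derivative
    bratio - 1 + 2/z is at least 1 / (2 z). *)
Lemma bden_lower z : 1 <= z -> exp (z - 1) / z ^ 2 <= bden z.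
Proof.
intros Hz.
assert (De : forall t, 0 < t -> is_derive (fun z => z ^ 2 * exp (1 - z)) t (exp (1 - t) * (2 * t - t ^ 2))).
{ intros t Ht; apply (Rder_eq _ _ (2 * t * exp (1 - t) + t ^ 2 * (-1 * exp (1 - t)))); [ring|].
  apply (Rder_mult (fun z => z ^ 2) (fun z => exp (1 - z))); [auto_derive; auto; ring|].
  apply (Rder_comp exp (fun z => 1 - z)); [apply is_derive_exp|auto_derive; auto; ring]. }
assert (V : bden 1 * (1 ^ 2 * exp (1 - 1)) <= bden z * (z ^ 2 * exp (1 - z))).
{ apply (mvt_incr_on (fun z => bden z * (z ^ 2 * exp (1 - z))) (fun t => bden t * exp (1 - t) * t ^ 2 * (bratio t - 1 + 2 / t))); [lra| |].
  - intros t Ht; eapply Rder_eq; [|apply (Rder_mult _ _ t _ _ (bden_derive t) (De t Ht))].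
    field; lra.
  - intros t Ht; pose proof (bratio_lower t ltac:(lra)); pose proof (bden_pos t); pose proof (exp_pos (1 - t)).
    assert (3 / (2 * t) <= 2 / t).
    { replace (3 / (2 * t)) with (3 / 2 * / t) by (field; lra); apply Rmult_le_compat_r; [left; apply Rinv_0_lt_compat|]; lra. }
    apply Rmult_le_pos; [|lra]; apply Rmult_le_pos; [|nra]; nra. }
rewrite Rminus_diag, exp_0 in V.
pose proof (bessel_ge1 (1 ^ 2 / 4) ltac:(lra)) as H1; fold (bden 1) in H1.
apply Rle_div_l; [nra|].
assert (E : exp (1 - z) * exp (z - 1) = 1) by (rewrite <- exp_plus, <- exp_0; f_equal; ring).
assert (1 * exp (z - 1) <= bden z * (z ^ 2 * exp (1 - z)) * exp (z - 1)).
{ apply Rmult_le_compat_r; [left; apply exp_pos|lra]. }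
replace (bden z * (z ^ 2 * exp (1 - z)) * exp (z - 1)) with (bden z * z ^ 2 * (exp (1 - z) * exp (z - 1))) in H by ring.
rewrite E in H; lra.
Qed.

(** * The inequality for large indices *)

Lemma mvt_pos (F f : R -> R) a b : (forall t, 0 < t -> is_derive F t (f t)) -> 0 < a <= b ->
  exists c, a <= c <= b /\ F b - F a = f c * (b - a).
Proof.
intros HF Hab; destruct (MVT_gen F a b f) as [c [Hc E]].
- intros x; rewrite Rmin_left, Rmax_right by lra; intros; apply HF; lra.
- intros x; rewrite Rmin_left, Rmax_right by lra; intros; apply derive_continuity_pt with (f x), HF; lra.
- rewrite Rmin_left, Rmax_right in Hc by lra; exists c; auto.
Qed.

Lemma Rder_shift (F : R -> R) (t k l : R) : is_derive F (t + k) l -> is_derive (fun x => F (x + k)) t l.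
Proof.
intros H; apply (Rder_eq _ _ (1 * l)); [ring|].
apply (Rder_comp F (fun x => x + k)); auto; auto_derive; auto; ring.
Qed.

Lemma second_difference (F f f' : R -> R) k x : 0 < k < x ->
  (forall t, 0 < t -> is_derive F t (f t)) -> (forall t, 0 < t -> is_derive f t (f' t)) ->
  exists c, x - k <= c <= x + k /\ F (x + k) - 2 * F x + F (x - k) = f' c * k ^ 2.
Proof.
intros Hk HF Hf.
destruct (mvt_pos (fun t => F (t + k) - F t) (fun t => f (t + k) - f t) (x - k) x) as [c [Hc E]]; [|lra|].
- intros t Ht; apply Rder_minus; [apply Rder_shift|]; apply HF; lra.
- destruct (mvt_pos f f' c (c + k) Hf ltac:(lra)) as [d [Hd E2]].
  exists d; split; [lra|].
  rewrite E2 in E; replace (x - k + k) with x in E by ring; replace (c + k - c) with k in E by ring.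
  replace (x - (x - k)) with k in E by ring; lra.
Qed.

Lemma third_difference (F f f' f'' : R -> R) k x : 0 < k < x ->
  (forall t, 0 < t -> is_derive F t (f t)) -> (forall t, 0 < t -> is_derive f t (f' t)) ->
  (forall t, 0 < t -> is_derive f' t (f'' t)) ->
  exists c, x - k <= c <= x + 2 * k /\
   (F (x + 2 * k) - 2 * F (x + k) + F x) - (F (x + k) - 2 * F x + F (x - k)) = f'' c * k ^ 3.
Proof.
intros Hk HF Hf Hf'.
destruct (second_difference (fun t => F (t + k) - F t) (fun t => f (t + k) - f t) (fun t => f' (t + k) - f' t) k x) as [c [Hc E]]; auto.
- intros t Ht; apply Rder_minus; [apply Rder_shift|]; apply HF; lra.
- intros t Ht; apply Rder_minus; [apply Rder_shift|]; apply Hf; lra.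
- destruct (mvt_pos f' f'' c (c + k) Hf' ltac:(lra)) as [d [Hd E2]].
  exists d; split; [lra|].
  rewrite E2 in E; replace (x + 2 * k) with (x + k + k) by ring; replace (x - k + k) with x in E by ring.
  replace (c + k - c) with k in E by ring; lra.
Qed.

Definition lgh (v : R) : R := ln (bessel v).

Definition dlgh (v : R) : R := bessel1 v / bessel v.

(** The second derivative of [bessel] is eliminated by its differential equation, so the higher
    logarithmic derivatives are polynomials in [dlgh] and 1/v and need only bounds on the ratio. *)
Definition d2lgh (v : R) : R := (1 - 2 * dlgh v) / v - dlgh v ^ 2.

Definition d3lgh (v : R) : R := - 2 * d2lgh v / v - (1 - 2 * dlgh v) / v ^ 2 - 2 * dlgh v * d2lgh v.

Lemma lgh_derive v : 0 < v -> is_derive lgh v (dlgh v).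
Proof.
intros Hv; pose proof (bessel_ge1 v ltac:(lra)).
apply (Rder_eq _ _ (bessel1 v * / bessel v)); [reflexivity|].
apply (Rder_comp ln bessel); [|apply bessel_derive].
apply is_derive_ln; lra.
Qed.

Lemma dlgh_derive v : 0 < v -> is_derive dlgh v (d2lgh v).
Proof.
intros Hv; pose proof (bessel_ge1 v ltac:(lra)) as H.
pose proof (is_derive_div bessel1 bessel v _ _ (bessel1_derive v Hv) (bessel_derive v) (Rgt_not_eq _ _ (Rlt_le_trans 0 1 _ Rlt_0_1 H))) as D.
eapply Rder_eq; [|exact D].
unfold d2lgh, dlgh, minus, plus, opp, mult, scal; simpl; field; split; lra.
Qed.

Lemma d2lgh_derive v : 0 < v -> is_derive d2lgh v (d3lgh v).
Proof.
intros Hv; unfold d2lgh.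
pose proof (dlgh_derive v Hv) as D.
pose proof (Rder_mult dlgh dlgh v _ _ D D) as D2.
assert (Di : is_derive (fun v => / v) v (- / v ^ 2)) by (auto_derive; [lra|field; lra]).
assert (D1 : is_derive (fun v => 1 + (-2) * dlgh v) v (0 + (-2) * d2lgh v)).
{ apply Rder_plus; [apply (is_derive_const (K := R_AbsRing) (V := R_NormedModule))|apply Rder_scal; auto]. }
pose proof (Rder_minus _ _ _ _ _ (Rder_mult _ _ v _ _ D1 Di) D2) as E.
apply (Rder_ext (fun x => (1 + (-2) * dlgh x) * / x - dlgh x * dlgh x)).
- intros x; unfold Rdiv; ring.
- eapply Rder_eq; [|exact E]; unfold d3lgh, d2lgh; field; lra.
Qed.

Definition zv (v : R) : R := 2 * sqrt v.

Lemma zv_sq v : 0 <= v -> v = zv v ^ 2 / 4.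
Proof. intros H; unfold zv; rewrite Rpow_mult_distr, pow2_sqrt by auto; field. Qed.

Lemma dlgh_bratio v : 0 < v -> dlgh v = 2 * bratio (zv v) / zv v.
Proof.
intros Hv; unfold bratio; rewrite <- zv_sq by lra; unfold dlgh.
assert (0 < zv v) by (unfold zv; pose proof (sqrt_lt_R0 v Hv); lra).
pose proof (bessel_ge1 v ltac:(lra)); field; lra.
Qed.

(** The leading terms 1 and r^2 cancel and leave -4 w^3 with w = 1/z. The factor 0.96 absorbs the
    next order for w <= 1/100 and still satisfies 0.96 PI > 3 in [Dlog_upper]. *)
Lemma d2lgh_upper v : 0 < v -> 100 <= zv v -> d2lgh v <= - (384 / 100) / zv v ^ 3.
Proof.
intros Hv Hz; unfold d2lgh; rewrite dlgh_bratio by auto.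
pose proof (bratio_lower (zv v) ltac:(lra)) as L.
pose proof (zv_sq v ltac:(lra)) as Ev.
set (z := zv v) in *; clearbody z; set (r := bratio z) in *; rewrite Ev.
set (w := / z).
assert (Hw : 0 < w <= 1 / 100).
{ unfold w; split; [apply Rinv_0_lt_compat; lra|].
  replace (1 / 100) with (/ 100) by field; apply Rinv_le_contravar; lra. }
replace (3 / (2 * z)) with (3 / 2 * w) in L by (unfold w; field; lra).
replace ((1 - 2 * (2 * r / z)) / (z ^ 2 / 4) - (2 * r / z) ^ 2) with (4 * w ^ 2 * (1 - 4 * r * w - r ^ 2)) by (unfold w; field; lra).
replace (- (384 / 100) / z ^ 3) with (4 * w ^ 2 * (- (96 / 100) * w)) by (unfold w; field; lra).
apply Rmult_le_compat_l; [nra|]; nra.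
Qed.

(** Both bounds on the ratio give r = 1 - (3/2) w + c w^2 with 0 <= c <= 1. In this parametrisation
    all orders below w^5 cancel identically, leaving -16 Y w^5 with |Y| <= 3. *)
Lemma d3lgh_bound v : 0 < v -> 100 <= zv v -> Rabs (d3lgh v) <= 48 / zv v ^ 5.
Proof.
intros Hv Hz; unfold d3lgh, d2lgh; rewrite dlgh_bratio by auto.
pose proof (bratio_lower (zv v) ltac:(lra)) as L; pose proof (bratio_upper (zv v) ltac:(lra)) as U.
pose proof (zv_sq v ltac:(lra)) as Ev.
set (z := zv v) in *; clearbody z; set (r := bratio z) in *; rewrite Ev.
set (w := / z).
assert (Hw : 0 < w <= 1 / 100).
{ unfold w; split; [apply Rinv_0_lt_compat; lra|].
  replace (1 / 100) with (/ 100) by field; apply Rinv_le_contravar; lra. }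
set (c := (r - 1 + 3 / 2 * w) / w ^ 2).
assert (Hc : 0 <= c <= 1).
{ replace (3 / (2 * z)) with (3 / 2 * w) in L, U by (unfold w; field; lra).
  replace (1 / z ^ 2) with (w ^ 2) in U by (unfold w; field; lra).
  assert (0 < w ^ 2) by nra.
  unfold c; split; [apply Rdiv_le_0_compat; lra|apply Rle_div_l; lra]. }
set (f := - (3 / 2) + c * w).
assert (Er : r = 1 + w * f) by (unfold f, c; field; lra).
assert (Ez : z = / w) by (unfold w; rewrite Rinv_inv; auto).
set (Y := - 2 * c - 3 * f ^ 2 - 12 * f - 12 - w * (f ^ 3 + 6 * f ^ 2 + 12 * f)).
replace (- 2 * ((1 - 2 * (2 * r / z)) / (z ^ 2 / 4) - (2 * r / z) ^ 2) / (z ^ 2 / 4) - (1 - 2 * (2 * r / z)) / (z ^ 2 / 4) ^ 2 -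
   2 * (2 * r / z) * ((1 - 2 * (2 * r / z)) / (z ^ 2 / 4) - (2 * r / z) ^ 2)) with (w ^ 5 * (- 16 * Y)).
- replace (48 / z ^ 5) with (w ^ 5 * 48) by (unfold w; field; lra).
  rewrite Rabs_mult, (Rabs_pos_eq (w ^ 5)) by (apply pow_le; lra).
  apply Rmult_le_compat_l; [apply pow_le; lra|].
  assert (Hf : - (3 / 2) <= f <= - (149 / 100)) by (unfold f; split; nra).
  assert (A1 : 222 / 100 <= f ^ 2 <= 225 / 100) by nra.
  assert (A2 : - (34 / 10) <= f ^ 3 <= - (33 / 10)) by (replace (f ^ 3) with (f * f ^ 2) by ring; nra).
  assert (A3 : Rabs (f ^ 3 + 6 * f ^ 2 + 12 * f) <= 9) by (apply Rabs_le; lra).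
  assert (A4 : Rabs (w * (f ^ 3 + 6 * f ^ 2 + 12 * f)) <= 9 / 100).
  { rewrite Rabs_mult, (Rabs_pos_eq w) by lra.
    pose proof (Rabs_pos (f ^ 3 + 6 * f ^ 2 + 12 * f)).
    replace (9 / 100) with (1 / 100 * 9) by field; apply Rmult_le_compat; lra. }
  apply Rabs_le_between in A4.
  assert (A5 : - (82 / 100) <= - 3 * f ^ 2 - 12 * f - 12 <= - (60 / 100)).
  { split; nra. }
  apply Rabs_le; unfold Y; lra.
- rewrite Er, Ez; unfold Y.
  assert (Ec : c * w = f + 3 / 2) by (unfold f; ring).
  assert (Ec2 : c = (f + 3 / 2) / w) by (rewrite <- Ec; field; lra).
  rewrite Ec2; field; lra.
Qed.

(* With [u], [v] as in [turan_expr], [al = 1 - u] and [be = 1 - v]. *)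
Lemma turan_core (al be L : R) : 0 < L -> L <= al <= 1 -> L <= be <= 1 -> (al - be) ^ 2 <= 3 * L ^ 3 ->
  0 <= 4 * al * be - (al + be - al * be) ^ 2.
Proof.
intros HL Ha Hb H.
replace (4 * al * be - (al + be - al * be) ^ 2) with
  (al * be * (2 * (al + be) - al * be) - (al - be) ^ 2) by ring.
assert (L ^ 2 <= al * be) by nra.
assert (3 * L <= 2 * (al + be) - al * be) by nra.
assert (L ^ 2 * (3 * L) <= al * be * (2 * (al + be) - al * be)) by (apply Rmult_le_compat; nra).
nra.
Qed.

Lemma turan_expr (a b c d : R) : 0 < b -> 0 < c ->
  4 * (b ^ 2 - a * c) * (c ^ 2 - b * d) - (b * c - a * d) ^ 2 =
  b ^ 2 * c ^ 2 * (let u := a * c / b ^ 2 in let v := b * d / c ^ 2 in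
    4 * (1 - u) * (1 - v) - ((1 - u) + (1 - v) - (1 - u) * (1 - v)) ^ 2).
Proof. intros Hb Hc; cbv zeta; field; lra. Qed.

(** For dl <= 1/100 the quotient (1 + dl)^2 / (1 - dl)^2 is at most 1 + 5 dl. As the unperturbed
    ratio is at most 1, the relative error is also an absolute one. *)
Lemma ratio_perturb (A B C a b c dl : R) : 0 < A -> 0 < B -> 0 < C -> 0 <= dl <= 1 / 100 ->
  Rabs (a - A) <= dl * A -> Rabs (b - B) <= dl * B -> Rabs (c - C) <= dl * C -> A * C <= B ^ 2 ->
  0 < b /\ 0 < a * c / b ^ 2 /\ Rabs (a * c / b ^ 2 - A * C / B ^ 2) <= 5 * dl.
Proof.
intros HA HB HC Hd Ha Hb Hc Hu.
apply Rabs_le_between in Ha; apply Rabs_le_between in Hb; apply Rabs_le_between in Hc.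
assert (Pa : (1 - dl) * A <= a <= (1 + dl) * A) by lra.
assert (Pb : (1 - dl) * B <= b <= (1 + dl) * B) by lra.
assert (Pc : (1 - dl) * C <= c <= (1 + dl) * C) by lra.
assert (b0 : 0 < b) by nra.
assert (a0 : 0 < a) by nra. assert (c0 : 0 < c) by nra.
split; auto; split; [apply Rdiv_lt_0_compat; nra|].
set (u := A * C / B ^ 2).
assert (Eu : A * C = u * B ^ 2) by (unfold u; field; lra).
assert (Hu0 : 0 < u <= 1).
{ unfold u; split; [apply Rdiv_lt_0_compat; nra|apply Rle_div_l; nra]. }
assert (L1 : (1 - dl) ^ 2 * (A * C) <= a * c).
{ replace ((1 - dl) ^ 2 * (A * C)) with (((1 - dl) * A) * ((1 - dl) * C)) by ring; apply Rmult_le_compat; nra. }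
assert (U1 : a * c <= (1 + dl) ^ 2 * (A * C)).
{ replace ((1 + dl) ^ 2 * (A * C)) with (((1 + dl) * A) * ((1 + dl) * C)) by ring; apply Rmult_le_compat; nra. }
assert (L2 : (1 - dl) ^ 2 * B ^ 2 <= b ^ 2) by (rewrite <- Rpow_mult_distr; apply pow_incr; nra).
assert (U2 : b ^ 2 <= (1 + dl) ^ 2 * B ^ 2) by (rewrite <- Rpow_mult_distr; apply pow_incr; nra).
assert (HB2 : 0 < u * B ^ 2) by nra.
rewrite Eu in L1, U1.
assert (b2 : 0 < b ^ 2) by nra.
assert (k1 : (1 + dl) ^ 2 <= (1 + 5 * dl) * (1 - dl) ^ 2) by nra.
assert (k2 : (1 - 5 * dl) * (1 + dl) ^ 2 <= (1 - dl) ^ 2) by nra.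
assert (UU : a * c / b ^ 2 <= u * (1 + 5 * dl)).
{ apply Rle_div_l; auto.
  apply Rle_trans with ((1 + dl) ^ 2 * (u * B ^ 2)); auto.
  apply Rle_trans with (u * (1 + 5 * dl) * ((1 - dl) ^ 2 * B ^ 2)).
  - replace (u * (1 + 5 * dl) * ((1 - dl) ^ 2 * B ^ 2)) with ((1 + 5 * dl) * (1 - dl) ^ 2 * (u * B ^ 2)) by ring.
    apply Rmult_le_compat_r; lra.
  - apply Rmult_le_compat_l; nra. }
assert (LL : u * (1 - 5 * dl) <= a * c / b ^ 2).
{ apply (proj1 (Rle_div_r _ _ _ b2)).
  apply Rle_trans with ((1 - dl) ^ 2 * (u * B ^ 2)); auto.
  apply Rle_trans with (u * (1 - 5 * dl) * ((1 + dl) ^ 2 * B ^ 2)).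
  - apply Rmult_le_compat_l; nra.
  - replace (u * (1 - 5 * dl) * ((1 + dl) ^ 2 * B ^ 2)) with ((1 - 5 * dl) * (1 + dl) ^ 2 * (u * B ^ 2)) by ring.
    apply Rmult_le_compat_r; lra. }
apply Rabs_le; nra.
Qed.

Definition kap : R := 4 * PI ^ 2.

(* [Mx x = Mt x + kap], so [Mx] is the main term up to a negligible constant. *)
Definition Mx (x : R) : R := kap * bessel (kap * x).

Lemma kap_pos : 0 < kap.
Proof. unfold kap; pose proof PI_RGT_0; nra. Qed.

Lemma Mt_Mx x : 0 <= x -> Mt x = Mx x - kap.
Proof.
intros Hx; apply is_series_unique.
pose proof (is_series_Rscal kap _ _ (ex_h hcoef (kap * x) CV_hcoef)) as Q.
apply is_series_tail in Q.
replace (Mx x - kap) with (kap * PSeries hcoef (kap * x) - kap * (hcoef 0 * (kap * x) ^ 0)).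
- revert Q; apply is_series_Rext; intros k; unfold mterm, hcoef; fold kap.
  rewrite Rpow_mult_distr; simpl (kap ^ S (S k)).
  pose proof (INR_fact_lt_0 (S k)); pose proof (INR_fact_lt_0 (S (S k))); simpl (kap ^ S k); field; lra.
- unfold Mx, bessel, hcoef; simpl; field.
Qed.

Lemma zv_kap x : 0 <= x -> zv (kap * x) = 4 * PI * sqrt x.
Proof.
intros Hx; unfold zv, kap.
pose proof PI_RGT_0.
replace (4 * PI ^ 2 * x) with ((2 * PI) * (2 * PI) * x) by ring.
rewrite sqrt_mult, sqrt_square by nra; ring.
Qed.

Lemma Mx_lower x : 1 <= x -> exp (4 * PI * sqrt x - 1) / (4 * x) <= Mx x.
Proof.
intros Hx.
assert (Hs : 1 <= sqrt x) by (rewrite <- sqrt_1; apply sqrt_le_1; lra).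
pose proof PI_lower as PL; pose proof kap_pos.
assert (Hz : 1 <= zv (kap * x)) by (rewrite zv_kap by lra; nra).
pose proof (bden_lower _ Hz) as B; unfold bden in B; rewrite <- zv_sq in B by nra.
replace (zv (kap * x) ^ 2) with (4 * (kap * x)) in B by (rewrite (zv_sq (kap * x)) at 1 by nra; field).
rewrite zv_kap in B by lra; unfold Mx.
replace (exp (4 * PI * sqrt x - 1) / (4 * x)) with (kap * (exp (4 * PI * sqrt x - 1) / (4 * (kap * x)))) by (field; lra).
apply Rmult_le_compat_l; lra.
Qed.

(** Shaped for [coef_relative_error]: 5/2 is below 2 PI - 15/4, and 720 = 3 * 80 * 3 collects the 3
    in front of [A], the factor 80 s^8 = 20 x^3 * 4 x, and exp 1 <= 3. At s = 12 it holds since 16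
    <= exp 3 and 720 * 12^8 < 16^10; beyond that the exponential grows faster. *)
Lemma exp_dominates s : 12 <= s -> 720 * s ^ 8 <= exp (5 / 2 * s).
Proof.
intros Hs.
set (t := (s - 12) / 12).
assert (Ht : 0 <= t) by (unfold t; lra).
assert (Es : s = 12 * (1 + t)) by (unfold t; field).
assert (H1 : s ^ 8 <= 12 ^ 8 * exp (8 * t)).
{ rewrite Es, Rpow_mult_distr; apply Rmult_le_compat_l; [apply pow_le; lra|].
  replace (8 * t) with (INR 8 * t) by (simpl; ring); rewrite <- exp_pow.
  apply pow_incr; pose proof (exp_ge_1p t); lra. }
assert (H2 : 720 * 12 ^ 8 <= exp 30).
{ assert (E8 : 9 / 8 <= exp (1 / 8)) by (pose proof (exp_ge_1p (1 / 8)); lra).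
  assert (E3 : 16 <= exp 3).
  { replace 3 with (INR 8 * (INR 3 * (1 / 8))) by (simpl; field); rewrite <- !exp_pow.
    apply Rle_trans with ((142 / 100) ^ 8); [simpl; lra|].
    apply pow_incr; split; [lra|].
    apply Rle_trans with ((9 / 8) ^ 3); [simpl; lra|apply pow_incr; lra]. }
  replace 30 with (INR 10 * 3) by (simpl; field); rewrite <- exp_pow.
  apply Rle_trans with (16 ^ 10); [simpl; lra|apply pow_incr; lra]. }
replace (5 / 2 * s) with (30 + 30 * t) by (rewrite Es; field); rewrite exp_plus.
assert (H3 : exp (8 * t) <= exp (30 * t)) by (apply exp_mono; lra).
pose proof (exp_pos (8 * t)).
apply Rle_trans with (720 * 12 ^ 8 * exp (8 * t)); [lra|].
  apply Rmult_le_compat; lra.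
Qed.

(** The exponential saving is spent on a power k^(-3), which is just beyond the order k^(-5/2) of
    the differences to be controlled. *)
Lemma coef_relative_error (c : nat -> Z) k : j_fourier_coefficients c -> (144 <= k)%nat ->
  Rabs (IZR (c k) - Mx (INR k)) <= / (20 * INR k ^ 3) * Mx (INR k).
Proof.
intros Hc Hk.
assert (Hk' : 144 <= INR k) by (apply le_INR in Hk; simpl in Hk; lra).
pose proof (coef_error c k Hc Hk) as E; rewrite Mt_Mx in E by lra.
set (x := INR k) in *.
set (s := sqrt x) in *.
assert (Hs : 12 <= s).
{ replace 12 with (sqrt (12 * 12)) by (apply sqrt_square; lra); apply sqrt_le_1; lra. }
assert (Hx : x = s ^ 2) by (unfold s; rewrite pow2_sqrt; lra).
pose proof PI_lower as PL; pose proof PI_upper as PU.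
pose proof (Mx_lower x ltac:(lra)) as L; fold s in L.
pose proof (exp_dominates s Hs) as D.
set (A := exp ((2 * PI + 15 / 4) * s)) in *.
assert (HA : kap <= A).
{ unfold kap, A; eapply Rle_trans; [|apply exp_ge_1p]; nra. }
assert (Rabs (IZR (c k) - Mx x) <= 3 * A).
{ replace (IZR (c k) - Mx x) with ((IZR (c k) - (Mx x - kap)) + - kap) by ring.
  eapply Rle_trans; [apply Rabs_triang|]; rewrite Rabs_Ropp, (Rabs_pos_eq kap) by (left; apply kap_pos); lra. }
eapply Rle_trans; [exact H|].
apply Rle_trans with (/ (20 * x ^ 3) * (exp (4 * PI * s - 1) / (4 * x))).
2:{ apply Rmult_le_compat_l; auto; left; apply Rinv_0_lt_compat; assert (0 < x ^ 3) by (apply pow_lt; lra); lra. }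
replace (/ (20 * x ^ 3) * (exp (4 * PI * s - 1) / (4 * x))) with (exp (4 * PI * s - 1) / (80 * s ^ 8)) by (rewrite Hx; field; lra).
assert (0 < s ^ 8) by (apply pow_lt; lra).
apply (proj1 (Rle_div_r _ _ (80 * s ^ 8) ltac:(lra))).
replace (4 * PI * s - 1) with ((2 * PI + 15 / 4) * s + (2 * PI - 15 / 4) * s + - (1)) by ring.
rewrite !exp_plus; fold A.
assert (HA0 : 0 < A) by apply exp_pos.
assert (D2 : 720 * s ^ 8 <= exp ((2 * PI - 15 / 4) * s)).
{ eapply Rle_trans; [exact D|]; apply exp_mono; apply Rmult_le_compat_r; lra. }
assert (E1 : / 3 <= exp (- (1))).
{ rewrite exp_Ropp; apply Rinv_le_contravar; [apply exp_pos|apply exp_le_3]. }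
rewrite (Rmult_assoc A (exp ((2 * PI - 15 / 4) * s))).
replace (3 * A * (80 * s ^ 8)) with (A * (720 * s ^ 8 * / 3)) by field.
apply Rmult_le_compat_l; [lra|]; apply Rmult_le_compat; lra.
Qed.

(* The second difference of [ln Mx] at [x]. *)
Definition Dlog (x : R) : R := lgh (kap * x + kap) - 2 * lgh (kap * x) + lgh (kap * x - kap).

Lemma Mx_ratio x : 1 < x -> Mx (x - 1) * Mx (x + 1) / Mx x ^ 2 = exp (Dlog x).
Proof.
intros Hx; pose proof kap_pos as K; unfold Mx, Dlog, lgh.
replace (kap * (x - 1)) with (kap * x - kap) by ring; replace (kap * (x + 1)) with (kap * x + kap) by ring.
pose proof (bessel_ge1 (kap * x - kap) ltac:(nra)); pose proof (bessel_ge1 (kap * x + kap) ltac:(nra)); pose proof (bessel_ge1 (kap * x) ltac:(nra)).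
unfold Rminus at 2; rewrite !exp_plus, exp_Ropp.
replace (2 * ln (bessel (kap * x))) with (INR 2 * ln (bessel (kap * x))) by (simpl; ring).
rewrite <- exp_pow, !exp_ln by lra.
field; split; lra.
Qed.

(** A second difference is a second derivative at an intermediate point. The factor kap^2 against (4
    PI)^3 turns 3.84 into 0.96 PI, which exceeds 3. *)
Lemma Dlog_upper x S : 100 <= x -> x + 1 <= S ^ 2 -> 0 < S -> Dlog x <= - 3 / S ^ 3.
Proof.
intros Hx HS S0; pose proof kap_pos as K; pose proof PI_lower as PL.
destruct (second_difference lgh dlgh d2lgh kap (kap * x) ltac:(nra) lgh_derive dlgh_derive) as [c [Hc E]].
unfold Dlog; rewrite E.
assert (c0 : 0 < c) by nra.
assert (Ec : c = kap * (c / kap)) by (field; lra).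
set (e := c / kap) in *.
assert (He : x - 1 <= e <= x + 1) by (rewrite Ec in Hc; split; nra).
pose proof (zv_kap e ltac:(lra)) as Z; rewrite <- Ec in Z.
assert (Hse : 9 <= sqrt e).
{ replace 9 with (sqrt (9 * 9)) by (apply sqrt_square; lra); apply sqrt_le_1; lra. }
assert (HseS : sqrt e <= S).
{ rewrite <- (sqrt_pow2 S) by lra; apply sqrt_le_1; lra. }
pose proof (d2lgh_upper c c0 ltac:(rewrite Z; nra)) as P; rewrite Z in P.
apply Rle_trans with (- (384 / 100) / (4 * PI * sqrt e) ^ 3 * kap ^ 2); [apply Rmult_le_compat_r; [nra|auto]|].
replace (- (384 / 100) / (4 * PI * sqrt e) ^ 3 * kap ^ 2) with (- (96 / 100 * PI * / sqrt e ^ 3)) by (unfold kap; field; lra).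
replace (- 3 / S ^ 3) with (- (3 * / S ^ 3)) by (field; lra).
apply Ropp_le_contravar, Rmult_le_compat; try lra.
- left; apply Rinv_0_lt_compat, pow_lt; auto.
- apply Rinv_le_contravar; [apply pow_lt; lra|apply pow_incr; lra].
Qed.

(** A difference of adjacent second differences is a third derivative; 48 kap^3 / (4 PI)^5 equals 3
    PI. *)
Lemma Dlog_diff x T : 100 <= x -> T ^ 2 <= x - 1 -> 0 < T -> Rabs (Dlog (x + 1) - Dlog x) <= 3 * PI / T ^ 5.
Proof.
intros Hx HT T0; pose proof kap_pos as K; pose proof PI_lower as PL.
destruct (third_difference lgh dlgh d2lgh d3lgh kap (kap * x) ltac:(nra) lgh_derive dlgh_derive d2lgh_derive) as [c [Hc E]].
unfold Dlog; replace (kap * (x + 1) + kap) with (kap * x + 2 * kap) by ring.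
replace (kap * (x + 1) - kap) with (kap * x) by ring; replace (kap * (x + 1)) with (kap * x + kap) by ring.
rewrite E.
assert (c0 : 0 < c) by nra.
assert (Ec : c = kap * (c / kap)) by (field; lra).
set (e := c / kap) in *.
assert (He : x - 1 <= e) by (rewrite Ec in Hc; nra).
pose proof (zv_kap e ltac:(lra)) as Z; rewrite <- Ec in Z.
assert (Hse : 9 <= sqrt e).
{ replace 9 with (sqrt (9 * 9)) by (apply sqrt_square; lra); apply sqrt_le_1; lra. }
assert (HseT : T <= sqrt e).
{ rewrite <- (sqrt_pow2 T) by lra; apply sqrt_le_1; lra || nra. }
pose proof (d3lgh_bound c c0 ltac:(rewrite Z; nra)) as P; rewrite Z in P.
rewrite Rabs_mult, (Rabs_pos_eq (kap ^ 3)) by (apply pow_le; lra).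
apply Rle_trans with (48 / (4 * PI * sqrt e) ^ 5 * kap ^ 3); [apply Rmult_le_compat_r; [apply pow_le; lra|auto]|].
replace (48 / (4 * PI * sqrt e) ^ 5 * kap ^ 3) with (3 * PI * / sqrt e ^ 5) by (unfold kap; field; lra).
apply Rmult_le_compat_l; [lra|].
apply Rinv_le_contravar; [apply pow_lt; auto|apply pow_incr; lra].
Qed.

Lemma exp_lip a b : a <= 0 -> b <= 0 -> Rabs (exp a - exp b) <= Rabs (a - b).
Proof.
assert (W : forall a b, a <= b -> b <= 0 -> Rabs (exp a - exp b) <= Rabs (a - b)).
{ intros x y Hxy Hy.
  assert (exp x <= exp y) by (apply exp_mono; auto).
  rewrite !Rabs_left1 by lra.
  pose proof (exp_ge_1p (x - y)) as L; pose proof (exp_pos y).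
  assert (exp y <= 1) by (rewrite <- exp_0; apply exp_mono; auto).
  assert (exp x = exp y * exp (x - y)) by (rewrite <- exp_plus; f_equal; ring).
  nra. }
intros Ha Hb; destruct (Rle_dec a b); [apply W; auto|].
rewrite <- Rabs_Ropp, <- (Rabs_Ropp (a - b)), !Ropp_minus_distr; apply W; lra.
Qed.

Lemma turan_large (c : nat -> Z) n : j_fourier_coefficients c -> (145 <= n)%nat ->
  let a k := IZR (c k) in
  0 <= 4 * (a n ^ 2 - a (n - 1)%nat * a (n + 1)%nat) * (a (n + 1)%nat ^ 2 - a n * a (n + 2)%nat)
     - (a n * a (n + 1)%nat - a (n - 1)%nat * a (n + 2)%nat) ^ 2.
Proof.
intros Hc Hn a.
assert (Hn' : 145 <= INR n) by (apply le_INR in Hn; simpl in Hn; lra).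
set (x := INR n) in *.
assert (X0 : INR (n - 1) = x - 1) by (unfold x; rewrite minus_INR by lia; reflexivity).
assert (X1 : INR (n + 1) = x + 1) by (unfold x; rewrite plus_INR; reflexivity).
assert (X2 : INR (n + 2) = x + 2) by (unfold x; rewrite plus_INR; simpl; ring).
set (dl := / (20 * (x - 1) ^ 3)).
assert (MP : forall y, 1 <= y -> 0 < Mx y).
{ intros y Hy; unfold Mx; pose proof kap_pos; pose proof (bessel_ge1 (kap * y) ltac:(nra)); nra. }
assert (HE : forall k, (n - 1 <= k)%nat -> Rabs (a k - Mx (INR k)) <= dl * Mx (INR k)).
{ intros k Hk; eapply Rle_trans; [apply coef_relative_error; auto; lia|].
  assert (x - 1 <= INR k) by (rewrite <- X0; apply le_INR; auto).
  apply Rmult_le_compat_r; [left; apply MP; lra|].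
  unfold dl; assert (0 < (x - 1) ^ 3) by (apply pow_lt; lra).
  apply Rinv_le_contravar; [lra|]; apply Rmult_le_compat_l; [lra|apply pow_incr; lra]. }
pose proof (HE (n - 1)%nat ltac:(lia)) as E0; rewrite X0 in E0.
pose proof (HE n ltac:(lia)) as E1; fold x in E1.
pose proof (HE (n + 1)%nat ltac:(lia)) as E2; rewrite X1 in E2.
pose proof (HE (n + 2)%nat ltac:(lia)) as E3; rewrite X2 in E3.
(* All intermediate points lie between x - 1 and x + 2. The lower bound on 1 - u uses the largest
   root, the bound on its variation the smallest; [TS] compares them so that everything is expressed
   in w = 1 / S. *)
set (S := sqrt (x + 2)). set (T := sqrt (x - 1)).
assert (S2 : S ^ 2 = x + 2) by (apply pow2_sqrt; lra).
assert (T2 : T ^ 2 = x - 1) by (apply pow2_sqrt; lra).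
assert (HS : 12 <= S).
{ replace 12 with (sqrt (12 * 12)) by (apply sqrt_square; lra); apply sqrt_le_1; lra. }
assert (HT : 12 <= T).
{ replace 12 with (sqrt (12 * 12)) by (apply sqrt_square; lra); apply sqrt_le_1; lra. }
set (D := Dlog x). set (D' := Dlog (x + 1)).
assert (U1 : D <= - 3 / S ^ 3) by (apply Dlog_upper; lra).
assert (U2 : D' <= - 3 / S ^ 3) by (apply Dlog_upper; lra).
assert (V : Rabs (D' - D) <= 3 * PI / T ^ 5) by (apply Dlog_diff; lra).
pose proof PI_upper as PU; pose proof PI_lower as PL.
set (w := / S).
assert (Hw : 0 < w <= 1 / 12).
{ unfold w; split; [apply Rinv_0_lt_compat; lra|]; replace (1 / 12) with (/ 12) by field; apply Rinv_le_contravar; lra. }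
replace (- 3 / S ^ 3) with (- (3 * w ^ 3)) in U1, U2 by (unfold w; field; lra).
assert (w3 : 0 < w ^ 3 <= 1 / 1728).
{ split; [apply pow_lt; lra|]; apply Rle_trans with ((1 / 12) ^ 3); [apply pow_incr; lra|simpl; lra]. }
assert (TS : 98 / 100 * S <= T).
{ apply Rsqr_incr_0_var; [|lra]; rewrite !Rsqr_pow2, Rpow_mult_distr, S2, T2; lra. }
assert (V2 : 3 * PI / T ^ 5 <= 11 * w ^ 5).
{ apply Rle_trans with (3 * (3144 / 1000) * / (98 / 100 * S) ^ 5).
  - apply Rmult_le_compat; try lra; [left; apply Rinv_0_lt_compat, pow_lt; lra|].
    apply Rinv_le_contravar; [apply pow_lt; lra|apply pow_incr; lra].
  - replace (/ (98 / 100 * S) ^ 5) with (/ (98 / 100) ^ 5 * w ^ 5) by (unfold w; field; lra).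
    rewrite <- Rmult_assoc; apply Rmult_le_compat_r; [apply pow_le; lra|].
    apply (Rmult_le_reg_r ((98 / 100) ^ 5)); [simpl; lra|].
    rewrite Rmult_assoc, Rinv_l by (simpl; lra); simpl; lra. }
assert (Hdl : 0 < dl <= 6 / 100 * w ^ 6).
{ unfold dl; assert (0 < (x - 1) ^ 3) by (apply pow_lt; lra); split; [apply Rinv_0_lt_compat; lra|].
  rewrite <- T2, <- pow_mult; simpl (2 * 3)%nat.
  apply Rle_trans with (/ (20 * (98 / 100 * S) ^ 6)).
  - apply Rinv_le_contravar; [assert (0 < (98 / 100 * S) ^ 6) by (apply pow_lt; lra); lra|].
    apply Rmult_le_compat_l; [lra|apply pow_incr; lra].
  - replace (/ (20 * (98 / 100 * S) ^ 6)) with (/ (20 * (98 / 100) ^ 6) * w ^ 6) by (unfold w; field; lra).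
    apply Rmult_le_compat_r; [apply pow_le; lra|].
    apply (Rmult_le_reg_r (20 * (98 / 100) ^ 6)); [simpl; lra|].
    rewrite Rinv_l by (simpl; lra); simpl; lra. }
assert (w6 : w ^ 6 = w ^ 3 * w ^ 3) by ring.
assert (w65 : w ^ 6 <= 1 / 12 * w ^ 5).
{ replace (w ^ 6) with (w * w ^ 5) by ring; apply Rmult_le_compat_r; [apply pow_le|]; lra. }
assert (dl <= 1 / 100) by (rewrite w6 in Hdl; nra).
assert (Ra : forall y, 2 <= y -> Dlog y <= 0 -> Mx (y - 1) * Mx (y + 1) <= Mx y ^ 2).
{ intros y Hy HD; pose proof (Mx_ratio y ltac:(lra)) as Q.
  assert (exp (Dlog y) <= 1) by (rewrite <- exp_0; apply exp_mono; auto).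
  rewrite <- Q in H0; apply Rle_div_l in H0; [lra|].
  apply pow_lt, MP; lra. }
destruct (ratio_perturb _ _ _ _ _ _ dl (MP (x - 1) ltac:(lra)) (MP x ltac:(lra)) (MP (x + 1) ltac:(lra)) ltac:(lra) E0 E1 E2)
  as [Pb [Pu Du]]; [apply Ra; [lra|fold D; lra]|].
destruct (ratio_perturb _ _ _ _ _ _ dl (MP x ltac:(lra)) (MP (x + 1) ltac:(lra)) (MP (x + 2) ltac:(lra)) ltac:(lra) E1 E2 E3)
  as [Pc [Pv Dv]].
{ pose proof (Ra (x + 1) ltac:(lra)) as Q; replace (x + 1 - 1) with x in Q by ring; replace (x + 1 + 1) with (x + 2) in Q by ring.
  apply Q; fold D'; lra. }
rewrite Mx_ratio in Du by lra; fold D in Du.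
assert (Q2 := Mx_ratio (x + 1) ltac:(lra)); replace (x + 1 - 1) with x in Q2 by ring; replace (x + 1 + 1) with (x + 2) in Q2 by ring.
rewrite Q2 in Dv; fold D' in Dv.
rewrite turan_expr by auto; cbv zeta.
apply Rmult_le_pos; [nra|].
set (u := a (n - 1)%nat * a (n + 1)%nat / a n ^ 2) in *.
set (v := a n * a (n + 2)%nat / a (n + 1)%nat ^ 2) in *.
apply Rabs_le_between in Du; apply Rabs_le_between in Dv.
assert (HX : exp (- (3 * w ^ 3)) <= 1 - 29 / 10 * w ^ 3).
{ pose proof (exp_ge_1p (3 * w ^ 3)) as L.
  assert (EE : exp (- (3 * w ^ 3)) * exp (3 * w ^ 3) = 1) by (rewrite <- exp_plus, <- exp_0; f_equal; ring).
  pose proof (exp_pos (- (3 * w ^ 3))); nra. }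
assert (HD1 : exp D <= 1 - 29 / 10 * w ^ 3) by (eapply Rle_trans; [apply exp_mono; exact U1|auto]).
assert (HD2 : exp D' <= 1 - 29 / 10 * w ^ 3) by (eapply Rle_trans; [apply exp_mono; exact U2|auto]).
pose proof (exp_lip D' D ltac:(lra) ltac:(lra)) as Lp.
(* The main terms contribute 11 w^5, and replacing both ratios by the true coefficients costs 10 dl,
   at most 0.6 w^6. *)
assert (Hdiff : Rabs (u - v) <= 115 / 10 * w ^ 5).
{ assert (Rabs (exp D' - exp D) <= 11 * w ^ 5) by lra.
  apply Rabs_le_between in H0; apply Rabs_le; lra. }
(* The loss from 29/10 to 28/10 pays for the coefficient error 5 dl. *)
apply (turan_core _ _ (28 / 10 * w ^ 3)); try (split; nra); [nra|].
replace (1 - u - (1 - v)) with (- (u - v)) by ring.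
replace ((- (u - v)) ^ 2) with (Rabs (u - v) ^ 2) by (rewrite pow2_abs; ring).
(* The square has order w^10 against w^9, so the spare factor w <= 1/12 compensates for the larger
   constant. *)
apply Rle_trans with ((115 / 10 * w ^ 5) ^ 2); [apply pow_incr; split; auto; apply Rabs_pos|].
replace ((115 / 10 * w ^ 5) ^ 2) with (13225 / 100 * w * w ^ 9) by (field).
replace (3 * (28 / 10 * w ^ 3) ^ 3) with (65856 / 1000 * w ^ 9) by field.
apply Rmult_le_compat_r; [apply pow_le|]; lra.
Qed.

(** * The finite check *)

(** Lists hold coefficients, lowest first, and the length is the precision: the first argument
    determines where the sum is truncated. *)
Fixpoint axpy (c : Z) (a b : list Z) : list Z :=
  match a, b with
  | x :: a', y :: b' => (x + c * y)%Z :: axpy c a' b'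
  | _, _ => a
  end.

Fixpoint mulacc (acc l m : list Z) : list Z :=
  match l with
  | nil => acc
  | x :: l' => mulacc (axpy x acc m) l' (0%Z :: m)
  end.

(* Long division of [e] by the series [1 + q t]. *)
Fixpoint sdiv (L : nat) (e t : list Z) : list Z :=
  match L, e with
  | S L', x :: e' => x :: sdiv L' (axpy (- x) e' t) t
  | _, _ => nil
  end.

Fixpoint eprod_list (N L : nat) : list Z :=
  match N with
  | O => 1%Z :: repeat 0%Z L
  | S N' => let p := eprod_list N' L in axpy (-1) p (repeat 0%Z N ++ p)
  end.

Definition smul (L : nat) (a b : list Z) : list Z := mulacc (repeat 0%Z L) a b.

Definition sigma3 (n : nat) : Z :=
  let m := Z.of_nat n in
  fold_right Z.add 0%Z (map (fun d => d ^ 3)%Z (filter (fun d => Z.eqb (m mod d) 0) (map Z.of_nat (seq 1 n)))).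

Definition E4_list (L : nat) : list Z := 1%Z :: map (fun n => 240 * sigma3 n)%Z (seq 1 L).

(** Coefficients of q j modulo q^(L+1): entry 0 is the pole, and the coefficient [c n] stands at
    entry n + 1. The 24th power of the product is divided out as eight cubes. *)
Definition jlist (L : nat) : list Z :=
  let e := E4_list L in
  let e3 := smul (S L) e (smul (S L) e e) in
  let p := eprod_list L L in
  let p3 := tl (smul (S L) p (smul (S L) p p)) in
  let d x := sdiv (S L) x p3 in
  d (d (d (d (d (d (d (d e3))))))).

Fixpoint turan_check (l : list Z) : bool :=
  match l with
  | a :: ((b :: c :: d :: _) as l') =>
      ((b * c - a * d) ^ 2 <=? 4 * (b ^ 2 - a * c) * (c ^ 2 - b * d))%Z && turan_check l'
  | _ => true
  end.

(** * Integer lists as germs of power series at 0 *)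

Fixpoint evlist (l : list Z) (q : R) : C :=
  match l with nil => RtoC 0 | a :: l' => (RtoC (IZR a) + RtoC q * evlist l' q)%C end.

(* [f = g + O(q^L)] as [q] tends to [0+]. *)
Definition near (L : nat) (f g : R -> C) : Prop :=
  exists K r : R, 0 <= K /\ 0 < r <= / 4 /\ forall q : R, 0 < q <= r -> Cmod (f q - g q) <= K * q ^ L.

Definition bdd (f : R -> C) : Prop := near 0 f (fun _ => RtoC 0).

Lemma near_eq L f g : (forall q, 0 < q <= / 4 -> f q = g q) -> near L f g.
Proof.
intros H; exists 0, (/ 4); repeat split; try lra; intros q Hq; rewrite H by auto.
unfold Cminus; rewrite Cplus_opp_r, Cmod_0; lra.
Qed.

Lemma near_sym L f g : near L f g -> near L g f.
Proof.
intros (K & r & HK & Hr & H); exists K, r; repeat split; try lra; intros q Hq.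
replace (g q - f q)%C with (- (f q - g q))%C by ring; rewrite Cmod_opp; auto.
Qed.

Lemma near_plus L f f' g g' : near L f f' -> near L g g' -> near L (fun q => f q + g q)%C (fun q => f' q + g' q)%C.
Proof.
intros (K & r & HK & Hr & H) (K' & r' & HK' & Hr' & H'); exists (K + K'), (Rmin r r').
pose proof (Rmin_l r r'); pose proof (Rmin_r r r'); pose proof (Rmin_glb_lt r r' 0 ltac:(lra) ltac:(lra)).
repeat split; try lra; intros q Hq.
replace (f q + g q - (f' q + g' q))%C with ((f q - f' q) + (g q - g' q))%C by ring.
eapply Rle_trans; [apply Cmod_triangle|]; rewrite Rmult_plus_distr_r; apply Rplus_le_compat; [apply H|apply H']; lra.
Qed.

Lemma near_trans L f g h : near L f g -> near L g h -> near L f h.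
Proof.
intros (K & r & HK & Hr & H) (K' & r' & HK' & Hr' & H'); exists (K + K'), (Rmin r r').
pose proof (Rmin_l r r'); pose proof (Rmin_r r r'); pose proof (Rmin_glb_lt r r' 0 ltac:(lra) ltac:(lra)).
repeat split; try lra; intros q Hq.
replace (f q - h q)%C with ((f q - g q) + (g q - h q))%C by ring.
eapply Rle_trans; [apply Cmod_triangle|]; rewrite Rmult_plus_distr_r; apply Rplus_le_compat; [apply H|apply H']; lra.
Qed.

Lemma near_weaken L M f g : (M <= L)%nat -> near L f g -> near M f g.
Proof.
intros HL (K & r & HK & Hr & H); exists K, r; repeat split; try lra; intros q Hq.
eapply Rle_trans; [apply H; auto|]; apply Rmult_le_compat_l; auto.
replace L with (M + (L - M))%nat by lia; rewrite pow_add.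
rewrite <- (Rmult_1_r (q ^ M)) at 2; apply Rmult_le_compat_l; [apply pow_le; lra|].
rewrite <- (pow1 (L - M)); apply pow_incr; lra.
Qed.

Lemma bdd_near L f g : near L f g -> bdd g -> bdd f.
Proof. intros H Hg; eapply near_trans; [eapply near_weaken; [|exact H]; lia|auto]. Qed.

Lemma bdd_bound f : bdd f -> exists K r : R, 0 <= K /\ 0 < r <= / 4 /\ forall q : R, 0 < q <= r -> Cmod (f q) <= K.
Proof.
intros (K & r & HK & Hr & H); exists K, r; repeat split; try lra; intros q Hq.
specialize (H q Hq); rewrite Cminus_0_r in H; simpl in H; lra.
Qed.

Lemma bdd_of f K : 0 <= K -> (forall q, 0 < q <= / 4 -> Cmod (f q) <= K) -> bdd f.
Proof.
intros HK H; exists K, (/ 4); repeat split; try lra; intros q Hq; rewrite Cminus_0_r; simpl; rewrite Rmult_1_r; auto.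
Qed.

Lemma near_mult_l L f f' g : near L f f' -> bdd g -> near L (fun q => f q * g q)%C (fun q => f' q * g q)%C.
Proof.
intros (K & r & HK & Hr & H) Hg; destruct (bdd_bound _ Hg) as (K' & r' & HK' & Hr' & H').
exists (K * K'), (Rmin r r').
pose proof (Rmin_l r r'); pose proof (Rmin_r r r'); pose proof (Rmin_glb_lt r r' 0 ltac:(lra) ltac:(lra)).
repeat split; try lra; [apply Rmult_le_pos; auto|]; intros q Hq.
replace (f q * g q - f' q * g q)%C with ((f q - f' q) * g q)%C by ring; rewrite Cmod_mult.
replace (K * K' * q ^ L) with (K * q ^ L * K') by ring.
apply Rmult_le_compat; try apply Cmod_ge_0; [apply H|apply H']; lra.
Qed.

Lemma near_mult_r L f g g' : near L g g' -> bdd f -> near L (fun q => f q * g q)%C (fun q => f q * g' q)%C.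
Proof.
intros H Hf; eapply near_trans; [apply near_eq; intros; apply Cmult_comm|].
eapply near_trans; [apply near_mult_l; eauto|apply near_eq; intros; apply Cmult_comm].
Qed.

Lemma near_mult L f f' g g' : near L f f' -> near L g g' -> bdd f' -> bdd g' ->
  near L (fun q => f q * g q)%C (fun q => f' q * g' q)%C.
Proof.
intros Hf Hg Bf Bg; eapply near_trans; [apply (near_mult_l L f f' g Hf); eapply bdd_near; eauto|].
apply near_mult_r; auto.
Qed.

Lemma bdd_mult f g : bdd f -> bdd g -> bdd (fun q => f q * g q)%C.
Proof.
intros Hf Hg; eapply near_trans; [apply near_mult_l; [exact Hf|exact Hg]|].
apply near_eq; intros; ring.
Qed.

Lemma bdd_const c : bdd (fun _ => c).
Proof. apply (bdd_of _ (Cmod c)); [apply Cmod_ge_0|intros; lra]. Qed.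

Lemma bdd_plus f g : bdd f -> bdd g -> bdd (fun q => f q + g q)%C.
Proof.
intros Hf Hg; eapply near_trans; [apply near_plus; [exact Hf|exact Hg]|].
apply near_eq; intros; ring.
Qed.

Lemma bdd_id : bdd RtoC.
Proof. apply (bdd_of _ 1); [lra|intros; rewrite Cmod_R, Rabs_pos_eq; lra]. Qed.

Lemma bdd_ev l : bdd (evlist l).
Proof.
induction l as [|a l IH]; [apply bdd_const|].
apply (bdd_plus (fun _ => RtoC (IZR a)) (fun q => RtoC q * evlist l q)%C); [apply bdd_const|].
apply bdd_mult; [apply bdd_id|auto].
Qed.

Lemma near_shift L f g (a : C) : near L f g -> near (S L) (fun q => a + RtoC q * f q)%C (fun q => a + RtoC q * g q)%C.
Proof.
intros (K & r & HK & Hr & H); exists K, r; repeat split; try lra; intros q Hq.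
replace (a + q * f q - (a + q * g q))%C with (RtoC q * (f q - g q))%C by ring.
rewrite Cmod_mult, Cmod_R, Rabs_pos_eq by lra; simpl.
replace (K * (q * q ^ L)) with (q * (K * q ^ L)) by ring; apply Rmult_le_compat_l; [lra|auto].
Qed.

Lemma near_unshift L f g (a : C) : near (S L) (fun q => a + RtoC q * f q)%C (fun q => a + RtoC q * g q)%C -> near L f g.
Proof.
intros (K & r & HK & Hr & H); exists K, r; repeat split; try lra; intros q Hq.
specialize (H q Hq).
replace (a + q * f q - (a + q * g q))%C with (RtoC q * (f q - g q))%C in H by ring.
rewrite Cmod_mult, Cmod_R, Rabs_pos_eq in H by lra; simpl in H.
apply (Rmult_le_reg_l q); lra.
Qed.

(** Integrality makes one small [q] enough: the constant terms differ by at most M q <= 1/2, hence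
    not at all. *)
Lemma near_const L f g (a b : Z) : bdd f -> bdd g ->
  near (S L) (fun q => RtoC (IZR a) + RtoC q * f q)%C (fun q => RtoC (IZR b) + RtoC q * g q)%C -> a = b.
Proof.
intros Hf Hg H.
destruct H as (K & r & HK & Hr & H).
destruct (bdd_bound _ Hf) as (K1 & r1 & HK1 & Hr1 & H1); destruct (bdd_bound _ Hg) as (K2 & r2 & HK2 & Hr2 & H2).
set (M := K + K1 + K2 + 1).
pose proof (Rmin_l r (Rmin r1 r2)); pose proof (Rmin_r r (Rmin r1 r2)); pose proof (Rmin_l r1 r2); pose proof (Rmin_r r1 r2).
assert (R0 : 0 < Rmin r (Rmin r1 r2)) by (apply Rmin_glb_lt; [|apply Rmin_glb_lt]; lra).
set (p := Rmin r (Rmin r1 r2)) in *.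
assert (HM : 0 < / M) by (apply Rinv_0_lt_compat; unfold M; lra).
pose proof (Rmin_l p (/ M / 2)); pose proof (Rmin_r p (/ M / 2)).
assert (Q0 : 0 < Rmin p (/ M / 2)) by (apply Rmin_glb_lt; lra).
set (q := Rmin p (/ M / 2)) in *.
specialize (H q ltac:(lra)); specialize (H1 q ltac:(lra)); specialize (H2 q ltac:(lra)).
assert (E : Rabs (IZR a - IZR b) <= M * q).
{ rewrite <- Cmod_R, RtoC_minus.
  replace (RtoC (IZR a) - RtoC (IZR b))%C with ((IZR a + q * f q - (IZR b + q * g q)) + RtoC q * (g q - f q))%C by ring.
  eapply Rle_trans; [apply Cmod_triangle|]; rewrite Cmod_mult, Cmod_R, (Rabs_pos_eq q) by lra.
  assert (Cmod (g q - f q) <= K2 + K1) by (unfold Cminus; eapply Rle_trans; [apply Cmod_triangle|]; rewrite Cmod_opp; lra).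
  assert (K * q ^ S L <= K * q).
  { apply Rmult_le_compat_l; auto; simpl; rewrite <- (Rmult_1_r q) at 3; apply Rmult_le_compat_l; [lra|].
    rewrite <- (pow1 L); apply pow_incr; lra. }
  assert (q * Cmod (g q - f q) <= q * (K2 + K1)) by (apply Rmult_le_compat_l; lra).
  unfold M; nra. }
assert (M * q <= / 2).
{ apply Rle_trans with (M * (/ M / 2)); [apply Rmult_le_compat_l; [unfold M; lra|auto]|right; field; unfold M; lra]. }
rewrite <- minus_IZR, <- abs_IZR in E.
assert (E1 : IZR (Z.abs (a - b)) < 1) by lra.
apply lt_IZR in E1; lia.
Qed.

Lemma evlist_unique x : forall y, length x = length y -> near (length x) (evlist x) (evlist y) -> x = y.
Proof.
induction x as [|a x IH]; intros [|b y] Hl H; try discriminate; auto.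
simpl in Hl, H; injection Hl as Hl.
assert (a = b) by (eapply near_const; [| |exact H]; apply bdd_ev); subst b.
f_equal; apply IH; auto; eapply near_unshift; exact H.
Qed.

Lemma axpy_length c a : forall b, length (axpy c a b) = length a.
Proof. induction a as [|x a IH]; intros [|y b]; simpl; auto. Qed.

Lemma near_axpy c a : forall b, near (length a) (evlist (axpy c a b)) (fun q => evlist a q + IZR c * evlist b q)%C.
Proof.
induction a as [|x a IH]; intros [|y b].
- apply near_eq; intros; simpl; ring.
- apply (near_trans 0 _ (fun _ => RtoC 0)); [exact (bdd_ev nil)|]; apply near_sym.
  apply (bdd_plus (evlist nil) (fun q => IZR c * evlist (y :: b) q)%C); [apply bdd_ev|].
  apply (bdd_mult (fun _ => RtoC (IZR c))); [apply bdd_const|apply bdd_ev].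
- apply near_eq; intros; simpl; ring.
- simpl; eapply near_trans; [apply near_shift, IH|].
  apply near_eq; intros; rewrite plus_IZR, mult_IZR, RtoC_plus, RtoC_mult; ring.
Qed.

Lemma mulacc_length l : forall acc m, length (mulacc acc l m) = length acc.
Proof. induction l; simpl; intros; auto; rewrite IHl, axpy_length; auto. Qed.

Lemma near_mulacc l : forall acc m,
  near (length acc) (evlist (mulacc acc l m)) (fun q => evlist acc q + evlist l q * evlist m q)%C.
Proof.
induction l as [|x l IH]; intros acc m; simpl.
- apply near_eq; intros; ring.
- specialize (IH (axpy x acc m) (0%Z :: m)); rewrite axpy_length in IH.
  eapply near_trans; [exact IH|].
  eapply near_trans; [apply near_plus; [apply near_axpy|apply near_eq; reflexivity]|].
  apply near_eq; intros; simpl; ring.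
Qed.

Lemma evlist_zeros n l q : evlist (repeat 0%Z n ++ l) q = (RtoC q ^ n * evlist l q)%C.
Proof. induction n; simpl; [ring|rewrite IHn; ring]. Qed.

Lemma evlist_zero n q : evlist (repeat 0%Z n) q = RtoC 0.
Proof. rewrite <- (app_nil_r (repeat 0%Z n)), evlist_zeros; simpl; ring. Qed.

Lemma smul_length L a b : length (smul L a b) = L.
Proof. unfold smul; rewrite mulacc_length, repeat_length; auto. Qed.

Lemma near_smul L f g a b : near L f (evlist a) -> near L g (evlist b) -> near L (fun q => f q * g q)%C (evlist (smul L a b)).
Proof.
intros Hf Hg; eapply near_trans; [apply near_mult; [exact Hf|exact Hg|apply bdd_ev|apply bdd_ev]|].
pose proof (near_mulacc a (repeat 0%Z L) b) as H; rewrite repeat_length in H.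
eapply near_trans; [|apply near_sym, H]; apply near_eq; intros; rewrite evlist_zero; ring.
Qed.

Lemma sdiv_length L : forall e t, (L <= length e)%nat -> length (sdiv L e t) = L.
Proof.
induction L; intros [|x e] t; simpl; intros; auto; try lia.
rewrite IHL; auto; rewrite axpy_length; lia.
Qed.

Lemma near_sdiv L : forall e t, (L <= length e)%nat ->
  near L (fun q => evlist (sdiv L e t) q * (1 + q * evlist t q))%C (evlist e).
Proof.
induction L; intros e t He.
{ eapply near_trans; [|apply near_sym, bdd_ev]; apply near_eq; intros; simpl; ring. }
destruct e as [|x e]; simpl in He; [lia|]; simpl.
set (e' := axpy (- x) e t).
apply near_trans with (fun q : R => IZR x + q * (IZR x * evlist t q + evlist (sdiv L e' t) q * (1 + q * evlist t q)))%C.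
{ apply near_eq; intros; ring. }
apply near_shift.
assert (H : near L (fun q => evlist (sdiv L e' t) q * (1 + q * evlist t q))%C (fun q => evlist e q + IZR (- x) * evlist t q)%C).
{ eapply near_trans; [apply IHL; unfold e'; rewrite axpy_length; lia|].
  eapply near_weaken; [|apply near_axpy]; lia. }
eapply near_trans; [apply near_plus; [apply near_eq; reflexivity|exact H]|].
apply near_eq; intros; rewrite opp_IZR, RtoC_opp; ring.
Qed.

Lemma near_cancel L f g u m : 0 < m -> (forall q, 0 < q <= / 4 -> m <= Cmod (u q)) ->
  near L (fun q => f q * u q)%C (fun q => g q * u q)%C -> near L f g.
Proof.
intros Hm Hu (K & r & HK & Hr & H); exists (K / m), r; repeat split; try lra.
{ apply Rmult_le_pos; auto; left; apply Rinv_0_lt_compat; auto. }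
intros q Hq; specialize (H q Hq); specialize (Hu q ltac:(lra)).
replace (f q * u q - g q * u q)%C with ((f q - g q) * u q)%C in H by ring; rewrite Cmod_mult in H.
replace (K / m * q ^ L) with (K * q ^ L / m) by (field; lra).
apply (proj1 (Rle_div_r _ _ _ Hm)).
eapply Rle_trans; [apply Rmult_le_compat_l; [apply Cmod_ge_0|exact Hu]|auto].
Qed.

Lemma near_div L f u e t m : 0 < m -> (forall q, 0 < q <= / 4 -> m <= Cmod (u q)) -> (L <= length e)%nat ->
  near L u (evlist (1%Z :: t)) -> near L (fun q => f q * u q)%C (evlist e) -> near L f (evlist (sdiv L e t)).
Proof.
intros Hm Hu He Ht H; apply (near_cancel L _ _ u m Hm Hu).
eapply near_trans; [exact H|]; apply near_sym.
eapply near_trans; [apply near_mult_r; [exact Ht|apply bdd_ev]|apply near_sdiv; auto].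
Qed.

Lemma near_div8 L f u e t m : 0 < m -> (forall q, 0 < q <= / 4 -> m <= Cmod (u q)) -> (L <= length e)%nat ->
  near L u (evlist (1%Z :: t)) -> near L (fun q => f q * u q ^ 8)%C (evlist e) ->
  let d x := sdiv L x t in near L f (evlist (d (d (d (d (d (d (d (d e))))))))).
Proof.
intros Hm Hu He Ht H d.
assert (D : forall k x, (L <= length x)%nat -> near L (fun q => f q * u q ^ S k)%C (evlist x) ->
  near L (fun q => f q * u q ^ k)%C (evlist (d x)) /\ (L <= length (d x))%nat).
{ intros k x Hx Hk; split; [|unfold d; rewrite sdiv_length; auto].
  apply (near_div L _ u x t m); auto.
  eapply near_trans; [|exact Hk]; apply near_eq; intros; simpl; ring. }
destruct (D 7%nat _ He H) as [H1 L1]; destruct (D 6%nat _ L1 H1) as [H2 L2]; destruct (D 5%nat _ L2 H2) as [H3 L3].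
destruct (D 4%nat _ L3 H3) as [H4 L4]; destruct (D 3%nat _ L4 H4) as [H5 L5]; destruct (D 2%nat _ L5 H5) as [H6 L6].
destruct (D 1%nat _ L6 H6) as [H7 L7]; destruct (D 0%nat _ L7 H7) as [H8 L8].
eapply near_trans; [|exact H8]; apply near_eq; intros; simpl; ring.
Qed.

Lemma eprod_list_length N L : length (eprod_list N L) = S L.
Proof. induction N; simpl; [rewrite repeat_length; auto|rewrite axpy_length; auto]. Qed.

Lemma near_eprod_list N L : near (S L) (fun q => eprod q N) (evlist (eprod_list N L)).
Proof.
induction N.
- apply near_eq; intros; simpl; rewrite evlist_zero; ring.
- pose proof (near_axpy (-1) (eprod_list N L) (repeat 0%Z (S N) ++ eprod_list N L)) as H; rewrite eprod_list_length in H.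
  apply near_trans with (fun q => evlist (eprod_list N L) q * (1 - RtoC q ^ S N))%C.
  + apply (near_mult_l (S L) (fun q => eprod q N) (evlist (eprod_list N L)) (fun q => 1 - RtoC q ^ S N)%C); auto.
    apply (bdd_of _ 2); [lra|]; intros q Hq.
    eapply Rle_trans; [apply Cmod_1_minus_le|]; rewrite Cmod_pow, Cmod_R, Rabs_pos_eq by lra.
    pose proof (pow_S_lt1 q N ltac:(lra)); lra.
  + apply near_sym; eapply near_trans; [exact H|]; apply near_eq; intros; rewrite evlist_zeros; ring.
Qed.

Lemma Csum_tail (u : nat -> C) (b : nat -> R) B N l : CSer u l ->
  (forall n, Cmod (u (N + n)%nat) <= b n) -> is_series b B -> Cmod (l - csum u N) <= B.
Proof.
intros Hu Hb HB; apply (CSer_mod_le (fun n => u (N + n)%nat) _ b); auto.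
clear Hb HB; revert u l Hu; induction N; intros u l Hu; simpl.
- apply (CSer_eq _ l); [ring|auto].
- apply (CSer_eq _ ((l - u 0%nat) - csum (fun k => u (S k)) N)%C); [|apply (IHN (fun k => u (S k))), CSer_tail; auto].
  change (csum u N + u N)%C with (csum u (S N)); rewrite csum_head; ring.
Qed.

(** In the telescoped series the omitted tail begins with q^(N+1), and for q <= 1/4 the partial
    products are at most exp(1/3). *)
Lemma near_euler N : near (S N) (fun q => euler q) (fun q => eprod q N).
Proof.
exists (2 * exp (/ 3)), (/ 4); pose proof (exp_pos (/ 3)); repeat split; try lra; intros q Hq.
assert (Hm : Cmod q = q) by (rewrite Cmod_R, Rabs_pos_eq; lra).
set (u := fun n => (RtoC q ^ S n * eprod q n)%C).
assert (Hb : forall n, Cmod (u n) <= exp (/ 3) * q ^ S n).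
{ intros n; unfold u; eapply Rle_trans; [apply euler_term_bound; lra|]; rewrite Hm.
  apply Rmult_le_compat_r; [apply pow_le; lra|]; apply exp_mono.
  apply (proj2 (Rle_div_l _ _ (1 - q) ltac:(lra))); lra. }
assert (Hs : CSer u (Csum u)).
{ apply (CSer_Csum _ _ Hb); apply ex_series_Rscal, ex_series_geom1; lra. }
assert (E : forall n, eprod q n = (1 - csum u n)%C).
{ induction n; [simpl; ring|]; rewrite eprod_S, csum_S.
  transitivity (eprod q n - u n)%C; [unfold u; ring|rewrite IHn; ring]. }
rewrite E; unfold euler; fold u.
replace (1 - Csum u - (1 - csum u N))%C with (- (Csum u - csum u N))%C by ring; rewrite Cmod_opp.
apply (Rle_trans _ (exp (/ 3) * q ^ S N * / (1 - q))).
- apply (Csum_tail u (fun n => exp (/ 3) * q ^ S N * q ^ n) _ N); auto.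
  + intros n; eapply Rle_trans; [apply Hb|]; right; rewrite Rmult_assoc, <- pow_add; do 2 f_equal; lia.
  + apply is_series_Rscal, is_series_geom; rewrite Rabs_pos_eq; lra.
- rewrite (Rmult_comm 2), Rmult_assoc, (Rmult_assoc _ 2), (Rmult_comm (q ^ S N)).
  apply Rmult_le_compat_l; [lra|]; apply Rmult_le_compat_r; [apply pow_le; lra|].
  replace 2 with (/ / 2) by field; apply Rinv_le_contravar; lra.
Qed.

Lemma evlist_csum (a : nat -> Z) q L : forall s,
  evlist (map a (seq s L)) q = csum (fun n => IZR (a (s + n)%nat) * RtoC q ^ n)%C L.
Proof.
induction L; intros s; [reflexivity|].
rewrite csum_head; simpl; rewrite IHL, Nat.add_0_r, <- csum_scal; f_equal; [ring|].
apply csum_ext; intros; rewrite <- plus_n_Sm; simpl; ring.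
Qed.

(** Convergence at 1/2 bounds the coefficients by a multiple of 2^n, so for q <= 1/4 the tail is
    geometric with ratio at most 1/2. *)
Lemma near_series (a : nat -> Z) f L : (forall q, 0 < q < 1 -> CSer (fun n => IZR (a n) * RtoC q ^ n)%C (f q)) ->
  near L f (evlist (map a (seq 0 L))).
Proof.
intros H; pose proof (H (/ 2) ltac:(lra)) as H0; apply CSer_is_series in H0 as [H0 _].
assert (HM : exists M, forall n, Rabs (IZR (a n)) <= M * 2 ^ n).
{ destruct (filterlim_bounded (K := R_AbsRing) (V := R_NormedModule) (fun n => IZR (a n) * (/ 2) ^ n)) as [M HM].
  - exists 0; apply (ex_series_lim_0 (fun n => IZR (a n) * (/ 2) ^ n)).
    eexists; eapply is_series_Rext; [|exact H0]; intros n; simpl.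
    rewrite <- RtoC_pow; simpl; ring.
  - exists M; intros n; specialize (HM n).
    change (Rabs (IZR (a n) * (/ 2) ^ n) <= M) in HM; rewrite Rabs_mult, (Rabs_pos_eq ((/ 2) ^ n)) in HM by (apply pow_le; lra).
    rewrite pow_inv in HM; apply (Rmult_le_reg_r (/ 2 ^ n)); [apply Rinv_0_lt_compat, pow_lt; lra|].
    rewrite (Rmult_assoc M), Rinv_r by (apply pow_nonzero; lra); lra. }
destruct HM as [M HM].
assert (M0 : 0 <= M) by (specialize (HM 0%nat); pose proof (Rabs_pos (IZR (a 0%nat))); simpl in HM; lra).
exists (2 * M * 2 ^ L), (/ 4); repeat split; try lra.
{ apply Rmult_le_pos; [lra|apply pow_le; lra]. }
intros q Hq; rewrite evlist_csum; simpl.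
apply (Rle_trans _ (M * (2 * q) ^ L * / (1 - 2 * q))).
- apply (Csum_tail (fun n => IZR (a n) * RtoC q ^ n)%C (fun n => M * (2 * q) ^ L * (2 * q) ^ n) _ L); [apply H; lra| |].
  + intros n; rewrite Cmod_mult, Cmod_pow, !Cmod_R, (Rabs_pos_eq q) by lra.
    replace (M * (2 * q) ^ L * (2 * q) ^ n) with (M * 2 ^ (L + n) * q ^ (L + n)).
    * apply Rmult_le_compat_r; [apply pow_le; lra|apply HM].
    * rewrite Rmult_assoc, (Rmult_assoc M), <- pow_add, <- Rpow_mult_distr; reflexivity.
  + apply is_series_Rscal, is_series_geom; rewrite Rabs_pos_eq; lra.
- rewrite Rpow_mult_distr.
  replace (2 * M * 2 ^ L * q ^ L) with (M * (2 ^ L * q ^ L) * 2) by ring.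
  apply Rmult_le_compat_l; [apply Rmult_le_pos; auto; apply Rmult_le_pos; apply pow_le; lra|].
  replace 2 with (/ / 2) at 2 by field; apply Rinv_le_contravar; lra.
Qed.

Lemma sigma3_sigma n : IZR (sigma3 n) = INR (Defs.sigma 3 n).
Proof.
rewrite INR_IZR_INZ; f_equal; unfold sigma3, Defs.sigma; cbv zeta.
generalize (seq 1 n); intros l; induction l as [|d l IH]; [reflexivity|].
assert (E : (Z.of_nat n mod Z.of_nat d =? 0)%Z = Nat.eqb (Nat.modulo n d) 0).
{ rewrite <- Nat2Z.inj_mod; destruct (Nat.eqb_spec (Nat.modulo n d) 0) as [e|e]; [rewrite e; reflexivity|].
  apply Z.eqb_neq; lia. }
cbn [map filter]; rewrite E; destruct (Nat.eqb (Nat.modulo n d) 0); [|exact IH].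
cbn [map fold_right list_sum]; rewrite IH, Nat2Z.inj_add, Nat2Z.inj_pow; reflexivity.
Qed.

Lemma near_E4 L : near (S L) (fun q => 1 + 240 * lambert 3 (RtoC q))%C (evlist (E4_list L)).
Proof.
set (a := fun n => match n with O => 1%Z | S _ => (240 * sigma3 n)%Z end).
replace (E4_list L) with (map a (seq 0 (S L))).
2:{ unfold E4_list; simpl; f_equal; apply map_ext_in; intros n Hn; apply in_seq in Hn; destruct n; [lia|reflexivity]. }
apply near_series; intros q Hq.
assert (Hm : 0 < Cmod q < 1) by (rewrite Cmod_R, Rabs_pos_eq; lra).
apply (CSer_eq _ (IZR (a 0%nat) * RtoC q ^ 0 + 240 * lambert 3 q)%C); [simpl; ring|].
apply (CSer_head (fun n => IZR (a n) * RtoC q ^ n)%C).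
eapply CSer_ext; [|apply (CSer_scal 240), (sigma_lambert 3 q Hm)].
intros n; unfold a; rewrite mult_IZR, sigma3_sigma, RtoC_mult; ring.
Qed.

Lemma nome_real q : 0 < q < 1 -> exists t, 0 < Im t /\ nome t = RtoC q.
Proof.
intros Hq; exists (Ci * RtoC (- ln q / (2 * PI)))%C; pose proof PI_RGT_0.
assert (ln q < 0) by (rewrite <- ln_1; apply ln_increasing; lra).
split.
- simpl; apply Rle_lt_trans with (0 * (- ln q / (2 * PI))); [lra|].
  assert (0 < - ln q / (2 * PI)); [|nra]; apply Rdiv_lt_0_compat; lra.
- unfold nome; rewrite <- (exp_ln q) at 2 by lra; rewrite <- Cexp_RtoC; f_equal.
  apply C_eq; simpl; field; lra.
Qed.

Definition shifted (c : nat -> Z) (n : nat) : Z := match n with O => 1%Z | S m => c m end.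

(** Points of the imaginary axis realise every nome in (0, 1), and real nomes suffice to identify
    the coefficients. Multiplication by [q] turns the pole into the leading coefficient 1. *)
Lemma j_real_series c : j_fourier_coefficients c ->
  forall q, 0 < q < 1 -> CSer (fun n => IZR (shifted c n) * RtoC q ^ n)%C ((1 + 240 * lambert 3 q) ^ 3 / euler q ^ 24)%C.
Proof.
intros Hc q Hq; destruct (nome_real q Hq) as [t [Ht E]].
pose proof (Hc t Ht) as H; rewrite j_invariant_klein in H by auto; unfold klein, discr in H; rewrite E in H.
apply CSer_of_is_series in H.
assert (q0 : RtoC q <> RtoC 0) by (intros X; apply RtoC_inj in X; lra).
assert (HP : euler q <> 0%C) by (apply euler_nz; rewrite Cmod_R, Rabs_pos_eq; lra).
apply (CSer_eq _ (IZR (shifted c 0) * RtoC q ^ 0 + q * ((1 + 240 * lambert 3 q) ^ 3 / (q * euler q ^ 24) - / q))%C).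
{ apply (Cpow_nz _ 24) in HP; revert HP; generalize (euler q ^ 24)%C; intros P HP; simpl; field; auto. }
apply (CSer_head (fun n => IZR (shifted c n) * RtoC q ^ n)%C).
eapply CSer_ext; [|apply (CSer_scal q), H]; intros n; simpl; ring.
Qed.

(* By Jacobi, the cube of the Euler product is sparse, which keeps eight divisions by it cheaper than one by its eighth power. *)
Definition eprod3_list (L : nat) : list Z := let p := eprod_list L L in smul (S L) p (smul (S L) p p).

(** The identity (q j) (euler^3)^8 = E_4^3 is transported to integer lists modulo q^(L+1), where
    division is exact because the divisor begins with 1. That leading coefficient is left as a
    hypothesis to be computed for the concrete [L]. *)
Lemma jlist_correct c L : j_fourier_coefficients c -> Z.eqb (hd 0%Z (eprod3_list L)) 1 = true ->
  map (shifted c) (seq 0 (S L)) = jlist L.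
Proof.
intros Hc Hp; apply Z.eqb_eq in Hp.
set (A := fun q : R => ((1 + 240 * lambert 3 q) ^ 3 / euler q ^ 24)%C).
assert (NA : near (S L) A (evlist (map (shifted c) (seq 0 (S L))))) by (apply near_series, j_real_series; auto).
set (m := exp (- (/ 4 / (1 - / 4) ^ 2))).
assert (HU : forall q, 0 < q <= / 4 -> m <= Cmod (euler q)).
{ intros q Hq; apply euler_lower; [rewrite Cmod_R, Rabs_pos_eq|]; lra. }
assert (Hm : 0 < m) by apply exp_pos.
assert (NP : near (S L) (fun q => euler q) (evlist (eprod_list L L))).
{ eapply near_trans; [apply near_euler|apply near_eprod_list]. }
assert (NP3 : near (S L) (fun q => euler q ^ 3)%C (evlist (eprod3_list L))).
{ eapply near_trans; [|apply near_smul; [exact NP|apply near_smul; exact NP]]; apply near_eq; intros; simpl; ring. }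
assert (Hp3 : eprod3_list L = 1%Z :: tl (eprod3_list L)).
{ pose proof (smul_length (S L) (eprod_list L L) (smul (S L) (eprod_list L L) (eprod_list L L))) as Hl.
  change (length (eprod3_list L) = S L) in Hl; destruct (eprod3_list L); [discriminate|simpl in *; subst; auto]. }
rewrite Hp3 in NP3.
pose proof (near_E4 L) as NE.
set (e := E4_list L) in *.
assert (NE3 : near (S L) (fun q => A q * (euler q ^ 3) ^ 8)%C (evlist (smul (S L) e (smul (S L) e e)))).
{ eapply near_trans; [|apply near_smul; [exact NE|apply near_smul; exact NE]]; apply near_eq; intros q Hq.
  assert (euler q <> 0%C) by (apply euler_nz; rewrite Cmod_R, Rabs_pos_eq; lra).
  apply (Cpow_nz _ 24) in H; unfold A; rewrite <- Cpow_mult_r; simpl (3 * 8)%nat.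
  revert H; generalize (euler q ^ 24)%C; intros P HP; field; auto. }
assert (Le : (S L <= length (smul (S L) e (smul (S L) e e)))%nat) by (rewrite smul_length; auto).
assert (HU3 : forall q, 0 < q <= / 4 -> m ^ 3 <= Cmod (euler q ^ 3)).
{ intros q Hq; rewrite Cmod_pow; apply pow_incr; split; [lra|auto]. }
pose proof (near_div8 (S L) A (fun q => euler q ^ 3)%C _ _ (m ^ 3) (pow_lt _ 3 Hm) HU3 Le NP3 NE3) as D.
apply evlist_unique; rewrite length_map, length_seq.
- unfold jlist; rewrite !sdiv_length; repeat rewrite sdiv_length; auto; rewrite smul_length; auto.
- eapply near_trans; [apply near_sym, NA|exact D].
Qed.

Lemma turan_check_correct l : turan_check l = true -> forall n, (n + 3 < length l)%nat ->
  let a k := nth k l 0%Z in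
  ((a (n + 1)%nat * a (n + 2)%nat - a n * a (n + 3)%nat) ^ 2
    <= 4 * (a (n + 1)%nat ^ 2 - a n * a (n + 2)%nat) * (a (n + 2)%nat ^ 2 - a (n + 1)%nat * a (n + 3)%nat))%Z.
Proof.
induction l as [|x l IH]; intros H n Hn a; [simpl in Hn; lia|].
destruct l as [|y [|z [|w l]]]; try (simpl in Hn; lia).
change ((((y * z - x * w) ^ 2 <=? 4 * (y ^ 2 - x * z) * (z ^ 2 - y * w))%Z && turan_check (y :: z :: w :: l))%bool = true) in H.
apply andb_prop in H as [H1 H2].
destruct n as [|n]; [apply Z.leb_le in H1; exact H1|].
apply (IH H2 n); simpl in *; lia.
Qed.

(** Precision 147 reaches [c 146], the last coefficient needed at n = 144; the two [tl] drop the
    pole and the constant term [c 0]. *)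
Lemma turan_jlist : turan_check (tl (tl (jlist 147))) = true.
Proof. vm_cast_no_check (eq_refl true). Qed.

Lemma eprod3_list_hd : Z.eqb (hd 0%Z (eprod3_list 147)) 1 = true.
Proof. vm_cast_no_check (eq_refl true). Qed.

Lemma turan_small (c : nat -> Z) n : j_fourier_coefficients c -> (2 <= n <= 144)%nat ->
  let a k := IZR (c k) in
  0 <= 4 * (a n ^ 2 - a (n - 1)%nat * a (n + 1)%nat) * (a (n + 1)%nat ^ 2 - a n * a (n + 2)%nat)
     - (a n * a (n + 1)%nat - a (n - 1)%nat * a (n + 2)%nat) ^ 2.
Proof.
intros Hc Hn a.
pose proof turan_jlist as H; rewrite <- (jlist_correct c 147 Hc eprod3_list_hd) in H.
replace (tl (tl (map (shifted c) (seq 0 148)))) with (map c (seq 1 146)) in H.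
2:{ change (seq 0 148) with (0 :: 1 :: seq 2 146)%nat; cbn [map tl]; rewrite <- (seq_shift 146 1), map_map; reflexivity. }
pose proof (turan_check_correct _ H (n - 2)) as T; rewrite length_map, length_seq in T; specialize (T ltac:(lia)).
assert (E : forall k, (k < 146)%nat -> nth k (map c (seq 1 146)) 0%Z = c (k + 1)%nat).
{ intros k Hk; rewrite (nth_indep _ 0%Z (c 0%nat)) by (rewrite length_map, length_seq; auto).
  rewrite map_nth, seq_nth by auto; f_equal; lia. }
cbv beta zeta in T; rewrite !E in T by lia.
replace (n - 2 + 1 + 1)%nat with n in T by lia; replace (n - 2 + 2 + 1)%nat with (n + 1)%nat in T by lia.
replace (n - 2 + 3 + 1)%nat with (n + 2)%nat in T by lia; replace (n - 2 + 1)%nat with (n - 1)%nat in T by lia.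
apply IZR_le in T; rewrite !Z.pow_2_r in T.
repeat (rewrite ?mult_IZR, ?minus_IZR in T); unfold a; lra.
Qed.

Theorem theorem4p2 :
  forall c : nat -> Z,
    j_fourier_coefficients c ->
    higher_order_turan (fun n => IZR (c n)).
Proof.
intros c Hc n Hn; apply Rle_ge.
destruct (le_lt_dec n 144) as [Hs|Hl]; [apply (turan_small c n Hc)|apply (turan_large c n Hc)]; lia.
Qed.
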